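(* Let $(A,\mathfrak{m})$ be an unmixed Noetherian local ring of dimension $d$ and let $M$ be a finitely generated $A$-module with $\operatorname{rank} M = r \geq 1$. Assume that $\mu_n(\mathfrak{m}, M) \leq 1$ for some $n \geq d$. Also assume that $A$ is a quotient of a Gorenstein local ring. Then $\nu(M) \geq r\operatorname{type}(A)$. Furthermore the following assertions are equivalent: (i) $M \cong \omega_A^r$. (ii) $\nu(M) = r \operatorname{type}(A)$.
   Context: A Noetherian local ring $A$ is unmixed if $\dim \widehat{A}/Q = \dim \widehat{A}$ for all associated primes $Q$ of the completion $\widehat{A}$ of $A$. The $n$-th Bass number of $M$ with respect to $\mathfrak{m}$ is $\mu_n(\mathfrak{m},M) = \dim_{A/\mathfrak{m}} \operatorname{Ext}^n_A(A/\mathfrak{m}, M)$. A finitely generated $A$-module $M$ has rank $r$ if $M_P \cong A_P^r$ for every $P \in \operatorname{Ass}(A)$. $\nu(M)$ is the minimal number of generators of $M$. $\operatorname{type}(A) = \mu_{t}(\mathfrak{m},A)$ with $t = \operatorname{depth} A$. $\omega_A$ is the canonical module of $A$ (under these hypotheses $A$ is Cohen-Macaulay, so, being a quotient of a Gorenstein local ring, it has a canonical module), and $\omega_A^r$ is the direct sum of $r$ copies of it. *)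

(* Defs.v *)
From HB Require Import structures.
From mathcomp Require Import all_boot all_algebra.
From mathcomp Require Import generic_quotient ring_quotient.
From mathcomp Require Import all_classical.
From mathcomp Require Import ring.

Set Implicit Arguments.
Unset Strict Implicit.
Unset Printing Implicit Defensive.

Import GRing.Theory.

Local Open Scope ring_scope.
Local Open Scope quotient_scope.

(* Ideals are the bundled predicates [idealr A] and [prime_idealr A] of
   ring_quotient; both are proper by definition.  Numerical invariants (Krull
   dimension, depth, Bass numbers, ...) are relations [invariant X n], read
   "the invariant of X exists, is finite and equals n".  The direct sum of n
   copies of U is {ffun 'I_n -> U}. *)

Section Modules.
Variable A : comNzRingType.

Definition isomorphic (U V : lmodType A) : Prop :=
  exists f : {linear U -> V}, bijective f.

Definition in_span (V : lmodType A) n (e : 'I_n -> V) (x : V) : Prop :=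
  exists a : 'I_n -> A, x = \sum_i a i *: e i.

Definition generating (V : lmodType A) n (e : 'I_n -> V) : Prop :=
  forall x, in_span e x.

Definition finitely_generated (V : lmodType A) : Prop :=
  exists n (e : 'I_n -> V), generating e.

Definition min_generators (V : lmodType A) (nu : nat) : Prop :=
  (exists e : 'I_nu -> V, generating e) /\
  (forall n (e : 'I_n -> V), generating e -> (nu <= n)%N).

Definition noetherian : Prop :=
  forall I : idealr A,
    exists n (e : 'I_n -> A), forall x, x \in I <-> in_span (V := A^o) e x.

Definition maximal_ideal (I : idealr A) : Prop :=
  forall J : idealr A, {subset I <= J} -> {subset J <= I}.

Definition local_ring (m : idealr A) : Prop :=
  forall I : idealr A, maximal_ideal I <-> I =i m.

Definition strict_subideal (P Q : prime_idealr A) : Prop :=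
  {subset P <= Q} /\ exists2 x, x \in Q & x \notin P.

Definition prime_chain (n : nat) : Prop :=
  exists P : nat -> prime_idealr A,
    forall i, (i < n)%N -> strict_subideal (P i) (P i.+1).

Definition krull_dim (d : nat) : Prop :=
  prime_chain d /\ (forall n, prime_chain n -> (n <= d)%N).

Definition associated_prime (P : prime_idealr A) : Prop :=
  exists a : A, forall x, (x \in P) = (x * a == 0).

End Modules.

Arguments noetherian : clear implicits.
Arguments krull_dim : clear implicits.

(* A / I, besides being the ring {ideal_quot I}, is an A-module. *)
Section IdealQuotientModule.
Variables (A : comNzRingType) (I : idealr A).

Definition ideal_quot_scale (a : A) (x : {ideal_quot I}) : {ideal_quot I} :=
  \pi_{ideal_quot I} a * x.

Let scaleA a b x :
  ideal_quot_scale a (ideal_quot_scale b x) = ideal_quot_scale (a * b) x.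
Proof. by rewrite /ideal_quot_scale mulrA -[x]reprK !piE. Qed.
Let scale1 : left_id 1 ideal_quot_scale.
Proof. by move=> x; rewrite /ideal_quot_scale -[x]reprK !piE mul1r. Qed.
Let scaleDr : right_distributive ideal_quot_scale +%R.
Proof. by move=> a x y; exact: mulrDr. Qed.
Let scaleDl x : {morph ideal_quot_scale^~ x : a b / a + b}.
Proof.
by move=> a b; rewrite /ideal_quot_scale -mulrDl; congr (_ * _); rewrite !piE.
Qed.

HB.instance Definition _ := GRing.Zmodule_isLmodule.Build A {ideal_quot I}
  scaleA scale1 scaleDr scaleDl.

End IdealQuotientModule.

Section QuotientModule.
Variables (A : comNzRingType) (V : lmodType A) (N : submodClosed V).

Let zmod_closedN : zmod_closed (N : {pred V}).
Proof. exact: GRing.submod_closedB (GRing.submodClosedP N). Qed.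

Definition submod_zmod : zmodClosed V :=
  HB.pack_for (zmodClosed V) (GRing.SubmodClosed.sort N)
    (GRing.isZmodClosed.Build V (GRing.SubmodClosed.sort N) zmod_closedN).

Definition quotmod : Type := Quotient.quot submod_zmod.
HB.instance Definition _ := GRing.Zmodule.on quotmod.

Definition quotmod_scale (a : A) (x : quotmod) : quotmod :=
  \pi_(Quotient.quot submod_zmod) (a *: repr (x : Quotient.quot submod_zmod)).

Lemma quotmod_scaleE a (x : V) :
  quotmod_scale a (\pi_(Quotient.quot submod_zmod) x) = \pi_(Quotient.quot submod_zmod) (a *: x).
Proof.
apply/eqP; rewrite -Quotient.idealrBE -scalerBr.
by apply: (rpredZ (s := N)); rewrite (Quotient.idealrBE submod_zmod) reprK.
Qed.

Let piD (x y : V) : \pi_(Quotient.quot submod_zmod) (x + y) =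
  \pi_(Quotient.quot submod_zmod) x + \pi_(Quotient.quot submod_zmod) y.
Proof. by rewrite piE. Qed.

Let piP (x : quotmod) : exists v, x = \pi_(Quotient.quot submod_zmod) v.
Proof. by exists (repr (x : Quotient.quot submod_zmod)); rewrite reprK. Qed.

Let scaleA a b x :
  quotmod_scale a (quotmod_scale b x) = quotmod_scale (a * b) x.
Proof. by have [v ->] := piP x; rewrite !quotmod_scaleE scalerA. Qed.
Let scale1 : left_id 1 quotmod_scale.
Proof. by move=> x; have [v ->] := piP x; rewrite quotmod_scaleE scale1r. Qed.
Let scaleDr : right_distributive quotmod_scale +%R.
Proof.
move=> a x y; have [[v ->] [w ->]] := (piP x, piP y).
by rewrite -piD !quotmod_scaleE scalerDr piD.
Qed.
Let scaleDl x : {morph quotmod_scale^~ x : a b / a + b}.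
Proof.
by move=> a b; have [v ->] := piP x; rewrite !quotmod_scaleE scalerDl piD.
Qed.

HB.instance Definition _ := GRing.Zmodule_isLmodule.Build A quotmod
  scaleA scale1 scaleDr scaleDl.

End QuotientModule.

(* The m-adic completion: Cauchy sequences modulo null sequences. *)
Section Completion.
Variables (A : comNzRingType) (m : idealr A).

Fixpoint ideal_pow (n : nat) (x : A) : Prop :=
  if n is n'.+1 then
    exists k (a b : 'I_k -> A),
      [/\ forall i, a i \in m, forall i, ideal_pow n' (b i)
        & x = \sum_i a i * b i]
  else True.

Lemma ideal_pow0 n : ideal_pow n 0.
Proof.
case: n => //= n; exists 0%N, (fun=> 0), (fun=> 0).
by split=> [[]|[]|] //; rewrite big_ord0.
Qed.

Lemma ideal_powD n x y : ideal_pow n x -> ideal_pow n y -> ideal_pow n (x + y).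
Proof.
case: n => //= n [k [a [b [ma pb ->]]]] [l [c [d [mc pd ->]]]].
exists (k + l)%N, (fun i : 'I_(k + l) => match fintype.split i with inl j => a j | inr j => c j end),
  (fun i : 'I_(k + l) => match fintype.split i with inl j => b j | inr j => d j end).
split=> [i|i|]; [by case: fintype.split | by case: fintype.split |].
rewrite big_split_ord /=; congr (_ + _); apply: eq_bigr => i _.
  by rewrite (unsplitK (inl i)).
by rewrite (unsplitK (inr i)).
Qed.

Lemma ideal_powM n z x : ideal_pow n x -> ideal_pow n (z * x).
Proof.
case: n => //= n [k [a [b [ma pb ->]]]]; exists k, (fun i => z * a i), b.
split=> // [i|]; first exact: idealMr.
by rewrite mulr_sumr; apply: eq_bigr => i _; rewrite mulrA.
Qed.

Lemma ideal_powN n x : ideal_pow n x -> ideal_pow n (- x).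
Proof. by rewrite -mulN1r; exact: ideal_powM. Qed.

Lemma ideal_pow1 x : ideal_pow 1 x -> x \in m.
Proof.
move=> [k [a [b [ma _ ->]]]]; apply: rpred_sum => i _.
by rewrite mulrC; exact: idealMr.
Qed.

Definition cauchy_seq : {pred nat -> A} := [pred u | `[< forall k, exists N,
  forall i j, (N <= i)%N -> (N <= j)%N -> ideal_pow k (u i - u j) >] ].

Lemma cauchy_seq_subring : subring_closed cauchy_seq.
Proof.
split=> [|u v /asboolP uC /asboolP vC|u v /asboolP uC /asboolP vC];
  apply/asboolP => k.
- by exists 0%N => i j _ _; rewrite subrr; exact: ideal_pow0.
- have [[N uN] [N' vN]] := (uC k, vC k).
  exists (maxn N N') => i j; rewrite !geq_max => /andP[Ni N'i] /andP[Nj N'j].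
  rewrite (_ : _ - _ = (u i - u j) + - (v i - v j)); last first.
    by rewrite !opprD !opprK /= addrACA.
  by apply: ideal_powD; [exact: uN | apply: ideal_powN; exact: vN].
- have [[N uN] [N' vN]] := (uC k, vC k).
  exists (maxn N N') => i j; rewrite !geq_max => /andP[Ni N'i] /andP[Nj N'j].
  rewrite (_ : _ - _ = v i * (u i - u j) + u j * (v i - v j)); last first.
    by rewrite !mulrBr addrA [v i * u i]mulrC [v i * u j]mulrC subrK.
  by apply: ideal_powD; apply: ideal_powM; [exact: uN | exact: vN].
Qed.

HB.instance Definition _ :=
  GRing.isSubringClosed.Build (nat -> A) cauchy_seq cauchy_seq_subring.

Definition cauchy : Type := {u : nat -> A | u \in cauchy_seq}.
HB.instance Definition _ := [isSub of cauchy for @sval _ _].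
HB.instance Definition _ := [Choice of cauchy by <:].
HB.instance Definition _ := [SubChoice_isSubComNzRing of cauchy by <:].

Definition null_seq : {pred cauchy} := [pred u : cauchy | `[< forall k,
  exists N, forall i, (N <= i)%N -> ideal_pow k (val u i) >] ].

Lemma null_seq_idealr : idealr_closed null_seq.
Proof.
split=> [||w u v /asboolP uC /asboolP vC].
- by apply/asboolP => k; exists 0%N => i _; exact: ideal_pow0.
- apply/negP => /asboolP/(_ 1%N)[N /(_ N (leqnn N))/ideal_pow1].
  by rewrite idealr1.
- apply/asboolP => k; have [[N uN] [N' vN]] := (uC k, vC k).
  exists (maxn N N') => i; rewrite geq_max => /andP[Ni N'i].
  by apply: ideal_powD; [apply: ideal_powM; exact: uN | exact: vN].
Qed.

HB.instance Definition _ := isIdealr.Build cauchy null_seq null_seq_idealr.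

Definition completion : comNzRingType := {ideal_quot null_seq}.

Definition unmixed : Prop :=
  forall Q : prime_idealr completion, associated_prime Q ->
  forall d, krull_dim {ideal_quot Q} d <-> krull_dim completion d.

End Completion.

Section Localization.
Variables (A : comNzRingType) (P : prime_idealr A).

Definition denom : Type := {s : A | s \notin P}.
Definition dval (s : denom) : A := sval s.
HB.instance Definition _ := [isSub of denom for dval].
HB.instance Definition _ := [Choice of denom by <:].

Let notin1 : 1 \notin P. Proof. by rewrite idealr1. Qed.
Let notinM (s t : denom) : dval s * dval t \notin P.
Proof. by rewrite prime_idealrM negb_or (valP s) (valP t). Qed.

Definition denom1 : denom := exist _ 1 notin1.
Definition denomM (s t : denom) : denom :=
  exist _ (dval s * dval t) (notinM s t).
Lemma dval1 : dval denom1 = 1. Proof. by []. Qed.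
Lemma dvalM s t : dval (denomM s t) = dval s * dval t. Proof. by []. Qed.

Section Module.
Variable V : lmodType A.

Let scale_eq (k a b c d : A) (x y : V) :
  a *: x = b *: y -> c = k * a -> d = k * b -> c *: x = d *: y.
Proof. by move=> e -> ->; rewrite -!scalerA e. Qed.

Definition loc_equiv (x y : V * denom) : bool := `[< exists u : denom,
  dval u *: (dval y.2 *: x.1) = dval u *: (dval x.2 *: y.1) >].

Lemma loc_equiv_is_equiv : equiv_class_of loc_equiv.
Proof.
split=> [x|x y|[y t] [x s] [z w]].
- by apply/asboolP; exists denom1.
- by apply/asboolP/asboolP => -[u xy]; exists u.
- move=> /asboolP[u /= xy] /asboolP[v /= yz]; apply/asboolP.
  exists (denomM t (denomM u v)) => /=; rewrite !scalerA in xy yz *.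
  transitivity ((dval v * dval w * (dval u * dval s)) *: y).
    by apply: (scale_eq (k := dval v * dval w) xy); ring.
  by apply: (scale_eq (k := dval u * dval s) yz); ring.
Qed.

Canonical loc_equiv_equiv := EquivRelPack loc_equiv_is_equiv.
Canonical loc_equiv_encModRel := defaultEncModRel loc_equiv.

(* The localization V_P. *)
Definition locmod : Type := {eq_quot loc_equiv}.
HB.instance Definition _ := Choice.on locmod.

(* The fraction x / s. *)
Definition frac (x : V) (s : denom) : locmod := \pi_({eq_quot loc_equiv}) (x, s).

Lemma frac_eqP x s y t :
  frac x s = frac y t <->
  exists u : denom, (dval u * dval t) *: x = (dval u * dval s) *: y.
Proof.
split=> [/eqmodP/asboolP[u /=]|[u e]].
  by rewrite !scalerA; exists u.
by apply/eqmodP/asboolP; exists u; rewrite /= !scalerA.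
Qed.

Definition num (z : locmod) : V := (repr (z : {eq_quot loc_equiv})).1.
Definition den (z : locmod) : denom := (repr (z : {eq_quot loc_equiv})).2.

Lemma fracK z : frac (num z) (den z) = z.
Proof. by rewrite /frac /num /den -surjective_pairing reprK. Qed.

Definition loc_add (z w : locmod) : locmod :=
  frac (dval (den w) *: num z + dval (den z) *: num w) (denomM (den z) (den w)).
Definition loc_opp (z : locmod) : locmod := frac (- num z) (den z).

Lemma loc_addE x s y t :
  loc_add (frac x s) (frac y t) =
  frac (dval t *: x + dval s *: y) (denomM s t).
Proof.
rewrite /loc_add.
have /frac_eqP[u] := fracK (frac x s); have /frac_eqP[v] := fracK (frac y t).
set y' := num (frac y t); set t' := den (frac y t).
set x' := num (frac x s); set s' := den (frac x s) => yE xE.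
apply/frac_eqP; exists (denomM u v) => /=; rewrite !scalerDr !scalerA.
congr (_ + _).
  by apply: (scale_eq (k := dval v * dval t * dval t') xE); ring.
by apply: (scale_eq (k := dval u * dval s * dval s') yE); ring.
Qed.

Lemma loc_oppE x s : loc_opp (frac x s) = frac (- x) s.
Proof.
have /frac_eqP[u e] := fracK (frac x s).
by apply/frac_eqP; exists u; rewrite !scalerN e.
Qed.

Lemma locP z : exists x s, z = frac x s.
Proof. by exists (num z), (den z); rewrite fracK. Qed.

Let addA : associative loc_add.
Proof.
move=> z w v; have [x [s ->]] := locP z; have [y [t ->]] := locP w.
have [x' [r ->]] := locP v; rewrite !loc_addE; apply/frac_eqP; exists denom1.
rewrite /= !scalerDr !scalerA addrA.
by congr (_ *: _ + _ *: _ + _ *: _); ring.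
Qed.

Let addC : commutative loc_add.
Proof.
move=> z w; have [x [s ->]] := locP z; have [y [t ->]] := locP w.
rewrite !loc_addE; apply/frac_eqP; exists denom1.
by rewrite /= !scalerDr !scalerA addrC; congr (_ *: _ + _ *: _); ring.
Qed.

Let add0 : left_id (frac 0 denom1) loc_add.
Proof.
move=> z; have [x [s ->]] := locP z.
rewrite !loc_addE; apply/frac_eqP; exists denom1.
by rewrite /= scaler0 add0r !scalerA; congr (_ *: _); ring.
Qed.

Let addN : left_inverse (frac 0 denom1) loc_opp loc_add.
Proof.
move=> z; have [x [s ->]] := locP z.
rewrite loc_oppE !loc_addE; apply/frac_eqP; exists denom1.
by rewrite /= scalerN addNr !scaler0.
Qed.

HB.instance Definition _ :=
  GRing.isZmodule.Build locmod addA addC add0 addN.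

End Module.

Definition locring : Type := locmod A^o.
HB.instance Definition _ := GRing.Zmodule.on locring.

Section Scale.
Variable V : lmodType A.

Definition loc_scale (c : locring) (z : locmod V) : locmod V :=
  frac ((num c : A) *: num z) (denomM (den c) (den z)).

Lemma loc_scaleE (a : A^o) s (x : V) t :
  loc_scale (frac a s) (frac x t) = frac ((a : A) *: x) (denomM s t).
Proof.
rewrite /loc_scale.
have /frac_eqP[u] := fracK (frac a s); have /frac_eqP[v] := fracK (frac x t).
set x' := num (frac x t); set t' := den (frac x t).
set a' := num (frac a s); set s' := den (frac a s) => xE.
rewrite /GRing.scale /= => aE.
apply/frac_eqP; exists (denomM u v) => /=; rewrite !scalerA.
rewrite (_ : _ * a' = (dval u * dval s * a') * (dval v * dval t)); last by ring.
by rewrite aE -scalerA xE scalerA; congr (_ *: _); ring.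
Qed.

Lemma loc_scale1 : left_id (frac (1 : A^o) denom1) loc_scale.
Proof.
move=> z; have [x [s ->]] := locP z; rewrite loc_scaleE.
by apply/frac_eqP; exists denom1; rewrite /= scale1r !mul1r.
Qed.

Lemma loc_scaleDr : right_distributive loc_scale +%R.
Proof.
move=> c z w; have [a [s ->]] := locP c; have [x [t ->]] := locP z.
have [y [r ->]] := locP w; rewrite /GRing.add /= loc_addE !loc_scaleE loc_addE.
apply/frac_eqP; exists denom1; rewrite /= !scalerDr !scalerA.
by congr (_ *: _ + _ *: _); ring.
Qed.

Lemma loc_scaleDl z : {morph loc_scale^~ z : b c / b + c}.
Proof.
move=> b c; have [a [s ->]] := locP b; have [a' [t ->]] := locP c.
have [y [r ->]] := locP z; rewrite /GRing.add /= loc_addE !loc_scaleE loc_addE.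
rewrite (_ : dval t *: a + dval s *: a' = dval t * a + dval s * a') //.
apply/frac_eqP; exists denom1; rewrite /= !scalerDr !scalerA.
by rewrite -scalerDl; congr (_ *: _); ring.
Qed.

End Scale.

Lemma loc_mulE (a b : A^o) s t :
  loc_scale (frac a s) (frac b t) = frac (a * b : A^o) (denomM s t).
Proof. exact: loc_scaleE. Qed.

Lemma loc_scaleA (V : lmodType A) (b c : locring) (z : locmod V) :
  loc_scale b (loc_scale c z) = loc_scale (loc_scale b c) z.
Proof.
have [a [s ->]] := locP b; have [a' [t ->]] := locP c.
have [x [r ->]] := locP z.
rewrite (loc_scaleE a' t x r) (loc_scaleE a s _ (denomM t r)).
rewrite (loc_mulE a a' s t) (loc_scaleE (a * a' : A^o) _ x r).
apply/frac_eqP; exists denom1; rewrite /= !scalerA.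
by congr (_ *: _); ring.
Qed.

Let mulC : commutative (@loc_scale A^o).
Proof.
move=> b c; have [a [s ->]] := locP b; have [a' [t ->]] := locP c.
rewrite !loc_mulE; apply/frac_eqP; exists denom1.
by rewrite /GRing.scale /=; ring.
Qed.

Let mulA : associative (@loc_scale A^o).
Proof. by move=> a b c; rewrite loc_scaleA. Qed.

Let mulDl : left_distributive (@loc_scale A^o) +%R.
Proof. by move=> a b c; rewrite loc_scaleDl. Qed.

Let nonzero1 : frac (1 : A^o) denom1 != 0 :> locring.
Proof.
apply/eqP => /frac_eqP[u]; rewrite /GRing.scale /= !mulr1 mulr0 => u0.
by have : dval u \notin P := valP u; rewrite u0 idealr0.
Qed.

(* The ring A_P. *)
HB.instance Definition _ := GRing.Zmodule_isComNzRing.Build locring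
  mulA mulC (@loc_scale1 A^o) mulDl nonzero1.

HB.instance Definition _ (V : lmodType A) :=
  GRing.Zmodule_isLmodule.Build locring (locmod V)
    (@loc_scaleA V) (@loc_scale1 V) (@loc_scaleDr V) (@loc_scaleDl V).

End Localization.

Definition has_rank (A : comNzRingType) (V : lmodType A) (r : nat) : Prop :=
  forall P : prime_idealr A, associated_prime P ->
    @isomorphic (locring P) (locmod P V) {ffun 'I_r -> (locring P)^o}.

Section Resolutions.
Variable A : comNzRingType.

Definition projective (P : lmodType A) : Prop :=
  forall (X Y : lmodType A) (g : {linear X -> Y}) (f : {linear P -> Y}),
    (forall y, exists x, g x = y) ->
    exists h : {linear P -> X}, forall p, g (h p) = f p.

Definition injective_module (E : lmodType A) : Prop :=
  forall (X Y : lmodType A) (g : {linear X -> Y}) (f : {linear X -> E}),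
    injective g -> exists h : {linear Y -> E}, forall x, h (g x) = f x.

(* ... -> P 2 -> P 1 -> P 0 -> V -> 0 *)
Record projective_resolution (V : lmodType A) := ProjectiveResolution {
  proj_obj :> nat -> lmodType A;
  proj_diff : forall n, {linear proj_obj n.+1 -> proj_obj n};
  proj_aug : {linear proj_obj 0%N -> V};
  proj_projective : forall n, projective (proj_obj n);
  proj_aug_surj : forall v, exists x, proj_aug x = v;
  proj_exact0 : forall x,
    proj_aug x = 0 <-> exists y, x = proj_diff 0 y;
  proj_exactS : forall n x,
    proj_diff n x = 0 <-> exists y, x = proj_diff n.+1 y
}.

(* 0 -> V -> E 0 -> E 1 -> E 2 -> ... *)
Record injective_resolution (V : lmodType A) := InjectiveResolution {
  inj_obj :> nat -> lmodType A;
  inj_diff : forall n, {linear inj_obj n -> inj_obj n.+1};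
  inj_aug : {linear V -> inj_obj 0%N};
  inj_injective : forall n, injective_module (inj_obj n);
  inj_aug_inj : injective inj_aug;
  inj_exact0 : forall x,
    inj_diff 0 x = 0 <-> exists y, x = inj_aug y;
  inj_exactS : forall n x,
    inj_diff n.+1 x = 0 <-> exists y, x = inj_diff n y
}.

Definition finite_injective_dim (V : lmodType A) : Prop :=
  exists (E : injective_resolution V) (n : nat),
    forall i, (n < i)%N -> forall x : E i, x = 0.

End Resolutions.

(* Ext^n(V, M) is the n-th cohomology of Hom(P, M), for P a projective
   resolution of V. *)
Section Ext.
Variables (A : comNzRingType) (V : lmodType A) (P : projective_resolution V).
Variables (M : lmodType A) (n : nat).

Definition cocycle : {pred P n -> M} := [pred f : P n -> M |
  `[< linear f /\ forall x, f (proj_diff P n x) = 0 >] ].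

Lemma cocycle_submod : submod_closed cocycle.
Proof.
split=> [|a f g /asboolP[fL f0] /asboolP[gL g0]]; apply/asboolP; split=> //.
- by move=> a x y; rewrite [RHS]addr0 [RHS]scaler0.
- have fgE z : (a *: f + g) z = a *: f z + g z by [].
  move=> b x y; rewrite !fgE fL gL !scalerDr !scalerA [a * b]mulrC.
  by rewrite addrACA.
- have fgE z : (a *: f + g) z = a *: f z + g z by [].
  by move=> x; rewrite fgE f0 g0 scaler0 addr0.
Qed.

HB.instance Definition _ :=
  GRing.isSubmodClosed.Build A (P n -> M) cocycle cocycle_submod.

Definition cocycles : Type := {f : P n -> M | f \in cocycle}.
HB.instance Definition _ := [isSub of cocycles for @sval _ _].
HB.instance Definition _ := [Choice of cocycles by <:].
HB.instance Definition _ := [SubChoice_isSubLmodule of cocycles by <:].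

Definition is_coboundary k : (P k -> M) -> Prop :=
  if k is k'.+1 then
    fun f => exists g : {linear P k' -> M}, f = g \o proj_diff P k'
  else fun f => f = \0.

Definition coboundary : {pred cocycles} :=
  [pred f : cocycles | `[< is_coboundary (val f) >] ].

Lemma coboundary_submod : submod_closed coboundary.
Proof.
split=> [|a f g /asboolP fB /asboolP gB]; apply/asboolP.
  by rewrite /=; case: (n) => //= k; exists \0; apply/funext.
rewrite [val _](_ : _ = a *: val f + val g) //.
move: (val f) (val g) fB gB; case: (n) => [|k] f' g' /=.
  move=> -> ->; apply/funext => x.
  by rewrite (_ : (_ + _) x = a *: \0 x + \0 x) //= scaler0 addr0.
move=> [h ->] [h' ->]; exists (a \*: h \+ h').
by apply/funext.
Qed.

HB.instance Definition _ :=
  GRing.isSubmodClosed.Build A cocycles coboundary coboundary_submod.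

Definition Ext : lmodType A := quotmod coboundary.

End Ext.

Section LocalInvariants.
Variables (A : comNzRingType) (m : idealr A).

(* mu_n(m, M) = c.  The A-module Ext^n(A/m, M) is killed by m; its dimension
   over A/m is c iff it is isomorphic to (A/m)^c, A-linear and A/m-linear maps
   being the same.  The choice of the resolution P is immaterial. *)
Definition bass_number (M : lmodType A) (n c : nat) : Prop :=
  exists P : projective_resolution {ideal_quot m},
    isomorphic (Ext P M n) {ffun 'I_c -> {ideal_quot m}}.

(* y belongs to (x_1, ..., x_k) M *)
Definition in_ideal_mul (M : lmodType A) (xs : seq A) (y : M) : Prop :=
  exists z : 'I_(size xs) -> M, y = \sum_(i < size xs) xs`_i *: z i.

Definition regular_seq (M : lmodType A) (xs : seq A) : Prop :=
  (forall i, (i < size xs)%N -> forall y : M,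
     in_ideal_mul (take i xs) (xs`_i *: y) -> in_ideal_mul (take i xs) y) /\
  exists y : M, ~ in_ideal_mul xs y.

Definition depth (M : lmodType A) (t : nat) : Prop :=
  (exists xs, [/\ size xs = t, {subset xs <= m} & regular_seq M xs]) /\
  (forall xs, {subset xs <= m} -> regular_seq M xs -> (size xs <= t)%N).

Definition ring_type (tau : nat) : Prop :=
  exists t, depth A^o t /\ bass_number A^o t tau.

Definition cohen_macaulay : Prop :=
  exists d, krull_dim A d /\ depth A^o d.

Definition gorenstein : Prop :=
  [/\ noetherian A, local_ring m & finite_injective_dim (A := A) A^o].

(* A canonical module of a Cohen-Macaulay local ring is a maximal
   Cohen-Macaulay module of type 1 and of finite injective dimension. *)
Definition canonical_module (omega : lmodType A) : Prop :=
  [/\ cohen_macaulay, finitely_generated omega,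
      exists d, [/\ krull_dim A d, depth omega d & bass_number omega d 1]
    & finite_injective_dim omega].

End LocalInvariants.

Definition gorenstein_quotient (A : comNzRingType) : Prop :=
  exists (R : comNzRingType) (n : idealr R) (f : {rmorphism R -> A}),
    gorenstein n /\ forall a, exists x, f x = a.

(* Main.v *)
(* Take a dualizing complex J of A and let X be Hom(M, J), with Hom(M, J^(d-j))
   in degree j.  By local duality the Bass numbers of M are the ranks b_j of the
   minimal free resolution of X.  Localizing at the associated primes of A, all
   of which have dimension d, the ranks of the successive syzygies of X are
   computed from r and the b_j; so b_n <= 1 for some n >= d makes the resolution
   stop at some N >= d.  Comparing Ext(k, -) of the syzygies gives depth A >= N,
   hence N = d and A is Cohen-Macaulay.  The last syzygy is then free of rank
   b_d >= r, and climbing the resolution gives nu(M) = b_d * type(A).  If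
   b_d = r, the last map of the resolution vanishes, so M is maximal
   Cohen-Macaulay with free dual of rank r, and biduality identifies M with the
   r-th power of the canonical module. *)
Require Import Defs.
From HB Require Import structures.
From mathcomp Require Import all_boot all_algebra.
From mathcomp Require Import generic_quotient ring_quotient.
From mathcomp Require Import all_classical.
From mathcomp Require Import ring zify.
Set Implicit Arguments.
Unset Strict Implicit.
Unset Printing Implicit Defensive.
Import GRing.Theory.
Local Open Scope ring_scope.

(** * Submodules as predicates; submodules and quotients as modules *)

Section LinearMaps.
Variable A : comNzRingType.
Implicit Types U V W : lmodType A.

(** Unmixedness speaks of the completion, whereas the rank count needs dim A/P = d for the
    associated primes P of A itself; the transfer uses systems of parameters approximated in A.
    Localized modules are avoided: vanishing, length and rank at q are statements about submodules
    up to a denominator outside q. The count itself is short. With c_j the rank of the j-th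
    cokernel, c_(j+1) = b_j - c_j for j >= d, and c_d >= r > 0; since 0 <= c_n <= b_n <= 1, one of
    c_n and c_(n+1) is 0, and a syzygy of rank 0 inside a free module is 0, every nonzero element of
    a free module being visible at some associated prime of A. If b_d = r and d > 0, the step from d
    - 1 to d reads r = r + b_(d-1) - c_(d-1), which makes the map into F_(d-1) vanish. *)

Definition mkL U V (f : U -> V) (fL : linear f) : {linear U -> V} :=
  HB.pack f (GRing.isLinear.Build _ _ _ _ f fL).

Lemma mkLE U V (f : U -> V) (fL : linear f) x : mkL fL x = f x.
Proof. by []. Qed.

Lemma linP U V (f : {linear U -> V}) : linear f.
Proof. exact: linearP. Qed.

(** Submodules stay predicates on an ambient module, so that sums, images and preimages create no
    new carrier; [submod] bundles one only where a submodule or a quotient must itself be a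
    module. *)
Definition smod V (S : V -> Prop) : Prop :=
  S 0 /\ forall a x y, S x -> S y -> S (a *: x + y).

Section SmodTheory.
Variables (V : lmodType A) (S : V -> Prop).
Hypothesis sS : smod S.
Lemma smod0 : S 0. Proof. by case: sS. Qed.
Lemma smodD x y : S x -> S y -> S (x + y).
Proof. by move=> Sx Sy; rewrite -[x]scale1r; apply: sS.2. Qed.
Lemma smodZ a x : S x -> S (a *: x).
Proof. by move=> Sx; rewrite -[_ *: _]addr0; apply: sS.2 => //; exact: smod0. Qed.
Lemma smodN x : S x -> S (- x).
Proof. by move=> Sx; rewrite -scaleN1r; exact: smodZ. Qed.
Lemma smodB x y : S x -> S y -> S (x - y).
Proof. by move=> Sx Sy; apply: smodD => //; exact: smodN. Qed.
Lemma smod_sum (I : Type) (r : seq I) (P : pred I) (F : I -> V) :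
  (forall i, P i -> S (F i)) -> S (\sum_(i <- r | P i) F i).
Proof.
move=> SF; elim/big_ind: _ => //; [exact: smod0 | exact: smodD].
Qed.
Lemma smodBr x y : S (x - y) -> S y -> S x.
Proof. by move=> Sxy Sy; rewrite -(subrK y x); exact: smodD. Qed.
Lemma smodBl x y : S (x - y) -> S x -> S y.
Proof. by move=> Sxy Sx; rewrite -(subKr x y); exact: smodB. Qed.
End SmodTheory.

Lemma smodI V (S T : V -> Prop) : smod S -> smod T -> smod (fun x => S x /\ T x).
Proof.
move=> sS sT; split; first by split; exact: smod0.
by move=> a x y [Sx Tx] [Sy Ty]; split; [apply: sS.2 | apply: sT.2].
Qed.

Definition addS V (S T : V -> Prop) x := exists2 y, S y & T (x - y).

Lemma smod_add V (S T : V -> Prop) : smod S -> smod T -> smod (addS S T).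
Proof.
move=> sS sT; split; first by exists 0; [exact: smod0 | rewrite subr0; exact: smod0].
move=> a x y [u Su Tu] [v Sv Tv]; exists (a *: u + v); first exact: sS.2.
by rewrite opprD addrACA -scalerBr; apply: sT.2.
Qed.

Lemma smodT V : smod (fun _ : V => True). Proof. by []. Qed.
Lemma smod1 V : smod (fun x : V => x = 0).
Proof. by split=> // a x y -> ->; rewrite scaler0 addr0. Qed.

Lemma smod_img U V (f : {linear U -> V}) (S : U -> Prop) :
  smod S -> smod (fun y => exists2 x, S x & y = f x).
Proof.
move=> sS; split; first by exists 0; [exact: smod0 | rewrite linear0].
move=> a _ _ [x Sx ->] [y Sy ->]; exists (a *: x + y); first exact: sS.2.
by rewrite linearP.
Qed.

Lemma smod_preim U V (f : {linear U -> V}) (S : V -> Prop) :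
  smod S -> smod (fun x => S (f x)).
Proof.
move=> sS; split; first by rewrite linear0; exact: smod0.
by move=> a x y Sx Sy; rewrite linearP; exact: sS.2.
Qed.

Record submod V := Submod { sset :> V -> Prop; ssetP : smod sset }.

Definition spred V (S : submod V) : {pred V} := [pred x | `[< S x >]].

Lemma spred_closed V (S : submod V) : submod_closed (spred S).
Proof.
split; first by apply/asboolP; exact: smod0 (ssetP S).
by move=> a x y /asboolP Sx /asboolP Sy; apply/asboolP; apply: (ssetP S).2.
Qed.

End LinearMaps.
Arguments smodT {A V}.
Arguments smod1 {A V}.

HB.instance Definition _ (A : comNzRingType) (V : lmodType A) (S : submod V) :=
  GRing.isSubmodClosed.Build A V (spred S) (spred_closed S).

Section SubQuo.
Variables (A : comNzRingType) (V : lmodType A) (S : submod V).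

Definition subm : Type := {x : V | x \in spred S}.
HB.instance Definition _ := [isSub of subm for @sval _ _].
HB.instance Definition _ := [Choice of subm by <:].
HB.instance Definition _ := [SubChoice_isSubLmodule of subm by <:].

Definition sinc_fun (x : subm) : V := val x.
Lemma sinc_linear : linear sinc_fun. Proof. by []. Qed.
Definition sinc : {linear subm -> V} := mkL sinc_linear.

Lemma sinc_inj : injective sinc.
Proof. exact: val_inj. Qed.
Lemma sincP x : S (sinc x).
Proof. by have /asboolP := valP x. Qed.
Lemma sinc_surj v : S v -> exists x, sinc x = v.
Proof. by move=> /asboolP Sv; exists (exist _ v Sv). Qed.

Definition quom : lmodType A := quotmod (spred S : submodClosed V).

Definition qpi_fun (v : V) : quom := (\pi_(Quotient.quot (submod_zmod (spred S : submodClosed V))) v)%qT.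
Lemma qpi_linear : linear qpi_fun.
Proof.
move=> a x y; rewrite [a *: qpi_fun x](_ : _ = qpi_fun (a *: x)); last first.
  exact: quotmod_scaleE.
by rewrite /qpi_fun piE.
Qed.
Definition qpi : {linear V -> quom} := mkL qpi_linear.
Lemma qpi_surj z : exists v, qpi v = z.
Proof. by exists (repr (z : Quotient.quot (submod_zmod (spred S : submodClosed V)))); rewrite /= /qpi_fun reprK. Qed.
Lemma qpi0 v : qpi v = 0 <-> S v.
Proof.
rewrite -(linear0 qpi) /= /qpi_fun; split.
  by move=> /eqP; rewrite -Quotient.idealrBE subr0 => /asboolP.
by move=> Sv; apply/eqP; rewrite -Quotient.idealrBE subr0; apply/asboolP.
Qed.

End SubQuo.
Arguments sinc {A V} S.
Arguments qpi {A V} S.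

(** * Factorization, lifting and extension of linear maps *)

Section Factor.
Variable A : comNzRingType.
Implicit Types U V W K Q : lmodType A.

Lemma lin_factor V Q W (p : {linear V -> Q}) (f : {linear V -> W}) :
  (forall z, exists v, p v = z) -> (forall v, p v = 0 -> f v = 0) ->
  exists g : {linear Q -> W}, forall v, g (p v) = f v.
Proof.
move=> psurj pf; have [s sK] := choice psurj.
have gE v : f (s (p v)) = f v.
  apply/eqP; rewrite -subr_eq0 -linearB; apply/eqP/pf.
  by rewrite linearB sK subrr.
suff gL : linear (f \o s) by exists (mkL gL) => v; rewrite mkLE /= gE.
move=> a x y /=; rewrite -linearP -(gE (_ + _)); congr (f (s _)).
by rewrite linearP !sK.
Qed.

Lemma lin_lift U V K (i : {linear K -> V}) (f : {linear U -> V}) :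
  injective i -> (forall u, exists k, i k = f u) ->
  exists g : {linear U -> K}, forall u, i (g u) = f u.
Proof.
move=> iinj fi; have [g gE] := choice fi.
suff gL : linear g by exists (mkL gL).
by move=> a x y; apply: iinj; rewrite linearP !gE linearP.
Qed.

Lemma lin_inj U V (f : {linear U -> V}) :
  (forall x, f x = 0 -> x = 0) -> injective f.
Proof.
move=> f0 x y fxy; apply/eqP; rewrite -subr_eq0; apply/eqP/f0.
by rewrite linearB fxy subrr.
Qed.

Lemma inj_lin0 U V (f : {linear U -> V}) x : injective f -> f x = 0 -> x = 0.
Proof. by move=> fi fx; apply: fi; rewrite fx linear0. Qed.

Definition ses U V W (i : {linear U -> V}) (p : {linear V -> W}) : Prop :=
  [/\ injective i, forall z, exists y, p y = z
    & forall y, p y = 0 <-> exists x, y = i x].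

Lemma ses_sub V (S : submod V) : ses (sinc S) (qpi S).
Proof.
split; [exact: sinc_inj | exact: qpi_surj |].
move=> y; rewrite qpi0; split=> [/sinc_surj[x <-]|[x ->]]; first by exists x.
exact: sincP.
Qed.

Lemma injective_ext (E : lmodType A) U V (i : {linear U -> V}) (f : {linear U -> E}) :
  injective_module E -> (forall x, i x = 0 -> x = 0) ->
  exists h : {linear V -> E}, forall x, h (i x) = f x.
Proof. by move=> inj i0; apply: inj; exact: lin_inj. Qed.

(* maps out of a submodule extend even when the map to the ambient module is
   not injective, provided its kernel is respected *)
Lemma injective_ext2 (E : lmodType A) U V (i : {linear U -> V}) (f : {linear U -> E}) :
  injective_module E -> (forall x, i x = 0 -> f x = 0) ->
  exists h : {linear V -> E}, forall x, h (i x) = f x.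
Proof.
move=> inj i0.
have sI : smod (fun y => exists2 x, True & y = i x) by exact/smod_img/smodT.
pose I := Submod sI.
have [i' i'E] : exists i' : {linear U -> subm I}, forall x, sinc I (i' x) = i x.
  apply: lin_lift; first exact: sinc_inj.
  by move=> u; apply: sinc_surj; exists u.
have [g gE] : exists g : {linear subm I -> E}, forall x, g (i' x) = f x.
  apply: lin_factor => [z|v v0].
    have [v _ vE] := sincP z; exists v; apply: sinc_inj; by rewrite i'E -vE.
  by apply: i0; rewrite -i'E v0 linear0.
have [h hE] := inj _ _ (sinc I) g (@sinc_inj _ _ I).
by exists h => x; rewrite -i'E hE gE.
Qed.

End Factor.

(** * Spans, finite generation, noetherian rings *)

Section Spans.
Variable A : comNzRingType.
Implicit Types U V W : lmodType A.

(** Recursion on the list lets an induction on generators peel off one coefficient at a time; [spnE]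
    identifies this with [in_span]. *)
Fixpoint spn V (s : seq V) (x : V) : Prop :=
  if s is v :: s' then exists a, spn s' (x - a *: v) else x = 0.

Lemma smod_spn V (s : seq V) : smod (spn s).
Proof.
elim: s => [|v s IH] /=; first exact: smod1.
split; first by exists 0; rewrite scale0r subrr; exact: smod0.
move=> a x y [b Hb] [c Hc]; exists (a * b + c).
rewrite scalerDl opprD addrACA -scalerA -scalerBr; exact: IH.2.
Qed.

Lemma spn_mem V (s : seq V) x : x \in s -> spn s x.
Proof.
elim: s => //= v s IH; rewrite inE => /orP[/eqP->|/IH sx].
  by exists 1; rewrite scale1r subrr; exact: smod0 (smod_spn _).
by exists 0; rewrite scale0r subr0.
Qed.

Lemma spn_min V (s : seq V) (S : V -> Prop) x : smod S ->
  (forall v, v \in s -> S v) -> spn s x -> S x.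
Proof.
move=> sS; elim: s x => [|v s IH] x Ss /=; first by move=> ->; exact: smod0.
case=> a /IH Sx; apply: (smodBr sS (y := a *: v)).
  by apply: Sx => w ws; apply: Ss; rewrite inE ws orbT.
by apply: smodZ => //; apply: Ss; rewrite mem_head.
Qed.

Lemma smod_in_span V n (e : 'I_n -> V) : smod (in_span e).
Proof.
split; first by exists (fun=> 0); rewrite big1 // => i _; rewrite scale0r.
move=> a x y [c ->] [d ->]; exists (fun i => a * c i + d i).
rewrite scaler_sumr -big_split; apply: eq_bigr => i _ /=.
by rewrite scalerDl scalerA.
Qed.

Lemma in_span_gen V n (e : 'I_n -> V) i : in_span e (e i).
Proof.
exists (fun j => (j == i)%:R); rewrite (bigD1 i) //= eqxx scale1r.
by rewrite big1 ?addr0 // => j /negbTE ->; rewrite scale0r.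
Qed.

Lemma in_span_min V n (e : 'I_n -> V) (S : V -> Prop) x : smod S ->
  (forall i, S (e i)) -> in_span e x -> S x.
Proof. by move=> sS Se [c ->]; apply: smod_sum => // i _; apply: smodZ. Qed.

Lemma in_spanE V n (e : 'I_n -> V) x : in_span e x <-> spn (codom e) x.
Proof.
split; first by apply: in_span_min => [|i]; [exact: smod_spn | exact/spn_mem/codom_f].
apply: spn_min; first exact: smod_in_span.
by move=> v /codomP[i ->]; exact: in_span_gen.
Qed.

Lemma spnE V (s : seq V) x : spn s x <-> in_span (fun i : 'I_(size s) => s`_i) x.
Proof.
split; last first.
  by apply: in_span_min => [|i]; [exact: smod_spn | exact/spn_mem/mem_nth].
apply: spn_min; first exact: smod_in_span.
move=> v /(nthP 0)[i ilt <-].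
exact: (in_span_gen (fun i : 'I_(size s) => s`_i) (Ordinal ilt)).
Qed.

Definition fgs V (S : V -> Prop) := exists s : seq V, forall x, S x <-> spn s x.
Definition fgm V := fgs (fun _ : V => True).

Lemma fgmP V : finitely_generated V <-> fgm V.
Proof.
split=> [[n [e eg]]|[s sV]].
  by exists (codom e) => x; split=> // _; apply/in_spanE.
by exists (size s), (fun i => s`_i) => x; apply/spnE/sV.
Qed.

Definition idl (I : A -> Prop) := smod (V := A^o) I.

Definition noeth := forall I, idl I -> fgs (V := A^o) I.

Lemma idlMl (I : A -> Prop) a x : idl I -> I x -> I (a * x).
Proof. by move=> sI; exact: (smodZ sI). Qed.
Lemma idlMr (I : A -> Prop) a x : idl I -> I x -> I (x * a).
Proof. by rewrite mulrC; exact: idlMl. Qed.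
Lemma idlD (I : A -> Prop) x y : idl I -> I x -> I y -> I (x + y).
Proof. by move=> sI; exact: (smodD sI). Qed.
Lemma idlB (I : A -> Prop) x y : idl I -> I x -> I y -> I (x - y).
Proof. by move=> sI; exact: (smodB sI). Qed.
Lemma idl0 (I : A -> Prop) : idl I -> I 0.
Proof. exact: smod0. Qed.

Section MkIdeal.
Variable I : A -> Prop.
Hypotheses (sI : idl I) (I1 : ~ I 1).
Definition ipred : {pred A} := [pred x | `[< I x >]].
Lemma ipred_closed : idealr_closed ipred.
Proof.
split; first by apply/asboolP; exact: idl0 sI.
  by apply/negP => /asboolP.
by move=> a u v /asboolP Iu /asboolP Iv; apply/asboolP; apply: sI.2.
Qed.
Definition mk_idealr : idealr A := HB.pack_for (idealr A) ipred
  (isIdealr.Build A ipred ipred_closed).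
Lemma mk_idealrE x : (x \in mk_idealr) <-> I x.
Proof. by split=> /asboolP. Qed.
End MkIdeal.

(** The bundled ideals of [noetherian] are proper, while [noeth] ranges over all ideals; the unit
    ideal is generated by 1. *)
Lemma noethP : noetherian A <-> noeth.
Proof.
split=> [nA I sI|nA I].
  have [I1|I1] := pselect (I 1).
    exists [:: 1 : A^o] => x; split=> _ /=.
      by exists x; rewrite /GRing.scale /= mulr1 subrr.
    by rewrite -[x]mulr1; exact: idlMl.
  have [n [e Ie]] := nA (mk_idealr sI I1).
  by exists (codom e) => x; rewrite -in_spanE -Ie mk_idealrE.
have sI : idl (fun x => x \in I).
  by split=> [|a x y Ix Iy]; [exact: idealr0 | apply: rpredD => //; exact: idealMr].
have [s Is] := nA _ sI; exists (size s), (fun i => s`_i) => x.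
by rewrite -spnE; exact: Is.
Qed.

(** Induction on the generators of the ambient span. The coefficients of [v] in elements of S form a
    finitely generated ideal; lifts of its generators, together with generators of the part of S
    inside the span of the remaining list, generate S. *)
Lemma fgs_noeth V (s : seq V) (S : V -> Prop) : noeth -> smod S ->
  (forall x, S x -> spn s x) -> fgs S.
Proof.
move=> nA; elim: s S => [|v s IH] S sS Ss.
  exists [::] => x; split=> [/Ss //|/= ->]; exact: smod0.
pose I a := exists2 x, S x & spn s (x - a *: v).
have sI : idl I.
  split; first by exists 0; [exact: smod0 | rewrite scale0r subrr; exact: smod0 (smod_spn _)].
  move=> a b c [x Sx xs] [y Sy ys]; exists (a *: x + y); first exact: sS.2.
  rewrite (_ : _ - _ = a *: (x - b *: v) + (y - c *: v)); first exact: (smod_spn s).2.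
  by rewrite scalerDl scalerBr -[a *: b]/(a * b) scalerA opprD addrACA.
have [t It] := nA I sI.
have /choice[f fP] : forall a, exists y, I a -> S y /\ spn s (y - a *: v).
  move=> a.
  have [[x Sx xs]|nIa] := pselect (I a); first by exists x.
  by exists 0.
have [u Su] := IH (fun x => S x /\ spn s x) (smodI sS (smod_spn s)) (fun x => @proj2 _ _).
exists ([seq f a | a <- t] ++ u) => x; split; last first.
  apply: spn_min => // w; rewrite mem_cat => /orP[/mapP[a at_ ->]|wu].
    by apply: (fP a _).1; apply/It/spn_mem.
  by have [] := (Su w).2 (spn_mem wu).
move=> Sx; have [a xas] := Ss _ Sx.
set T := _ ++ _; have sT := smod_spn T.
have : spn (V := A^o) t a by apply/It; exists x.
have sJ : idl (fun a => exists2 y, spn T y & spn s (y - a *: v)).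
  split; first by exists 0; [exact: smod0 | rewrite scale0r subrr; exact: smod0 (smod_spn s)].
  move=> b c d [y Ty ys] [z Tz zs]; exists (b *: y + z); first exact: sT.2.
  rewrite (_ : _ - _ = b *: (y - c *: v) + (z - d *: v)); first exact: (smod_spn s).2.
  by rewrite scalerDl scalerBr -[b *: c]/(b * c) scalerA opprD addrACA.
case/(spn_min sJ) => [b bt|y Ty ys].
  exists (f b); last by apply: (fP b _).2; apply/It/spn_mem.
  by apply: spn_mem; rewrite mem_cat map_f.
have Sy : S y.
  apply: spn_min Ty => // w; rewrite mem_cat => /orP[/mapP[b bt ->]|wu].
    by apply: (fP b _).1; apply/It/spn_mem.
  by have [] := (Su w).2 (spn_mem wu).
apply: (smodBr sT (y := y)) => //; apply: (@spn_min _ u).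
- exact: sT.
- by move=> w wu; apply: spn_mem; rewrite mem_cat wu orbT.
apply/Su; split; first exact: smodB.
rewrite (_ : x - y = (x - a *: v) - (y - a *: v)); first exact: smodB (smod_spn s) _ _ _ _.
by rewrite opprB addrA subrK.
Qed.

Lemma spn_map U V (f : {linear U -> V}) s x : spn s x -> spn [seq f y | y <- s] (f x).
Proof.
apply: (spn_min (smod_preim f (smod_spn [seq f y | y <- s]))) => v vs.
exact/spn_mem/map_f.
Qed.

Lemma fgs_sub V (S : V -> Prop) : noeth -> fgm V -> smod S -> fgs S.
Proof. by move=> nA [s sV] sS; apply: (fgs_noeth (s := s)) => // x _; apply/sV. Qed.

Lemma fgs_subm V (S : submod V) : fgs S -> fgm (subm S).
Proof.
case=> s Ss; have /choice[g gE] : forall v, exists y, S v -> sinc S y = v.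
  move=> v.
  have [/sinc_surj[y yv]|nS] := pselect (S v); first by exists y.
  by exists 0.
exists [seq g v | v <- s] => x; split=> // _.
have sP := smod_preim (sinc S) (smod_spn s).
have /Ss : S (sinc S x) by exact: sincP.
have sI := smod_img (sinc S) (smod_spn [seq g v | v <- s]).
case/(spn_min sI) => [v vs|y sy /sinc_inj -> //].
have Sv : S v by apply/Ss/spn_mem.
by exists (g v); [exact/spn_mem/map_f | rewrite gE].
Qed.

Lemma fgm_img U V (f : {linear U -> V}) :
  fgm U -> (forall y, exists x, f x = y) -> fgm V.
Proof.
case=> s sU fs; exists [seq f x | x <- s] => y; split=> // _.
by have [x <-] := fs y; apply/spn_map/sU.
Qed.

(** Without a maximal member, dependent choice gives a strictly increasing sequence in F, but its
    union is finitely generated, hence reached at a finite stage. Noetherian inductions below pick a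
    maximal counterexample through this lemma. *)
Lemma acc V (F : (V -> Prop) -> Prop) : (forall S, F S -> smod S) ->
  (forall S : V -> Prop, smod S -> fgs S) -> (exists S, F S) ->
  exists2 S, F S & forall T, F T -> (forall x, S x -> T x) -> forall x, T x -> S x.
Proof.
move=> Fs fgV [S0 FS0]; apply: contrapT => nmax.
have step (S : {S | F S}) : exists T : {T | F T},
  (forall x, sval S x -> sval T x) /\ exists2 x, sval T x & ~ sval S x.
  case: S => S FS /=; apply: contrapT => nT; apply: nmax; exists S => // T FT ST x Tx.
  apply: contrapT => nSx; apply: nT; exists (exist _ T FT); split=> //; by exists x.
have [nxt nxtP] := choice step.
pose N n := iter n nxt (exist _ S0 FS0).
have Nm i j x : (i <= j)%N -> sval (N i) x -> sval (N j) x.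
  move/subnK <-; elim: (j - i)%N => // k IH /IH; rewrite addSn /N iterS.
  exact: (nxtP _).1.
have sN i := Fs _ (proj2_sig (N i)).
have sU : smod (fun x => exists i, sval (N i) x).
  split; first by exists 0%N; exact: smod0.
  move=> a x y [i ix] [j jy]; exists (maxn i j); apply: (sN _).2.
    exact: Nm (leq_maxl _ _) ix.
  exact: Nm (leq_maxr _ _) jy.
have [s Us] := fgV _ sU.
have [k ks] : exists k, forall v, v \in s -> sval (N k) v.
  have : forall v, v \in s -> exists i, sval (N i) v by move=> v vs; apply/Us/spn_mem.
  elim: {Us} s => [|v s IH] H; first by exists 0%N.
  have [|k kP] := IH; first by move=> w ws; apply: H; rewrite inE ws orbT.
  have [i iv] := H v (mem_head _ _); exists (maxn i k) => w.
  rewrite inE => /orP[/eqP->|/kP]; first exact: Nm (leq_maxl _ _) iv.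
  exact: Nm (leq_maxr _ _).
have [x Nx nNx] := (nxtP (N k)).2; apply: nNx.
apply: (spn_min (sN k) ks); apply/Us; exists k.+1; exact: Nx.
Qed.

End Spans.

(** * Lengths of localized subquotients *)

Section Local.
Variable A : comNzRingType.
Implicit Types (U V W : lmodType A) (p q : A -> Prop).

Definition prm p := [/\ idl p, ~ p 1 & forall x y, p (x * y) -> p x \/ p y].

(* complements of multiplicative subsets; [fun a => a <> 1] is the one that makes localization trivial *)
Definition mulc q := ~ q 1 /\ forall s t, ~ q s -> ~ q t -> ~ q (s * t).

Lemma prm_mulc p : prm p -> mulc p.
Proof. by case=> _ p1 pM; split=> // s t ps pt /pM[]. Qed.

Lemma mulc1 : mulc (fun a => a <> 1).
Proof.
by split=> [|s t /contrapT -> /contrapT ->]; rewrite ?mulr1; apply.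
Qed.

(** The saturation of S at q: x/1 lies in the localization of S. [mulc q] only asks the complement
    of q to be multiplicative, so q may also be the complement of the powers of one element. *)
Definition qin q V (S : V -> Prop) x := exists2 s, ~ q s & S (s *: x).

Section Qin.
Variables (q : A -> Prop) (V : lmodType A) (S : V -> Prop).
Hypotheses (mq : mulc q) (sS : smod S).

Lemma sub_qin x : S x -> qin q S x.
Proof. by move=> Sx; exists 1; [exact: mq.1 | rewrite scale1r]. Qed.

Lemma smod_qin : smod (qin q S).
Proof.
split; first by apply: sub_qin; exact: smod0.
move=> a x y [s qs Sx] [t qt Sy]; exists (s * t); first exact: mq.2.
have -> : (s * t) *: (a *: x + y) = (t * a) *: (s *: x) + s *: (t *: y).
  by rewrite scalerDr !scalerA; congr (_ *: _ + _); ring.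
by apply: smodD => //; exact: smodZ.
Qed.

Lemma qin_qin x : qin q (qin q S) x -> qin q S x.
Proof. by case=> s qs [t qt St]; exists (t * s); [exact: mq.2 | rewrite -scalerA]. Qed.

Lemma qinZ s x : ~ q s -> qin q S (s *: x) -> qin q S x.
Proof. by move=> qs qx; apply: qin_qin; exists s. Qed.

End Qin.

Lemma qin_mono q V (S T : V -> Prop) x : (forall y, S y -> T y) -> qin q S x -> qin q T x.
Proof. by move=> ST [s qs Sx]; exists s => //; exact: ST. Qed.

Definition qnull q V := forall x : V, qin q (fun y => y = 0) x.

(** The length of (T/S)_q is at least n: starting from S there are n steps of submodules inside T,
    each strict after localization. *)
Fixpoint len_ge q V n (S T : V -> Prop) : Prop :=
  if n is n'.+1 then
    exists S', [/\ smod S', forall x, S x -> S' x, forall x, S' x -> T x,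
      exists2 x, S' x & ~ qin q S x & len_ge q n' S' T]
  else True.

Definition has_len q V (S T : V -> Prop) n := len_ge q n S T /\ ~ len_ge q n.+1 S T.

Section Len.
Variable q : A -> Prop.
Hypothesis mq : mulc q.

Lemma len_ge_bot V n (S S' T : V -> Prop) : (forall x, S x -> S' x) ->
  len_ge q n S' T -> len_ge q n S T.
Proof.
case: n => //= n SS' [S'' [? S'S'' ? [x Sx nx] ?]]; exists S''; split=> //.
  by move=> y /SS'/S'S''.
by exists x => // qx; apply: nx; apply: qin_mono qx.
Qed.

Lemma len_ge_top V n (S T T' : V -> Prop) : (forall x, T x -> T' x) ->
  len_ge q n S T -> len_ge q n S T'.
Proof.
move=> TT'; elim: n S => //= n IH S [S' [? ? S'T ? /IH]].
by exists S'; split=> // x /S'T/TT'.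
Qed.

Lemma len_geS V n (S T : V -> Prop) : len_ge q n.+1 S T -> len_ge q n S T.
Proof.
elim: n S => // n IH S [S' [? ? ? ? /IH]]; by exists S'.
Qed.

Lemma len_ge_le V k n (S T : V -> Prop) : (k <= n)%N -> len_ge q n S T -> len_ge q k S T.
Proof. by move/subnK <-; elim: (n - k)%N => // i IH /len_geS/IH. Qed.

Lemma has_len_ge V k n (S T : V -> Prop) : has_len q S T n -> len_ge q k S T -> (k <= n)%N.
Proof. by case=> _ nS kS; rewrite leqNgt; apply/negP => /len_ge_le/(_ kS). Qed.

Lemma has_len_uniq V k n (S T : V -> Prop) : has_len q S T n -> has_len q S T k -> n = k.
Proof.
move=> hn hk; apply/eqP; rewrite eqn_leq (has_len_ge hk hn.1).
by rewrite (has_len_ge hn hk.1).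
Qed.

Lemma len_fin V n (S T : V -> Prop) : ~ len_ge q n S T ->
  exists2 k, (k < n)%N & has_len q S T k.
Proof.
elim: n => [[] //|n IH nS]; have [ng|ng] := pselect (len_ge q n S T); first by exists n.
by have [k kn hk] := IH ng; exists k => //; exact: ltnW.
Qed.

Lemma len_cat V a b (S T U : V -> Prop) : (forall x, S x -> T x) -> (forall x, T x -> U x) ->
  len_ge q a S T -> len_ge q b T U -> len_ge q (a + b) S U.
Proof.
elim: a S => [|a IH] S ST TU /=; first by move=> _; exact: len_ge_bot.
move=> [S' [sS' SS' S'T st Hl]] Hb; exists S'; split=> //; last exact: IH.
by move=> x /S'T/TU.
Qed.

(** Each step from S to S' stays strict either after intersecting with T or after adding T; were
    both to collapse at q, the modular law would put S' in the saturation of S. So the number of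
    steps splits as a + b. *)
Lemma len_split V n (S T U : V -> Prop) : smod S -> smod T -> smod U ->
  (forall x, T x -> U x) -> len_ge q n S U ->
  exists a b, [/\ (a + b)%N = n, len_ge q a (fun x => S x /\ T x) T
    & len_ge q b (addS S T) U].
Proof.
move=> sS sT sU TU; elim: n S sS => [|n IH] S sS /=; first by exists 0%N, 0%N.
move=> [S' [sS' SS' S'U [x S'x nx] /IH[//|a [b [abn ha hb]]]]].
have [[y [S'y Ty] ny]|nstr] :=
  pselect (exists2 y, S' y /\ T y & ~ qin q (fun x => S x /\ T x) y).
  exists a.+1, b; split; first by rewrite addSn abn.
    exists (fun x => S' x /\ T x); split=> //; first exact: smodI.
    - by move=> z [/SS'].
    - by move=> z [].
    - by exists y.
  by apply: len_ge_bot hb => z [u /SS' ? ?]; exists u.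
exists a, b.+1; split; first by rewrite addnS abn.
  by apply: len_ge_bot ha => z [/SS'].
exists (addS S' T); split=> //; first exact: smod_add.
- by move=> z [u /SS' ? ?]; exists u.
- by move=> z [u /S'U ? /TU ?]; apply: (smodBr sU (y := u)).
exists x; first by exists x => //; rewrite subrr; exact: smod0.
case=> s qs [u Su Tu]; apply: nx; apply: (qinZ mq qs).
have [t qt [tS _]] : qin q (fun x => S x /\ T x) (s *: x - u).
  apply: contrapT => nqu; apply: nstr; exists (s *: x - u) => //; split=> //.
  by apply: smodB => //; [exact: smodZ | exact: SS'].
exists t => //; move: tS; rewrite scalerBr => /(smodBr sS); apply; exact: smodZ.
Qed.

Lemma has_len_add V a b (S T U : V -> Prop) : smod S -> smod T -> smod U ->
  (forall x, S x -> T x) -> (forall x, T x -> U x) ->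
  has_len q S T a -> has_len q T U b -> has_len q S U (a + b).
Proof.
move=> sS sT sU ST TU ha hb; split; first exact: (len_cat ST TU ha.1 hb.1).
move=> /(len_split sS sT sU TU)[a' [b' [abn ha' hb']]].
have la : (a' <= a)%N.
  by apply: (has_len_ge ha); apply: len_ge_bot ha' => x Sx; split=> //; exact: ST.
have lb : (b' <= b)%N.
  apply: (has_len_ge hb); apply: len_ge_bot hb' => x Tx.
  by exists 0; [exact: smod0 | rewrite subr0].
by lia.
Qed.

Lemma has_len_inv V n (S T U : V -> Prop) : smod S -> smod T -> smod U ->
  (forall x, S x -> T x) -> (forall x, T x -> U x) -> has_len q S U n ->
  exists a b, [/\ (a + b)%N = n, has_len q S T a & has_len q T U b].
Proof.
move=> sS sT sU ST TU hn.
have [a _ ha] : exists2 a, (a < n.+1)%N & has_len q S T a.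
  by apply: len_fin => h; apply: hn.2; apply: len_ge_top h.
have [b _ hb] : exists2 a, (a < n.+1)%N & has_len q T U a.
  by apply: len_fin => h; apply: hn.2; apply: len_ge_bot h.
exists a, b; split=> //; apply: (has_len_uniq (has_len_add sS sT sU ST TU ha hb)); exact: hn.
Qed.

(** A linear relation replaces a homomorphism: totality on T up to denominators and reflection of S'
    keep the image of a strict chain strict. Relations are used because connecting maps and inverses
    of local isomorphisms are not functions of representatives. *)
Lemma len_rel U V n (r : U -> V -> Prop) (S T : U -> Prop) (S' T' : V -> Prop) :
  smod S -> smod T -> smod S' -> smod T' -> (forall y, S' y -> T' y) ->
  r 0 0 -> (forall a x y x' y', r x y -> r x' y' -> r (a *: x + x') (a *: y + y')) ->
  (forall x, T x -> exists s y, [/\ ~ q s, T' y & r (s *: x) y]) ->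
  (forall x y, T x -> r x y -> S' y -> qin q S x) ->
  len_ge q n S T -> len_ge q n S' T'.
Proof.
move=> sS sT sS' sT' S'T' r0 rL rtot rref.
have rZ a x y : r x y -> r (a *: x) (a *: y).
  by move=> rxy; have := rL a _ _ _ _ rxy r0; rewrite !addr0.
pose M (N : U -> Prop) y := T' y /\ exists x y0, [/\ N x, r x y0 & S' (y - y0)].
suff main N : smod N -> (forall x, S x -> N x) -> (forall x, N x -> T x) ->
    len_ge q n N T -> len_ge q n (M N) T'.
  move=> nST; have S'M N : smod N -> forall y, S' y -> M N y.
    move=> sN y S'y; split; first exact: S'T'.
    by exists 0, 0; split=> //; [exact: smod0 | rewrite subr0].
  have sI := smodI sS sT; have /main H : smod (fun x => S x) by [].
  case: n main H nST => // n main H [S1 [sS1 SS1 S1T [x S1x nx] hl]].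
  have [ST|nST] := pselect (forall x, S x -> T x).
    by apply: (len_ge_bot (S'M _ sS)); apply: H => //; exists S1; split=> //; exists x.
  by exfalso; apply: nST => y /SS1/S1T.
elim: n N => //= n IH N sN SN NT [N' [sN' NN' N'T [x N'x nx] /IH hl]].
have SN' y : S y -> N' y by move=> /SN/NN'.
exists (M N'); split.
- split.
    by split; [exact: smod0 | exists 0, 0; split=> //; [exact: smod0 | rewrite subrr; exact: smod0]].
  move=> a y z [Ty [u [v [N'u ruv S'yv]]]] [Tz [u' [v' [N'u' ruv' S'zv]]]].
  split; first exact: sT'.2.
  exists (a *: u + u'), (a *: v + v'); split; [exact: sN'.2 | exact: rL |].
  by rewrite opprD addrACA -scalerBr; exact: sS'.2.
- by move=> y [Ty [u [v [/NN' Nu ruv Syv]]]]; split=> //; exists u, v.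
- by move=> y [].
- have [s [y [qs Ty rxy]]] := rtot _ (N'T _ N'x).
  exists y.
    split=> //; exists (s *: x), y; split=> //; first exact: smodZ.
    by rewrite subrr; exact: smod0.
  case=> t qt [_ [u [v [Nu ruv Svy]]]]; apply: nx.
  apply: (qinZ mq qs); apply: (qinZ mq qt).
  have /rref : r ((-1) *: u + t *: (s *: x)) ((-1) *: v + t *: y).
    by apply: rL => //; exact: rZ.
  rewrite !scaleN1r ![- _ + _]addrC => /(_ _ Svy) H.
  have {}H : qin q N (t *: (s *: x) - u).
    apply: (qin_mono SN); apply: H; apply: smodB => //; last exact: NT.
    by do 2!apply: smodZ => //; exact: N'T.
  by apply: (smodBr (smod_qin mq sN) H); exact: sub_qin.
by apply: hl => //; exact: SN'.
Qed.

End Len.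

Lemma has_len_rel q U V n (r : U -> V -> Prop) (S T : U -> Prop) (S' T' : V -> Prop) :
  mulc q -> smod S -> smod T -> smod S' -> smod T' ->
  (forall y, S y -> T y) -> (forall y, S' y -> T' y) ->
  r 0 0 -> (forall a x y x' y', r x y -> r x' y' -> r (a *: x + x') (a *: y + y')) ->
  (forall x, T x -> exists s y, [/\ ~ q s, T' y & r (s *: x) y]) ->
  (forall y, T' y -> exists s x, [/\ ~ q s, T x & r x (s *: y)]) ->
  (forall x y, T x -> r x y -> S' y -> qin q S x) ->
  (forall x y, T' y -> r x y -> S x -> qin q S' y) ->
  has_len q S T n -> has_len q S' T' n.
Proof.
move=> mq sS sT sS' sT' ST S'T' r0 rL t1 t2 r1 r2 [h1 h2]; split.
  exact: (len_rel mq sS sT sS' sT' S'T' r0 rL t1 r1 h1).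
move=> h; apply: h2; apply: (len_rel (r := fun y x => r x y) mq sS' sT' sS sT _ r0) h => //.
- by move=> a x y x' y'; exact: rL.
- by move=> y x T'y rxy Sx; exact: r2 rxy Sx.
Qed.

Definition ml q V n := has_len q (fun x : V => x = 0) (fun=> True) n.

Lemma len_img q U V n (f : {linear U -> V}) (S T : U -> Prop) (S' T' : V -> Prop) :
  mulc q -> smod S -> smod T -> smod S' -> smod T' ->
  (forall y, S y -> T y) -> (forall y, S' y -> T' y) ->
  (forall x, T x -> T' (f x)) -> (forall y, T' y -> qin q (fun y => exists2 x, T x & S' (y - f x)) y) ->
  (forall x, S x -> S' (f x)) ->
  (forall x, T x -> S' (f x) -> qin q S x) ->
  has_len q S T n -> has_len q S' T' n.
Proof.
move=> mq sS sT sS' sT' ST S'T' fT fT' fS fS'.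
apply: (has_len_rel (r := fun x y => S' (y - f x))) => //.
- by rewrite linear0 subr0; exact: smod0.
- move=> a x y x' y' H H'; rewrite linearP opprD addrACA -scalerBr; exact: sS'.2.
- move=> x Tx; exists 1, (f x); split=> //; [exact: mq.1 | exact: fT |].
  by rewrite scale1r subrr; exact: smod0.
- by move=> y /fT'[s qs [x Tx Sx]]; exists s, x.
- by move=> x y Tx H Sy; apply: fS' => //; exact: (smodBl sS' H).
- move=> x y _ H Sx; apply: sub_qin => //; apply: (smodBr sS' H); exact: fS.
Qed.

Lemma ml_ses q U V W (i : {linear U -> V}) (p : {linear V -> W}) a b :
  mulc q -> ses i p -> ml q U a -> ml q W b -> ml q V (a + b).
Proof.
move=> mq [iinj ps ip] hU hW; pose I y := exists2 x : U, True & y = i x.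
have sI : smod I by apply: smod_img; exact: smodT.
have pI y : p y = 0 <-> I y by rewrite ip; split=> [[x]|[x _]]; exists x.
apply: (has_len_add (T := I) mq) => //; [exact: smod1 | by move=> ? ->; exact: smod0 | |].
  apply: len_img hU => //; try exact: smod1.
  - by move=> ? ->; exact: smod0.
  - by move=> x _; exists x.
  - by move=> y [x _ ->]; apply: sub_qin => //; exists x; rewrite ?subrr.
  - by move=> x ->; rewrite linear0.
  - by move=> x _ /(inj_lin0 iinj); exact: sub_qin.
apply: (has_len_rel (r := fun w v => p v = w)) hW => //; rewrite ?linear0 //.
- exact: smod1.
- by move=> c x y x' y' <- <-; rewrite linearP.
- by move=> w _; have [y <-] := ps w; exists 1, y; rewrite scale1r; split=> //; exact: mq.1.
- by move=> y _; exists 1, (p y); rewrite scale1r; split=> //; exact: mq.1.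
- by move=> w v _ pv /pI pv0; apply: sub_qin => //; rewrite -pv.
- by move=> w v _ pv w0; apply: sub_qin => //; apply/pI; rewrite pv.
Qed.

Lemma ml_ses_inv q U V W (i : {linear U -> V}) (p : {linear V -> W}) n :
  mulc q -> ses i p -> ml q V n -> exists a b, [/\ (a + b)%N = n, ml q U a & ml q W b].
Proof.
move=> mq sip hV; have [iinj ps ip] := sip.
have [k kn hU] : exists2 k, (k < n.+1)%N & ml q U k.
  apply: len_fin => h; apply: hV.2.
  apply: (len_rel mq (r := fun u v => v = i u)) h => //; try exact: smod1.
  - by rewrite linear0.
  - by move=> a x y x' y' -> ->; rewrite linearP.
  - by move=> x _; exists 1, (i x); rewrite scale1r; split=> //; exact: mq.1.
  - by move=> x y _ -> /(inj_lin0 iinj); exact: sub_qin.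
have [l ln hW] : exists2 k, (k < n.+1)%N & ml q W k.
  apply: len_fin => h; apply: hV.2.
  apply: (len_rel mq (r := fun w v => p v = w)) h => //; try exact: smod1.
  - by rewrite linear0.
  - by move=> c x y x' y' <- <-; rewrite linearP.
  - by move=> w _; have [y <-] := ps w; exists 1, y; rewrite scale1r; split=> //; exact: mq.1.
  - by move=> w v _ <- ->; rewrite linear0; apply: sub_qin.
exists k, l; split=> //; exact: (has_len_uniq (ml_ses mq sip hU hW)).
Qed.

Lemma ml0 q V : mulc q -> qnull q V <-> ml q V 0.
Proof.
move=> mq; split=> [nV|[_ n1] x].
  by split=> //= -[S' [_ _ _ [x _ []]]]; exact: nV.
apply: contrapT => nx; apply: n1; exists (fun=> True); split=> //; by exists x.
Qed.

End Local.

(** * Nakayama's lemma, prime filtrations, associated primes, prime avoidance *)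

Section Devissage.
Variable A : comNzRingType.
Implicit Types (U V W : lmodType A) (p q : A -> Prop).

Lemma scaleC V a b (v : V) : a *: (b *: v) = b *: (a *: v).
Proof. by rewrite !scalerA mulrC. Qed.

Fixpoint ispn (I : A -> Prop) V (s : seq V) (x : V) : Prop :=
  if s is v :: s' then exists2 a, I a & ispn I s' (x - a *: v) else x = 0.

Lemma smod_ispn I V (s : seq V) : idl I -> smod (ispn I s).
Proof.
move=> sI; elim: s => [|v s IH] /=; first exact: smod1.
split; first by exists 0; [exact: idl0 | rewrite scale0r subrr; exact: smod0].
move=> a x y [b Ib Hb] [c Ic Hc]; exists (a * b + c); first exact: sI.2.
rewrite scalerDl opprD addrACA -scalerA -scalerBr; exact: IH.2.
Qed.

Lemma ispnZ I V (s : seq V) a x : idl I -> I a -> spn s x -> ispn I s (a *: x).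
Proof.
move=> sI Ia; elim: s x => [|v s IH] x /=; first by move=> ->; rewrite scaler0.
by case=> b /IH; rewrite scalerBr scalerA; exists (a * b) => //; exact: idlMr.
Qed.

Lemma ispn_min (I : A -> Prop) V (s : seq V) (S : V -> Prop) x : smod S ->
  (forall a v, I a -> v \in s -> S (a *: v)) -> ispn I s x -> S x.
Proof.
move=> sS; elim: s x => [|v s IH] x Ss /=; first by move=> ->; exact: smod0.
case=> a Ia /IH Sx; apply: (smodBr sS (y := a *: v)).
  by apply: Sx => b w Ib ws; apply: Ss; rewrite // inE ws orbT.
by apply: Ss; rewrite ?mem_head.
Qed.

(** Induction on the generators in place of a determinant: the relation for [v] reads (s0 - a0) v in
    T + I s, and u = s0 - a0 is again a denominator because I lies in q, so [v] can be eliminated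
    from the other relations. *)
Lemma nakayama q (I : A -> Prop) V (s : seq V) (T : V -> Prop) : prm q -> idl I ->
  (forall a, I a -> q a) -> smod T ->
  (forall v, v \in s -> qin q (addS T (ispn I s)) v) ->
  forall v, spn s v -> qin q T v.
Proof.
move=> pq sI Iq; have mq := prm_mulc pq; have [sq q1 qM] := pq.
move=> sT H v /(spn_min (smod_qin mq sT)); apply => {v}.
elim: s T sT H => // v s IH T sT H.
have [s0 qs0 [t Tt [a0 Ia0 H0]]] := H v (mem_head _ _).
pose u := s0 - a0.
have qu : ~ q u by move=> qu; apply: qs0; rewrite -(subrK a0 s0); apply: idlD => //; exact: Iq.
have sTI := smod_add sT (smod_ispn s sI).
have uv : addS T (ispn I s) (u *: v) by exists t => //; rewrite scalerBl addrAC.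
have {}IH : forall w, w \in s -> qin q T w.
  apply: IH => // w ws.
  have [|s1 qs1 [t1 Tt1 [a1 Ia1 H1]]] := H w; first by rewrite inE ws orbT.
  exists (u * s1); first exact: mq.2.
  have : addS T (ispn I s) (u *: (s1 *: w - a1 *: v)).
    apply: smodZ => //; exists t1 => //; by rewrite addrAC.
  rewrite scalerBr !scalerA [u * a1]mulrC -(scalerA a1) => /(smodBr sTI); apply.
  exact: smodZ.
have Iq' x : ispn I s x -> qin q T x.
  apply: ispn_min; first exact: smod_qin.
  by move=> a w Ia ws; apply: smodZ; [exact: smod_qin | exact: IH].
move=> w; rewrite inE => /orP[/eqP->|/IH //].
apply: (qinZ mq qu); have [t' Tt' /Iq'] := uv.
by move/(smodBr (smod_qin mq sT)); apply; exact: sub_qin.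
Qed.

Definition ann V (x : V) (a : A) := a *: x = 0.

Lemma ann_idl V (x : V) : idl (ann x).
Proof.
split; first by rewrite /ann scale0r.
by move=> a b c hb hc; rewrite /ann scalerDl -scalerA hb hc scaler0 addr0.
Qed.

(** Among the annihilators of multiples of x that stay inside q, a maximal one is prime. *)
Lemma assoc_ex q V (x : V) : noeth A -> mulc q -> ~ qin q (fun y => y = 0) x ->
  exists a, prm (ann (a *: x)) /\ forall s, ann (a *: x) s -> q s.
Proof.
move=> nA mq nx.
have [|||_ [a [-> aq]] amax] := @acc A A^o (fun I => exists a, I = ann (a *: x) /\ forall s, ann (a *: x) s -> q s).
- by move=> _ [a [-> _]]; exact: (ann_idl (a *: x)).
- exact: nA.
- exists (ann x), 1; rewrite scale1r; split=> // s sx; apply: contrapT => qs.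
  by apply: nx; exists s.
exists a; split=> //; split; first exact: ann_idl.
  by move=> a1; apply: mq.1; exact: aq.
have max b : (forall s, ann (b *: (a *: x)) s -> q s) ->
    forall c, ann (b *: (a *: x)) c -> ann (a *: x) c.
  move=> bq; apply: amax; first by exists (b * a); rewrite -!scalerA.
  move=> c h; rewrite /ann; transitivity (b *: (c *: (a *: x))); first exact: scaleC.
  by rewrite h scaler0.
move=> c b; rewrite /ann => cb0.
have [bq|] := pselect (forall s, ann (b *: (a *: x)) s -> q s).
  by left; apply: (max b) => //; exact: (etrans (scalerA _ _ _) cb0).
move=> /existsNP[s /not_implyP[sba qs]]; right.
apply: (max s) => [t|]; last exact: (etrans (scaleC _ _ _) sba).
move=> ts; apply: contrapT => qt; apply: (mq.2 _ _ qt qs); apply: aq.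
exact: (etrans (esym (scalerA _ _ _)) ts).
Qed.

Lemma assoc_ex1 V (x : V) : noeth A -> x <> 0 -> exists a, prm (ann (a *: x)).
Proof.
move=> nA x0; have [|a [pa _]] := @assoc_ex _ V x nA (mulc1 A).
  by case=> s /contrapT ->; rewrite scale1r.
by exists a.
Qed.

(** The prime filtration as an induction principle: a maximal submodule with the property can be
    enlarged by an element whose class modulo it has prime annihilator. The scalars J killing V are
    carried along to restrict the primes that occur. *)
Lemma devissage (J : A -> Prop) (PP : lmodType A -> Prop) : noeth A ->
  (forall V, (forall x : V, x = 0) -> PP V) ->
  (forall U V W (i : {linear U -> V}) (p : {linear V -> W}), ses i p -> PP U -> PP W -> PP V) ->
  (forall V (x : V), (forall y, exists a, y = a *: x) -> prm (ann x) ->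
     (forall a, J a -> ann x a) -> PP V) ->
  forall V, fgm V -> (forall a (x : V), J a -> a *: x = 0) -> PP V.
Proof.
move=> nA P0 Pext Pcyc V fV JV.
have [|||_ [T PT ->] Tmax] := @acc A V (fun S => exists2 T : submod V, PP (subm T) & S = T).
- by move=> _ [T _ ->]; exact: ssetP.
- by move=> S; exact: fgs_sub.
- exists (Submod (smod1 (V := V))); eexists; last by [].
  by apply: P0 => x; apply: sinc_inj; rewrite linear0; exact: (sincP x).
have Tall x : T x.
  apply: contrapT => nTx.
  have [|a] := @assoc_ex1 _ (qpi T x) nA; first by rewrite qpi0.
  rewrite -linearZZ; set ax := a *: x => pax.
  have sT := ssetP T.
  have sT' : smod (fun w => exists b, T (w - b *: ax)).
    split; first by exists 0; rewrite scale0r subrr; exact: smod0.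
    move=> b v w [c Tv] [d Tw]; exists (b * c + d).
    by rewrite scalerDl opprD addrACA -scalerA -scalerBr; exact: sT.2.
  have sZ := smod_img (qpi T) (smod_spn [:: ax]).
  pose T' := Submod sT'; pose Z := Submod sZ.
  have axT' : T' ax by exists 1; rewrite scale1r subrr; exact: smod0.
  have [i iE] : exists i : {linear subm T -> subm T'}, forall u, sinc T' (i u) = sinc T u.
    apply: lin_lift; first exact: sinc_inj.
    move=> u; apply: sinc_surj; exists 0; rewrite scale0r subr0; exact: sincP.
  have [p pE] : exists p : {linear subm T' -> subm Z},
      forall u, sinc Z (p u) = (qpi T \o sinc T') u.
    apply: lin_lift; first exact: sinc_inj.
    move=> u; apply: sinc_surj; have [b Tb] := sincP u.
    exists (b *: ax); first by exists b; rewrite subrr.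
    rewrite -[LHS]/(qpi T (sinc T' u)); apply/eqP; rewrite -subr_eq0 -linearB.
    exact/eqP/qpi0.
  have sip : ses i p.
    split.
    - by move=> u v iuv; apply: sinc_inj; rewrite -!iE iuv.
    - move=> z; have [w [b wb] zw] := sincP z.
      have [u uE] := @sinc_surj _ _ T' (b *: ax) (smodZ sT' b axT').
      exists u; apply: sinc_inj; rewrite pE zw -[LHS]/(qpi T (sinc T' u)) uE.
      by move/eqP: wb; rewrite subr_eq0 => /eqP ->.
    - move=> y; split=> [py|[u ->]]; last first.
        apply: sinc_inj; rewrite pE linear0 -[LHS]/(qpi T (sinc T' (i u))) iE.
        exact/qpi0/sincP.
      have /sinc_surj[u uE] : T (sinc T' y) by apply/qpi0; rewrite -[qpi T _]pE py linear0.
      by exists u; apply: sinc_inj; rewrite iE uE.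
  have PZ : PP (subm Z).
    have [z zE] : exists z, sinc Z z = qpi T ax.
      by apply: sinc_surj; exists ax => //; exact/spn_mem/mem_head.
    have annE b : ann z b <-> ann (qpi T ax) b.
      rewrite /ann -zE; split=> [bz|bz]; first by rewrite -linearZZ bz linear0.
      by apply: sinc_inj; rewrite linearZZ bz linear0.
    have annE' : ann z = ann (qpi T ax) by apply/funext => b; apply/propext/annE.
    apply: (Pcyc _ z); rewrite ?annE' //.
      move=> y; have [w [b wb] yw] := sincP y; exists b.
      apply: sinc_inj; rewrite linearZZ zE yw -linearZZ; congr (qpi T _).
      by apply/eqP; rewrite -subr_eq0 wb.
    by move=> b Jb; rewrite /ann -linearZZ JV ?linear0.
  have /Tmax H : exists2 T0 : submod V, PP (subm T0) & (T' : V -> Prop) = T0.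
    by exists T' => //; exact: Pext sip PT PZ.
  have [_ n1 _] := pax; apply: n1; rewrite /ann scale1r; apply/qpi0; apply: H => //.
  by move=> w Tw; exists 0; rewrite scale0r subr0.
have [j jE] : exists j : {linear V -> subm T}, forall v, sinc T (j v) = v.
  pose idV : {linear V -> V} := idfun.
  apply: (@lin_lift _ V V (subm T) (sinc T) idV); first exact: sinc_inj.
  by move=> v; exact: sinc_surj.
pose N := subm (Submod (smod1 (V := V))).
have N0 (x : N) : x = 0 by apply: sinc_inj; rewrite linear0; exact: (sincP x).
have zL (U W : lmodType A) : linear (fun _ : U => 0 : W) by move=> a x y; rewrite scaler0 addr0.
apply: (Pext _ _ _ (sinc T) (mkL (zL V N)) _ PT (P0 _ N0)).
split; [exact: sinc_inj | by move=> z; exists 0; rewrite (N0 z) |].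
by move=> y; split=> // _; exists (j y).
Qed.

Definition mkAq (I : A -> Prop) (sI : idl I) : lmodType A := quom (Submod (sI : smod (V := A^o) I)).

Section Aq.
Variables (I : A -> Prop) (sI : idl I).
Definition aq1 : mkAq sI := qpi (Submod (sI : smod (V := A^o) I)) (1 : A^o).
Lemma aq_gen y : exists a, y = a *: aq1.
Proof.
have [a <-] := qpi_surj y; exists a; rewrite -linearZZ; congr (qpi _ _).
by rewrite /GRing.scale /= mulr1.
Qed.
Lemma aq_ann a : ann aq1 a <-> I a.
Proof.
by rewrite /ann -linearZZ (_ : a *: (1 : A^o) = a) ?qpi0 //; exact: mulr1.
Qed.
Lemma fgm_aq : fgm (mkAq sI).
Proof.
exists [:: aq1] => x; split=> // _; have [a ->] := aq_gen x.
by exists a; rewrite subrr.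
Qed.
End Aq.

Lemma cyc_map V W (x : V) (y : W) : (forall z, exists a, z = a *: x) ->
  (forall a, ann x a -> ann y a) -> exists f : {linear V -> W}, f x = y.
Proof.
move=> xg xy.
have pL : linear (fun a : A^o => a *: x : V) by move=> a b c; rewrite scalerDl -scalerA.
have fL : linear (fun a : A^o => a *: y : W) by move=> a b c; rewrite scalerDl -scalerA.
have [z|v|g gE] := @lin_factor _ _ _ _ (mkL pL) (mkL fL).
- by have [a ->] := xg z; exists a.
- exact: xy.
by exists g; have := gE 1; rewrite !mkLE !scale1r.
Qed.

Lemma ml_cyc_lt q V (x : V) s : (forall z, exists a, z = a *: x) -> mulc q ->
  ann x s -> ~ q s -> qnull q V.
Proof.
move=> xg mq xs qs z; have [a ->] := xg z; exists s => //.
by rewrite scaleC (xs : s *: x = 0) scaler0.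
Qed.

Lemma ml_cyc q V (x : V) : (forall z, exists a, z = a *: x) -> prm q ->
  ann x = q -> ml q V 1.
Proof.
move=> xg pq xq; have mq := prm_mulc pq; split.
  exists (fun=> True); split=> //; exists x => // -[s qs sx].
  by apply: qs; rewrite -xq.
move=> [S [sS _ _ [y Sy ny] [S' [_ _ _ [z _ []]]]]].
have [a ya] := xg y; have [b ->] := xg z; exists a; last first.
  by rewrite scaleC -ya; exact: smodZ.
by rewrite -xq => ax; apply: ny; apply: sub_qin => //; rewrite ya (ax : a *: x = 0).
Qed.

(** q is minimal over J, so a factor A/p of a prime filtration either vanishes at q or has p = q and
    length one. *)
Lemma ml_fin q (J : A -> Prop) V : noeth A -> prm q ->
  (forall p, prm p -> (forall a, J a -> p a) -> (forall a, p a -> q a) ->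
     forall a, q a -> p a) ->
  fgm V -> (forall a (x : V), J a -> a *: x = 0) -> exists n, ml q V n.
Proof.
move=> nA pq Jq; have mq := prm_mulc pq.
apply: (@devissage J (fun W => exists n, ml q W n)) => //.
- by move=> W W0; exists 0%N; apply: (ml0 W mq).1 => x; exists 1; [exact: mq.1 | exact: W0].
- by move=> U W X i p sip [a ha] [b hb]; exists (a + b)%N; exact: ml_ses sip ha hb.
move=> W x xg px Jx.
have [pq'|] := pselect (forall a, ann x a -> q a).
  exists 1%N; apply: (ml_cyc xg pq); apply/funext => a; apply/propext; split; first exact: pq'.
  exact: Jq.
move=> /existsNP[s /not_implyP[xs qs]]; exists 0%N.
by apply: (ml0 W mq).1; exact: ml_cyc_lt xg mq xs qs.
Qed.

Lemma ann_mul V (x : V) a : prm (ann x) -> ~ ann x a -> ann (a *: x) = ann x.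
Proof.
move=> [sx x1 xM] xa; apply/funext => b; apply/propext; split=> h.
  by have [] := xM b a (etrans (esym (scalerA _ _ _)) h).
by rewrite /ann scaleC (h : b *: x = 0) scaler0.
Qed.

Lemma ann_linear U V (f : {linear U -> V}) (x : U) :
  (forall a, f (a *: x) = 0 -> a *: x = 0) -> ann (f x) = ann x.
Proof.
move=> H; apply/funext => a; apply/propext; rewrite /ann -linearZZ.
by split=> [/H //|->]; rewrite linear0.
Qed.

(** Through an extension, an element with prime annihilator either has a multiple in U with the same
    annihilator or keeps its annihilator in W. L is only a covering list: its entries need not be
    prime. *)
Lemma ass_fin V : noeth A -> fgm V -> exists n (L : nat -> A -> Prop),
  forall x : V, prm (ann x) -> exists2 i, (i < n)%N & L i = ann x.
Proof.
move=> nA fV.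
pose PP (W : lmodType A) := exists n (L : nat -> A -> Prop),
  forall x : W, prm (ann x) -> exists2 i, (i < n)%N & L i = ann x.
apply: (@devissage (fun=> False) PP) => //.
- by move=> W W0; exists 0%N, (fun=> fun=> False) => x [_ []]; rewrite /ann (W0 x) scaler0.
- move=> U W X i p sip [n1 [L1 H1]] [n2 [L2 H2]]; have [iinj ps ip] := sip.
  exists (n1 + n2)%N, (fun k => if (k < n1)%N then L1 k else L2 (k - n1)%N) => x px.
  have [[a [xa pa]]|npa] := pselect (exists a, ~ ann x a /\ p (a *: x) = 0).
    have [u xu] := (ip _).1 pa; have := H1 u.
    rewrite -(@ann_linear _ _ i u); last by move=> b; exact: inj_lin0.
    rewrite -xu ann_mul // => /(_ px)[k kn Lk].
    by exists k; rewrite ?kn //; exact: ltn_addr.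
  have := H2 (p x); rewrite ann_linear => [/(_ px)[k kn Lk]|a pa]; last first.
    by apply: contrapT => xa; apply: npa; exists a.
  by exists (n1 + k)%N; rewrite ?ltn_add2l // ltnNge leq_addr /= addKn.
move=> W x xg px _; exists 1%N, (fun=> ann x) => y py; exists 0%N => //.
have [a ya] := xg y; rewrite ya ann_mul // => xa; case: py => _ y1 _.
by apply: y1; rewrite /ann scale1r ya.
Qed.

(** By induction f k lies in I and outside every L i with i <> k. If moreover every L k contains f
    k, the sum of the last f and the product of the others avoids them all. *)
Lemma prime_avoid n (L : nat -> A -> Prop) (I : A -> Prop) : idl I ->
  (forall i, (i < n)%N -> prm (L i)) ->
  (forall i, (i < n)%N -> exists2 x, I x & ~ L i x) ->
  exists2 x, I x & forall i, (i < n)%N -> ~ L i x.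
Proof.
move=> sI; elim: n L => [|n IH] L pL IL; first by exists 0; [exact: idl0|].
have /choice[f fP] : forall k, exists x, (k <= n)%N -> I x /\ forall i, (i < n.+1)%N -> i != k -> ~ L i x.
  move=> k; have [kn|_] := leqP k n; last by exists 0.
  have bl i : (i < n)%N -> (bump k i < n.+1)%N by rewrite /bump; case: leqP => /=; lia.
  have [i /bl/pL //|i /bl/IL //|x Ix xL] := IH (fun i => L (bump k i)).
  exists x => _; split=> // i ilt ik; have := xL (unbump k i).
  by rewrite unbumpKcond (negPf ik) add0n; apply; rewrite /unbump; case: leqP => /=; lia.
have [[k kn nLk]|allL] := pselect (exists2 k, (k < n.+1)%N & ~ L k (f k)).
  exists (f k); first exact: (fP k kn).1.
  by move=> i ilt; have [->//|ik] := eqVneq i k; exact: (fP k kn).2.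
have Lf k : (k < n.+1)%N -> L k (f k).
  by move=> kn; apply: contrapT => nL; apply: allL; exists k.
case: n => [|n] in IH L pL IL fP allL Lf *.
  have [x Ix Lx] := IL 0%N isT; by exists x => // -[].
pose P := \prod_(i < n.+1) f i.
have LP j : (j < n.+1)%N -> L j P.
  move=> jn; have [sL _ _] := pL j (ltnW jn); rewrite /P (bigD1 (Ordinal jn)) //=.
  by apply: idlMr => //; apply: Lf; exact: ltnW.
have IP : I P.
  by rewrite /P big_ord_recl; apply: idlMr => //; exact: (fP 0%N isT).1.
exists (f n.+1 + P); first by apply: idlD => //; exact: (fP n.+1 (leqnn _)).1.
move=> j; rewrite ltnS leq_eqVlt => /orP[/eqP->|jn]; last first.
  have [sL _ _] := pL j (ltnW jn) => LfP.
  have : L j (f n.+1).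
    by rewrite -(addrK P (f n.+1)); apply: idlB => //; exact: LP.
  by apply: (fP n.+1 (leqnn _)).2; [exact: ltnW | rewrite ltn_eqF].
have [sL L1 LM] := pL n.+1 (leqnn _) => LfP.
have : L n.+1 P.
  by rewrite -(addKr (f n.+1) P) addrC; apply: idlB => //; exact: Lf.
rewrite /P; apply: (big_ind (fun x => ~ L n.+1 x)) => [//|x y nx ny /LM[]//|i _].
have ilt : (i < n.+1)%N := ltn_ord i.
apply: (fP i (ltnW ilt)).2 => //.
by rewrite gtn_eqF.
Qed.

End Devissage.

(** * Cohomology of Hom(N, J) for a complex J of injectives *)

Section InjCohomology.
Variable A : comNzRingType.
Variables (J : nat -> lmodType A) (dl : forall i, {linear J i -> J i.+1}).
Hypotheses (Jinj : forall i, injective_module (J i)) (Jdd : forall i x, dl i.+1 (dl i x) = 0).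
Implicit Types (U V W N : lmodType A) (p q : A -> Prop).

(** Cocycles are bare functions with linearity as a condition, so that [Zc] and [Bc] are submodules
    of the module of all functions and the length calculus applies. The quotient of [Zc] by [Bc] is
    written D^n(N) in what follows. *)
Definition Zc N n (z : N -> J n) : Prop := linear z /\ forall x, dl n (z x) = 0.

Definition Bc N n : (N -> J n) -> Prop :=
  match n with
  | 0 => fun z => forall x, z x = 0
  | n'.+1 => fun z => exists w : {linear N -> J n'}, forall x, z x = dl n' (w x)
  end.

Lemma smod_lin N (E : lmodType A) : smod (fun z : N -> E => linear z).
Proof.
split=> [a x y|b z w zL wL a x y]; first by rewrite [LHS]/0 /= scaler0 addr0.
have E' u : (b *: z + w) u = b *: z u + w u by [].
by rewrite !E' zL wL !scalerDr addrACA scaleC.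
Qed.

Lemma smod_Zc N n : smod (@Zc N n).
Proof.
split; first by split; [exact: (smod_lin N (J n)).1 | move=> x; exact: linear0].
move=> a z w [zL z0] [wL w0]; split; first exact: (smod_lin N (J n)).2.
by move=> x; rewrite [_ x](_ : _ = a *: z x + w x) // linearP z0 w0 scaler0 addr0.
Qed.

Lemma smod_Bc N n : smod (@Bc N n).
Proof.
case: n => [|n]; split=> //=.
- by move=> a z w z0 w0 x; rewrite [LHS](_ : _ = a *: z x + w x) // z0 w0 scaler0 addr0.
- by exists \0 => x; rewrite linear0.
move=> a z w [u zu] [v wv]; exists (a \*: u \+ v) => x.
by rewrite [LHS](_ : _ = a *: z x + w x) // zu wv -linearP.
Qed.

Lemma Bc_Zc N n z : @Bc N n z -> Zc z.
Proof.
case: n z => [|n] z /= => [z0|[w zw]].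
  by split=> [a x y|x]; rewrite !z0 ?linear0 ?scaler0 ?addr0.
by split=> [a x y|x]; rewrite !zw ?linearP // Jdd.
Qed.

Lemma Zc_comp U V n (f : {linear U -> V}) (z : V -> J n) : Zc z -> Zc (z \o f).
Proof.
by case=> zL z0; split=> [a x y|x] /=; [rewrite linearP zL | rewrite z0].
Qed.

Lemma Bc_comp U V n (f : {linear U -> V}) (z : V -> J n) : Bc z -> Bc (z \o f).
Proof.
case: n z => [|n] z /= => [z0 x|[w zw]]; first exact: z0.
by exists (w \o f) => x /=; rewrite zw.
Qed.

Section LES.
Variables (U V W : lmodType A) (i : {linear U -> V}) (p : {linear V -> W}).
Hypothesis sip : ses i p.

Lemma ses_fac (E : lmodType A) (f : {linear V -> E}) : (forall u, f (i u) = 0) ->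
  exists g : {linear W -> E}, forall v, g (p v) = f v.
Proof.
have [_ ps ip] := sip => fi; apply: lin_factor => // v /ip[u ->]; exact: fi.
Qed.

Lemma ses_pi u : p (i u) = 0.
Proof. by have [_ _ ip] := sip; apply/ip; exists u. Qed.

(** Exactness at D^n(V): the cochain bounding the restriction to U extends to V by injectivity, and
    subtracting its differential leaves a map that vanishes on U. *)
Lemma les1 n (z : V -> J n) : Zc z -> Bc (z \o i) ->
  exists2 z' : W -> J n, Zc z' & Bc (z - (z' \o p)).
Proof.
move=> [zL z0] Bzi; have [iinj ps ip] := sip; pose f := mkL zL.
suff [g gf Bg] : exists2 g : {linear V -> J n}, (forall u, g (i u) = 0) & Bc (fun x => z x - g x)
   /\ forall x, dl n (g x) = 0.
  have [h hE] := ses_fac gf; exists h; last first.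
    by rewrite (_ : _ - _ = fun x => z x - g x) //; [exact: Bg.1 | apply/funext => x; rewrite -hE].
  split; first exact: linP.
  by move=> w; have [v <-] := ps w; rewrite hE Bg.2.
case: n z zL z0 @f Bzi => [|n] z zL z0 f /= => [zi|[w zw]].
  by exists f; [exact: zi | split=> x; [rewrite subrr | exact: z0]].
have [v vE] := Jinj w iinj.
exists (f \- (dl n \o v)) => [u|].
  by have := zw u; rewrite /= vE => ->; rewrite subrr.
split; last by move=> x; rewrite linearB z0 Jdd subrr.
by exists v => x; rewrite opprB addrC subrK.
Qed.

Lemma les2_0 (z : W -> J 0%N) : Bc (z \o p) -> Bc z.
Proof. by have [_ ps _] := sip => /= h w; have [v <-] := ps w; exact: h. Qed.

(** Exactness at D^(n+1)(W), with a scalar carried through: [z'] is a preimage under the connecting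
    map, and a scalar that kills its class kills the class of z. *)
Lemma les2 n (z : W -> J n.+1) : Zc z -> Bc (z \o p) ->
  exists2 z' : U -> J n, Zc z' & forall a, Bc (a *: z') -> Bc (a *: z).
Proof.
move=> [zL z0] [w zw]; have [iinj ps ip] := sip.
exists (w \o i).
  split; first exact: linP.
  by move=> u /=; rewrite -zw /= ses_pi -[z]/(mkL zL : _ -> _) linear0.
move=> a Ba.
suff [h hE] : exists h : {linear V -> J n}, (forall u, h (i u) = 0) /\
    forall x, a *: (z (p x)) = dl n (h x).
  have [g gE] := ses_fac hE.1; exists g => y; have [x <-] := ps y.
  by rewrite gE -hE.2.
case: n z zL z0 w zw Ba => [|n] z zL z0 w zw /= => [w0|[v vE]].
  by exists (a \*: w); split=> [u|x]; [exact: w0 | rewrite linearZZ -zw].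
have [v' v'E] := Jinj v iinj.
exists ((a \*: w) \- (dl n \o v')); split=> [u|x].
  by rewrite /= v'E -vE subrr.
by rewrite linearB /= linearZZ -zw Jdd subr0.
Qed.

(** Exactness at D^n(U): [z'] represents the connecting image of z, and whenever a multiple of it
    bounds, the same multiple of z extends to a cocycle of V. *)
Lemma les3 n (z : U -> J n) : Zc z ->
  exists2 z' : W -> J n.+1, Zc z' & forall a, Bc (a *: z') ->
    exists2 y : V -> J n, Zc y & y \o i = a *: z.
Proof.
move=> [zL z0]; have [iinj ps ip] := sip.
have [w wE] := Jinj (mkL zL) iinj.
have [|g gE] := @ses_fac _ (dl n \o w).
  by move=> u /=; rewrite wE; exact: z0.
exists g.
  split; first exact: linP.
  by move=> y; have [x <-] := ps y; rewrite gE Jdd.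
move=> a [v vE]; exists (fun x => a *: w x - v (p x)).
  split; first exact: (linP ((a \*: w) \- (v \o p))).
  by move=> x; rewrite linearB linearZZ -vE -[_ (p x)]/(a *: g (p x)) gE subrr.
by apply/funext => u /=; rewrite ses_pi linear0 subr0 wE.
Qed.

End LES.

(** D^n(N) vanishes at q. Below, [Dfg n N] is finite generation of D^n(N), and [NZ q n p] says that
    D^n(A/p) is nonzero at q, A/p being any cyclic module with annihilator p. *)
Definition Dnull q n N := forall z : N -> J n, Zc z -> qin q (@Bc N n) z.

Section Dnull.
Variable q : A -> Prop.
Hypothesis mq : mulc q.
Variables (U V W : lmodType A) (i : {linear U -> V}) (p : {linear V -> W}).
Hypothesis sip : ses i p.

Lemma Dnull_mid n : Dnull q n U -> Dnull q n W -> Dnull q n V.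
Proof.
move=> nU nW z Zz; have [s qs Bs] := nU _ (Zc_comp i Zz).
have [|z' Zz' Bz'] := @les1 _ _ _ i p sip n (s *: z) _ Bs.
  by apply: smodZ => //; exact: smod_Zc.
have [t qt Bt] := nW _ Zz'.
apply: (qinZ mq qs); exists t => //.
apply: (smodBr (smod_Bc V n) (y := t *: (z' \o p))); last exact: (Bc_comp p Bt).
by rewrite -scalerBr; apply: smodZ => //; exact: smod_Bc.
Qed.

Lemma Dnull_sub n : Dnull q n V -> Dnull q n.+1 W -> Dnull q n U.
Proof.
move=> nV nW z Zz; have [z' Zz' H] := les3 sip Zz.
have [s qs /H[y Zy yE]] := nW _ Zz'.
have [t qt Bt] := nV _ Zy; apply: (qinZ mq qs); exists t => //.
by rewrite -yE; exact: (Bc_comp i Bt).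
Qed.

Lemma Dnull_quo n : Dnull q n U -> Dnull q n.+1 V -> Dnull q n.+1 W.
Proof.
move=> nU nV z Zz; have [s qs Bs] := nV _ (Zc_comp p Zz).
have [|z' Zz' H] := @les2 _ _ _ i p sip n (s *: z) _ Bs.
  by apply: smodZ => //; exact: smod_Zc.
by have [t qt /H Bt] := nU _ Zz'; apply: (qinZ mq qs); exists t.
Qed.

Lemma Dnull_quo0 : Dnull q 0 V -> Dnull q 0 W.
Proof.
move=> nV z Zz; have [s qs Bs] := nV _ (Zc_comp p Zz).
by exists s => //; exact: (@les2_0 _ _ _ i p sip (s *: z) Bs).
Qed.

End Dnull.

Lemma fg_qnull q V : mulc q -> fgm V -> qnull q V ->
  exists2 s, ~ q s & forall x : V, s *: x = 0.
Proof.
move=> mq [t tV] nV.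
suff [s qs sP] : exists2 s, ~ q s & forall x, x \in t -> s *: x = 0.
  exists s => // x; apply: (@spn_min _ _ t (fun x => s *: x = 0)) => //; last exact/tV.
  split; first by rewrite scaler0.
  by move=> a y z yz zz; rewrite scalerDr scaleC yz zz scaler0 addr0.
elim: {tV} t => [|v t [s qs sP]]; first by exists 1 => //; exact: mq.1.
have [u qu uv] := nV v; exists (u * s); first exact: mq.2.
move=> x; rewrite inE => /orP[/eqP->|/sP sx]; first by rewrite mulrC -scalerA uv scaler0.
by rewrite -scalerA sx scaler0.
Qed.

Lemma Dnull_qnull q n V : mulc q -> fgm V -> qnull q V -> Dnull q n V.
Proof.
move=> mq fV nV; have [s qs sV] := fg_qnull mq fV nV.
move=> z [zL _]; exists s => //.
have -> : s *: z = 0 by apply/funext => x; rewrite -[LHS](linearZZ (mkL zL)) sV linear0.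
by apply: smod0; exact: smod_Bc.
Qed.

Definition Dfg n N := exists s : seq (N -> J n), (forall v, v \in s -> Zc v) /\
  forall z, Zc z -> addS (spn s) (@Bc N n) z.

Definition cyc V (x : V) := forall y, exists a, y = a *: x.

Definition NZ q n p := exists V (x : V), [/\ cyc x, ann x = p & ~ Dnull q n V].

Lemma fgm_cyc V (x : V) : cyc x -> fgm V.
Proof.
move=> xg; exists [:: x] => y; split=> // _; have [a ->] := xg y.
by exists a; rewrite subrr.
Qed.

(** Vanishing at q passes through extensions, so nonvanishing on V is inherited by some factor A/p
    of a prime filtration; p lies in q, since otherwise A/p itself is zero at q. *)
Lemma devissage_D q n (K : A -> Prop) V : noeth A -> mulc q -> fgm V ->
  (forall a (x : V), K a -> a *: x = 0) -> ~ Dnull q n V ->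
  exists p, [/\ prm p, forall a, K a -> p a, forall a, p a -> q a & NZ q n p].
Proof.
move=> nA mq fV KV; apply: contra_notP => nex.
apply: (@devissage _ K (fun V => Dnull q n V)) => //.
- move=> X X0; apply: Dnull_qnull => //.
    by exists [::] => x; split=> // _; exact: X0.
  by move=> x; exists 1; [exact: mq.1 | exact: X0].
- by move=> X Y Z i p sip; exact: (Dnull_mid mq sip).
move=> X x xg px Kx; apply: contrapT => nX; apply: nex; exists (ann x); split=> //.
  move=> a xa; apply: contrapT => qa; apply: nX; apply: Dnull_qnull => //.
    exact: fgm_cyc xg.
  exact: ml_cyc_lt xg mq xa qa.
by exists X, x.
Qed.

Hypothesis nA : noeth A.
Hypothesis fgD : forall n N, fgm N -> Dfg n N.

(** Multiplication by x is injective on A/p. If D^(n+1) of its cokernel vanished at q, then x, an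
    element of q, would act surjectively on the finitely generated D^n(A/p) at q, and Nakayama's
    lemma would kill the latter. Devissage of the cokernel produces p'. *)
Lemma NZ_up q n p x : prm q -> prm p -> q x -> ~ p x -> NZ q n p ->
  exists p', [/\ prm p', forall a, p a -> p' a, p' x, forall a, p' a -> q a & NZ q n.+1 p'].
Proof.
move=> pq pp qx px [V [v [vg vp nV]]]; have mq := prm_mulc pq.
have fV := fgm_cyc vg.
pose mx : {linear V -> V} := x \*: idfun.
have sI : smod (fun y => exists2 w, True & y = mx w) by apply: smod_img; exact: smodT.
pose W := quom (Submod sI).
have smx : ses mx (qpi (Submod sI)).
  split; last 1 first.
  - move=> y; rewrite qpi0 /=; split=> [[w _ ->]|[w ->]]; by exists w.
  - apply: lin_inj => y; have [a ->] := vg y => /= xa.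
    have : ann v (x * a) by rewrite /ann -scalerA.
    by rewrite vp; case: pp => _ _ pM /pM[/px[]|]; rewrite -vp.
  - exact: qpi_surj.
have fW : fgm W by apply: fgm_img fV (@qpi_surj _ _ _).
have [||p' [pp' Kp' qp' nz]] := @devissage_D q n.+1 (fun a => p a \/ a = x) W nA mq fW.
- move=> a y; have [w <-] := qpi_surj y; rewrite -linearZZ => -[pa|->]; last first.
    by apply/qpi0; exists w.
  have [b ->] := vg w; rewrite scaleC (_ : a *: v = 0) ?scaler0 ?linear0 //.
  by move: pa; rewrite -vp.
- move=> nW; apply: nV.
  have [s [Zs sZ]] := fgD n fV.
  have sB := smod_Bc V n.
  have key (z : V -> J n) : Zc z -> exists2 t, ~ q t & exists2 y : V -> J n, Zc y & t *: z = x *: y.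
    move=> Zz; have [z' Zz' H] := les3 smx Zz.
    have [t qt Bt] := nW z' Zz'; have [y Zy yE] := H _ Bt.
    exists t => //; exists y => //.
    rewrite -yE; apply/funext => u.
    case: Zy => yL _; rewrite -[LHS]/(mkL yL (x *: u)) linearZZ //.
  have spB (z : V -> J n) : spn s z -> qin q (@Bc V n) z.
    apply: (nakayama (I := q)) => //; first by case: pq.
    move=> w ws; have [t qt [y /sZ[u su Bu] twy]] := key w (Zs _ ws).
    exists t => //; exists (x *: (y - u)); first exact: smodZ.
    rewrite twy -scalerBr opprB addrC subrK; apply: ispnZ => //; by case: pq.
  move=> z /sZ[u /spB Bu Bzu]; have sqB := smod_qin mq sB.
  by apply: (smodBr sqB (y := u)) => //; exact: sub_qin.
by exists p'; split=> //; [move=> a pa; apply: Kp'; left | apply: Kp'; right].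
Qed.

(** Take p maximal among the counterexamples; [NZ_up] moves to a strictly larger prime inside q, one
    degree higher. *)
Lemma NZ_climb q n p : prm q -> prm p -> (forall a, p a -> q a) -> NZ q n p ->
  exists n', [/\ (n <= n')%N, NZ q n' q & p <> q -> (n < n')%N].
Proof.
move=> pq pp0 pq0 nz0; apply: contrapT => H.
pose F (p : A -> Prop) := [/\ prm p, forall a, p a -> q a & exists2 n, NZ q n p &
  ~ exists n', [/\ (n <= n')%N, NZ q n' q & p <> q -> (n < n')%N]].
have [|||p1 [pp1 p1q [n1 nz1 H1]] p1max] := @acc A A^o F.
- by move=> ? [[]].
- by [].
- by exists p; split=> //; exists n.
have [p1E|p1q'] := pselect (p1 = q); first by apply: H1; exists n1; split=> //; move: nz1; rewrite p1E.
have [x qx p1x] : exists2 x, q x & ~ p1 x.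
  apply: contrapT => nx; apply: p1q'; apply/funext => a; apply/propext; split; first exact: p1q.
  by move=> qa; apply: contrapT => p1a; apply: nx; exists a.
have [p2 [pp2 p12 p2x p2q nz2]] := NZ_up pq pp1 qx p1x nz1.
have [|nF] := pselect (F p2).
  by move=> /p1max/(_ p12) p21; apply: p1x; exact: p21.
apply: nF; split=> //; exists n1.+1 => // -[n' [nn' nz' _]].
by apply: H1; exists n'; split=> //; exact: ltnW.
Qed.

Definition pchain l p := exists c : nat -> A -> Prop, [/\ c 0%N = p,
  forall i, (i <= l)%N -> prm (c i)
  & forall i, (i < l)%N -> (forall a, c i a -> c i.+1 a) /\ exists2 x, c i.+1 x & ~ c i x].

Lemma NZ_loc q n p : (forall a, p a -> q a) -> NZ p n p -> NZ q n p.
Proof.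
move=> pq [V [x [xg xp nV]]]; exists V, x; split=> // H; apply: nV => z /H[s qs Bs].
by exists s => // ps; apply: qs; exact: pq.
Qed.

(** The chain is climbed one prime at a time, each climb taking place in the localization at the
    next prime, and every strict inclusion raises the degree by at least one. *)
Lemma NZ_chain m n p l : prm m -> (forall r, prm r -> forall a, r a -> m a) ->
  pchain l p -> NZ p n p -> exists2 n', (n + l <= n')%N & NZ m n' m.
Proof.
move=> pm mmax; elim: l n p => [|l IH] n p [c [c0 cp cs]] nz.
  have pp : prm p by rewrite -c0; exact: cp.
  have [n' [nn' nz' _]] := NZ_climb pm pp (mmax _ pp) (NZ_loc (mmax _ pp) nz).
  by exists n'; rewrite ?addn0.
have pp : prm p by rewrite -c0; exact: cp.
have [pc1 [x c1x px]] := cs 0%N isT; rewrite c0 in pc1 px.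
have [n' [_ nz' nn']] := NZ_climb (cp 1%N isT) pp pc1 (NZ_loc pc1 nz).
have [|n'' nn'' nz''] := IH n' (c 1%N) _ nz'.
  by exists (fun i => c i.+1); split=> // i il; [exact: cp | exact: cs].
exists n'' => //; apply: leq_trans nn''; rewrite addnS -addSn leq_add2r; apply: nn'.
by move=> pE; apply: px; rewrite pE.
Qed.

End InjCohomology.

(** * Lengths of the cohomology of Hom(N, J) *)

Section DLength.
Variable A : comNzRingType.
Variables (J : nat -> lmodType A) (dl : forall i, {linear J i -> J i.+1}).
Hypotheses (Jinj : forall i, injective_module (J i)) (Jdd : forall i x, dl i.+1 (dl i x) = 0).
Implicit Types (U V W N : lmodType A) (p q : A -> Prop).
Local Notation Zc := (Zc dl).
Local Notation Bc := (Bc dl).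
Local Notation Dnull := (Dnull dl).
Local Notation NZ := (NZ dl).

Definition Dlen_ge q n N a := len_ge q a (@Bc N n) (@Zc N n).

Lemma sBc N n : smod (@Bc N n). Proof. exact: smod_Bc. Qed.
Lemma sZc N n : smod (@Zc N n). Proof. exact: smod_Zc. Qed.

Lemma cyc_iso V W (x : V) (y : W) : cyc x -> cyc y -> ann x = ann y ->
  exists (f : {linear V -> W}) (g : {linear W -> V}), cancel f g /\ cancel g f.
Proof.
move=> xg yg xy.
have [f fx] : exists f : {linear V -> W}, f x = y by apply: cyc_map => // a; rewrite xy.
have [g gy] : exists f : {linear W -> V}, f y = x by apply: cyc_map => // a; rewrite xy.
exists f, g; split=> z.
  by have [a ->] := xg z; rewrite !linearZZ fx gy.
by have [a ->] := yg z; rewrite !linearZZ gy fx.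
Qed.

Lemma Dlen_cyc q n V W (x : V) (y : W) a : mulc q -> cyc x -> cyc y -> ann x = ann y ->
  Dlen_ge q n V a -> Dlen_ge q n W a.
Proof.
move=> mq xg yg xy; have [f [g [fg gf]]] := cyc_iso xg yg xy.
apply: (len_rel mq (r := fun z w => w = z \o g)) => //; try exact: sBc; try exact: sZc.
- by move=> z; exact: Bc_Zc.
- by move=> b z w z' w' -> ->.
- move=> z Zz; exists 1, (z \o g); rewrite scale1r; split=> //; [exact: mq.1 | exact: Zc_comp].
- move=> z w _ -> /(Bc_comp f) Bz; apply: sub_qin => //.
  by rewrite (_ : z = (z \o g) \o f) //; apply/funext => u /=; rewrite fg.
Qed.

Lemma Dnull_len q n N : mulc q -> Dnull q n N <-> ~ Dlen_ge q n N 1.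
Proof.
move=> mq; split=> [nN [S [_ _ SZ [z /SZ/nN //]]]|H z Zz].
apply: contrapT => nz; apply: H; exists (@Zc N n); split=> //; first exact: sZc.
  by move=> w; exact: Bc_Zc.
by exists z.
Qed.

Lemma Dnull_cyc q n V W (x : V) (y : W) : mulc q -> cyc x -> cyc y -> ann x = ann y ->
  Dnull q n V -> Dnull q n W.
Proof.
move=> mq xg yg xy /(Dnull_len _ _ mq) H; apply/(Dnull_len _ _ mq) => H'.
by apply: H; apply: Dlen_cyc H'.
Qed.

Lemma not_NZ q n p V (x : V) : mulc q -> cyc x -> ann x = p -> ~ NZ q n p -> Dnull q n V.
Proof. by move=> mq xg xp nz; apply: contrapT => nV; apply: nz; exists V, x. Qed.

Definition Dnull_pred q n N : Prop := if n is n'.+1 then Dnull q n' N else True.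

(** The side conditions make D^n(W) -> D^n(V) injective and D^n(V) -> D^n(U) surjective at q. A
    chain coming from W, below the cocycles T that restrict to boundaries on U, is continued by a
    chain coming from U above T. *)
Lemma Dlen_ses q n U V W (i : {linear U -> V}) (p : {linear V -> W}) a b : mulc q ->
  ses i p -> Dnull_pred q n U -> Dnull q n.+1 W ->
  Dlen_ge q n U a -> Dlen_ge q n W b -> Dlen_ge q n V (a + b).
Proof.
move=> mq sip nU nW hU hW; rewrite addnC.
pose T (z : V -> J n) := Zc z /\ Bc (z \o i).
have sT : smod T.
  apply: smodI; first exact: sZc.
  split=> [|c z w Bz Bw]; first exact: (smod0 (sBc U n)).
  exact: (sBc U n).2 _ _ _ Bz Bw.
apply: (@len_cat _ _ _ _ _ _ T) => //.
- by move=> z Bz; split; [exact: Bc_Zc | exact: Bc_comp].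
- by move=> z [].
- apply: (len_rel mq (r := fun w z => Bc (z - (w \o p)))) hW => //; try exact: sBc; try exact: sZc.
  + by move=> z Bz; split; [exact: Bc_Zc | exact: Bc_comp].
  + by rewrite subrr; exact: smod0 (sBc V n).
  + move=> c w z w' z' H H'.
    rewrite (_ : _ - _ = c *: (z - (w \o p)) + (z' - (w' \o p))); first exact: (sBc V n).2.
    by rewrite scalerBr addrACA -opprD.
  + move=> w Zw; exists 1, (w \o p); split; [exact: mq.1 | | ].
      split; first exact: Zc_comp.
      rewrite (_ : _ \o _ = 0); first exact: smod0 (sBc U n).
      by case: Zw => wL _; apply/funext => u /=; rewrite (ses_pi sip) -[w _]/(mkL wL 0) linear0.
    by rewrite scale1r subrr; exact: smod0 (sBc V n).
  + move=> w z Zw H Bz; have {H} := smodBl (sBc V n) H Bz.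
    case: n {T sT hU nW z Bz} w Zw nU => [|n] w Zw nU Bw.
      by exists 1; [exact: mq.1 | rewrite scale1r; exact: les2_0 sip _ Bw].
    have [z' /nU[s qs Bz'] H] := les2 Jinj Jdd sip Zw Bw.
    by exists s => //; exact: H.
- apply: (len_rel mq (r := fun w z => w = z \o i)) hU => //; try exact: sBc; try exact: sZc.
  + by move=> z [].
  + by move=> c w z w' z' -> ->.
  + move=> w /(les3 Jinj Jdd sip)[z' /nW[s qs Bz'] H]; have [y Zy yE] := H _ Bz'.
    by exists s, y.
  + by move=> w z _ -> [_ Bz]; apply: sub_qin.
Qed.

End DLength.

(** * D^n(A/q) at a prime q when J resolves A *)

Section Gorenstein.
Variable A : comNzRingType.
Variables (J : nat -> lmodType A) (dl : forall i, {linear J i -> J i.+1}).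
Hypotheses (Jinj : forall i, injective_module (J i)) (Jdd : forall i x, dl i.+1 (dl i x) = 0).
Hypothesis nA : noeth A.
Implicit Types (U V W N : lmodType A) (p q : A -> Prop).
Local Notation Zc := (Zc dl).
Local Notation Bc := (Bc dl).
Local Notation Dnull := (Dnull dl).
Local Notation NZ := (NZ dl).
Local Notation Dlen_ge := (Dlen_ge dl).
Variable aug : {linear A^o -> J 0%N}.
Hypothesis aug_inj : injective aug.
Hypothesis aug_exact : forall x, dl 0 x = 0 -> exists a, x = aug a.
Hypothesis aug0 : forall a, dl 0 (aug a) = 0.
Hypothesis Jexact : forall n x, dl n.+1 x = 0 -> exists y, x = dl n y.
Variable D' : nat.
Hypothesis Jbound : forall n, (D' < n)%N -> forall x : J n, x = 0.

Lemma lin_ring (E : lmodType A) (y : E) : exists f : {linear A^o -> E}, forall a, f a = a *: y.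
Proof.
have fL : linear (fun a : A^o => a *: y : E) by move=> a b c; rewrite scalerDl -scalerA.
by exists (mkL fL).
Qed.

Lemma ring_linE (E : lmodType A) (f : A^o -> E) : linear f -> forall a, f a = a *: f 1.
Proof.
move=> fL a; rewrite -[RHS](linearZZ (mkL fL)); congr (f _); exact: (esym (mulr1 a)).
Qed.

Lemma D_ring n (z : A^o -> J n.+1) : Zc z -> Bc z.
Proof.
move=> [zL z0]; have [y yE] := Jexact (z0 1); have [f fE] := lin_ring y.
by exists f => a; rewrite fE linearZZ -yE -ring_linE.
Qed.

(** V behaves at q like the quotient of a Gorenstein ring by a regular sequence of length k: D^n(V)
    is zero at q for n <> k, and D^k(V) is cyclic at q, with a generator e whose annihilator is
    locally that of v. *)
Definition QC q k V (v : V) := [/\ cyc v, forall a, ann v a -> q a,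
  forall n, n <> k -> Dnull q n V
  & exists2 e : V -> J k, Zc e &
     (forall z : V -> J k, Zc z -> exists s r, ~ q s /\ Bc (s *: z - r *: e)) /\
     forall r, qin q (@Bc V k) (r *: e) -> qin q (V := A^o) (ann v) r].

Lemma QC0 q : prm q -> QC q 0 (1 : A^o).
Proof.
move=> [sq q1 qM]; have mq := prm_mulc (And3 sq q1 qM); split.
- by move=> a; exists a; exact: (esym (mulr1 a)).
- move=> a; rewrite /ann [a *: 1](mulr1 a : _ = a) => ->; exact: idl0.
- by case=> // n _ z Zz; apply: (sub_qin mq); exact: D_ring.
exists aug; first by split=> *; [exact: linearP | exact: aug0].
split=> [z [zL z0]|r [s qs Bs]].
  have [a az] := aug_exact (z0 1); exists 1, a; split=> // b.
  have -> : (1 *: z - a *: (aug : A^o -> J 0%N)) b = 1 *: z b - a *: aug b by [].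
  rewrite scale1r (ring_linE zL) az (ring_linE (linP aug) b) (ring_linE (linP aug) a).
  by rewrite scaleC subrr.
exists s => //; rewrite /ann; apply: (inj_lin0 aug_inj).
rewrite linearZZ; exact: (etrans (esym (scalerA s r _)) (Bs 1)).
Qed.

(** The long exact sequence of multiplication by x moves the only nonzero cohomology from degree k
    to k + 1 and reduces it modulo x. It is run by hand on cochains, since x is regular only at
    q. *)
Lemma QC_step q k V (v : V) x : prm q -> QC q k v -> q x ->
  (forall y : V, qin q (fun y => y = 0) (x *: y) -> qin q (fun y => y = 0) y) ->
  exists V' (v' : V'), QC q k.+1 v'.
Proof.
move=> pq [vg vq nV [e Ze [eg ea]]] qx xreg; have mq := prm_mulc pq; have fV := fgm_cyc vg.
have [sq q1 qM] := pq.
pose mx : {linear V -> V} := x \*: idfun.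
have sI : smod (fun y => exists2 w, True & y = mx w) by apply: smod_img; exact: smodT.
pose p := qpi (Submod sI); pose V1 : lmodType A := quom (Submod sI).
have ps : forall y : V1, exists w, p w = y by exact: qpi_surj.
have px w : p (x *: w) = 0 by apply/qpi0; exists w.
have pE w : p w = 0 -> exists w', w = x *: w' by move=> /qpi0[w' _ ->]; exists w'.
(* The kernel of x is finitely generated and null at q, so one denominator s0 kills all of it; maps
   on V therefore extend along x after multiplication by s0. *)
have [s0 qs0 s0K] : exists2 s, ~ q s & forall w : V, x *: w = 0 -> s *: w = 0.
  have sK : smod (fun w : V => x *: w = 0).
    by split=> [|a u w ux wx]; rewrite ?scaler0 // scalerDr scaleC ux wx scaler0 addr0.
  have [|s qs sP] := fg_qnull mq (fgs_subm (S := Submod sK) (fgs_sub nA fV sK)).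
    move=> u; have [s qs su] : qin q (fun y => y = 0) (sinc (Submod sK) u).
      by apply: xreg; exists 1; rewrite ?(sincP u : x *: _ = 0) ?scaler0.
    by exists s => //; apply: sinc_inj; rewrite linearZZ su linear0.
  exists s => // w xw; have [u <-] := @sinc_surj _ _ (Submod sK) w xw.
  by rewrite -linearZZ sP linear0.
have ext (E : lmodType A) (Einj : injective_module E) (f : {linear V -> E}) :
    exists h : {linear V -> E}, forall w, h (x *: w) = s0 *: f w.
  have [w /= xw|h hE] := @injective_ext2 _ E _ _ mx (s0 \*: f) Einj.
    by rewrite -linearZZ s0K // linear0.
  by exists h.
have fac (E : lmodType A) (f : {linear V -> E}) : (forall w, f (x *: w) = 0) ->
    exists g : {linear V1 -> E}, forall w, g (p w) = f w.
  by move=> fx; apply: lin_factor => // w /pE[w' ->].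
have [eL e0] := Ze.
have eZ a w : e (a *: w) = a *: e w by exact: (linearZZ (mkL eL)).
(* [w1] extends s0 e along multiplication by x. Its differential vanishes on xV and descends to
   [e1], the connecting image of e up to s0, which generates the new cohomology. *)
have [w1 w1E] := ext _ (@Jinj k) (mkL eL).
have [|e1 e1E] := fac _ (dl k \o w1).
  by move=> w /=; rewrite w1E linearZZ e0 scaler0.
have Ze1 : Zc (e1 : V1 -> J k.+1).
  by split=> [|y]; [exact: linP | have [w <-] := ps y; rewrite e1E Jdd].
have desc n (u : {linear V -> J n}) : qin q (@Bc V n) (fun w => u (x *: w)) ->
    exists s g, ~ q s /\ (exists2 g' : {linear V1 -> J n}, g = g' :> (V1 -> J n) & forall w, dl n (g (p w)) = s *: dl n (u w)).
  case=> t qt; case: n u => [|n] u Bt.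
    have [w|g gE] := fac _ (t \*: u); first exact: Bt.
    by exists t, g; split=> //; exists g => // w; rewrite gE /= linearZZ.
  have [c cE] := Bt; have [c' c'E] := ext _ (@Jinj n) c.
  have [w|g gE] := fac _ (((s0 * t) \*: u) \- (dl n \o c')).
    rewrite /= (_ : dl n _ = s0 *: (t *: u (x *: w))); first by rewrite scalerA subrr.
    by rewrite c'E; transitivity (s0 *: dl n (c w)); [exact: linearZZ | rewrite -cE].
  exists (s0 * t), g; split; first exact: mq.2.
  by exists g => // w; rewrite gE /= linearB linearZZ Jdd subr0.
have Zux n (z1 : V1 -> J n.+1) (u : {linear V -> J n}) c : 
    (forall w, c *: z1 (p w) = dl n (u w)) -> linear z1 -> Zc (fun w => u (x *: w)).
  move=> zu z1L; split=> [a w w'|w]; first by rewrite scalerDr scaleC linearP.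
  by rewrite -zu px -[z1 0]/(mkL z1L 0) linear0 scaler0.
have null_desc n (z1 : V1 -> J n.+1) : Zc z1 -> Dnull q n V ->
    qin q (@Bc V n.+1) (z1 \o p) -> qin q (@Bc V1 n.+1) z1.
  move=> [z1L _] nVn [c qc [u uE]].
  have [t [g [qt [g' -> gE]]]] := desc n u (nVn _ (Zux _ _ _ c uE z1L)).
  exists (t * c); first exact: mq.2.
  exists g' => y; have [w <-] := ps y; rewrite gE -uE.
  by rewrite [LHS](_ : _ = (t * c) *: z1 (p w)) // -scalerA.
exists V1, (p v); split.
- by move=> y; have [w <-] := ps y; have [a ->] := vg w; exists a; rewrite linearZZ.
- move=> a; rewrite /ann -linearZZ => /pE[w]; have [b ->] := vg w => avE.
  have : ann v (a - x * b) by rewrite /ann scalerBl avE scalerA subrr.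
  by move/vq => qab; rewrite -(subrK (x * b) a); apply: idlD => //; exact: idlMr.
- move=> n nk z1 Zz1.
  (* In degree k the pullback to V is locally r e for some r. It vanishes on xV, so r x annihilates
     e and hence locally v; x being regular at q, r annihilates v and the pullback is zero. *)
  have nullp : n = k -> qin q (@Bc V n) (z1 \o p).
    move=> nE; move: z1 Zz1; rewrite nE => z1 Zz1.
    have [s [r [qs Bsr]]] := eg _ (Zc_comp p Zz1).
    have qre : qin q (@Bc V k) ((r * x) *: e).
      exists 1; [exact: mq.1 | rewrite scale1r].
      have {}Bsr := Bc_comp mx Bsr.
      rewrite -[_ *: _]opprK; apply: smodN; first exact: sBc.
      rewrite (_ : - _ = (s *: (z1 \o p) - r *: e) \o mx) //; apply/funext => w.
      rewrite [RHS](_ : _ = s *: z1 (p (x *: w)) - r *: e (x *: w)) //.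
      have [z1L _] := Zz1; rewrite px -[z1 0]/(mkL z1L 0) linear0 scaler0 sub0r.
      by rewrite eZ scalerA.
    have [t qt trx] := ea _ qre.
    have [t' qt' t'r] : qin q (fun y : V => y = 0) (r *: v).
      apply: xreg; exists t => //; rewrite !scalerA (_ : t * x * r = t * (r * x)); last by ring.
      exact: trx.
    exists (t' * s); first exact: mq.2.
    rewrite -scalerA; apply: (smodBr (sBc _ V k) (y := t' *: (r *: e))).
      by rewrite -scalerBr; apply: smodZ => //; exact: sBc.
    rewrite (_ : _ *: _ = 0); first exact: smod0 (sBc _ V k).
    apply/funext => w; rewrite [LHS](_ : _ = t' *: (r *: e w)) //.
    have [a ->] := vg w; rewrite -!eZ (scaleC r) (scaleC t') t'r scaler0.
    by rewrite -[e 0]/(mkL eL 0) linear0.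
  have nullp' : qin q (@Bc V n) (z1 \o p).
    have [/nullp //|nk'] := pselect (n = k); exact: nV nk' _ (Zc_comp p Zz1).
  case: n nk z1 Zz1 {nullp} nullp' => [|n] nk z1 Zz1 nullp.
    have [s qs Bs] := nullp; exists s => // y; have [w <-] := ps y; exact: Bs.
  by apply: null_desc => //; apply: nV => nE; apply: nk; rewrite nE.
exists e1 => //; split=> [z1 Zz1|r [s qs [g gE]]].
  have [c qc [u uE]] := nV k.+1 (fun E => n_Sn k (esym E)) _ (Zc_comp p Zz1).
  have [z1L _] := Zz1.
  have [t [r [qt Btr]]] := eg _ (Zux _ _ _ c uE z1L).
  have [|t' [g [qt' [g' -> gE]]]] := desc k ((s0 * t) \*: u \- r \*: w1).
    exists 1; first exact: mq.1.
    rewrite scale1r (_ : (fun w => _) = s0 *: (t *: (fun w => u (x *: w)) - r *: e)).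
      by apply: smodZ => //; exact: sBc.
    apply/funext => w; rewrite /= w1E [RHS](_ : _ = s0 *: (t *: u (x *: w) - r *: e w)) //.
    by rewrite scalerBr !scalerA [r * _]mulrC.
  exists (t' * s0 * t * c), (t' * r); split; first by do 3!apply: mq.2 => //.
  exists g' => y; have [w <-] := ps y; rewrite gE.
  rewrite (_ : dl k _ = (s0 * t) *: (c *: z1 (p w)) - r *: e1 (p w)); last first.
    rewrite (linearB (dl k)) !(linearZZ (dl k)) e1E; congr (_ *: _ - _).
    by rewrite -uE.
  rewrite [LHS](_ : _ = (t' * s0 * t * c) *: z1 (p w) - (t' * r) *: e1 (p w)) //.
  by rewrite scalerBr !scalerA !mulrA.
have Zy : Zc (fun w => (s * r) *: w1 w - g (p w)).
  split; first exact: (linP (((s * r) \*: w1) \- (g \o p))).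
  move=> w; rewrite linearB linearZZ -gE -[dl k (w1 w)]/((dl k \o w1) w) -e1E.
  by rewrite [X in _ - X](_ : _ = s *: (r *: e1 (p w))) // scalerA subrr.
have [t [a [qt Bta]]] := eg _ Zy.
have /ea[c qc cE] : qin q (@Bc V k) ((t * s * r * s0 - a * x) *: e).
  exists 1; [exact: mq.1 | rewrite scale1r].
  rewrite (_ : _ *: e = (t *: (fun w => (s * r) *: w1 w - g (p w)) - a *: e) \o mx).
    exact: (Bc_comp mx Bta).
  apply/funext => w.
  rewrite [RHS](_ : _ = t *: ((s * r) *: w1 (x *: w) - g (p (x *: w))) - a *: e (x *: w)) //.
  rewrite px linear0 subr0 w1E eZ !scalerA.
  by rewrite [LHS](_ : _ = (t * s * r * s0 - a * x) *: e w) // scalerBl !mulrA.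
exists (c * (t * s * s0)); first by do 3!apply: mq.2 => //.
rewrite /ann -linearZZ; apply/qpi0; exists ((c * a) *: v) => //=.
have cE' : (c * (t * s * r * s0)) *: v = (x * (c * a)) *: v.
  apply/eqP; rewrite -subr_eq0 -scalerBl; apply/eqP; rewrite -[RHS]cE; congr (_ *: v).
  rewrite -[RHS]/(c * (t * s * r * s0 - a * x)); ring.
transitivity ((c * (t * s * r * s0)) *: v); last by rewrite cE' scalerA.
congr (_ *: v); rewrite -[LHS]/(c * (t * s * s0) * r); ring.
Qed.

Lemma QC_loc q r k V (v : V) : prm q -> (forall a, r a -> q a) -> prm r -> (forall a, ann v a -> r a) ->
  QC q k v -> QC r k v.
Proof.
move=> pq rq pr vr [vg _ nV [e Ze [eg ea]]]; split=> //.
  by move=> n /nV H z /H[s qs Bs]; exists s => // /rq.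
exists e => //; split.
  by move=> z /eg[s [a [qs Bsa]]]; exists s, a; split=> // /rq.
move=> a [s rs Bs]; have [t qt tsa] : qin q (V := A^o) (ann v) (s *: (a : A^o)).
  by apply: ea; exists 1; [exact: (prm_mulc pq).1 | rewrite scale1r -scalerA].
exists (t * s); first by apply: (prm_mulc pr).2 => // /rq.
by rewrite -scalerA.
Qed.

Lemma QC_nonnull q k V (v : V) : prm q -> QC q k v -> ~ Dnull q k V.
Proof.
move=> pq [vg vq nV [e Ze [eg ea]]] nk; have mq := prm_mulc pq.
have [s qs Bs] := nk _ Ze.
have [t qt /vq] : qin q (V := A^o) (ann v) s by apply: ea; apply: sub_qin.
exact: mq.2 qt qs.
Qed.

Hypothesis fgD : forall n N, fgm N -> Dfg dl n N.

Lemma QC_NZ q k V (v : V) : prm q -> QC q k v ->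
  exists2 k', (k <= k')%N & NZ q k' q.
Proof.
move=> pq hQ; have mq := prm_mulc pq; have [vg vq _ _] := hQ.
have [||p [pp _ pq' nz]] := @devissage_D _ _ _ Jinj Jdd q k (fun=> False) V nA mq (fgm_cyc vg).
- by [].
- exact: QC_nonnull hQ.
have [k' [kk' nz' _]] := NZ_climb Jinj Jdd nA fgD pq pp pq' nz.
by exists k'.
Qed.

Lemma NZ_bound q n p : mulc q -> NZ q n p -> (n <= D')%N.
Proof.
move=> mq [V [x [_ _ nV]]]; rewrite leqNgt; apply/negP => /Jbound J0; apply: nV => z _.
by apply: sub_qin => //; rewrite (_ : z = 0); [exact: smod0 (sBc dl V n) | apply/funext => y; exact: J0].
Qed.

(** Degrees are bounded by the length of J, so k can be taken maximal. Then no x in q is regular on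
    V at q, and by prime avoidance q is contained in, hence equal to, the annihilator of some
    element of V. *)
Lemma QC_max q : prm q -> exists k V (v : V), QC q k v /\ exists y : V, ann y = q.
Proof.
move=> pq; have mq := prm_mulc pq.
pose P k := `[< exists V (v : V), QC q k v >].
have P0 : exists k, P k by exists 0%N; apply/asboolP; exists A^o, 1; exact: QC0.
have Pb k : P k -> (k <= D')%N.
  move=> /asboolP[V [v hQ]]; have [k' kk' nz] := QC_NZ pq hQ.
  exact: leq_trans kk' (NZ_bound mq nz).
have [k /asboolP[V [v hQ]] kmax] := ex_maxnP P0 Pb; exists k, V, v; split=> //.
have [vg vq _ _] := hQ.
have [n [L HL]] := ass_fin nA (fgm_cyc vg).
pose ok i := [/\ prm (L i), forall a, L i a -> q a & exists y : V, ann y = L i].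
have [a [pa aq]] : exists a, prm (ann (a *: v)) /\ forall s, ann (a *: v) s -> q s.
  by apply: assoc_ex => // -[s qs sv]; apply: qs; exact: vq.
have [i0 i0n i0L] := HL _ pa.
have ok0 : ok i0 by rewrite /ok i0L; split=> //; exists (a *: v).
pose L' i := if `[< ok i >] then L i else L i0.
have okL' i : [/\ prm (L' i), forall a, L' i a -> q a & exists y : V, ann y = L' i].
  by rewrite /L'; case: asboolP.
have [[i iL]|nL] := pselect (exists2 i, (i < n)%N & forall x, q x -> L' i x).
  move=> iq; have [_ Lq [y yL]] := okL' i; exists y; rewrite yL.
  by apply/funext => b; apply/propext; split; [exact: Lq | exact: iq].
exfalso.
have [|||x qx xL] := @prime_avoid _ n L' q.
- by case: pq.
- by move=> i _; have [] := okL' i.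
- move=> i iltn; apply: contrapT => nx; apply: nL; exists i => // x qx.
  by apply: contrapT => nLx; apply: nx; exists x.
have [|V' [v' hQ']] := QC_step pq hQ qx; last first.
  suff /kmax : P k.+1 by rewrite ltnn.
  by apply/asboolP; exists V', v'.
move=> y [s qs sxy]; apply: contrapT => ny.
have [b [pb bq]] := assoc_ex nA mq ny; have [j jn jL] := HL _ pb.
have okj : ok j by rewrite /ok jL; split=> //; exists (b *: y).
have [_ _ pM] := pb; have [|/bq //|] := pM s x.
  rewrite /ann; transitivity (b *: (s *: (x *: y))); last by rewrite sxy scaler0.
  by rewrite !scalerA; congr (_ *: _); ring.
by move=> xb; apply: (xL j jn); rewrite /L' asboolT // jL.
Qed.

(** This expresses that A_q is Gorenstein: Ext^n(k(q), A_q) is nonzero in the single degree h, with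
    length one. It is read off the cyclic V of [QC_max], which turns out to have finite length at
    q. *)
Lemma gorenstein_prime q : prm q -> exists h, [/\ NZ q h q, forall n, NZ q n q -> n = h
  & forall V (x : V), cyc x -> ann x = q -> ~ Dlen_ge q h V 2].
Proof.
move=> pq; have mq := prm_mulc pq; have [k [V [v [hQ [y yq]]]]] := QC_max pq.
have [vg vq nV [e Ze [eg ea]]] := hQ; have fV := fgm_cyc vg.
have Ann a (w : V) : ann v a -> a *: w = 0.
  by move=> va; have [b ->] := vg w; rewrite scaleC (va : a *: v = 0) scaler0.
pose P n := `[< NZ q n q >].
have [k1 kk1 nz1] := QC_NZ pq hQ.
have [||h /asboolP nzh hmax'] := @ex_maxnP P D'.
- by exists k1; apply/asboolP.
- by move=> n /asboolP; exact: NZ_bound.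
have hmax n : NZ q n q -> (n <= h)%N by move=> nz; apply: hmax'; exact/asboolP.
have above n N : (h < n)%N -> fgm N -> Dnull q n N.
  move=> hn fN; apply: contrapT => nN.
  have [||p [pp _ pq' nz]] := @devissage_D _ _ _ Jinj Jdd q n (fun=> False) N nA mq fN => //.
  have [n' [nn' /hmax nz' _]] := NZ_climb Jinj Jdd nA fgD pq pp pq' nz; lia.
pose Y := Submod (smod_spn [:: y]).
have [y0 y0E] : exists y0, sinc Y y0 = y by apply/sinc_surj/spn_mem/mem_head.
have y0g : cyc y0.
  move=> z; have [a za] := sincP z; exists a; apply: sinc_inj; rewrite linearZZ y0E.
  by apply/eqP; rewrite -subr_eq0 za.
have y0q : ann y0 = q by rewrite -yq -y0E ann_linear // => a; exact: inj_lin0 (@sinc_inj _ _ Y).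
have nY : ~ Dnull q h (subm Y).
  have [C [c [cg cq nC]]] := nzh => H; apply: nC; exact: (Dnull_cyc Jdd mq y0g cg (etrans y0q (esym cq)) H).
(* Above h everything vanishes at q, so the embedding of A/q in V makes D^h(V) surject at q onto the
   nonzero D^h(A/q). *)
have kh : k = h.
  apply: contrapT => nkh; apply: nY; apply: (Dnull_sub Jinj Jdd mq (ses_sub Y)).
    by apply: nV => /esym.
  by apply: above => //; exact: fgm_img fV (@qpi_surj _ _ _).
(* A prime over ann v strictly inside q would carry cohomology in some degree at least k, and
   climbing on to q would exceed the top degree h = k. *)
have vmin p : prm p -> (forall a, ann v a -> p a) -> (forall a, p a -> q a) -> forall a, q a -> p a.
  move=> pp vp pq'; apply: contrapT => nqp; have hp := QC_loc pq pq' pp vp hQ.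
  have [k' kk' nz'] := QC_NZ pp hp.
  have [k'' [_ /hmax nz'' lt]] := NZ_climb Jinj Jdd nA fgD pq pp pq' (NZ_loc pq' nz').
  have {}lt : (k' < k'')%N by apply: lt => pE; apply: nqp; rewrite pE.
  lia.
have kill U : fgm U -> (forall a (x : U), ann v a -> a *: x = 0) -> forall n, ~ NZ q n q -> Dnull q n U.
  move=> fU vU n nz; apply: contrapT => nU.
  have [p [pp vp pq' nzp]] := devissage_D Jinj Jdd nA mq fU vU nU.
  apply: nz; have pE : p = q.
    by apply/funext => a; apply/propext; split; [exact: pq' | exact: vmin].
  by move: nzp; rewrite pE.
have [C [c [cg cq nC]]] := nzh.
have [f fv] : exists f : {linear V -> C}, f v = c.
  by apply: cyc_map => // a; rewrite cq; exact: vq.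
have sK : smod (fun w => f w = 0) by exact: (smod_preim f (smod1 (V := C))).
have sf : ses (sinc (Submod sK)) f.
  split; first exact: sinc_inj.
    by move=> z; have [a ->] := cg z; exists (a *: v); rewrite linearZZ fv.
  move=> w; split=> [fw|[u ->]]; last exact: (sincP u).
  by have [u <-] := @sinc_surj _ _ (Submod sK) w fw; exists u.
have fK : fgm (subm (Submod sK)) by apply: fgs_subm; exact: fgs_sub.
have vK a (x : subm (Submod sK)) : ann v a -> a *: x = 0.
  by move=> va; apply: sinc_inj; rewrite linearZZ linear0 Ann.
(* Degrees below h are excluded by induction: V maps onto A/q with a kernel filtered at q by copies
   of A/q, whose cohomology one degree lower is zero, and D^n(V) is zero as well. *)
have below n : NZ q n q -> n = h.
  elim/ltn_ind: n => n IH nzn; apply: contrapT => nh.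
  have [C1 [c1 [c1g c1q nC1]]] := nzn.
  apply: nC1; apply: (Dnull_cyc Jdd mq cg c1g); first by rewrite cq.
  have nVn : Dnull q n V by apply: nV; rewrite kh.
  case: n nh nzn IH nVn => [|n] nh nzn IH nVn; first exact: (Dnull_quo0 sf nVn).
  apply: (Dnull_quo Jinj Jdd mq sf) => //; apply: kill => // nzn'.
  have nE := IH n (leqnn _) nzn'; have := hmax _ nzn; lia.
exists h; split=> // C' c' c'g c'q l2.
have l2C : Dlen_ge q h C 2 by apply: Dlen_cyc l2 => //; rewrite cq.
have [m mV] := ml_fin nA pq vmin fV Ann.
(* Were D^h(A/q) of length at least 2, devissage would give D^h(V) a length greater than that of V
   at q, while [QC] makes it locally isomorphic to V. *)
pose PP (X : lmodType A) := (forall n, n <> h -> Dnull q n X) /\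
  exists m, [/\ ml q X m, Dlen_ge q h X m & (0 < m)%N -> Dlen_ge q h X m.+1].
have [_ [m' [mV' _ H]]] : PP V.
  apply: (@devissage _ (ann v) PP) => //.
  - move=> X X0; have Xq : qnull q X by move=> x; exists 1; [exact: mq.1 | exact: X0].
    have fX : fgm X by exists [::] => x; split=> // _; exact: X0.
    split=> [n _|]; first exact: Dnull_qnull.
    by exists 0%N; split=> //; exact: (ml0 X mq).1.
  - move=> X Z W i p sip [nX [a [ma da da']]] [nW [b [mb db db']]].
    split=> [n nh|]; first exact: (Dnull_mid Jinj Jdd mq sip (nX _ nh) (nW _ nh)).
    have side : Dnull_pred dl q h X.
      by case: (h) nX => // n nX; apply: nX => E; exact: (n_Sn _ E).
    have sideW : Dnull q h.+1 W by apply: nW => E; exact: (n_Sn _ (esym E)).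
    have HH := (@Dlen_ses _ _ _ Jinj Jdd q h _ _ _ _ _ _ _ mq sip side sideW da db).
    exists (a + b)%N; split; [exact: ml_ses mq sip ma mb | exact: HH |].
    rewrite addn_gt0 => /orP[/da' d|/db' d].
      by rewrite -addSn; exact: (@Dlen_ses _ _ _ Jinj Jdd q h _ _ _ _ _ _ _ mq sip side sideW d db).
    by rewrite -addnS; exact: (@Dlen_ses _ _ _ Jinj Jdd q h _ _ _ _ _ _ _ mq sip side sideW da d).
  move=> X x xg px vx.
  have [xq|/existsNP[s /not_implyP[xs qs]]] := pselect (forall a, ann x a -> q a).
    have xE : ann x = q.
      by apply/funext => a; apply/propext; split; [exact: xq | exact: vmin].
    split=> [n nh|].
      by apply: (not_NZ mq xg xE) => /below.
    exists 1%N; split=> [| |_]; first exact: ml_cyc xg pq xE.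
      apply: contrapT => /(Dnull_len Jdd _ _ mq) nX; apply: nC.
      exact: (Dnull_cyc Jdd mq xg cg (etrans xE (esym cq)) nX).
    by apply: Dlen_cyc l2C => //; rewrite cq.
  have Xq := ml_cyc_lt xg mq xs qs.
  split=> [n _|]; first exact: Dnull_qnull mq (fgm_cyc xg) Xq.
  by exists 0%N; split=> //; exact: (ml0 X mq).1.
have mE := has_len_uniq mV mV'; subst m' h.
have m0 : (0 < m)%N.
  rewrite lt0n; apply/eqP => m0; have := mV; rewrite m0 => /(ml0 V mq).2 /(_ v)[s qs sv].
  by apply: qs; exact: vq.
apply: mV.2; apply: (len_rel mq (r := fun z w => exists r, @Bc V k (z - r *: e) /\ w = r *: v)) (H m0) => //.
- exact: sBc.
- exact: sZc.
- exact: smod1.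
- by exists 0; rewrite !scale0r subrr; split=> //; exact: smod0 (sBc dl V k).
- move=> a z w z' w' [r [Br ->]] [r' [Br' ->]]; exists (a * r + r'); split.
    rewrite (_ : _ - _ = a *: (z - r *: e) + (z' - r' *: e)); first exact: (sBc dl V k).2.
    by rewrite scalerBr scalerDl opprD addrACA scalerA.
  by rewrite scalerDl scalerA.
- by move=> z /eg[s [r [qs Bs]]]; exists s, (r *: v); split=> //; exists r.
move=> z w _ [r [Br ->]] rv; apply: (sub_qin mq).
apply: (smodBr (sBc dl V k) Br); rewrite (_ : _ *: _ = 0); first exact: smod0 (sBc dl V k).
have [eL _] := Ze; apply/funext => u; rewrite [LHS](_ : _ = r *: e u) //.
have [a ->] := vg u; rewrite -[e _]/(mkL eL (a *: v)) -linearZZ scaleC rv scaler0.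
exact: linear0.
Qed.

End Gorenstein.

(** * Injective hulls and cancellation of injective summands *)

Section Hull.
Local Open Scope classical_set_scope.
Variable A : comNzRingType.
Implicit Types (U V W I X Y K : lmodType A).

Definition essential V (N E : V -> Prop) :=
  forall x, E x -> x <> 0 -> exists a, a *: x <> 0 /\ N (a *: x).

(* Zorn's lemma for submodules above N with a property of finite character *)
Lemma zorn_smod V (N : V -> Prop) (P : (V -> Prop) -> Prop) : smod N -> P N ->
  (forall F : set (set V), F !=set0 -> total_on F subset ->
     (forall S, F S -> [/\ smod S, forall x, N x -> S x & P S]) -> P (bigcup F id)) ->
  exists S, [/\ smod S, forall x, N x -> S x, P S
    & forall T, smod T -> (forall x, S x -> T x) -> P T -> forall x, T x -> S x].
Proof.
move=> sN PN Pchain.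
pose t (S : set V) : set V := fun x => N x \/ S x.
have [F FP Ft|S [[sS PS] Smax]] := @Zorn_bigcup V (fun S => smod (t S) /\ P (t S)).
  have [[S0 FS0]|F0] := pselect (F !=set0); last first.
    have -> : t (bigcup F id) = N.
      apply/funext => x; apply/propext; split=> [[//|[S FS]]|]; last by left.
      by exfalso; apply: F0; exists S.
    by [].
  pose G : set (set V) := fun T => exists2 S, F S & T = t S.
  have tE : t (bigcup F id) = bigcup G id.
    apply/funext => x; apply/propext; split=> [[Nx|[S FS Sx]]|[_ [S FS ->] [Nx|Sx]]].
    - by exists (t S0); [exists S0 | left].
    - by exists (t S); [exists S | right].
    - by left.
    - by right; exists S.
  have Gt : total_on G subset.
    move=> _ _ [S FS ->] [T FT ->]; have [ST|TS] := Ft _ _ FS FT; [left|right] => x [Nx|Sx].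
    - by left.
    - by right; exact: ST.
    - by left.
    - by right; exact: TS.
  rewrite tE; split; last first.
    apply: Pchain => //; first by exists (t S0), S0.
    by move=> _ [S /FP[sS PS] ->]; split=> // x; left.
  split; first by exists (t S0); [exists S0 | left; exact: smod0].
  move=> a x y [S GS Sx] [T GT Ty].
  have sG R : G R -> smod R by move=> [R' /FP[sR _] ->].
  have [ST|TS] := Gt _ _ GS GT.
    by exists T => //; apply: (sG _ GT).2 => //; exact: ST.
  by exists S => //; apply: (sG _ GS).2 => //; exact: TS.
exists (t S); split=> // [x|T sT ST PT x Tx]; first by left.
have tT : t T = T.
  by apply/funext => y; apply/propext; split=> [[Ny|//]|]; [apply: ST; left | right].
apply: contrapT => nSx; apply: (Smax T); last by rewrite tT.
split=> [y Sy|TS]; first by apply: ST; right.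
by apply: nSx; right; exact: TS.
Qed.

(** E is a maximal essential extension of N in I, and K is maximal with zero intersection with E.
    The inclusion of E extends over I/K to a map h whose image is again essential over N, hence
    equal to E; so h after the projection retracts I onto E with kernel K. *)
Lemma hull I (N : I -> Prop) : injective_module I -> smod N ->
  exists E K : I -> Prop, [/\ smod E, smod K, forall x, N x -> E x, essential N E
    & (forall x, E x -> K x -> x = 0) /\ forall x, exists2 e, E e & K (x - e)].
Proof.
move=> Iinj sN.
have [||E [sE NE essE Emax]] := @zorn_smod I N (essential N) sN.
- by move=> x Nx x0; exists 1; rewrite scale1r.
- by move=> F _ _ FP x [S /FP[_ _ Se] Sx] x0; exact: Se.
have [|||K [sK _ KE Kmax]] := @zorn_smod I (fun x => x = 0) (fun K : I -> Prop => forall x, E x -> K x -> x = 0).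
- exact: smod1.
- by [].
- by move=> F _ _ FP x Ex [S /FP[_ _ Se] Sx]; exact: Se.
exists E, K; split=> //; split=> // .
pose SK := Submod sK; pose SE := Submod sE; pose p := qpi SK.
have pess z : z <> 0 -> exists a e, [/\ E e, e <> 0 & a *: z = p e].
  have [x <-] := qpi_surj z => px0.
  have nKx : ~ K x by move=> Kx; apply: px0; apply/qpi0.
  apply: contrapT => nex; apply: nKx.
  have sKx := smod_add sK (smod_spn [:: x]).
  apply: (Kmax _ sKx) => [y Ky||].
  - by exists y => //; rewrite subrr; exact: smod0 (smod_spn _).
  - move=> y Ey [k Kk [a]] /= /eqP; rewrite subr_eq0 => /eqP yk.
    apply: contrapT => y0; apply: nex; exists a, y; split=> //.
    rewrite -linearZZ -yk linearB (_ : p k = 0) ?subr0 //; exact/qpi0.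
  - exists 0; first exact: smod0.
    by rewrite subr0; apply/spn_mem/mem_head.
have pE e : E e -> p e = 0 -> e = 0 by move=> Ee /qpi0; exact: KE.
have [|h hE] := @injective_ext _ I _ _ (p \o sinc SE) (sinc SE) Iinj.
  by move=> u /= /(pE _ (sincP u)) u0; apply: sinc_inj; rewrite u0 linear0.
have {}hE e : E e -> h (p e) = e.
  by move=> /(@sinc_surj _ _ SE)[u <-]; exact: hE.
have sH := smod_img h (smodT (V := quom SK)).
have HE : forall x, (exists2 z, True & x = h z) -> E x.
  apply: (Emax _ sH) => [x Ex|_ [z _ ->] hz0]; first by exists (p x) => //; rewrite hE.
  have z0 : z <> 0 by move=> z0; apply: hz0; rewrite z0 linear0.
  have [a [e [Ee e0 az]]] := pess z z0.
  have [b [be0 Nbe]] := essE e Ee e0.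
  by exists (b * a); rewrite -scalerA -(linearZZ h) az hE.
move=> x; exists (h (p x)); first by apply: HE; exists (p x).
apply/(@qpi0 _ _ SK); set w := _ - _; apply: contrapT => pw.
have [a [e [Ee e0 aw]]] := pess _ pw; apply: e0.
have hw : h (p w) = 0.
  have Ehx : E (h (p x)) by apply: HE; exists (p x).
  by rewrite /w (linearB p) (linearB h) (hE _ Ehx) subrr.
by rewrite -(hE e Ee) -aw (linearZZ h) hw scaler0.
Qed.

Lemma ses_split K X Y (k : {linear K -> X}) (r : {linear X -> Y}) :
  injective_module K -> ses k r ->
  exists s : {linear Y -> X}, (forall y, r (s y) = y) /\ forall x, exists u, x = k u + s (r x).
Proof.
move=> Kinj [kinj rs kr]; have [g gE] := Kinj _ _ k idfun kinj.
have [//|v rv|s sE] := @lin_factor _ _ _ _ r (idfun \- (k \o g)).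
  by have [u ->] := (kr v).1 rv; rewrite /= gE subrr.
exists s; split=> [y|x].
  have [x <-] := rs y; rewrite sE /= linearB (_ : r (k _) = 0) ?subr0 //.
  by apply/kr; exists (g x).
by exists (g x); rewrite sE /= addrC subrK.
Qed.

Lemma injective_retract X Y (r : {linear X -> Y}) (s : {linear Y -> X}) :
  injective_module X -> (forall y, r (s y) = y) -> injective_module Y.
Proof.
move=> Xinj rs U V g f ginj; have [h hE] := Xinj _ _ g (s \o f) ginj.
by exists (r \o h) => u /=; rewrite hE /= rs.
Qed.

Lemma injective_quo K X Y (k : {linear K -> X}) (r : {linear X -> Y}) :
  injective_module K -> injective_module X -> ses k r -> injective_module Y.
Proof.
move=> Kinj Xinj sk; have [s [rs _]] := ses_split Kinj sk.
exact: injective_retract Xinj rs.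
Qed.

Fixpoint injdim_le n (Q : lmodType A) : Prop :=
  if n is n'.+1 then exists (I Q' : lmodType A) (i : {linear Q -> I}) (p : {linear I -> Q'}),
    [/\ injective_module I, ses i p & injdim_le n' Q']
  else injective_module Q.

(** The first injective term of X may be divided by the image of K, which is injective again, so
    that the quotient remains injective; the later terms do not change. *)
Lemma injdim_quo n K X Y (k : {linear K -> X}) (r : {linear X -> Y}) :
  injective_module K -> ses k r -> injdim_le n X -> injdim_le n Y.
Proof.
move=> Kinj sk; case: n => [|n] /=; first by move=> Xinj; exact: injective_quo sk.
move=> [I [Q' [i [p [Iinj sip dQ']]]]].
have [kinj rs kr] := sk; have [iinj ps ip] := sip.
have sK := smod_img (i \o k) (smodT (V := K)).
pose S := Submod sK.
have [j jE] : exists j : {linear K -> subm S}, forall u, sinc S (j u) = i (k u).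
  apply: (@lin_lift _ _ _ _ _ (i \o k)); first exact: sinc_inj.
  by move=> u; apply: sinc_surj; exists u.
have Sinj : injective_module (subm S).
  have [s sE] : exists s : {linear subm S -> K}, forall u, i (k (s u)) = sinc S u.
    apply: (@lin_lift _ _ _ _ (i \o k) (sinc S)); first by move=> u v /iinj/kinj.
    by move=> u; have [w _ ->] := sincP u; exists w.
  by apply: (injective_retract (r := j) (s := s) Kinj) => u; apply: sinc_inj; rewrite jE sE.
have [|y ry|l lE] := @lin_factor _ _ _ _ r (qpi S \o i); first exact: rs.
  by have [u ->] := (kr y).1 ry; apply/qpi0; exists u.
have [|v pv|p' p'E] := @lin_factor _ _ _ _ (qpi S) p; first exact: qpi_surj.
  have [u _ ->] := (qpi0 _ _).1 pv; by apply/ip; exists (k u).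
exists (quom S), Q', l, p'; split=> //.
  exact: injective_quo Sinj Iinj (ses_sub S).
split.
- apply: lin_inj => y; have [x <-] := rs y; rewrite lE => /qpi0[u _ /iinj ->].
  by apply/kr; exists u.
- by move=> z; have [x <-] := ps z; exists (qpi S x); rewrite p'E.
move=> z; have [x <-] := qpi_surj z; rewrite p'E ip.
split=> [[y ->]|[y]]; first by exists (r y); rewrite lE.
have [w <-] := rs y; rewrite lE => /eqP; rewrite -subr_eq0 -linearB => /eqP/qpi0[u _].
by move=> /eqP; rewrite subr_eq => /eqP ->; exists (k u + w); rewrite linearD.
Qed.

Fixpoint minres n (Q : lmodType A) : Prop :=
  if n is n'.+1 then exists (I Q' : lmodType A) (i : {linear Q -> I}) (p : {linear I -> Q'}),
    [/\ injective_module I, ses i p, essential (fun y : I => exists x, y = i x) (fun=> True) & minres n' Q']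
  else forall x : Q, x = 0.

(** The first injective I is replaced by the hull E of Q. The complement of E is an injective
    submodule of the old cosyzygy, and [injdim_quo] removes it. [injdim_le n] counts degrees from 0
    to n, [minres n.+1] counts terms. *)
Lemma minresP n Q : injdim_le n Q -> minres n.+1 Q.
Proof.
elim: n Q => [|n IH] Q; last first.
  move=> [I [Q' [i [p [Iinj sip dQ']]]]]; have [iinj ps ip] := sip.
  have sN := smod_img i (smodT (V := Q)).
  have [E [K [sE sK NE ess [EK EKI]]]] := hull Iinj sN.
  pose SE := Submod sE; pose SK := Submod sK.
  have decomp x : exists u v, x = sinc SE u + sinc SK v.
    have [e Ee Ke] := EKI x; have [u uE] := @sinc_surj _ _ SE e Ee.
    have [v vE] := @sinc_surj _ _ SK _ Ke; exists u, v; by rewrite uE vE addrC subrK.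
  have dir u v : sinc SE u + sinc SK v = 0 -> u = 0 /\ v = 0.
    move=> uv; have uE : sinc SE u = - sinc SK v by apply/eqP; rewrite -addr_eq0 uv.
    have u0 : sinc SE u = 0.
      by apply: EK; [exact: (sincP u) | rewrite uE; apply: smodN => //; exact: (sincP v)].
    split; apply: sinc_inj; rewrite linear0 //.
    by move: uv; rewrite u0 add0r.
  have summand (T T' : submod I) : (forall x, exists u v, x = sinc T u + sinc T' v) ->
      (forall u v, sinc T u + sinc T' v = 0 -> u = 0 /\ v = 0) -> injective_module (subm T).
    move=> dec di; have /choice[g gP] : forall x, exists u, exists v, x = sinc T u + sinc T' v.
      by move=> x; have [u [v H]] := dec x; exists u, v.
    have gE x u v : x = sinc T u + sinc T' v -> g x = u.
      move=> xE; have [w wE] := gP x.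
      have [] := di (g x - u) (w - v) => [|/eqP]; last by rewrite subr_eq0 => /eqP.
      by rewrite !linearB addrACA -opprD -wE -xE subrr.
    have gL : linear g.
      move=> a x y; have [v vE] := gP x; have [w wE] := gP y.
      apply: (gE _ _ (a *: v + w)); rewrite [X in a *: X]vE [X in _ + X]wE !linearP.
      by rewrite scalerDr addrACA.
    apply: (injective_retract (r := mkL gL) (s := sinc T) Iinj) => u.
    by rewrite mkLE; apply: (gE _ _ 0); rewrite linear0 addr0.
  have Einj : injective_module (subm SE) by apply: (summand _ SK).
  have Kinj : injective_module (subm SK).
    apply: (summand _ SE) => [x|u v]; last by rewrite addrC => /dir[].
    by have [u [v ->]] := decomp x; exists v, u; rewrite addrC.
  have [i' i'E] : exists i' : {linear Q -> subm SE}, forall u, sinc SE (i' u) = i u.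
    apply: lin_lift; first exact: sinc_inj.
    by move=> u; apply: (@sinc_surj _ _ SE); apply: NE; exists u.
  have sI' := smod_img i' (smodT (V := Q)).
  pose N := Submod sI'; pose q := qpi N.
  have sq : ses i' q.
    split; last 1 first.
    - by move=> y; rewrite qpi0; split=> [[x _ ->]|[x ->]]; exists x.
    - by move=> x y xy; apply: iinj; rewrite -!i'E xy.
    - exact: qpi_surj.
  exists (subm SE), (quom N), i', q; split=> //.
    move=> u _ u0; have [|a [au [x _ xa]]] := ess _ (sincP u).
      by move=> su; apply: u0; apply: sinc_inj; rewrite su linear0.
    exists a; split; first by move=> au0; apply: au; rewrite -linearZZ au0 linear0.
    by exists x; apply: sinc_inj; rewrite linearZZ xa i'E.
  apply: IH.
  (* Q' is the direct sum of E/Q and K *)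
  have /choice[g gP] : forall z, exists u, exists v, z = p (sinc SE u + sinc SK v).
    by move=> z; have [x <-] := ps z; have [u [v ->]] := decomp x; exists u, v.
  have gE u v z : z = p (sinc SE u + sinc SK v) -> q (g z) = q u.
    move=> zE; have [w wE] := gP z; apply/eqP; rewrite -subr_eq0 -linearB; apply/eqP/qpi0.
    have /ip[x xE] : p (sinc SE (g z - u) + sinc SK (w - v)) = 0.
      by rewrite !linearB addrACA -opprD linearB -wE -zE subrr.
    have [|dE _] := dir (g z - u - i' x) (w - v).
      have -> : sinc SE (g z - u - i' x) = sinc SE (g z - u) - i x by rewrite linearB i'E.
      by rewrite -xE; set s1 := sinc SE _; rewrite opprD [s1 + (_ - _)]addrA subrr add0r addNr.
    by exists x => //; apply/eqP; rewrite -subr_eq0 dE.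
  have rL : linear (q \o g).
    move=> a x y; rewrite /= -(linearP q); have [v vE] := gP x; have [w wE] := gP y.
    apply: (gE _ (a *: v + w)); rewrite [in LHS]vE [in LHS]wE -(linearP p); congr (p _).
    by rewrite !linearP scalerDr addrACA.
  apply: (injdim_quo (k := p \o sinc SK) (r := mkL rL) Kinj) => //.
  have rE u v : mkL rL (p (sinc SE u + sinc SK v)) = q u by rewrite mkLE; exact: gE.
  split.
  - apply: lin_inj => v /= /ip[x xE]; have [] := dir (- i' x) v => //.
    by rewrite linearN i'E -xE addNr.
  - move=> z; have [u <-] := qpi_surj z; exists (p (sinc SE u + sinc SK 0)); exact: rE.
  move=> z; have [v vE] := gP z; split=> [|[w ->]]; last first.
    transitivity (mkL rL (p (sinc SE 0 + sinc SK w))); last by rewrite rE linear0.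
    by congr (mkL rL _); rewrite (linear0 (sinc SE)) add0r.
  rewrite {1}vE rE => /qpi0[x _ gx]; exists v; rewrite {1}vE (linearD p) gx i'E.
  by rewrite (_ : p (i x) = 0) ?add0r //; apply/ip; exists x.
move=> Qinj; exists Q, (quom (Submod (smodT (V := Q)))), idfun, (qpi (Submod smodT)); split=> //.
- split=> // [|y]; first exact: qpi_surj.
  by split=> [_|[x ->]]; [exists y | exact/qpi0].
- by move=> x _ x0; exists 1; rewrite scale1r; split=> //; exists x.
by move=> z; have [v <-] := qpi_surj z; apply/qpi0.
Qed.

End Hull.

(** * The connecting homomorphism on cochains *)

Section Connecting.
Variable A : comNzRingType.
Variables (J : nat -> lmodType A) (dl : forall i, {linear J i -> J i.+1}).
Hypotheses (Jinj : forall i, injective_module (J i)) (Jdd : forall i x, dl i.+1 (dl i x) = 0).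
Variables (U V W : lmodType A) (i : {linear U -> V}) (p : {linear V -> W}).
Hypothesis sip : ses i p.

(** [z] represents the connecting image of the class of [u]. It is a relation because it depends on
    the chosen extension w of u to V. *)
Definition conn n (u : U -> J n) (z : W -> J n.+1) := exists w : {linear V -> J n},
  (forall x, w (i x) = u x) /\ forall y, dl n (w y) = z (p y).

Lemma conn_lin n a (u u' : U -> J n) (z z' : W -> J n.+1) :
  conn u z -> conn u' z' -> conn (a *: u + u') (a *: z + z').
Proof.
move=> [w [wu wz]] [w' [wu' wz']]; exists (a \*: w \+ w'); split=> x.
  by rewrite [RHS](_ : _ = a *: u x + u' x) // -wu -wu'.
by rewrite [RHS](_ : _ = a *: z (p x) + z' (p x)) // -wz -wz' linearP.
Qed.

Lemma conn0 n : conn (0 : U -> J n) (0 : W -> J n.+1).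
Proof. by exists \0; split=> x //; rewrite linear0. Qed.

Lemma conn_ex n (u : U -> J n) : Zc dl u -> exists2 z, Zc dl z & conn u z.
Proof.
move=> [uL u0]; have [iinj ps _] := sip; have [w wE] := Jinj (mkL uL) iinj.
have [|g gE] := @ses_fac _ _ _ _ _ _ sip _ (dl n \o w).
  by move=> x /=; rewrite wE; exact: u0.
exists g; last by exists w; split=> // y; rewrite gE.
split; first exact: linP.
by move=> y; have [x <-] := ps y; rewrite gE Jdd.
Qed.

Lemma conn_ex' n (z : W -> J n.+1) : Zc dl z -> Bc dl (z \o p) -> exists2 u, Zc dl u & conn u z.
Proof.
move=> [zL z0] [w wE]; exists (w \o i); last by exists w; split=> // y; rewrite -wE.
split; first exact: linP.
by move=> x /=; rewrite -wE /= (ses_pi sip) -[z 0]/(mkL zL 0) linear0.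
Qed.

Lemma conn_Bc n (u : U -> J n) (z : W -> J n.+1) : conn u z -> Bc dl u -> Bc dl z.
Proof.
move=> [w [wu wz]] Bu; have [iinj ps _] := sip.
suff [h h0 hz] : exists2 h : {linear V -> J n}, (forall x, h (i x) = 0) & forall y, dl n (h y) = z (p y).
  have [g gE] := ses_fac sip h0; exists g => y; have [x <-] := ps y.
  by rewrite gE hz.
case: n u z w wu wz Bu => [|n] u z w wu wz /= Bu; first by exists w => // x; rewrite wu.
have [v vE] := Bu; have [v' v'E] := Jinj v iinj.
exists (w \- (dl n \o v')) => [x|y] /=; first by rewrite wu vE v'E subrr.
by rewrite linearB Jdd subr0.
Qed.

End Connecting.

(** * Minimal injective resolutions, free modules, local rings *)

Section MinimalResolution.
Variable A : comNzRingType.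

(** The terms vanish from index n on. Minimality of the resolution is [mi_ess]: the kernel of each
    differential is essential. *)
Record mininj (Q : lmodType A) (n : nat) := MinInj {
  mi_J : nat -> lmodType A;
  mi_d : forall i, {linear mi_J i -> mi_J i.+1};
  mi_aug : {linear Q -> mi_J 0%N};
  mi_inj : forall i, injective_module (mi_J i);
  mi_augI : injective mi_aug;
  mi_ex0 : forall x, mi_d 0%N x = 0 <-> exists q, x = mi_aug q;
  mi_exS : forall i x, mi_d i.+1 x = 0 <-> exists y, x = mi_d i y;
  mi_ess : forall i x, x <> 0 -> exists a, a *: x <> 0 /\ mi_d i (a *: x) = 0;
  mi_bd : forall i, (n <= i)%N -> forall x : mi_J i, x = 0 }.

Lemma injective_zero (Q : lmodType A) : (forall x : Q, x = 0) -> injective_module Q.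
Proof.
move=> Q0 U V g f gi; have zL : linear (fun _ : V => 0 : Q) by move=> a x y; rewrite scaler0 addr0.
by exists (mkL zL) => x; rewrite [RHS]Q0.
Qed.

Lemma minres_mininj n Q : minres n Q -> inhabited (mininj Q n).
Proof.
elim: n Q => [|n IH] Q /=.
  move=> Q0; have zL : linear (fun _ : Q => 0 : Q) by move=> a x y; rewrite scaler0 addr0.
  constructor; apply: (@MinInj Q 0 (fun=> Q) (fun=> mkL zL) idfun).
  - by move=> i; exact: injective_zero.
  - by [].
  - by move=> x; split=> // _; exists x.
  - by move=> i x; split=> // _; exists 0; rewrite (Q0 x).
  - by move=> i x [].
  - by [].
move=> [I [Q' [i [p [Iinj sip ess /IH[[J d aug Jinj augI ex0 exS Jess bd]]]]]]].
have [iinj ps ip] := sip.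
pose J' k := match k with 0 => I | k'.+1 => J k' end.
pose d' k : {linear J' k -> J' k.+1} :=
  match k return {linear J' k -> J' k.+1} with 0 => (aug \o p : {linear I -> J 0%N}) | k'.+1 => d k' end.
have p0 x : (aug \o p) x = 0 <-> exists q, x = i q.
  by rewrite -ip; split=> [/= /(inj_lin0 augI)//|/= ->]; rewrite linear0.
constructor; apply: (@MinInj Q n.+1 J' d' i) => //.
- by case.
- case=> [|k] x; last exact: exS.
  rewrite [d' 1%N _]/(d 0%N x) ex0; split=> [[q ->]|[y ->]]; last by exists (p y).
  by have [y <-] := ps q; exists y.
- case=> [|k] x x0; last exact: Jess.
  have [//|a [ax [q aq]]] := ess x _ x0; exists a; split=> //; apply/p0; by exists q.
- by case=> // k; exact: bd.
Qed.

Lemma findim_injdim (Q : lmodType A) : finite_injective_dim Q -> exists n, injdim_le n Q.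
Proof.
move=> [[J d aug Jinj augI ex0 exS] [n /= bd]]; exists n.+1.
have sK k : smod (fun x : J k => d k x = 0) by exact: (smod_preim (d k) smod1).
have dd k x : d k.+1 (d k x) = 0 by apply/exS; exists x.
pose S k := Submod (sK k).
have hex k : exists p : {linear J k -> subm (S k.+1)}, ses (sinc (S k)) p.
  have [p pE] : exists p : {linear J k -> subm (S k.+1)}, forall x, sinc (S k.+1) (p x) = d k x.
    apply: lin_lift; first exact: sinc_inj.
    by move=> u; apply: (@sinc_surj _ _ (S k.+1)); exact: dd.
  exists p; split; first exact: sinc_inj.
    move=> z; have /exS[y yE] := sincP z; exists y; apply: sinc_inj; by rewrite pE.
  move=> y; split=> [py|[x ->]].
    have /(@sinc_surj _ _ (S k))[x <-] : d k y = 0 by rewrite -pE py linear0.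
    by exists x.
  by apply: sinc_inj; rewrite pE linear0; exact: (sincP x).
have main l k : (k + l = n.+1)%N -> injdim_le l (subm (S k)).
  elim: l k => [|l IH] k kl /=.
    apply: injective_zero => x; apply: sinc_inj; rewrite linear0.
    by apply: bd; rewrite -kl addn0.
  have [p sp] := hex k; exists (J k), (subm (S k.+1)), (sinc (S k)), p; split=> //.
  by apply: IH; rewrite addSnnS.
have [p sp] := hex 0%N; exists (J 0%N), (subm (S 1%N)), aug, p; split=> //; last exact: main.
have [_ ps ip] := sp; split=> // y; rewrite ip; split=> [[x ->]|[x ->]].
  by apply/ex0; exact: (sincP x).
have /(@sinc_surj _ _ (S 0%N))[u <-] : d 0%N (aug x) = 0 by apply/ex0; exists x.
by exists u.
Qed.

Section Free.
Definition free b : lmodType A := ('I_b -> A^o : lmodType A).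

Lemma sumfE b (V : lmodType A) (I : Type) (r : seq I) (P : pred I) (F : I -> 'I_b -> V) j :
  (\sum_(i <- r | P i) F i) j = \sum_(i <- r | P i) F i j.
Proof. by elim/big_rec2: _ => // i x y _ <-. Qed.

Lemma free_map b (N : lmodType A) (e : 'I_b -> N) :
  exists f : {linear free b -> N}, forall c, f c = \sum_i c i *: e i.
Proof.
suff fL : linear (fun c : free b => \sum_i c i *: e i) by exists (mkL fL).
move=> a c d; rewrite scaler_sumr -big_split; apply: eq_bigr => i _ /=.
by rewrite [X in X *: _](_ : _ = a * c i + d i) // scalerDl scalerA.
Qed.

Definition fe b (i : 'I_b) : free b := fun j => (i == j)%:R.

Lemma free_sum b (c : free b) : c = \sum_i c i *: fe i.
Proof.
apply/funext => j; rewrite sumfE (bigD1 j) //= big1 => [|i ij].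
  by rewrite addr0 [RHS](_ : _ = c j * (j == j)%:R) // eqxx mulr1.
by rewrite [LHS](_ : _ = c i * (i == j)%:R) // (negPf ij) mulr0.
Qed.

Lemma fgm_free b : fgm (free b).
Proof. by apply/fgmP; exists b, (@fe b) => c; exists c; exact: free_sum. Qed.

Lemma free_cover (N : lmodType A) : fgm N -> exists b (f : {linear free b -> N}), forall y, exists x, f x = y.
Proof.
case/fgmP=> b [e eg]; have [f fE] := free_map e; exists b, f => y.
by have [c ->] := eg y; exists c; rewrite fE.
Qed.
End Free.

(** Locality on the level of predicates: m is prime and everything outside it is invertible, so
    saturating at m changes no submodule ([mloc_qin]). *)
Definition mloc (m : A -> Prop) := prm m /\ forall s, ~ m s -> exists t, t * s = 1.

Lemma mloc_max m p : mloc m -> prm p -> forall a, p a -> m a.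
Proof.
move=> [pm mu] [sp p1 pM] a pa; apply: contrapT => /mu[t ta]; apply: p1.
by rewrite -ta; exact: idlMl.
Qed.

Lemma mloc_qin m (V : lmodType A) (S : V -> Prop) x : mloc m -> smod S -> qin m S x -> S x.
Proof.
move=> [pm mu] sS [s /mu[t ts] Sx]; rewrite -[x]scale1r -ts -scalerA; exact: smodZ.
Qed.

End MinimalResolution.
Arguments mi_J {A Q n}.
Arguments mi_d {A Q n}.
Arguments mi_aug {A Q n}.

(** * Finite generation of Ext(N, A) *)

Section GorensteinRing.
Variables (A : comNzRingType) (n : nat) (E : mininj (A : comNzRingType)^o n).
Hypothesis nA : noeth A.
Variable m : A -> Prop.
Hypothesis lm : mloc m.
Implicit Types (p q : A -> Prop) (N V : lmodType A).
Local Notation J := (mi_J E).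
Local Notation dl := (mi_d E).

Lemma mi_dd i x : dl i.+1 (dl i x) = 0.
Proof. by apply/mi_exS; exists x. Qed.

Lemma D_free b k (z : free A b -> J k.+1) : Zc dl z -> Bc dl z.
Proof.
move=> [zL z0]; have /choice[y yE] : forall i, exists y, z (fe A i) = dl k y.
  by move=> i; apply/mi_exS; exact: z0.
have [f fE] := free_map y; exists f => c; rewrite fE linear_sum [in LHS](free_sum c).
rewrite -[z _]/(mkL zL (\sum_i c i *: fe A i)) linear_sum; apply: eq_bigr => i _.
by rewrite linearZZ -[mkL zL _]/(z (fe A i)) yE linearZZ.
Qed.

(** Dimension shift: D^k of a free module vanishes for k > 0, so the connecting map of a free cover
    carries generators of D^k of the kernel to generators of D^(k+1)(N). In degree 0 the cohomology
    is Hom(N, A). *)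
Lemma gor_fg k N : fgm N -> Dfg dl k N.
Proof.
elim: k N => [|k IH] N fN.
  have [s sN] := fN; have sZ := sZc dl N 0; pose S := Submod sZ.
  (* evaluation on generators embeds the cocycles into a power of A *)
  have /choice[f fP] : forall z : N -> J 0%N, exists c : free A (size s),
      Zc dl z -> forall i : 'I_(size s), z s`_i = mi_aug E (c i).
    move=> z; have [Zz|nZ] := pselect (Zc dl z); last by exists (fun=> 0).
    have /choice[c cE] : forall i : 'I_(size s), exists c, z s`_i = mi_aug E c.
      by move=> i; apply/mi_ex0; exact: Zz.2.
    by exists c.
  have fP' (x : subm S) (i : 'I_(size s)) : sinc S x s`_i = mi_aug E (f (sinc S x) i).
    exact: fP (sincP x) i.
  have fL : linear (fun z : subm S => f (sinc S z)).
    move=> a x y; apply/funext => i; apply: mi_augI.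
    rewrite -[LHS]/(mi_aug E (f (sinc S (a *: x + y)) i)) -fP' [RHS](_ : _ = mi_aug E (a *: f (sinc S x) i + f (sinc S y) i)) //.
    by rewrite (linearP (mi_aug E)) -!fP'.
  pose F := mkL fL; have Finj : injective F.
    move=> u w fuw; apply: sinc_inj; apply/funext => x.
    have [uL _] := sincP u; have [wL _] := sincP w.
    have uw v : v \in s -> sinc S u v = sinc S w v.
      move=> vs; have ilt : (index v s < size s)%N by rewrite index_mem.
      have := congr1 (fun c => mi_aug E (c (Ordinal ilt))) fuw.
      by rewrite !mkLE -!fP' /= nth_index.
    have sE : smod (fun x => sinc S u x = sinc S w x).
      split; first by rewrite -[LHS]/(mkL uL 0) -[RHS]/(mkL wL 0) (linear0 (mkL uL)) (linear0 (mkL wL)).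
      by move=> a y z yE zE; rewrite uL wL yE zE.
    by apply: (spn_min sE) ((sN x).1 I) => v; exact: uw.
  have [g gF] : exists g : {linear subm (Submod (smod_img F smodT)) -> subm S}, forall c, F (g c) = sinc _ c.
    apply: (lin_lift (i := F)) => // c; have [x _ xE] := sincP c; by exists x.
  have fS : fgm (subm S).
    apply: (fgm_img (f := g)); first by apply: fgs_subm; exact: (fgs_sub nA (fgm_free A (size s)) (smod_img F smodT)).
    move=> u; have [c cE] := @sinc_surj _ _ (Submod (smod_img F smodT)) (F u) (ex_intro2 _ _ u I erefl).
    by exists c; apply: Finj; rewrite gF cE.
  have [t tS] := fS; exists [seq sinc S c | c <- t]; split=> [_ /mapP[c ct ->]|z Zz]; first exact: (sincP c).
  have [u <-] := @sinc_surj _ _ S z Zz; exists (sinc S u); last by move=> x; rewrite subrr.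
  exact/spn_map/tS.
have [b [f fs]] := free_cover fN.
have sK := smod_preim f smod1; pose K := Submod sK.
have sf : ses (sinc K) f.
  split; [exact: sinc_inj | exact: fs |].
  move=> y; split=> [fy|[x ->]]; last exact: (sincP x).
  by have [x <-] := @sinc_surj _ _ K y fy; exists x.
have [s [Zs sZ]] := IH (subm K) (fgs_subm (S := K) (fgs_sub nA (fgm_free A b) sK)).
have /choice[g gP] : forall v, exists z, v \in s -> Zc dl z /\ conn dl (sinc K) f v z.
  move=> v; have [vs|] := boolP (v \in s); last by exists 0.
  have [z Zz cz] := conn_ex (@mi_inj _ _ _ E) mi_dd sf (Zs v vs); by exists z.
exists [seq g v | v <- s]; split=> [_ /mapP[v vs ->]|z Zz]; first exact: (gP v vs).1.
have [u Zu cuz] := conn_ex' sf Zz (D_free (Zc_comp f Zz)).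
have [u' su' Bu'] := sZ u Zu.
have [z' sz' cz'] : exists2 z', spn [seq g v | v <- s] z' & conn dl (sinc K) f u' z'.
  apply: (@spn_min _ _ s (fun u' => exists2 z', spn [seq g v | v <- s] z' & conn dl (sinc K) f u' z')) su'.
    split; first by exists 0; [exact: smod0 (smod_spn _) | exact: conn0].
    move=> a x y [zx szx cx] [zy szy cy]; exists (a *: zx + zy); first exact: (smod_spn _).2.
    exact: conn_lin.
  by move=> v vs; exists (g v); [exact/spn_mem/map_f | exact: (gP v vs).2].
exists z' => //; apply: (conn_Bc (@mi_inj _ _ _ E) mi_dd sf) Bu'.
have := conn_lin (-1) cz' cuz; by rewrite !scaleN1r ![- _ + _]addrC.
Qed.

Lemma mi_gor q : prm q -> exists h, [/\ NZ dl q h q, forall k, NZ dl q k q -> k = h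
  & forall V (x : V), cyc x -> ann x = q -> ~ Dlen_ge dl q h V 2].
Proof.
apply: (@gorenstein_prime _ _ dl (@mi_inj _ _ _ E) mi_dd nA (mi_aug E) (@mi_augI _ _ _ E) _ _ _ n).
- by move=> x /mi_ex0.
- by move=> a; apply/mi_ex0; exists a.
- by move=> k x /mi_exS.
- by move=> k kn; apply: mi_bd; exact: ltnW.
- exact: gor_fg.
Qed.

End GorensteinRing.

(** * Socles in a minimal complex of injectives *)

Section Socle.
Variable A : comNzRingType.
Variables (J : nat -> lmodType A) (dl : forall i, {linear J i -> J i.+1}).
Hypotheses (Jinj : forall i, injective_module (J i)) (Jdd : forall i x, dl i.+1 (dl i x) = 0).
Hypothesis Jess : forall i (x : J i), x <> 0 -> exists a, a *: x <> 0 /\ dl i (a *: x) = 0.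
Variable m : A -> Prop.
Hypothesis lm : mloc m.

Definition soc (V : lmodType A) (y : V) := forall a, m a -> a *: y = 0.

Lemma soc_smod (V : lmodType A) : smod (@soc V).
Proof.
split=> [a _|b x y sx sy a ma]; first by rewrite scaler0.
by rewrite scalerDr scaleC sx // sy // scaler0 addr0.
Qed.

(** Essentiality gives a nonzero multiple a y killed by the differential; a is outside m because m
    kills y, so a is a unit. *)
Lemma soc_dl i (y : J i) : soc y -> dl i y = 0.
Proof.
move=> sy; apply: contrapT => dy; have y0 : y <> 0 by move=> y0; apply: dy; rewrite y0 linear0.
have [a [ay day]] := Jess y0; have [_ mu] := lm.
have [t ta] : exists t, t * a = 1 by apply: mu => ma; apply: ay; exact: sy.
by apply: dy; rewrite -[y]scale1r -ta -scalerA linearZZ day scaler0.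
Qed.

Let k := mkAq (let: And3 s _ _ := lm.1 in s).
Let k1 : k := aq1 _.

Lemma soc_map (V : lmodType A) (y : V) : soc y -> exists f : {linear k -> V}, f k1 = y.
Proof. move=> sy; apply: cyc_map; [exact: aq_gen | by move=> a /aq_ann/sy]. Qed.

Lemma kmap_soc (V : lmodType A) (f : k -> V) : linear f -> soc (f k1).
Proof.
move=> fL a ma; rewrite -[f k1]/(mkL fL k1) -linearZZ.
by rewrite (_ : a *: k1 = 0) ?linear0 //; apply/aq_ann.
Qed.

Lemma kmap_eq (V : lmodType A) (f g : k -> V) : linear f -> linear g -> f k1 = g k1 -> f = g.
Proof.
move=> fL gL fg; apply/funext => x; have [a ->] := aq_gen x.
rewrite -[LHS]/(mkL fL (a *: k1)) -[RHS]/(mkL gL (a *: k1)).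
by rewrite (linearZZ (mkL fL)) (linearZZ (mkL gL)) !mkLE fg.
Qed.

(** By [soc_dl] the complex Hom(A/m, J) has zero differential, so the classes of D^i(A/m) are the
    socle elements of J^i. *)
Lemma Bc_k i (z : k -> J i) : Bc dl z -> z = 0.
Proof.
case: i z => [|i] z /= => [z0|[w zw]]; first exact/funext.
by apply/funext => x; rewrite zw; have [a ->] := aq_gen x; rewrite !linearZZ soc_dl ?scaler0 //;
   exact: kmap_soc (linP w).
Qed.

Lemma soc_null i : ~ NZ dl m i m -> forall y : J i, soc y -> y = 0.
Proof.
move=> nz y sy; have [f fy] := soc_map sy.
have Zf : Zc dl (f : k -> J i).
  split; first exact: linP.
  by move=> x; have [a ->] := aq_gen x; rewrite !linearZZ fy soc_dl ?scaler0.
rewrite -fy.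
suff f0 : (f : k -> J i) = 0 by rewrite f0.
apply: Bc_k; apply: (mloc_qin lm (smod_Bc dl _ _)).
apply: contrapT => nf; apply: nz; exists k, k1; split.
- exact: aq_gen.
- by apply/funext => a; apply/propext/aq_ann.
- by move=> H; apply: nf; exact: H.
Qed.

(** A socle element outside A y0 would give a second strict step in D^i(A/m). *)
Lemma soc_one i : NZ dl m i m -> (forall (V : lmodType A) (x : V), cyc x -> ann x = m -> ~ Dlen_ge dl m i V 2) ->
  exists y0 : J i, [/\ soc y0, y0 <> 0 & forall y, soc y -> exists a, y = a *: y0].
Proof.
move=> [V [x [xg xm nV]]] l2.
have mq := prm_mulc lm.1.
have kg : cyc k1 by exact: aq_gen.
have km : ann k1 = m by apply/funext => a; apply/propext/aq_ann.
have nk : ~ Dnull dl m i k.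
  by move=> H; apply: nV; exact: (Dnull_cyc Jdd mq kg xg (etrans km (esym xm)) H).
have [z0 [Zz0 nz0]] : exists z0 : k -> J i, Zc dl z0 /\ ~ qin m (@Bc _ _ dl k i) z0.
  by apply: contrapT => H; apply: nk => z Zz; apply: contrapT => nz; apply: H; exists z.
have sy0 := kmap_soc Zz0.1.
exists (z0 k1); split=> //.
  move=> zk; apply: nz0; apply: sub_qin => //.
  rewrite (_ : z0 = 0); first exact: smod0 (smod_Bc dl _ _).
  by apply: kmap_eq => //; [exact: Zz0.1 | exact: (smod_lin k (J i)).1].
move=> y sy; apply: contrapT => ny.
have [f fy] := soc_map sy.
have Zf : Zc dl (f : k -> J i).
  split; first exact: linP.
  by move=> u; have [a ->] := aq_gen u; rewrite !linearZZ fy soc_dl ?scaler0.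
apply: (l2 k k1 kg km).
have sS := smod_add (smod_Bc dl k i) (smod_spn [:: z0]).
exists (addS (@Bc _ _ dl k i) (spn [:: z0])); split=> //.
- by move=> z Bz; exists z => //; rewrite subrr; exact: smod0 (smod_spn _).
- move=> z [b Bb [a]] /= /eqP; rewrite subr_eq0 => /eqP zE.
  apply: (smodBr (smod_Zc dl k i) (y := b)); last exact: Bc_Zc.
  by rewrite zE; apply: smodZ => //; exact: smod_Zc.
- exists z0 => //; exists 0; first exact: smod0 (smod_Bc dl k i).
  by rewrite subr0; apply/spn_mem/mem_head.
exists (@Zc _ _ dl k i); split=> //.
- exact: smod_Zc.
- move=> z [b Bb [a]] /= /eqP; rewrite subr_eq0 => /eqP zE.
  apply: (smodBr (smod_Zc dl k i) (y := b)); last exact: Bc_Zc.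
  by rewrite zE; apply: smodZ => //; exact: smod_Zc.
exists (f : k -> J i) => // /(mloc_qin lm sS)[b /Bc_k -> [a]] /= /eqP.
rewrite subr0 subr_eq0 => /eqP fE; apply: ny; exists a.
by rewrite -fy fE.
Qed.

End Socle.

Lemma above_null (A : comNzRingType) (J : nat -> lmodType A) (dl : forall i, {linear J i -> J i.+1})
    (m : A -> Prop) D n (N : lmodType A) :
  (forall i, injective_module (J i)) -> (forall i x, dl i.+1 (dl i x) = 0) -> noeth A ->
  (forall n N, fgm N -> Dfg dl n N) -> prm m -> (forall p, prm p -> forall a, p a -> m a) ->
  (forall k, NZ dl m k m -> k = D) -> (D < n)%N -> fgm N -> Dnull dl m n N.
Proof.
move=> Jinj Jdd nA fgD pm mmax mD Dn fN; apply: contrapT => nN; have mq := prm_mulc pm.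
have [||p [pp _ pm' nz]] := @devissage_D _ _ _ Jinj Jdd m n (fun=> False) N nA mq fN => //.
have [n' [nn' /mD nE _]] := NZ_climb Jinj Jdd nA fgD pm pp pm' nz.
by move: nn'; rewrite nE leqNgt Dn.
Qed.

(** From degree D on the differential is zero: the inclusion of the submodule generated by a nonzero
    value d y is a cocycle of degree above D, hence a boundary, and a nonzero multiple of its
    primitive inside ker d would give a contradiction. Exactness and essentiality then kill the
    terms above D. *)
Lemma mi_zero (A : comNzRingType) (n : nat) (E : mininj (A : comNzRingType)^o n) (m : A -> Prop) D k :
  noeth A -> mloc m -> (forall k, NZ (mi_d E) m k m -> k = D) -> (D < k)%N ->
  forall x : mi_J E k, x = 0.
Proof.
move=> nA lm mD; case: k => // k; rewrite ltnS => Dk x; have [pm _] := lm.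
have dl0 y : mi_d E k y = 0.
  apply: contrapT => dy; pose y1 := mi_d E k y; pose S := Submod (smod_spn [:: y1]).
  have [y0 y0E] : exists y0, sinc S y0 = y1 by apply/sinc_surj/spn_mem/mem_head.
  have y0g : cyc y0.
    move=> z; have [a za] := sincP z; exists a; apply: sinc_inj; rewrite linearZZ y0E.
    by apply/eqP; rewrite -subr_eq0 za.
  have Zi : Zc (mi_d E) (sinc S : _ -> mi_J E k.+1).
    split; first exact: linP.
    by move=> z; have [a ->] := y0g z; rewrite !linearZZ y0E mi_dd scaler0.
  have := above_null (@mi_inj _ _ _ E) (@mi_dd _ _ E) nA (@gor_fg _ _ E nA) pm
    (fun p pp => mloc_max lm pp) mD (Dk : (D < k.+1)%N) (fgm_cyc y0g) Zi.
  move=> /(mloc_qin lm (smod_Bc _ _ _))[w wE].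
  have dw : mi_d E k (w y0) = y1 by rewrite -wE.
  have [|a [au dau]] := @mi_ess _ _ _ E k (w y0).
    by move=> w0; apply: dy; rewrite -/y1 -dw w0 linear0.
  apply: au; rewrite -linearZZ (_ : a *: y0 = 0) ?linear0 //.
  by apply: sinc_inj; rewrite linearZZ y0E -dw -linearZZ dau linear0.
apply: contrapT => x0; have [a [ax /mi_exS[y yE]]] := mi_ess x0.
by apply: ax; rewrite yE dl0.
Qed.

Lemma Bc_linear (A : comNzRingType) (J : nat -> lmodType A) (dl : forall i, {linear J i -> J i.+1}) (N : lmodType A) n
  (z : N -> J n) : Bc dl z -> linear z.
Proof.
case: n z => [|n] z /= => [z0|[w zw]] a x y; first by rewrite !z0 scaler0 addr0.
by rewrite !zw !linearP.
Qed.

(** * Descent of injectives along a surjection R -> A *)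

Section Descent.
Variables (R A : comNzRingType) (phi : {rmorphism R -> A}).
Hypothesis phi_surj : forall a, exists x, phi x = a.

(** Mentioning [phi] in the body makes it a parameter of the type, so that the R-module structure
    through [phi] is the one that gets inferred. *)
Definition restr (N : lmodType A) : Type := let _ := phi in N.
HB.instance Definition _ (N : lmodType A) := GRing.Zmodule.on (restr N).

Section Restr.
Variable N : lmodType A.
Definition restr_scale (r : R) (x : restr N) : restr N := phi r *: (x : N).
Let scA a b x : restr_scale a (restr_scale b x) = restr_scale (a * b) x.
Proof. by rewrite /restr_scale scalerA rmorphM. Qed.
Let sc1 : left_id 1 restr_scale.
Proof. by move=> x; rewrite /restr_scale rmorph1 scale1r. Qed.
Let scDr : right_distributive restr_scale +%R.
Proof. by move=> a x y; exact: scalerDr. Qed.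
Let scDl x : {morph restr_scale^~ x : a b / a + b}.
Proof. by move=> a b; rewrite /restr_scale rmorphD scalerDl. Qed.
HB.instance Definition _ := GRing.Zmodule_isLmodule.Build R (restr N) scA sc1 scDr scDl.
End Restr.

Lemma restrE (N : lmodType A) r (x : N) : r *: (x : restr N) = phi r *: x.
Proof. by []. Qed.

Section Tor.
Variable E : lmodType R.
Lemma torS_smod : smod (fun y : E => forall r, phi r = 0 -> r *: y = 0).
Proof.
split=> [r _|a x y Sx Sy r r0]; first by rewrite scaler0.
by rewrite scalerDr scaleC Sx // Sy // scaler0 addr0.
Qed.
Definition torS := Submod torS_smod.
(** This is Hom_R(A, E), realized through values at 1 as the elements of E killed by the kernel of
    [phi]. *)
Definition tor : Type := let _ := phi_surj in subm torS.
HB.instance Definition _ := GRing.Zmodule.on tor.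
Definition sig (a : A) : R := projT1 (cid (phi_surj a)).
Lemma sigK a : phi (sig a) = a.
Proof. exact: projT2 (cid (phi_surj a)). Qed.
Definition tor_scale (a : A) (x : tor) : tor := sig a *: (x : subm torS).
Lemma tor_scaleE r x : tor_scale (phi r) x = r *: (x : subm torS).
Proof.
apply: sinc_inj; rewrite !linearZZ; apply/eqP; rewrite -subr_eq0 -scalerBl; apply/eqP.
by apply: (sincP (x : subm torS)); rewrite rmorphB sigK subrr.
Qed.
Let scA a b x : tor_scale a (tor_scale b x) = tor_scale (a * b) x.
Proof.
by rewrite -(sigK a) -(sigK b) -rmorphM !tor_scaleE scalerA.
Qed.
Let sc1 : left_id 1 tor_scale.
Proof. by move=> x; rewrite -(rmorph1 phi) tor_scaleE scale1r. Qed.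
Let scDr : right_distributive tor_scale +%R.
Proof. by move=> a x y; exact: scalerDr. Qed.
Let scDl x : {morph tor_scale^~ x : a b / a + b}.
Proof. by move=> a b; rewrite -(sigK a) -(sigK b) -rmorphD !tor_scaleE scalerDl. Qed.
HB.instance Definition _ := GRing.Zmodule_isLmodule.Build A tor scA sc1 scDr scDl.

Definition tval (x : tor) : E := sinc torS x.
Lemma tvalZ r (x : tor) : tval (phi r *: x) = r *: tval x.
Proof. by rewrite -[phi r *: x]/(tor_scale (phi r) x) tor_scaleE /tval linearZZ. Qed.
Lemma tvalD (x y : tor) : tval (x + y) = tval x + tval y.
Proof. exact: linearD. Qed.
Lemma tval0 : tval 0 = 0. Proof. exact: linear0. Qed.
Lemma tval_inj : injective tval. Proof. exact: sinc_inj. Qed.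
Lemma tval_surj y : (forall r, phi r = 0 -> r *: y = 0) -> exists x, tval x = y.
Proof. exact: (@sinc_surj _ _ torS). Qed.
Lemma tvalP x r : phi r = 0 -> r *: tval x = 0.
Proof. exact: (sincP (S := torS) x). Qed.
End Tor.

(* R-linear maps N -> E and A-linear maps N -> tor E are the same *)
Section Up.
Variables (N : lmodType A) (E : lmodType R).
Definition up (z : N -> tor E) : restr N -> E := fun x => tval (z x).

Lemma up_lin z : linear z <-> linear (up z).
Proof.
split=> zL; [move=> r x y | move=> a x y].
  by rewrite /up -tvalZ -tvalD; congr (tval _); rewrite -zL.
have [r <-] := phi_surj a; apply: tval_inj; rewrite tvalD tvalZ; exact: (zL r x y).
Qed.

Lemma up_ex (w : restr N -> E) : linear w -> exists z, up z = w.
Proof.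
move=> wL; have /choice[z zE] : forall x, exists y, tval y = w x.
  move=> x; apply: tval_surj => r r0.
  rewrite -[w x]/(mkL wL x) -linearZZ (_ : r *: x = 0) ?linear0 //.
  by rewrite restrE r0 scale0r.
by exists z; apply/funext.
Qed.

Lemma up_inj : injective up.
Proof. by move=> z w /(congr1 (fun f => f _)) E1; apply/funext => x; apply: tval_inj; exact: E1. Qed.

Lemma up_comb r (z w : N -> tor E) : up (phi r *: z + w) = r *: up z + up w.
Proof. by apply/funext => x; rewrite /up tvalD tvalZ. Qed.
Lemma up_Z r (z : N -> tor E) : up (phi r *: z) = r *: up z.
Proof. by apply/funext => x; rewrite /up tvalZ. Qed.
Lemma up0 : up 0 = 0.
Proof. by apply/funext => x; rewrite /up tval0. Qed.
End Up.

Lemma tor_inj (E : lmodType R) : injective_module E -> injective_module (tor E : lmodType A).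
Proof.
move=> Einj U V g f gi.
have gL : linear (g : restr U -> restr V) by move=> r x y; exact: (linP g).
have fL : linear (up f) by apply/up_lin; exact: linP.
have [h hE] := Einj _ _ (mkL gL) (mkL fL) gi.
have [h' h'E] := up_ex (linP h).
have h'L : linear h' by apply/up_lin; rewrite h'E; exact: linP.
by exists (mkL h'L) => x; apply: tval_inj; rewrite mkLE -[LHS]/(up h' (g x)) h'E; exact: hE.
Qed.

Section TorMap.
Variables (E E' : lmodType R) (f : {linear E -> E'}).
Lemma tor_map_ex : exists g : {linear tor E -> tor E'}, forall x, tval (g x) = f (tval x).
Proof.
have /choice[g gE] : forall x : tor E, exists y : tor E', tval y = f (tval x).
  by move=> x; apply: tval_surj => r r0; rewrite -linearZZ tvalP ?linear0.
suff gL : linear g by exists (mkL gL).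
move=> a x y; have [r <-] := phi_surj a; apply: tval_inj.
by rewrite gE !tvalD !tvalZ linearP !gE.
Qed.
Definition tor_map := projT1 (cid tor_map_ex).
Lemma tor_mapE x : tval (tor_map x) = f (tval x).
Proof. exact: (projT2 (cid tor_map_ex) x). Qed.
End TorMap.

Section Transfer.
Variables (J : nat -> lmodType R) (dl : forall i, {linear J i -> J i.+1}).
Definition JA i : lmodType A := tor (J i).
Definition dA i : {linear JA i -> JA i.+1} := tor_map (dl i).
Implicit Types (N : lmodType A) (q : A -> Prop).

Lemma up_Zc N n (z : N -> JA n) : Zc dA z <-> Zc dl (up z).
Proof.
split=> -[zL z0]; split; try exact/up_lin.
  by move=> x; rewrite -tor_mapE -[tor_map _ _]/(dA n (z x)) z0 tval0.
by move=> x; apply: tval_inj; rewrite tor_mapE tval0; exact: z0.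
Qed.

Lemma up_Bc N n (z : N -> JA n) : Bc dA z <-> Bc dl (up z).
Proof.
case: n z => [|n] z /=.
  by split=> z0 x; [rewrite /up z0 tval0 | apply: tval_inj; rewrite tval0; exact: z0].
split=> [[w wE]|[w wE]].
  exists (mkL ((up_lin w).1 (linP w))) => x; by rewrite /up wE tor_mapE.
have [w' w'E] := up_ex (linP w).
have w'L : linear w' by apply/up_lin; rewrite w'E; exact: linP.
exists (mkL w'L) => x; apply: tval_inj; rewrite -[LHS]/(up z x) wE tor_mapE mkLE.
by rewrite -[tval (w' x)]/(up w' x) w'E.
Qed.

Lemma fgm_restr N : fgm N -> fgm (restr N).
Proof.
case=> s sN; exists (s : seq (restr N)) => x; split=> // _.
have := (sN x).1 I; elim: s x {sN} => //= v s IH x [a xs]; have [r ra] := phi_surj a; exists r.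
by apply: IH; rewrite restrE ra.
Qed.

Lemma Dnull_restr q n N : Dnull dA q n N <-> Dnull dl (q \o phi) n (restr N).
Proof.
split=> H.
  move=> w Zw; have [z zw] := up_ex Zw.1; rewrite -zw in Zw *.
  have [a] := H z ((up_Zc z).2 Zw); have [r <-] := phi_surj a => qr /up_Bc Bz.
  by exists r => //; rewrite -up_Z.
move=> z /up_Zc/H[r qr Bz]; exists (phi r) => //; apply/up_Bc; by rewrite up_Z.
Qed.

Lemma cyc_restr N (x : N) : cyc x -> cyc (x : restr N).
Proof. by move=> xg y; have [a ->] := xg y; have [r <-] := phi_surj a; exists r. Qed.

Lemma ann_restr N (x : N) : ann (x : restr N) = ann x \o phi.
Proof. by []. Qed.

Lemma idl_phi q : idl q -> idl (q \o phi).
Proof.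
move=> sq; split; first by rewrite /= rmorph0; exact: idl0.
by move=> r x y qx qy; rewrite /= rmorphD (rmorphM phi r x); apply: sq.2.
Qed.

Lemma prm_phi q : prm q -> prm (q \o phi).
Proof.
move=> [sq q1 qM]; split; first exact: idl_phi.
  by rewrite /= rmorph1.
by move=> x y /=; rewrite rmorphM => /qM.
Qed.

Lemma Dfg_restr n N : Dfg dl n (restr N) -> Dfg dA n N.
Proof.
move=> [s [Zs sZ]].
have /choice[g gP] : forall w, exists z : N -> JA n, linear w -> up z = w.
  move=> w; have [wL|nw] := pselect (linear w); last by exists 0.
  by have [z zw] := up_ex wL; exists z.
exists [seq g w | w <- s]; split=> [_ /mapP[w ws ->]|z /up_Zc/sZ[u su Bu]].
  by apply/up_Zc; rewrite gP; [exact: Zs | exact: (Zs w ws).1].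
have [z' sz' uz'] : exists2 z', spn [seq g w | w <- s] z' & up z' = u.
  elim: s u Zs su {sZ Bu} => [|w s IH] u Zs /=.
    by move=> ->; exists 0 => //; exact: up0.
  case=> r /IH[v vs|z' sz' uz']; first by apply: Zs; rewrite inE vs orbT.
  exists (phi r *: g w + z'); first by exists (phi r); rewrite addrC addKr.
  by rewrite up_comb uz' (gP w (Zs w (mem_head _ _)).1) addrC subrK.
exists z' => //; apply/up_Bc.
by rewrite (_ : up (z - z') = up z - u) // -uz'; have := up_comb (-1) z' z;
  rewrite rmorphN rmorph1 !scaleN1r ![- _ + _]addrC.
Qed.

Lemma Dlen2_restr q n N : Dlen_ge dA q n N 2 -> Dlen_ge dl (q \o phi) n (restr N) 2.
Proof.
pose im (S : (N -> JA n) -> Prop) (w : restr N -> J n) := exists2 z, S z & w = up z.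
have im_smod S : smod S -> smod (im S).
  move=> sS; split; first by exists 0; [exact: smod0 | rewrite up0].
  move=> r _ _ [z Sz ->] [w Sw ->]; exists (phi r *: z + w); first exact: sS.2.
  by rewrite up_comb.
have im_strict S z : ~ qin q S z -> ~ qin (q \o phi) (im S) (up z).
  move=> nz [r qr [w Sw]]; rewrite -up_Z => /up_inj zw; apply: nz; exists (phi r) => //.
  by rewrite zw.
have BcE w : Bc dl w -> im (@Bc _ _ dA N n) w.
  move=> Bw; have [z zw] := up_ex (Bc_linear Bw); exists z => //.
  by apply/up_Bc; rewrite zw.
have ZcE w : im (@Zc _ _ dA N n) w -> Zc dl w by case=> z Zz ->; apply/up_Zc.
case=> S1 [sS1 BS1 S1Z [z1 Sz1 nz1] [S2 [sS2 S12 S2Z [z2 Sz2 nz2] _]]].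
exists (im S1); split.
- exact: im_smod.
- by move=> w /BcE[z /BS1 Sz ->]; exists z.
- by move=> w [z /S1Z Zz ->]; apply: ZcE; exists z.
- exists (up z1); first by exists z1.
  by move=> H; apply: (im_strict _ _ nz1); exact: qin_mono BcE H.
exists (im S2); split=> //.
- exact: im_smod.
- by move=> w [z /S12 Sz ->]; exists z.
- by move=> w [z /S2Z Zz ->]; apply: ZcE; exists z.
- exists (up z2); first by exists z2.
  exact: im_strict.
Qed.

End Transfer.
End Descent.

(** * Dualizing complexes of a quotient of a Gorenstein ring *)

Record dualizing (A : comNzRingType) (m : A -> Prop) (D : nat) (J : nat -> lmodType A)
    (dl : forall i, {linear J i -> J i.+1}) : Prop := Dualizing {
  du_inj : forall i, injective_module (J i);
  du_dd : forall i x, dl i.+1 (dl i x) = 0;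
  du_ess : forall i (x : J i), x <> 0 -> exists a, a *: x <> 0 /\ dl i (a *: x) = 0;
  du_bd : forall k, (D < k)%N -> forall x : J k, x = 0;
  du_fg : forall n (N : lmodType A), fgm N -> Dfg dl n N;
  du_soc0 : forall k, k <> D -> forall y : J k, soc m y -> y = 0;
  du_soc1 : exists y0 : J D, [/\ soc m y0, y0 <> 0 & forall y, soc m y -> exists a, y = a *: y0];
  du_m : forall k, NZ dl m k m <-> k = D;
  du_prime : forall p, prm p -> exists h, [/\ NZ dl p h p, forall k, NZ dl p k p -> k = h
    & forall (V : lmodType A) (x : V), cyc x -> ann x = p -> ~ Dlen_ge dl p h V 2] }.

(** The ideal generated by a non-unit is proper, and a maximal proper ideal above it is m by
    locality. *)
Lemma local_mloc (A : comNzRingType) (m : idealr A) : noeth A -> local_ring m -> mloc (fun a => a \in m).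
Proof.
move=> nA lm.
have sm : idl (fun a => a \in m).
  by split=> [|a x y mx my]; [exact: idealr0 | apply: rpredD => //; exact: idealMr].
have m1 : ~ (1 \in m) by rewrite idealr1.
have mu s : ~ (s \in m) -> exists t, t * s = 1.
  move=> ms; apply: contrapT => nu.
  have [|||M [sM Ms M1] Mmax] := @acc A A^o (fun I => [/\ idl I, I s & ~ I 1]).
  - by move=> ? [].
  - exact: nA.
  - exists (fun a => exists t, a = t * s); split.
    + split; first by exists 0; rewrite mul0r.
      by move=> a _ _ [t ->] [u ->]; exists (a * t + u); rewrite mulrDl -mulrA.
    + by exists 1; rewrite mul1r.
    + by move=> [t ts]; apply: nu; exists t.
  apply: ms; have /(_ (mk_idealr sM M1)) [H _] := lm.
  rewrite -H; first exact/(mk_idealrE sM M1).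
  move=> J MJ x Jx; apply/(mk_idealrE sM M1).
  have MJ' : forall y, M y -> y \in J by move=> y My; apply: MJ; apply/(mk_idealrE sM M1).
  have FJ : [/\ idl (fun y => y \in J), s \in J & ~ (1 \in J)].
    split; [|exact: MJ' | by rewrite idealr1].
    by split=> [|a y z Jy Jz]; [exact: idealr0 | apply: rpredD => //; exact: idealMr].
  exact: (Mmax (fun y => y \in J) FJ MJ' x Jx).
split=> //; split=> // x y mxy.
have [|mx] := pselect (x \in m); first by left.
right; have [t tx] := mu x mx; rewrite -[y]mul1r -tx -mulrA; exact: (idlMl _ sm).
Qed.

Lemma NZ_restr (R A : comNzRingType) (phi : {rmorphism R -> A}) (phi_surj : forall a, exists x, phi x = a)
    (J : nat -> lmodType R) (dl : forall i, {linear J i -> J i.+1}) (Jdd : forall i x, dl i.+1 (dl i x) = 0)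
    (q p : A -> Prop) k : prm q -> idl p ->
  NZ (dA phi_surj dl) q k p <-> NZ dl (q \o phi) k (p \o phi).
Proof.
move=> pq sp; split=> [[V [x [xg xp nV]]]|[V [x [xg xp nV]]]].
  exists (restr phi V), (x : restr phi V); split; first exact: cyc_restr.
    by rewrite ann_restr xp.
  by move=> /Dnull_restr.
exists (mkAq sp), (aq1 sp); split; first exact: aq_gen.
  by apply/funext => a; apply/propext/aq_ann.
move=> /(Dnull_restr phi_surj) H; apply: nV.
have c1 : cyc (aq1 sp : restr phi (mkAq sp)) by exact: (cyc_restr phi_surj (@aq_gen _ _ sp)).
apply: (Dnull_cyc Jdd (prm_mulc (prm_phi phi pq)) c1 xg _ H).
by rewrite xp ann_restr; apply/funext => r; apply/propext/aq_ann.
Qed.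

(** The complex is Hom_R(A, E) for a minimal injective resolution E of R. It has the socles of E,
    one-dimensional and in the single degree D; for a prime p of A, D^h(A/p) is the same cohomology
    over R at the preimage of p, so it lives in one degree and has length one. *)
Lemma dualizing_quotient (A : comNzRingType) (m : A -> Prop) : mloc m -> gorenstein_quotient A ->
  exists D J dl, @dualizing A m D J dl.
Proof.
move=> lm [R [n [phi [[/noethP nR lR finj] ps]]]].
have lR' := local_mloc nR lR; set mR := (fun a => a \in n) in lR'.
have [pm mu] := lm; have [pR muR] := lR'.
have mE : m \o phi = mR.
  apply/funext => r; apply/propext; split; first exact: (mloc_max lR' (prm_phi phi pm)).
  move=> mr; apply: contrapT => /mu[b]; have [s <-] := ps b => sr.
  have [sR R1 _] := pR; apply: R1; rewrite -(subrK (s * r) 1).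
  have h1 : mR (1 - s * r).
    apply: (mloc_max lR' (prm_phi phi pm)); rewrite /= rmorphB rmorph1 rmorphM sr subrr.
    by have [sm _ _] := pm; exact: idl0.
  exact: (idlD sR h1 (idlMl _ sR mr)).
have [k /minresP/minres_mininj[E]] := findim_injdim finj.
have [D [nzD uD lD]] := mi_gor E nR pR.
pose dlA := dA ps (mi_d E).
have dd : forall i x, dlA i.+1 (dlA i x) = 0.
  by move=> i x; apply: tval_inj; rewrite !tor_mapE mi_dd tval0.
have inj i : injective_module (JA ps (mi_J E) i) by apply: tor_inj; exact: mi_inj.
have ess i (x : JA ps (mi_J E) i) : x <> 0 -> exists a, a *: x <> 0 /\ dlA i (a *: x) = 0.
  move=> x0; have [|a [ax dax]] := @mi_ess _ _ _ E i (tval x).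
    by move=> tx; apply: x0; apply: tval_inj; rewrite tx tval0.
  exists (phi a); split; first by move=> ax0; apply: ax; rewrite -tvalZ ax0 tval0.
  by apply: tval_inj; rewrite tor_mapE tvalZ dax tval0.
have sm : idl m by case: pm.
have nzm j : NZ dlA m j m <-> j = D.
  rewrite /dlA (NZ_restr ps (@mi_dd _ _ E) j pm sm) mE; split; [exact: uD | by move=> ->].
have prime p : prm p -> exists h, [/\ NZ dlA p h p, forall k, NZ dlA p k p -> k = h
    & forall (V : lmodType A) (x : V), cyc x -> ann x = p -> ~ Dlen_ge dlA p h V 2].
  move=> pp; have [sp _ _] := pp; have [h [nzh uh lh]] := mi_gor E nR (prm_phi phi pp).
  exists h; split; first exact/(NZ_restr ps (@mi_dd _ _ E) h pp sp).
    by move=> j /(NZ_restr ps (@mi_dd _ _ E) j pp sp)/uh.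
  move=> V x xg xp /Dlen2_restr; apply: (lh (restr phi V) (x : restr phi V)).
    exact: cyc_restr.
  by rewrite ann_restr xp.
exists D, (JA ps (mi_J E)), dlA; split=> //.
- by move=> j Dj x; apply: tval_inj; rewrite tval0; exact: (mi_zero nR lR' uD Dj).
- by move=> j N fN; apply: Dfg_restr; apply: gor_fg => //; exact: fgm_restr.
- move=> j jD; apply: (@soc_null _ _ _ ess _ lm j) => /nzm; exact: jD.
apply: (@soc_one _ _ _ dd ess _ lm); first exact/nzm.
have [h [nzh _ lh]] := prime m pm; by rewrite -((nzm h).1 nzh).
Qed.

Section Shift.
Variables (A : comNzRingType) (m : A -> Prop) (D : nat) (J : nat -> lmodType A).
Variable dl : forall i, {linear J i -> J i.+1}.
Hypothesis du : dualizing m D dl.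
Hypothesis J0 : forall x : J 0%N, x = 0.

Let J' i := J i.+1.
Let dl' i : {linear J' i -> J' i.+1} := dl i.+1.

Lemma Bc_shift (N : lmodType A) n : @Bc A J' dl' N n = @Bc A J dl N n.+1.
Proof.
apply/funext => z; apply/propext; case: n z => [|n] z //=; split=> [z0|[w zw]].
  by exists \0 => x; rewrite z0 linear0.
by move=> x; rewrite zw (J0 (w x)) linear0.
Qed.

Lemma Dnull_shift q n (N : lmodType A) : Dnull dl' q n N <-> Dnull dl q n.+1 N.
Proof. by rewrite /Dnull Bc_shift. Qed.

Lemma NZ_shift q n p : NZ dl' q n p <-> NZ dl q n.+1 p.
Proof. by split=> -[V [x [xg xp nV]]]; exists V, x; split=> // /Dnull_shift. Qed.

Lemma NZ_0 q p : mulc q -> ~ NZ dl q 0 p.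
Proof.
move=> mq [V [x [_ _ nV]]]; apply: nV => z _; exists 1; first exact: mq.1.
by rewrite scale1r => y; exact: J0.
Qed.

Lemma dualizing_shift : prm m -> (0 < D)%N /\ dualizing m D.-1 dl'.
Proof.
move=> pm; have D0 : (0 < D)%N.
  rewrite lt0n; apply/eqP => D0; apply: (NZ_0 (p := m) (prm_mulc pm)).
  by apply/(du_m du); rewrite D0.
split=> //; split.
- by move=> i; exact: (du_inj du).
- by move=> i; exact: (du_dd du).
- by move=> i; exact: (du_ess du).
- by move=> k Dk; apply: (du_bd du); lia.
- move=> n N fN; have [s [Zs sZ]] := du_fg du n.+1 fN.
  by exists s; rewrite Bc_shift; split.
- by move=> k kD; apply: (du_soc0 du) => kD'; apply: kD; lia.
- suff H k : k = D -> exists y0 : J k, [/\ soc m y0, y0 <> 0 & forall y, soc m y -> exists a, y = a *: y0].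
    exact: (H D.-1.+1 (prednK D0)).
  by move=> ->; exact: (du_soc1 du).
- by move=> k; rewrite NZ_shift (du_m du); split; lia.
move=> p pp; have [h [nzh uh lh]] := du_prime du pp; have mp := prm_mulc pp.
case: h nzh uh lh => [/(NZ_0 mp)//|h] nzh uh lh; exists h; split.
- exact/NZ_shift.
- by move=> k /NZ_shift/uh[].
- by move=> V x xg xp; rewrite /Dlen_ge Bc_shift; exact: lh.
Qed.
End Shift.

(** Leading zero terms are shifted away, which lowers D; for D = 0 the socle makes J^0 nonzero. A
    nonzero J^0 is what later forces D to be the dimension. *)
Lemma dualizing_reduced (A : comNzRingType) (m : A -> Prop) : mloc m -> gorenstein_quotient A ->
  exists D J dl, @dualizing A m D J dl /\ exists x : J 0%N, x <> 0.
Proof.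
move=> lm /(dualizing_quotient lm)[D [J [dl du]]].
elim: D J dl du => [|D IH] J dl du.
  by exists 0%N, J, dl; split=> //; have [y0 [_ y00 _]] := du_soc1 du; exists y0.
have [[x x0]|J0] := pselect (exists x : J 0%N, x <> 0); first by exists D.+1, J, dl; split=> //; exists x.
have [||_ du'] := dualizing_shift du; last exact: IH du'.
  by move=> x; apply: contrapT => x0; apply: J0; exists x.
exact: lm.1.
Qed.

(** * The dualizing complex and dimension *)

Section DualDim.
Variables (A : comNzRingType) (m : A -> Prop) (D : nat) (J : nat -> lmodType A).
Variable dl : forall i, {linear J i -> J i.+1}.
Hypothesis du : dualizing m D dl.
Hypothesis nA : noeth A.
Hypothesis lm : mloc m.
Implicit Types (p : A -> Prop) (N : lmodType A).

Lemma pchainS l p p' : prm p -> (forall a, p a -> p' a) -> (exists2 x, p' x & ~ p x) ->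
  pchain l p' -> pchain l.+1 p.
Proof.
move=> pp pp' [x p'x px] [c [c0 cp cs]].
exists (fun i => if i is i'.+1 then c i' else p); split=> //.
  by case=> // i; exact: cp.
case=> [_|i]; last exact: cs.
by rewrite c0; split=> //; exists x.
Qed.

(** One application of [NZ_up] adds one prime and exactly one degree, and the ascent can only end at
    m, where the degree is D. *)
Lemma NZ_long n p : prm p -> NZ dl m n p -> exists2 l, pchain l p & (n + l)%N = D.
Proof.
move=> pp nz; apply: contrapT => H.
pose F p := prm p /\ exists n, NZ dl m n p /\ ~ exists2 l, pchain l p & (n + l)%N = D.
have [|||p1 [pp1 [n1 [nz1 H1]]] p1max] := @acc A A^o F.
- by move=> ? [[]].
- exact: nA.
- by exists p; split=> //; exists n.
have [pm _] := lm; have pm1 := mloc_max lm pp1.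
have [pE|pE] := pselect (p1 = m).
  apply: H1; exists 0%N; first by exists (fun=> p1); split.
  by rewrite addn0; apply/(du_m du); move: nz1; rewrite pE.
have [x mx p1x] : exists2 x, m x & ~ p1 x.
  apply: contrapT => nx; apply: pE; apply/funext => a; apply/propext; split; first exact: pm1.
  by move=> ma; apply: contrapT => p1a; apply: nx; exists a.
have [p2 [pp2 p12 p2x p2m nz2]] := NZ_up (du_inj du) (du_dd du) nA (du_fg du) pm pp1 mx p1x nz1.
have [/p1max/(_ p12) p21|nF] := pselect (F p2); first by apply: p1x; exact: p21.
apply: nF; split=> //; exists n1.+1; split=> // -[l cl nl]; apply: H1; exists l.+1.
  by apply: pchainS cl => //; exists x.
by rewrite addnS -addSn.
Qed.

(* for l = 0 this bounds the degrees in which the cohomology of N is supported at p *)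
Lemma NZ_dim n p l : prm p -> NZ dl p n p -> pchain l p -> (n + l <= D)%N.
Proof.
move=> pp nz cl; have [pm _] := lm.
have [n' nn' /(du_m du) <-//] := NZ_chain (du_inj du) (du_dd du) nA (du_fg du) pm
  (fun r pr => mloc_max lm pr) cl nz.
Qed.

(** The support of D^n(N) has dimension at most D - n: nonvanishing at p climbs to A/p in some
    degree n' >= n, and a chain of length l above p then needs n' + l <= D. *)
Lemma Dnull_dim n p l N : prm p -> fgm N -> ~ Dnull dl p n N -> pchain l p -> (n + l <= D)%N.
Proof.
move=> pp fN nN cl; have mp := prm_mulc pp.
have [||p1 [pp1 _ p1p nz]] := @devissage_D _ _ _ (du_inj du) (du_dd du) p n (fun=> False) N nA mp fN => //.
have [n' [nn' nz' _]] := NZ_climb (du_inj du) (du_dd du) nA (du_fg du) pp pp1 p1p nz.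
by apply: leq_trans (NZ_dim pp nz' cl); rewrite leq_add2r.
Qed.

(** A nonzero element of the kernel of J^0 -> J^1 is a class in D^0(A), so D^0(A/p) is nonzero at m
    for some p, and [NZ_long] gives a chain of length D. Conversely a chain of length d starts at a
    prime P with some D^h(A/P) nonzero at P, and h + d <= D. *)
Lemma dualizing_dim d : (exists x : J 0%N, x <> 0) -> (forall l p, pchain l p -> (l <= d)%N) ->
  (exists p, pchain d p) -> D = d.
Proof.
move=> [x x0] dmax [P cP]; apply/eqP; rewrite eqn_leq; apply/andP; split.
  have [a [ax dax]] := du_ess du x0.
  have [f fE] : exists f : {linear (A : comNzRingType)^o -> J 0%N}, forall b, f b = b *: (a *: x) by exact: lin_ring.
  have mq := prm_mulc lm.1.
  have fA : fgm (A : comNzRingType)^o by exists [:: 1] => y; split=> // _; exists y; rewrite [_ *: _]mulr1 subrr.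
  have [||p [pp _ _ nz]] := @devissage_D _ _ _ (du_inj du) (du_dd du) m 0 (fun=> False) _ nA mq fA => //.
    move=> H; have [|s ms Bs] := H (f : _ -> _).
      by split=> [|y]; [exact: linP | rewrite fE linearZZ dax scaler0].
    have [_ mu] := lm; have [t ts] := mu s ms.
    apply: ax; have := Bs t; rewrite [LHS](_ : _ = s *: f t) // fE scalerA mulrC ts scale1r //.
  by have [l /dmax ld <-] := NZ_long pp nz.
have [c [c0 cp _]] := cP; have pP : prm P by rewrite -c0; exact: cp.
have [h [nz _ _]] := du_prime du pP.
by apply: leq_trans (NZ_dim pP nz cP); rewrite leq_addl.
Qed.

End DualDim.

(** * Krull's principal ideal theorem, height, systems of parameters *)

Section KrullHeight.
Variable A : comNzRingType.
Hypothesis nA : noeth A.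
Implicit Types (p q r I : A -> Prop).

Definition gen2 p (u v x : A) := exists a b, p (x - a * u - b * v).

Lemma gen2_idl p u v : idl p -> idl (gen2 p u v).
Proof.
move=> sp; split; first by exists 0, 0; rewrite !mul0r !subr0; exact: idl0.
move=> c x y [a [b px]] [a' [b' py]]; exists (c * a + a'), (c * b + b').
rewrite (_ : _ - _ = c *: (x - a * u - b * v : A^o) + (y - a' * u - b' * v)); first exact: sp.2.
by rewrite /GRing.scale /=; ring.
Qed.

Lemma has_len_quo q I n : mulc q -> forall sI : idl I, ml q (mkAq sI) n -> has_len q (V := A^o) I (fun=> True) n.
Proof.
move=> mq sI; have c0 (x : A) : I x <-> x *: aq1 sI = 0 := iff_sym (aq_ann sI x).
apply: (@has_len_rel A q (mkAq sI) A^o n (fun y x => y = (x : A) *: aq1 sI)) => //; try exact: smod1; try exact: smodT.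
- by rewrite scale0r.
- by move=> a x y x' y' -> ->; rewrite -[a *: y]/(a * y) scalerDl scalerA.
- move=> x _; have [a ->] := aq_gen x; exists 1, a; split=> //; first exact: mq.1.
  by rewrite scale1r.
- move=> y _; exists 1, (y *: aq1 sI); split=> //; first exact: mq.1.
  by rewrite scale1r.
- by move=> x y _ -> /c0 ->; exists 1; [exact: mq.1 | rewrite scaler0].
- by move=> y x _ -> /c0 H; exists 1; [exact: mq.1 | rewrite scale1r].
Qed.

(* The principal ideal theorem, by Krull's length count: with [u] a power of [z] such that
   (p,y) : u = (p,y) : u^2, both (p,u)/(p,u^2,uy) extended by (p,u,y)/(p,u) and (p,u^2,y)/(p,u^2,uy)
   have the length of A/(p,u), whence u lies in (p,u^2,y) locally at r. *)
Lemma principal_ideal p q r z : prm p -> prm q -> prm r ->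
  (forall a, p a -> q a) -> (exists2 x, q x & ~ p x) ->
  (forall a, q a -> r a) -> r z -> ~ q z ->
  exists p', [/\ prm p', forall a, p a -> p' a, p' z, forall a, p' a -> r a & exists2 x, r x & ~ p' x].
Proof.
move=> pp pq pr pq' [y qy py] qr rz qz; apply: contrapT => noex.
have [sp p1 pM] := pp; have [sq q1 qM] := pq; have [sr r1 rM] := pr; have mr := prm_mulc pr.
have [|||S [n n0 SE] Smax] := @acc A A^o (fun S => exists2 n, (0 < n)%N & S = fun t => gen2 p y 0 (t * z ^+ n)).
- move=> S [n _ ->]; split=> [|a t t' H H']; first by rewrite mul0r; exact: idl0 (gen2_idl _ _ sp).
  by rewrite mulrDl -mulrA; exact: (gen2_idl y 0 sp).2.
- exact: nA.
- by exists (fun t => gen2 p y 0 (t * z ^+ 1)), 1%N.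
pose u := z ^+ n.
have ust t : gen2 p y 0 (t * u * u) -> gen2 p y 0 (t * u).
  move=> H; have := Smax (fun t => gen2 p y 0 (t * z ^+ (n + n))); rewrite SE; apply.
  - by exists (n + n)%N => //; rewrite addn_gt0 n0.
  - by move=> x H'; rewrite exprD mulrA mulrC; exact: idlMl (gen2_idl _ _ sp) H'.
  - by rewrite exprD mulrA.
have qu : ~ q u.
  rewrite /u; elim: (n) => [|k IH]; rewrite ?expr0 // exprS.
  by case/qM.
have pu : ~ p u by move=> /pq'.
have ru : r u by rewrite /u -(prednK n0) exprS; exact: idlMr.
have sI2 := gen2_idl u 0 sp.
have pI2 x : p x -> forall v w, gen2 p v w x by move=> px v w; exists 0, 0; rewrite !mul0r !subr0.
(* By [noex], r is the only prime between p + (u) and r, so A/(p, u) has finite length at r. *)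
have [n1 h0] : exists n, ml r (mkAq sI2) n.
  apply: (@ml_fin A r (gen2 p u 0)) => //; last 1 first.
  - by move=> a x Ha; have [b ->] := aq_gen x; rewrite scaleC; move/aq_ann: Ha => ->; rewrite scaler0.
  - move=> p' pp' Ip' p'r a ra; apply: contrapT => p'a; apply: noex; exists p'; split=> //.
    + by move=> b /pI2/(_ u 0)/Ip'.
    + have : p' u by apply: Ip'; exists 1, 0; rewrite mul1r mul0r subrr subr0; exact: idl0.
      have [sp' p'1 p'M] := pp'; rewrite /u; elim: (n) => [|k IH]; rewrite ?expr0 // exprS.
      by case/p'M.
    + by exists a.
  - exact: fgm_aq.
have {h0} h2 := has_len_quo mr h0.
pose I1 := gen2 p (u * u) (u * y); pose I2 := gen2 p u 0; pose I3 := gen2 p u y; pose I4 := gen2 p (u * u) y.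
have sI1 : idl I1 by exact: gen2_idl.
have sI3 : idl I3 by exact: gen2_idl.
have sI4 : idl I4 by exact: gen2_idl.
have I12 x : I1 x -> I2 x.
  move=> [a [b H]]; exists (a * u + b * y), 0; rewrite mul0r subr0.
  by rewrite (_ : _ - _ = x - a * (u * u) - b * (u * y)) //; ring.
have I23 x : I2 x -> I3 x by move=> [a [b H]]; exists a, 0; move: H; rewrite mulr0 mul0r.
have I14 x : I1 x -> I4 x.
  by move=> [a [b H]]; exists a, (b * u); rewrite -mulrA.
have I43 x : I4 x -> I3 x by move=> [a [b H]]; exists (a * u), b; rewrite -mulrA.
have cancel v x : ~ p v -> p (v * x) -> p x by move=> pv /pM[].
have [b [a [ab h23 h3]]] := has_len_inv mr sI2 sI3 (@smodT _ A^o) I23 (fun _ _ => I) h2.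
have [mu muE] := @lin_ring A A^o u; have [my myE] := @lin_ring A A^o y.
have {}muE x : mu x = u * x by rewrite muE mulrC.
have {}myE x : my x = y * x by rewrite myE mulrC.
have h12 : has_len r (V := A^o) I1 I2 a.
  apply: (@len_img A r A^o A^o a mu I3 (fun=> True) I1 I2 mr sI3 (@smodT _ A^o) sI1 sI2 _ _ _ _ _ _ h3) => //.
  - by move=> x _; rewrite muE; exists x, 0; rewrite mul0r subr0 mulrC subrr; exact: idl0.
  - move=> w [c [c' H]]; exists 1; first exact: mr.1.
    rewrite scale1r; exists c => //; rewrite muE; exists 0, 0.
    by rewrite !mul0r !subr0; move: H; rewrite mulr0 subr0 mulrC.
  - move=> x [c [c' H]]; rewrite muE; exists c, c'.
    rewrite (_ : _ - _ = u * (x - c * u - c' * y)); last by ring.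
    exact: idlMl.
  - move=> x _; rewrite muE => -[c [c' H]]; apply: (sub_qin mr); exists c, c'.
    by apply: (cancel u (x - c * u - c' * y : A) pu); move: H; congr p; ring.
have h13 := has_len_add mr sI1 sI2 sI3 I12 I23 h12 h23.
have h14 : has_len r (V := A^o) I1 I4 n1.
  apply: (@len_img A r A^o A^o n1 my I2 (fun=> True) I1 I4 mr sI2 (@smodT _ A^o) sI1 sI4 _ _ _ _ _ _ h2) => //.
  - by move=> x _; rewrite myE; exists 0, x; rewrite mul0r subr0 mulrC subrr; exact: idl0.
  - move=> w [c [c' H]]; exists 1; first exact: mr.1.
    rewrite scale1r; exists c' => //; rewrite myE; exists c, 0.
    by move: H; congr p; ring.
  - move=> x [c [c' H]]; rewrite myE; exists 0, c.
    rewrite (_ : _ - _ = y * (x - c * u - c' * 0)); last by ring.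
    exact: idlMl.
  - move=> x _; rewrite myE => -[c [c' H]]; apply: (sub_qin mr).
    have [|e [e' He]] := ust c.
      exists (x - c' * u), 0; move: (idlMl (-1) sp H); congr p; ring.
    exists (e + c'), 0; apply: (cancel y (x - (e + c') * u - 0 * 0 : A) py).
    by have := idlD sp H (idlMl u sp He); congr p; ring.
have [a' [b' [ab' ha' hb']]] := has_len_inv mr sI1 sI4 sI3 I14 I43 h13.
(* Two routes lead from I1 to I3. Through I2 the length is a + b = n1; through I4 the first half
   alone has length n1. *)
have b'0 : b' = 0%N.
  by have := has_len_uniq ha' h14; move: ab ab'; lia.
have : qin r (V := A^o) I4 u.
  apply: contrapT => nu; have [_] := hb'; apply; rewrite b'0.
  exists I3; split=> //; exists u => //.
  by exists 1, 0; rewrite mul1r mul0r subrr subr0; exact: idl0.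
case=> s rs [c [c' H]].
(* Locally s u = c u^2 + c' y modulo p, with p and y inside q. As u is outside q, s - c u lies in q,
   and then s lies in r because u does. *)
have : q (u * (s - c * u)).
  have /(idlD sq (pq' _ H)) : q (c' * y) by exact: idlMl.
  by congr q; rewrite /GRing.scale /=; ring.
case/qM => // /qr H'; apply: rs; rewrite -(subrK (c * u) s); apply: idlD => //; exact: idlMl.
Qed.

Variable m : A -> Prop.
Hypothesis lm : mloc m.

Definition dim_le I e := forall p l, prm p -> (forall a, I a -> p a) -> pchain l p -> (l <= e)%N.
Definition nilmod I := forall x, m x -> exists N, I (x ^+ N).

Lemma pchain1 l p : pchain l.+1 p -> exists p', [/\ forall a, p a -> p' a, exists2 x, p' x & ~ p x & pchain l p'].
Proof.
move=> [c [c0 cp cs]]; exists (c 1%N); rewrite -c0; have [c01 c01'] := cs 0%N isT; split=> //.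
by exists (fun i => c i.+1); split=> // i il; [exact: cp | exact: cs].
Qed.

Lemma pchain_prm l p : pchain l p -> prm p.
Proof. by move=> [c [<- cp _]]; exact: cp. Qed.

Lemma pchain0 p : prm p -> pchain 0 p.
Proof. by move=> pp; exists (fun=> p); split. Qed.

(** By induction the part of the chain from its second prime q on is rerouted through a prime r
    containing z; if q misses z, the principal ideal theorem replaces q by a prime p' over p that
    contains z and is strictly below r. *)
Lemma chain_through l p z : pchain l.+1 p -> m z ->
  exists p', [/\ forall a, p a -> p' a, p' z & pchain l p'].
Proof.
move=> + mz; elim: l p => [|l IH] p.
  move=> /pchain_prm pp; exists m; split=> //; first exact: mloc_max.
  by apply: pchain0; case: lm.
move=> cp; have pp := pchain_prm cp; have [q [pq pq' cq]] := pchain1 cp; have pq0 := pchain_prm cq.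
have [r [qr rz cr]] := IH q cq.
have [qz|qz] := pselect (q z); first by exists q.
have pr := pchain_prm cr.
have [p' [pp' pp'1 p'z p'r p'r']] := principal_ideal pp pq0 pr pq pq' qr rz qz.
by exists p'; split=> //; exact: pchainS cr.
Qed.

(** One parameter shortens a chain by at most one, by [chain_through]; once I itself is primary to
    m, no chain of positive length starts above it. *)
Lemma height (zs : seq A^o) I : idl I -> nilmod (addS (V := A^o) I (spn (zs : seq A^o))) -> {in zs, forall z, m z} -> dim_le I (size zs).
Proof.
elim: zs I => [|z zs IH] I sI nI zm p [//|l] pp Ip cp.
  have [p' [pp' [x p'x px] cp']] := pchain1 cp.
  have [N] := nI x (mloc_max lm (pchain_prm cp') p'x).
  move=> [v Iv xv]; exfalso; apply: px; move: xv => /= /eqP; rewrite subr_eq0 => /eqP xv.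
  have [sp p1 pM] := pp; have : p (x ^+ N) by rewrite xv; exact: Ip.
  by elim: (N) => [|k IHk]; rewrite ?expr0 // exprS => /pM[].
have [p' [pp' p'z cp']] := chain_through cp (zm z (mem_head _ _)).
have sIz := gen2_idl z 0 sI.
rewrite ltnS; apply: (IH (gen2 I z 0) sIz _ _ p' l _ _ cp'); last 2 first.
- exact: pchain_prm cp'.
- move=> a [b [c H]]; have [sp' _ _] := pchain_prm cp'.
  rewrite -(subrK (b * z) a); apply: idlD => //; last exact: idlMl.
  by apply/pp'/Ip; move: H; rewrite mulr0 subr0.
- move=> x mx; have [N [v Iv [b xv]]] := nI x mx; exists N; exists (v + b * z).
    by exists b, 0; rewrite mulr0 subr0 addrK.
  by move: xv; rewrite opprD addrA.
by move=> v vs; apply: zm; rewrite inE vs orbT.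
Qed.

(** A prime over I contains an associated prime of A/I. Entries of the covering list that are not
    primes different from m are overwritten by one good prime [g], so that avoidance applies to the
    whole list. *)
Lemma minimal_primes I : idl I -> exists n (L : nat -> A -> Prop),
  (forall i, (i < n)%N -> prm (L i) /\ exists2 x, m x & ~ L i x) /\
  forall p, prm p -> (forall a, I a -> p a) -> (exists2 x, m x & ~ p x) ->
    exists2 i, (i < n)%N & (forall a, I a -> L i a) /\ forall a, L i a -> p a.
Proof.
move=> sI; pose good p := prm p /\ exists2 x, m x & ~ p x.
have [[g gg]|nog] := pselect (exists g, good g); last first.
  by exists 0%N, (fun=> m); split=> // p pp _ np; exfalso; apply: nog; exists p.
have [n [L LP]] := ass_fin nA (fgm_aq sI).
pose L' i := if pselect (good (L i)) then L i else g.
exists n, L'; split=> [i _|p pp Ip [y my py]]; first by rewrite /L'; case: pselect.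
have mp := prm_mulc pp.
have [|a [pa ap]] := @assoc_ex A p _ (aq1 sI) nA mp.
  by move=> [s ps /aq_ann/Ip].
have [i il Li] := LP _ pa; exists i => //; rewrite /L'; case: pselect => [?|] /=.
  rewrite Li; split=> // b Ib; rewrite /ann scaleC [b *: aq1 sI]((aq_ann sI b).2 Ib) scaler0 //.
by case; rewrite Li; split=> //; exists y => // /ap.
Qed.

Lemma dim0_nil I : idl I -> dim_le I 0 -> nilmod I.
Proof.
(* [q] is the complement of the powers of x, so localizing at q inverts x; an associated prime that
   survives lies strictly below m. *)
move=> sI d0 x mx; apply: contrapT => nx; pose q s := ~ exists N, s = x ^+ N.
have mq : mulc q.
  split; first by apply; exists 0%N.
  by move=> s t /contrapT[k ->] /contrapT[l ->]; apply; exists (k + l)%N; rewrite exprD.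
have [|a [pa ap]] := @assoc_ex A q _ (aq1 sI) nA mq.
  by move=> [s /contrapT[N ->] /aq_ann IN]; apply: nx; exists N.
have xa : ~ ann (a *: aq1 sI) x by move=> /ap; apply; exists 1%N.
suff : (1 <= 0)%N by [].
apply: (d0 _ _ pa).
  by move=> b Ib; rewrite /ann scaleC [b *: aq1 sI]((aq_ann sI b).2 Ib) scaler0 //.
apply: (@pchainS _ 0 _ m) => //; [exact: mloc_max | by exists x|].
by apply: pchain0; case: lm.
Qed.

(** An element of m outside the listed primes over I lowers the dimension by one. *)
Lemma parameters e I : idl I -> dim_le I e -> exists zs : seq A,
  [/\ size zs = e, {in zs, forall z, m z} & nilmod (addS (V := A^o) I (spn (zs : seq A^o)))].
Proof.
elim: e I => [|e IH] I sI dI.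
  exists [::]; split=> // x /(dim0_nil sI dI)[N IN]; exists N; exists (x ^+ N) => //=.
  by rewrite subrr.
have [n [L [Lp LI]]] := minimal_primes sI.
have [[sm m1 mM] _] := lm.
have [|i /Lp[]|z mz zL] := @prime_avoid A n L m sm => //; first by move=> i /Lp[].
have [|zs [zse zsm nz]] := IH (gen2 I z 0) (gen2_idl z 0 sI).
  move=> p l pp Ip cp.
  have Ip' a : I a -> p a by move=> Ia; apply: Ip; exists 0, 0; rewrite !mul0r !subr0.
  have pz : p z by apply: Ip; exists 1, 0; rewrite mul1r mulr0 subrr subr0; exact: idl0.
  have [H|pm] := pselect (exists2 x, m x & ~ p x).
    have [i il [IL Lp']] := LI p pp Ip' H.
    rewrite -ltnS; apply: (dI (L i)) => //; first exact: (Lp i il).1.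
    apply: pchainS cp => //; first exact: (Lp i il).1.
    by exists z => //; exact: zL.
  case: l cp => // l cp; have [p' [_ [x p'x px] cp']] := pchain1 cp.
  by exfalso; apply: pm; exists x => //; exact: (mloc_max lm (pchain_prm cp')).
exists (z :: zs); split=> [|v|x mx]; first by rewrite /= zse.
  by rewrite inE => /orP[/eqP->|/zsm].
have [N [v [a [b Iv]] xv]] := nz x mx; exists N; exists (v - a * z).
  by move: Iv; rewrite mulr0 subr0.
by exists a; move: xv; congr spn; rewrite -[a *: _]/(a * z); ring.
Qed.

End KrullHeight.

(** * Hilbert's basis theorem and the Rees algebra *)

Lemma hilbert_basis (A : comNzRingType) : noeth A -> noeth {poly A}.
Proof.
move=> nA I sI.
(* [LC n] collects the coefficients of X^n in members of I of degree at most n. This increasing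
   family of ideals is constant from some N on, and the members of degree at most N form a submodule
   of a finitely generated A-module. *)
pose LC n (a : A) := exists2 f : {poly A}, I f & (size f <= n.+1)%N /\ f`_n = a.
have ZC (f : {poly A}) a : I f -> I (a *: f) by move=> If; rewrite -mul_polyC; exact: idlMl.
have sLC n : idl (LC n).
  split; first by exists 0; [exact: idl0 | rewrite size_poly0 coef0].
  move=> a _ _ [f If [sf <-]] [g Ig [sg <-]]; exists (a *: f + g); first by apply: idlD => //; exact: ZC.
  rewrite coefD coefZ; split=> //; apply: (leq_trans (size_polyD _ _)).
  by rewrite geq_max sg (leq_trans (size_scale_leq _ _)).
have LCup n k a : LC n a -> LC (k + n)%N a.
  move=> [f If [sf <-]]; exists ('X^k * f); first exact: idlMl.
  rewrite coefXnM ltnNge leq_addr /= addKn; split=> //.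
  have [->|f0] := eqVneq f 0; first by rewrite mulr0 size_poly0.
  by rewrite -commr_polyXn size_mulXn // -addnS leq_add2l.
have [|||_ [N ->] Nmax] := @acc A A^o (fun S => exists n, S = LC n).
- by move=> S [n ->]; exact: sLC.
- exact: nA.
- by exists (LC 0%N), 0%N.
pose V (f : {poly A}) := I f /\ (size f <= N.+1)%N.
have sV : smod (V := {poly A} : lmodType A) V.
  split; first by split; [exact: idl0 | rewrite size_poly0].
  move=> a f g [If sf] [Ig sg]; split; first by apply: idlD => //; exact: ZC.
  by apply: (leq_trans (size_polyD _ _)); rewrite geq_max sg (leq_trans (size_scale_leq _ _)).
have [|s Vs] := @fgs_noeth A ({poly A} : lmodType A) [seq 'X^i | i <- iota 0 N.+1] V nA sV.
  move=> f [_ sf]; rewrite -[f]coefK poly_def; apply: (smod_sum (smod_spn _)) => i _.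
  apply: (smodZ (smod_spn _)); apply: spn_mem; apply/mapP; exists (i : nat) => //.
  by rewrite mem_iota /= add0n (leq_trans (ltn_ord i)).
exists s => f; split; last first.
  apply: (spn_min sI) => g gs; have [//] : V g by apply/Vs/spn_mem.
have VS g : V g -> spn (V := {poly A}^o) s g.
  move/Vs; apply: (@spn_min A ({poly A} : lmodType A) s (fun g => spn (V := {poly A}^o) s g)).
    split; first exact: smod0 (smod_spn _).
    by move=> a g1 g2 h1 h2; rewrite -mul_polyC; exact: (smod_spn _).2.
  by move=> v vs; exact: spn_mem.
have [n sfn] := ubnP (size f); elim: n f sfn => // n IH f sfn If.
have [sf|sf] := leqP (size f) N.+1; first by apply: VS.
pose k := (size f).-1.
have kN : (N <= k)%N by rewrite /k; lia.
have [g Ig [sg gN]] : LC N (lead_coef f).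
  apply: (Nmax (LC k)); first by exists k.
    by move=> a /(LCup _ (k - N)%N); rewrite subnK.
  by exists f => //; rewrite /k; split=> //; lia.
rewrite -(subrK ('X^(k - N) * g) f); apply: (smodD (smod_spn _)); last first.
  by apply: (@smodZ _ _ _ (smod_spn (V := {poly A}^o) s) ('X^(k - N)) g); exact: VS.
apply: IH; last by apply: idlB => //; exact: idlMl.
have sf0 : size f = k.+1 by rewrite /k; lia.
suff : (size ((f : {poly A}) - 'X^(k - N) * g)%R <= k)%N by move=> H; apply: leq_ltn_trans H _; rewrite -ltnS -sf0.
apply/leq_sizeP => j kj; rewrite coefB coefXnM ltnNge.
have -> /= : (k - N <= j)%N by lia.
have [jk|jk] := eqVneq j k.
  by rewrite jk subKn // gN lead_coefE -/k subrr.
have kj' : (k < j)%N by lia.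
have f0 : (f : {poly A})`_j = 0 by apply: nth_default; rewrite sf0.
have g0 : g`_(j - (k - N)) = 0 by apply: nth_default; apply: leq_trans sg _; lia.
by rewrite f0 g0 subrr.
Qed.

Section Rees.
Variables (A : comNzRingType) (m : idealr A).
Hypothesis nA : noeth A.

Lemma idl_pow n : idl (ideal_pow m n).
Proof. by split=> [|a x y hx hy]; [exact: ideal_pow0 | apply: ideal_powD => //; exact: ideal_powM]. Qed.

Lemma ideal_powE n x : x \in m -> forall y, ideal_pow m n y -> ideal_pow m n.+1 (x * y).
Proof. by move=> xm y hy /=; exists 1%N, (fun=> x), (fun=> y); rewrite big_ord1. Qed.

Lemma ideal_pow_ind n (S : A -> Prop) : (forall x y, S x -> S y -> S (x + y)) -> S 0 ->
  (forall x y, x \in m -> ideal_pow m n y -> S (x * y)) -> forall x, ideal_pow m n.+1 x -> S x.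
Proof.
move=> SD S0 SM x [k [a [b [am bm ->]]]].
by apply: (big_ind S) => // i _; exact: SM (am i) (bm i).
Qed.

Lemma ideal_powMM n k x y : ideal_pow m n x -> ideal_pow m k y -> ideal_pow m (n + k) (x * y).
Proof.
move=> + hy; elim: n x => [|n IH] x; first by move=> _; exact: ideal_powM.
move: x; apply: (@ideal_pow_ind n (fun x => ideal_pow m (n.+1 + k) (x * y))) => [u v hu hv||u v um hv].
- by rewrite mulrDl; exact: ideal_powD.
- by rewrite mul0r; exact: ideal_pow0.
- by rewrite addSn -mulrA; apply: ideal_powE => //; exact: IH.
Qed.

Lemma ideal_powS n x : ideal_pow m n.+1 x -> ideal_pow m n x.
Proof.
apply: (@ideal_pow_ind n (ideal_pow m n)) => [u v||u v um hv]; [exact: ideal_powD | exact: ideal_pow0 | exact: ideal_powM].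
Qed.

Lemma ideal_pow_le n k x : (k <= n)%N -> ideal_pow m n x -> ideal_pow m k x.
Proof. by move=> /subnK <-; elim: (n - k)%N => // l IH /ideal_powS. Qed.

Lemma ideal_pow1E x : ideal_pow m 1 x <-> x \in m.
Proof. by split; [exact: ideal_pow1 | move=> xm; rewrite -[x]mulr1; exact: ideal_powE]. Qed.

(** For xs generating m the image of [f] is the Rees algebra of m inside A[X]. Its source stays
    noetherian because one variable is adjoined per generator, and the subalgebra itself is never
    formed. *)
Lemma rees_cover (xs : seq A) : {subset xs <= m} -> exists (B : comNzRingType) (f : {rmorphism B -> {poly A}}),
  [/\ noeth B, forall b i, ideal_pow m i (f b)`_i, forall a, exists b, f b = a%:P
    & forall x, x \in xs -> exists b, f b = x *: 'X].
Proof.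
elim: xs => [|x xs IH] xm.
  exists A, polyC; split=> // [b i|a]; last by exists a.
  rewrite coefC; case: i => //= i; exact: (ideal_pow0 m i.+1).
have [v vs|B [f [nB fB fC fX]]] := IH; first by apply: xm; rewrite inE vs orbT.
have cfu : commr_rmorph f (x *: 'X) by move=> b; exact: mulrC.
exists {poly B}, (horner_morph cfu); split.
- exact: hilbert_basis.
- elim/poly_ind => [|p b IHp] i; first by rewrite rmorph0 coef0; exact: ideal_pow0.
  rewrite rmorphD rmorphM /= horner_morphX horner_morphC coefD -scalerAr coefZ coefMX.
  apply: ideal_powD => //; case: i => [|i] //.
  by apply: ideal_powE; [apply: xm; rewrite mem_head | exact: IHp].
- by move=> a; have [b ba] := fC a; exists b%:P; rewrite /= horner_morphC.
- move=> y; rewrite inE => /orP[/eqP->|/fX[b by_]]; last by exists b%:P; rewrite /= horner_morphC.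
  by exists 'X; rewrite /= horner_morphX.
Qed.

(** [L] is a homogeneous ideal of the Rees algebra. Its preimage in the noetherian cover is finitely
    generated, and the homogeneous components of the generators, with their degrees l, generate L: a
    form of the Artin-Rees lemma. *)
Lemma rees_fin (L : nat -> A -> Prop) : (forall n a, L n a -> ideal_pow m n a) -> (forall n, idl (L n)) ->
  (forall n x a, x \in m -> L n a -> L n.+1 (x * a)) ->
  exists k (l : 'I_k -> nat) (b : 'I_k -> A), (forall i, L (l i) (b i)) /\
    forall n a, L n a -> exists c : 'I_k -> A, (forall i, ideal_pow m (n - l i) (c i)) /\ a = \sum_i c i * b i.
Proof.
move=> Lm sL LM.
have sm : idl (fun a => a \in m).
  by split=> [|a x y mx my]; [exact: idealr0 | apply: rpredD => //; exact: idealMr].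
have [xs xsE] := nA sm.
have [|B [f [nB fB fC fX]]] := @rees_cover xs; first by move=> x xxs; apply/xsE/spn_mem.
have LMM n k x a : ideal_pow m k x -> L n a -> L (k + n)%N (x * a).
  move=> + La; elim: k x => [|k IH] x; first by move=> _; exact: idlMl.
  move: x; apply: (@ideal_pow_ind k (fun x => L (k.+1 + n)%N (x * a))) => [u v hu hv||u v um hv].
  - by rewrite mulrDl; exact: idlD.
  - by rewrite mul0r; exact: idl0.
  - by rewrite -mulrA addSn; apply: LM => //; exact: IH.
pose im g := exists b, f b = g.
have imD g h : im g -> im h -> im (g + h) by move=> [b <-] [b' <-]; exists (b + b'); rewrite rmorphD.
have imM g h : im g -> im h -> im (g * h) by move=> [b <-] [b' <-]; exists (b * b'); rewrite rmorphM.
have im0 : im 0 by exists 0; rewrite rmorph0.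
have imX n a : ideal_pow m n a -> im (a *: 'X^n).
  elim: n a => [|n IH] a; first by move=> _; rewrite expr0 alg_polyC; exact: fC.
  move: a; apply: (@ideal_pow_ind n (fun a => im (a *: 'X^(n.+1)))) => [u v hu hv||u v um hv].
  - by rewrite scalerDl; exact: imD.
  - by rewrite scale0r.
  - rewrite (_ : _ *: _ = (u *: 'X) * (v *: 'X^n)); last by rewrite exprS -!mul_polyC polyCM; ring.
    apply: (imM _ _ _ (IH _ hv)).
    move/xsE: um; apply: (@spn_min A A^o xs (fun u => im (u *: 'X))); last by move=> ? /fX.
    split; first by rewrite scale0r.
    move=> c y z hy hz; rewrite scalerDl -scalerA -mul_polyC.
    by apply: (imD _ _ _ hz); apply: imM => //; exact: fC.
pose I b := forall i, L i (f b)`_i.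
have sI : idl I.
  split; first by move=> i; rewrite rmorph0 coef0; exact: idl0.
  move=> c x y Ix Iy i; rewrite rmorphD coefD; apply: idlD => //.
  rewrite -[c *: x]/(c * x) rmorphM coefM; apply: (smod_sum (sL i)) => j _.
  by have := LMM _ _ _ _ (fB c j) (Ix (i - j)%N); rewrite subnKC // -ltnS.
have [gs gsE] := nB _ sI.
pose G := [seq (j, (f g)`_j) | g <- gs, j <- iota 0 (size (f g))].
exists (size G), (fun i => (nth (0%N, 0) G i).1), (fun i => (nth (0%N, 0) G i).2); split.
  move=> i; have /allpairsPdep[g [j [ggs _ ->]]] := mem_nth (0%N, 0) (ltn_ord i).
  by apply: (gsE g).2; exact: spn_mem.
move=> n a La; have [b0 b0E] := imX n a (Lm _ _ La).
have /gsE : I b0.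
  by move=> i; rewrite b0E coefZ coefXn; have [->|_] := eqVneq i n; rewrite ?mulr1 ?mulr0 //; exact: idl0.
pose LL (i : 'I_(size G)) := (nth (0%N, 0) G i).1; pose BB (i : 'I_(size G)) : A := (nth (0%N, 0) G i).2.
pose PP bb := forall n, exists c : 'I_(size G) -> A,
  (forall i, ideal_pow m (n - LL i) (c i)) /\ (f bb)`_n = \sum_i c i * BB i.
suff H bb : spn (V := B^o) gs bb -> PP bb.
  by move=> /H/(_ n); rewrite b0E coefZ coefXn eqxx mulr1.
apply: (@spn_min B B^o gs PP).
  split=> [k|r x y Px Py k].
    exists (fun=> 0); split; first by move=> i; exact: ideal_pow0.
    by rewrite rmorph0 coef0 big1 // => i _; rewrite mul0r.
  have [cy [cym cyE]] := Py k; have /choice[cx cxP] := Px.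
  exists (fun i => \sum_(j < k.+1) (f r)`_j * cx (k - j)%N i + cy i); split=> [i|].
    apply: ideal_powD => //; apply: (smod_sum (idl_pow _)) => j _.
    apply: (@ideal_pow_le (j + (k - j - LL i))); first by lia.
    by apply: ideal_powMM => //; exact: (cxP _).1.
  rewrite rmorphD coefD cyE -[r *: x]/(r * x) rmorphM coefM.
  under [RHS]eq_bigr => i _ do rewrite mulrDl mulr_suml.
  rewrite big_split /=; congr (_ + _); rewrite exchange_big /=; apply: eq_bigr => j _.
  by rewrite (cxP _).2 mulr_sumr; apply: eq_bigr => i _; rewrite mulrA.
move=> g ggs k; have [ks|ks] := ltnP k (size (f g)); last first.
  exists (fun=> 0); split; first by move=> i; exact: ideal_pow0.
  by rewrite nth_default // big1 // => i _; rewrite mul0r.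
have /(nthP (0%N, 0))[i0 i0G i0E] : (k, (f g)`_k) \in G.
  by apply/allpairsPdep; exists g, k; rewrite mem_iota.
exists (fun i => (i == Ordinal i0G)%:R); split=> [i|].
  have [->|_] := eqVneq i (Ordinal i0G); last exact: ideal_pow0.
  by rewrite /LL /= i0E subnn.
rewrite (bigD1 (Ordinal i0G)) //= eqxx mul1r big1 ?addr0 => [|i /negPf->]; last by rewrite mul0r.
by rewrite /BB /= i0E.
Qed.
End Rees.

(** * The completion is noetherian and local *)

Section CompletionTheory.
Variables (A : comNzRingType) (m : idealr A).
Local Notation B := (completion m).
Local Notation pow := (ideal_pow m).

Definition cls (u : cauchy m) : B := \pi_B%qT u.

Lemma cls_surj (x : B) : exists u, x = cls u.
Proof. by exists (repr x); rewrite /cls reprK. Qed.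

Lemma clsD u v : cls (u + v) = cls u + cls v. Proof. by rewrite /cls rmorphD. Qed.
Lemma clsM u v : cls (u * v) = cls u * cls v. Proof. by rewrite /cls rmorphM. Qed.
Lemma clsB u v : cls (u - v) = cls u - cls v. Proof. by rewrite /cls rmorphB. Qed.
Lemma cls1 : cls 1 = 1. Proof. by rewrite /cls rmorph1. Qed.

Definition evp n (u : nat -> A) := exists N, forall i, (N <= i)%N -> pow n (u i).

Lemma cls_eq u v : cls u = cls v <-> forall n, evp n (val (u - v)).
Proof.
split=> [/eqP|H].
  by rewrite /cls -Quotient.idealrBE => /asboolP.
by apply/eqP; rewrite /cls -Quotient.idealrBE; apply/asboolP.
Qed.

Lemma cauchyP (u : cauchy m) k : exists N, forall i j, (N <= i)%N -> (N <= j)%N -> pow k (val u i - val u j).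
Proof. by have /asboolP H : val u \in cauchy_seq m := valP u; exact: H. Qed.

(** The closure of m^n in the completion; [filt_span] shows that it is generated by the image of
    m^n. *)
Definition filt n (x : B) := exists2 u, x = cls u & evp n (val u).

Lemma filt_cls n u : filt n (cls u) <-> evp n (val u).
Proof.
split=> [[v /cls_eq/(_ n)[N uv] [N' vn]]|un]; last by exists u.
exists (maxn N N') => i; rewrite geq_max => /andP[Ni N'i].
rewrite -(subrK (val v i) (val u i)); apply: ideal_powD; [exact: uv | exact: vn].
Qed.

Lemma filt_sep x : (forall n, filt n x) -> x = 0.
Proof.
have [u ->] := cls_surj x => H; transitivity (cls 0); last by rewrite /cls rmorph0.
by apply/cls_eq => n; rewrite subr0; exact: (filt_cls n u).1 (H n).
Qed.

Lemma idl_filt n : idl (filt n).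
Proof.
split; first by exists 0; [rewrite /cls rmorph0 | exists 0%N => i _; exact: ideal_pow0].
move=> a x y; have [w ->] := cls_surj a => -[u -> [N uN]] [v -> [N' vN]].
exists (w * u + v); first by rewrite clsD clsM.
exists (maxn N N') => i; rewrite geq_max => /andP[Ni N'i].
by apply: ideal_powD; [apply: ideal_powM; exact: uN | exact: vN].
Qed.

Lemma filt_le n k x : (k <= n)%N -> filt n x -> filt k x.
Proof. by move=> kn [u -> [N uN]]; exists u => //; exists N => i /uN; exact: ideal_pow_le. Qed.

Lemma filt0 x : filt 0 x.
Proof. by have [u ->] := cls_surj x; exists u => //; exists 0%N. Qed.

Lemma filtM n k x y : filt n x -> filt k y -> filt (n + k) (x * y).
Proof.
move=> [u -> [N uN]] [v -> [N' vN]]; exists (u * v); first by rewrite clsM.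
exists (maxn N N') => i; rewrite geq_max => /andP[Ni N'i].
by apply: ideal_powMM; [exact: uN | exact: vN].
Qed.

Lemma const_cauchy (a : A) : (fun=> a) \in cauchy_seq m.
Proof. by apply/asboolP => k; exists 0%N => i j _ _; rewrite subrr; exact: ideal_pow0. Qed.

Definition mkc (u : nat -> A) (uC : u \in cauchy_seq m) : cauchy m := exist (fun u => u \in cauchy_seq m) u uC.

Definition iot (a : A) : B := cls (mkc (const_cauchy a)).

Lemma iotD a b : iot (a + b) = iot a + iot b.
Proof. by rewrite /iot -clsD; congr cls; apply: val_inj. Qed.
Lemma iotM a b : iot (a * b) = iot a * iot b.
Proof. by rewrite /iot -clsM; congr cls; apply: val_inj. Qed.
Lemma iotB a b : iot (a - b) = iot a - iot b.
Proof. by rewrite /iot -clsB; congr cls; apply: val_inj. Qed.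
Lemma iot0 : iot 0 = 0.
Proof. by rewrite -(subrr 0) iotB subrr. Qed.
Lemma iot1 : iot 1 = 1.
Proof. by rewrite -cls1; congr cls; apply: val_inj. Qed.
Lemma iot_sum (I : Type) (r : seq I) (P : pred I) F : iot (\sum_(i <- r | P i) F i) = \sum_(i <- r | P i) iot (F i).
Proof. exact: (big_morph _ iotD iot0). Qed.
Lemma iotX a n : iot (a ^+ n) = iot a ^+ n.
Proof. by elim: n => [|n IH]; rewrite ?iot1 // !exprS iotM IH. Qed.

Lemma filt_iot n a : filt n (iot a) <-> pow n a.
Proof. by rewrite filt_cls; split=> [[N /(_ N (leqnn N))]|an] //; exists 0%N. Qed.

Lemma approx n x : exists a, filt n (x - iot a).
Proof.
have [u ->] := cls_surj x; have [N uN] := cauchyP u n; exists (val u N).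
rewrite /iot -clsB filt_cls; exists N => i Ni; exact: uN.
Qed.

Lemma series (c : nat -> A) l : (forall n, pow (n - l) (c n)) ->
  exists x, forall n, filt (n - l) (x - iot (\sum_(i < n) c i)).
Proof.
move=> cm; have H n k : (n <= k)%N -> pow (n - l) (\sum_(i < k) c i - \sum_(i < n) c i).
  move=> /subnK <-; elim: (k - n)%N => [|j IH]; first by rewrite subrr; exact: ideal_pow0.
  rewrite addSn big_ord_recr /= addrAC; apply: ideal_powD => //.
  by apply: ideal_pow_le (cm _); lia.
have uC : (fun n => \sum_(i < n) c i) \in cauchy_seq m.
  apply/asboolP => k; exists (k + l)%N => i j ki kj.
  rewrite -(subrKA (\sum_(i < k + l) c i)) -[X in _ + X]opprB.
  by apply: ideal_powD; last apply: ideal_powN; rewrite -{1}(addnK l k); exact: H.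
exists (cls (mkc uC)) => n; rewrite /iot -clsB filt_cls; exists n => i ni; exact: H.
Qed.

(** A correction that improves the order by one, with coefficients from A, is iterated; the
    coefficients of each h i are summed by [series], and the remainder lies in every [filt n]. The
    number l i is the loss of order allowed in the i-th coefficient. *)
Lemma successive k (l : 'I_k -> nat) (h : 'I_k -> B) (S : B -> Prop) n0 :
  (forall n x, (n0 <= n)%N -> S x -> filt n x -> exists c : 'I_k -> A,
     [/\ forall i, pow (n - l i) (c i), S (x - \sum_i iot (c i) * h i) & filt n.+1 (x - \sum_i iot (c i) * h i)]) ->
  forall x, S x -> filt n0 x -> exists y : 'I_k -> B, x = \sum_i y i * h i.
Proof.
move=> H x Sx Fx.
have /choice[f fP] : forall p : nat * B, exists c : 'I_k -> A, (n0 <= p.1)%N -> S p.2 -> filt p.1 p.2 ->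
     [/\ forall i, pow (p.1 - l i) (c i), S (p.2 - \sum_i iot (c i) * h i) & filt p.1.+1 (p.2 - \sum_i iot (c i) * h i)].
  move=> [n y]; have [[n0n [Sy Fy]]|nH] := pselect ((n0 <= n)%N /\ S y /\ filt n y).
    by have [c cP] := H n y n0n Sy Fy; exists c.
  by exists (fun=> 0) => a b c; case: nH.
pose X := fix X n := if n is n'.+1 then X n' - \sum_i iot (f ((n' + n0)%N, X n') i) * h i else x.
have XP n : S (X n) /\ filt (n + n0) (X n).
  elim: n => [//|n [SX FX]]; by have [_ ? ?] := fP ((n + n0)%N, X n) (leq_addl _ _) SX FX.
pose c n i := f ((n + n0)%N, X n) i.
have cm n i : pow (n - l i) (c n i).
  have [SX FX] := XP n; have [/(_ i) Hc _ _] := fP ((n + n0)%N, X n) (leq_addl _ _) SX FX.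
  by apply: ideal_pow_le Hc => /=; lia.
have Xsum n : x = X n + \sum_i iot (\sum_(j < n) c j i) * h i.
  elim: n => [|n IH].
    by rewrite big1 ?addr0 // => i _; rewrite big_ord0 iot0 mul0r.
  under eq_bigr => i _ do rewrite big_ord_recr iotD mulrDl.
  by rewrite big_split /= [X in _ + X]addrC addrA subrK.
have /choice[y yP] : forall i, exists y, forall n, filt (n - l i) (y - iot (\sum_(j < n) c j i)).
  by move=> i; exact: (@series (fun n => c n i) (l i) (fun n => cm n i)).
exists y; apply/eqP; rewrite -subr_eq0; apply/eqP/filt_sep => n.
pose N := (n + \sum_i l i)%N.
rewrite {1}(Xsum N) -addrA -sumrB; apply: (idlD (idl_filt n)).
  by apply: filt_le (XP N).2; rewrite /N; lia.
apply: (smod_sum (idl_filt n)) => i _; rewrite -mulrBl; apply: (idlMr _ (idl_filt n)).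
rewrite -opprB -mulN1r; apply: (idlMl _ (idl_filt n)).
apply: filt_le (yP i N); rewrite /N (bigD1 i) //=; lia.
Qed.

Hypothesis nA : noeth A.

(** The initial forms of I make up a homogeneous ideal L of the Rees algebra, generated by finitely
    many b i; lifts h i of these to I generate I by successive approximation. *)
Lemma noeth_completion : noeth B.
Proof.
move=> I sI; pose L n a := pow n a /\ exists2 x, I x & filt n.+1 (x - iot a).
have [|||k [l [b [Lb LC]]]] := @rees_fin A m nA L.
- by move=> n a [].
- move=> n; split; first by split; [exact: ideal_pow0 | exists 0; [exact: idl0 | rewrite iot0 subr0; exact: (idl0 (idl_filt _))]].
  move=> a x y [hx [x' Ix Fx]] [hy [y' Iy Fy]]; split; first exact: (idl_pow _ _).2.
  exists (iot a * x' + y'); first exact: sI.2.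
  rewrite iotD iotM (_ : _ - _ = iot a * (x' - iot x) + (y' - iot y)); last by ring.
  exact: (idl_filt n.+1).2.
- move=> n x a xm [ha [y Iy Fy]]; split; first exact: ideal_powE.
  exists (iot x * y); first exact: idlMl.
  rewrite iotM -mulrBr; apply: (@filtM 1 n.+1) => //; apply/filt_iot/ideal_pow1E; exact: xm.
have /choice[h hP] : forall i, exists x, I x /\ filt (l i).+1 (x - iot (b i)).
  by move=> i; have [_ [x Ix Fx]] := Lb i; exists x.
exists (codom h) => x; split=> [Ix|]; last first.
  by apply: (spn_min sI) => _ /codomP[i ->]; exact: (hP i).1.
have [|y ->] := @successive k l h I 0 _ x Ix (filt0 x).
  move=> n z _ Iz Fz; have [a Fa] := approx n.+1 z.
  have pa : pow n a.
    apply/filt_iot; rewrite -[iot a](subKr z); apply: (idlB (idl_filt n)) => //.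
    exact: filt_le Fa.
  have [|c [cm aE]] := LC n a; first by split=> //; exists z.
  exists c; split=> //.
    by apply: idlB => //; apply: (smod_sum sI) => i _; apply: idlMl => //; exact: (hP i).1.
  rewrite -(subrKA (iot a)) {2}aE iot_sum -sumrB; apply: (idlD (idl_filt _)) => //.
  apply: (smod_sum (idl_filt _)) => i _; rewrite iotM -mulrBr -opprB mulrN -mulNr.
  apply: (@filt_le ((n - l i) + (l i).+1)); first by lia.
  apply: filtM; last exact: (hP i).2.
  by rewrite -mulN1r; apply: (idlMl _ (idl_filt _)); apply/filt_iot.
apply: (smod_sum (smod_spn _)) => i _; apply: (@smodZ _ _ _ (smod_spn (V := B^o) _) (y i) (h i)).
by apply: spn_mem; exact: codom_f.
Qed.

Lemma filt_span n (s : seq A) : (forall a, pow n a -> spn (V := A^o) s a) ->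
  forall x, filt n x -> spn (V := B^o) [seq iot a | a <- s] x.
Proof.
move=> ps x Fx.
have [|||k [l [b [Lb LC]]]] := @rees_fin A m nA (fun j => pow (maxn j n)).
- by move=> j a; apply: ideal_pow_le; exact: leq_maxl.
- by move=> j; exact: idl_pow.
- move=> j y a ym ha; apply: (@ideal_pow_le _ _ (maxn j n).+1); last exact: ideal_powE.
  by lia.
have [|y ->] := @successive k l (fun i => iot (b i)) (fun=> True) n _ x I Fx.
  move=> j z nj _ Fz; have [a Fa] := approx j.+1 z.
  have pa : pow (maxn j n) a.
    rewrite (maxn_idPl nj); apply/filt_iot; rewrite -[iot a](subKr z); apply: (idlB (idl_filt j)) => //.
    exact: filt_le Fa.
  have [c [cm aE]] := LC j a pa; exists c; split=> //.
  by under eq_bigr => i _ do rewrite -iotM; rewrite -iot_sum -aE.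
apply: (smod_sum (smod_spn _)) => i _.
apply: (@smodZ _ _ _ (smod_spn (V := B^o) _) (y i) (iot (b i))).
have : spn (V := A^o) s (b i) by apply: ps; apply: ideal_pow_le (Lb i); exact: leq_maxr.
apply: (@spn_min A A^o s (fun a => spn (V := B^o) [seq iot a | a <- s] (iot a))).
  split; first by rewrite iot0; exact: smod0 (smod_spn _).
  by move=> c v w hv hw; rewrite iotD -[c *: v]/(c * v) iotM; exact: (smod_spn (V := B^o) _).2.
by move=> v vs; apply/spn_mem/map_f.
Qed.

Hypothesis lm : mloc (fun a => a \in m).

(** A class outside [filt 1] has unit entries from some index on, and the termwise inverses are
    Cauchy since v_i - v_j = v_i v_j (u_j - u_i). *)
Lemma mloc_completion : mloc (filt 1).
Proof.
have F1 : ~ filt 1 1 by rewrite -iot1 => /filt_iot/ideal_pow1E; rewrite idealr1.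
have mu x : ~ filt 1 x -> exists t, t * x = 1.
  have [u ->] := cls_surj x => nu; have [N uN] := cauchyP u 1.
  have um i : (N <= i)%N -> val u i \notin m.
    move=> Ni; apply/negP => um; apply: nu; apply/filt_cls; exists N => j Nj.
    by rewrite -(subrK (val u i) (val u j)); apply: ideal_powD; [exact: uN | exact/ideal_pow1E].
  have [_ inv] := lm; have /choice[v vP] : forall i, exists t, (N <= i)%N -> t * val u i = 1.
    move=> i; have [Ni|Ni] := boolP (N <= i)%N; last by exists 0.
    by have [t tu] := inv _ (elimN idP (um i Ni)); exists t.
  have vC : v \in cauchy_seq m.
    apply/asboolP => k; have [N' uN'] := cauchyP u k; exists (maxn N N') => i j.
    rewrite !geq_max => /andP[Ni N'i] /andP[Nj N'j].
    rewrite (_ : _ - _ = v i * v j * (val u j - val u i)); first by apply: ideal_powM; exact: uN'.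
    by rewrite mulrBr -mulrA vP // mulr1 mulrAC vP // mul1r.
  exists (cls (mkc vC)); rewrite -clsM -cls1; apply/cls_eq => n; exists N => i Ni.
  rewrite (_ : val _ i = v i * val u i - 1) // vP // subrr; exact: ideal_pow0.
split=> //; split=> // [|x y xy]; first exact: idl_filt.
have [Fx|/mu[t tx]] := pselect (filt 1 x); [by left | right].
by rewrite -[y]mul1r -tx -mulrA; exact: (idlMl _ (idl_filt 1)).
Qed.

End CompletionTheory.

Local Open Scope quotient_scope.

(** * Chains of primes and Krull dimension *)

Section KrullDim.
Variable A : comNzRingType.

Section MkPrime.
Variable p : A -> Prop.
Hypothesis pp : prm p.
Let sp : idl p. Proof. by case: pp. Qed.
Let p1 : ~ p 1. Proof. by case: pp. Qed.
Lemma ipred_prime : prime_idealr_closed (ipred p).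
Proof.
move=> u v /asboolP uv; have [_ _ pM] := pp.
by apply/orP; case: (pM _ _ uv) => H; [left | right]; apply/asboolP.
Qed.
Definition mk_prime : prime_idealr A := HB.pack_for (prime_idealr A) (ipred p)
  (isIdealr.Build A (ipred p) (ipred_closed sp p1)) (isPrimeIdealrClosed.Build A (ipred p) ipred_prime).
Lemma mk_primeE x : (x \in mk_prime) <-> p x.
Proof. by split=> /asboolP. Qed.
End MkPrime.

Lemma prm_of (P : prime_idealr A) : prm (fun x => x \in P).
Proof.
split.
- by split=> [|a x y mx my]; [exact: idealr0 | apply: rpredD => //; exact: idealMr].
- by rewrite idealr1.
- by move=> x y; rewrite prime_idealrM => /orP.
Qed.

Lemma prime_chainP n : prime_chain A n <-> exists p, @pchain A n p.
Proof.
split=> [[P Ps]|[p [c [_ cp cs]]]].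
  exists (fun x => x \in P 0%N), (fun i x => x \in P i); split=> // [i _|i il]; first exact: prm_of.
  by have [H [x xi xn]] := Ps i il; split; [exact: H | exists x => //; exact/negP].
(* [prime_chain] asks for a total sequence of bundled primes, so the chain is made constant after
   index n. *)
exists (fun i => mk_prime (cp (minn i n) (geq_minr i n))) => i il; split.
  move=> x /mk_primeE H; apply/mk_primeE; rewrite (minn_idPl il) in H *.
  by apply: (cs i il).1; move: H; rewrite (minn_idPl (ltnW il)).
have [_ [x xi xn]] := cs i il; exists x; first by apply/mk_primeE; rewrite (minn_idPl il).
by apply/negP => /mk_primeE; rewrite (minn_idPl (ltnW il)).
Qed.

Lemma krull_dim_ex d : (exists p, @prm A p) -> (forall p l, @pchain A l p -> (l <= d)%N) ->
  exists2 e, (e <= d)%N & krull_dim A e.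
Proof.
move=> [p pp] dmax; have cmax n : prime_chain A n -> (n <= d)%N by move=> /prime_chainP[q /dmax].
suff H k : (k <= d)%N -> prime_chain A k -> exists2 e, (e <= d)%N & krull_dim A e.
  by apply: (H 0%N) => //; apply/prime_chainP; exists p; exact: pchain0.
move: {2}(d - k)%N (leqnn (d - k)) => j; elim: j k => [|j IH] k dk kd ck.
  exists k => //; split=> // n /cmax nd; lia.
have [[n [kn cn]]|nn] := pselect (exists n, (k < n)%N /\ prime_chain A n).
  by apply: (IH n) => //; [move: (cmax _ cn); lia | exact: cmax].
exists k => //; split=> // n cn; rewrite leqNgt; apply/negP => kn; apply: nn; by exists n.
Qed.
End KrullDim.

Lemma pchain_phi (R A : comNzRingType) (phi : {rmorphism R -> A}) (phi_surj : forall a, exists x, phi x = a)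
  (p : A -> Prop) l : pchain l p -> pchain l (p \o phi).
Proof.
move=> [c [<- cp cs]]; exists (fun i => c i \o phi); split=> // [i /cp|i /cs[cc [x xi xn]]].
  exact: prm_phi.
split=> [a|]; first exact: cc.
by have [y yx] := phi_surj x; exists y; rewrite /= yx.
Qed.

(** * Unmixedness and the associated primes of A *)

Section Unmixed.
Variables (A : comNzRingType) (m : idealr A).
Hypothesis nA : noeth A.
Hypothesis lm : mloc (fun a => a \in m).
Let M := fun a : A => a \in m.

Lemma ideal_pow_split n k (S : A -> Prop) : (forall x y, S x -> S y -> S (x + y)) -> S 0 ->
  (forall x y, ideal_pow m n x -> ideal_pow m k y -> S (x * y)) -> forall a, ideal_pow m (n + k) a -> S a.
Proof.
elim: n S => [|n IH] S SD S0 SM a; first by move=> ha; rewrite -[a]mul1r; exact: SM.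
apply: (@ideal_pow_ind _ _ (n + k) S) => // x y xm; apply: (IH (fun y => S (x * y))) => [u v||u v hu hv].
- by rewrite mulrDr; exact: SD.
- by rewrite mulr0.
- by rewrite mulrA; apply: SM => //; exact: ideal_powE.
Qed.

(** Let J be maximal among the ideals over K containing no power of m, and x in m outside J. Some
    m^n lies in J + (x) and some x^N in J, whence m^(N n) lies in J. *)
Lemma nil_pow (K : A -> Prop) : idl K -> nilmod M K -> exists n, forall a, ideal_pow m n a -> K a.
Proof.
move=> sK nK; apply: contrapT => nP.
have [|||J [sJ KJ nJ] Jmax] := @acc A A^o (fun J => [/\ idl J, forall a, K a -> J a &
   ~ exists n, forall a, ideal_pow m n a -> J a]).
- by move=> J [].
- exact: nA.
- by exists K.
have [x mx Jx] : exists2 x, x \in m & ~ J x.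
  apply: contrapT => H; apply: nJ; exists 1%N => a /ideal_pow1E am.
  by apply: contrapT => Ja; apply: H; exists a.
have sJx := gen2_idl x 0 sJ.
have JJx a : J a -> gen2 J x 0 a by move=> Ja; exists 0, 0; rewrite !mul0r !subr0.
have xJx : gen2 J x 0 x by exists 1, 0; rewrite mul1r mulr0 subrr subr0; exact: idl0.
have [n nJx] : exists n, forall a, ideal_pow m n a -> gen2 J x 0 a.
  apply: contrapT => H; apply: Jx; apply: (Jmax (gen2 J x 0)) => //; split=> // a Ka; exact/JJx/KJ.
have [N /KJ JxN] := nK x mx; apply: nJ; exists (N * n)%N.
suff H k : forall a, ideal_pow m (k * n) a -> gen2 J (x ^+ k) 0 a.
  move=> a /H[b [c Hb]]; rewrite -(subrK (b * x ^+ N) a); apply: (idlD sJ); last exact: (idlMl _ sJ).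
  by move: Hb; rewrite mulr0 subr0.
elim: k => [|k IH] a.
  by move=> _; exists a, 0; rewrite mulr1 mulr0 subrr subr0; exact: idl0.
rewrite mulSn; move: (k * n)%N IH => k' IH; have sJk := gen2_idl (x ^+ k.+1) 0 sJ.
move: n nJx a => n nJx.
have main b c : gen2 J x 0 b -> gen2 J (x ^+ k) 0 c -> gen2 J (x ^+ k.+1) 0 (b * c).
  move=> [u [u' Hu]] [v [v' Hv]]; exists (u * v), 0.
  have := idlD sJ (idlMl c sJ Hu) (idlMl (u * x) sJ Hv); congr J; rewrite exprS; ring.
move=> ha; apply: (@ideal_pow_split n k' (gen2 J (x ^+ k.+1) 0)) ha.
- by move=> u v; exact: idlD.
- exact: idl0.
- by move=> b c hb hc; apply: main; [exact: nJx | exact: IH].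
Qed.

(** [rees_fin] is applied to the constant family N, the intersection of all m^n. In a degree beyond
    all l i the coefficients lie in m, so N = m N and Nakayama's lemma applies. *)
Lemma krull_intersection a : (forall n, ideal_pow m n a) -> a = 0.
Proof.
move=> ha; pose N b := forall n, ideal_pow m n b.
have sN : idl N by split=> [n|c x y hx hy n]; [exact: ideal_pow0 | exact: (idl_pow m n).2].
have [|||k [l [b [Lb LC]]]] := @rees_fin A m nA (fun=> N) => //.
  by move=> _ x y xm hy; exact: (idlMl _ sN hy).
have [pm mu] := lm; have [sm _ _] := pm.
suff : qin M (fun x : A^o => x = 0) a by apply: mloc_qin => //; exact: smod1.
have bS c : N c -> ispn M (codom b : seq A^o) c.
  move=> Nc; have [x [xm ->]] := LC (\sum_i l i).+1 c Nc.
  apply: (smod_sum (smod_ispn _ sm)) => i _; apply: (ispnZ (a := x i) sm); last exact/spn_mem/codom_f.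
  apply/ideal_pow1E; apply: ideal_pow_le (xm i); rewrite (bigD1 i) //=; lia.
apply: (nakayama pm sm _ smod1 (s := codom b : seq A^o)) => //.
  move=> _ /codomP[i ->]; exists 1; first by case: pm.
  by rewrite scale1r; exists 0 => //; rewrite subr0; apply: bS; exact: Lb.
have [x [_ ->]] := LC 0%N a ha; apply: (smod_sum (smod_spn _)) => i _.
by apply: (@smodZ _ _ _ (smod_spn (V := A^o) _) (x i) (b i)); exact/spn_mem/codom_f.
Qed.

(** If dim A/P were less than dim A, an associated prime Q of the completion over P would have small
    dimension too; unmixedness then bounds the dimension of the completion, and parameters of the
    completion, approximated in A, bound dim A. *)
Lemma unmixed_chain d (P : A -> Prop) (a0 : A) : unmixed m -> krull_dim A d -> prm P ->
  (forall x, P x <-> x * a0 = 0) -> pchain d P.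
Proof.
case: d => [|d] um [cd dmax] pp Pa; first exact: pchain0.
apply: contrapT => nc; have [sP P1 _] := pp; have [pm mu] := lm; have [sm m1 _] := pm.
(* A chain of length d + 1 above P would start at P itself because dim A = d + 1, and no such chain
   exists. *)
have dP : dim_le P d.
  move=> p l pp' Pp cp; rewrite leqNgt; apply/negP => dl.
  have ld : l = d.+1 by have /dmax : prime_chain A l by [apply/prime_chainP; exists p]; lia.
  rewrite ld in cp; have [[x px Px]|H] := pselect (exists2 x, p x & ~ P x).
    have /dmax : prime_chain A d.+2 by apply/prime_chainP; exists P; apply: (pchainS pp Pp _ cp); exists x.
    by rewrite ltnn.
  apply: nc; rewrite (_ : P = p) //; apply/funext => x; apply/propext; split; first exact: Pp.
  by move=> px; apply: contrapT => Px; apply: H; exists x.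
have [ys [yse ym ynil]] := parameters nA lm sP dP; subst d.
have sK : idl (addS (V := A^o) P (spn (ys : seq A^o))) by exact: (smod_add sP (smod_spn _)).
have [n nK] := nil_pow sK ynil.
pose B := completion m; have nB : noeth B := noeth_completion nA.
have lB : mloc (@filt A m 1) := mloc_completion lm.
have al0 : (iot m a0 : B^o) <> 0.
  move=> al0; apply: P1; apply/Pa; rewrite mul1r; apply: krull_intersection => k.
  by apply/filt_iot; rewrite al0; exact: (idl0 (@idl_filt A m k)).
(* Q is an associated prime of the completion that contains the image of P, because P kills a0. *)
have [b pQ] := assoc_ex1 nB al0; set Q := ann _ in pQ; have [sQ Q1 _] := pQ.
have PQ x : P x -> Q (iot m x).
  move=> /Pa xa; rewrite /Q /ann; transitivity (b * iot m (x * a0)); last by rewrite xa iot0 mulr0.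
  by rewrite iotM mulrCA.
have dQ : dim_le Q (size ys).
  rewrite -(size_map (iot m)); apply: (height nB lB sQ).
    move=> x Fx; exists n.
    have Fxn : filt n (x ^+ n) by elim: (n) => [|k IH]; [exact: filt0 | rewrite exprS; exact: (@filtM _ _ 1)].
    have [s sE] := nA (idl_pow m n).
    have sKB : smod (V := B^o) (addS (V := B^o) Q (spn (V := B^o) [seq iot m i | i <- ys])).
      exact: (smod_add sQ (smod_spn _)).
    have := @filt_span A m nA n s (fun a => (sE a).1) _ Fxn; apply: (spn_min sKB) => _ /mapP[v vs ->].
    have [p Pp pv] : addS (V := A^o) P (spn (ys : seq A^o)) v by apply/nK/sE/spn_mem.
    exists (iot m p); first exact: PQ.
    rewrite -iotB; move: pv; apply: (@spn_min A A^o ys (fun a => spn (V := B^o) [seq iot m a | a <- ys] (iot m a))).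
      split; first by rewrite iot0; exact: smod0 (smod_spn _).
      by move=> c v' w hv hw; rewrite iotD -[c *: v']/(c * v') iotM; exact: (smod_spn (V := B^o) _).2.
    by move=> w ws; apply/spn_mem/map_f.
  by move=> _ /mapP[y yy ->]; apply/filt_iot/ideal_pow1E; exact: ym.
pose Q' := mk_prime pQ.
have pi0 (x : B) : \pi_{ideal_quot Q'} x = 0 <-> Q x.
  split=> [/eqP|Qx].
    by rewrite -[0](rmorph0 (\pi_{ideal_quot Q'})) -Quotient.idealrBE subr0 => /mk_primeE.
  by apply/eqP; rewrite -[0](rmorph0 (\pi_{ideal_quot Q'})) -Quotient.idealrBE subr0; exact/mk_primeE.
have pis (y : {ideal_quot Q'}) : exists x, \pi_{ideal_quot Q'} x = y by exists (repr y); rewrite reprK.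
have [||e ed ke] := @krull_dim_ex {ideal_quot Q'} (size ys).
- exists (fun y => y = 0); split.
  + by split=> // a x y -> ->; rewrite scaler0 addr0.
  + by move/eqP; rewrite oner_eq0.
  + move=> x y; have [x' <-] := pis x; have [y' <-] := pis y; rewrite -rmorphM => /pi0.
    by have [_ _ QM] := pQ; case/QM=> /pi0 H; [left | right].
- move=> p l cp; apply: (dQ (p \o \pi_{ideal_quot Q'})).
  + by apply: prm_phi; exact: pchain_prm cp.
  + by move=> a /pi0 /= ->; have [sp _ _] := pchain_prm cp; exact: idl0.
  + exact: (@pchain_phi B {ideal_quot Q'} (\pi_{ideal_quot Q'}) pis p l cp).
have asQ : associated_prime Q'.
  exists (b * iot m a0) => x; apply/idP/eqP; first by move/mk_primeE.
  by move=> xa; apply/mk_primeE.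
have [_ eB] := (um Q' asQ e).1 ke.
have s0 : idl (fun x : B => x = 0) by exact: smod1.
(* By unmixedness the completion has dimension e, so e of its elements generate an ideal primary to
   the maximal ideal. *)
have [|zs [zse zF znil]] := @parameters B nB _ lB e _ s0.
  by move=> p l _ _ cp; apply: eB; apply/prime_chainP; exists p.
pose K' a := spn (V := B^o) zs (iot m a).
have sK' : idl K'.
  split; first by rewrite /K' iot0; exact: smod0 (smod_spn _).
  by move=> c v' w hv hw; rewrite /K' iotD -[c *: v']/(c * v') iotM; exact: (smod_spn (V := B^o) _).2.
have [|n1 n1K] := nil_pow sK'.
  move=> x xm; have [|N [v -> H]] := znil (iot m x); first exact/filt_iot/ideal_pow1E.
  by exists N; rewrite /K' iotX; move: H; rewrite subr0.
(* The parameters are approximated in A modulo m^(n1+1), where m^n1 lies in the ideal they generate;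
   by Nakayama's lemma the approximations still generate an ideal containing m^n1. *)
have /choice[ap apP] : forall z : B, exists a, filt n1.+1 (z - iot m a) by move=> z; exact: approx.
pose zA := [seq ap z | z <- zs].
have spA y : spn (V := B^o) zs y -> exists2 c, spn (zA : seq A^o) c & filt n1.+1 (y - iot m c).
  apply: (@spn_min B B^o zs (fun y => exists2 c, spn (zA : seq A^o) c & filt n1.+1 (y - iot m c))).
    split; first by exists 0; [exact: smod0 (smod_spn _) | rewrite iot0 subr0; exact: (idl0 (@idl_filt A m _))].
    move=> r y1 y2 [c1 h1 f1] [c2 h2 f2]; exists (ap r * c1 + c2); first exact: (smod_spn (V := A^o) _).2.
    have sF := @idl_filt A m n1.+1.
    have := idlD sF (idlD sF (idlMl r sF f1) (idlMr (iot m c1) sF (apP r))) f2.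
    by congr filt; rewrite iotD iotM -[r *: y1]/(r * y1); ring.
  by move=> z zz; exists (ap z); [exact/spn_mem/map_f | exact: apP].
have [s1 s1E] := nA (idl_pow m n1).
have key v : ideal_pow m n1 v -> spn (zA : seq A^o) v.
  move=> hv; apply: (mloc_qin lm (smod_spn _)); move/s1E: hv.
  apply: (nakayama pm sm _ (smod_spn _)) => // w ws; exists 1 => //; rewrite scale1r.
  have hw : ideal_pow m n1 w by apply/s1E/spn_mem.
  have [c hc fc] := spA _ (n1K w hw); exists c => //.
  have : ideal_pow m n1.+1 (w - c) by apply/filt_iot; rewrite iotB.
  apply: (@ideal_pow_ind _ _ n1 (ispn M (s1 : seq A^o))).
  - by move=> x y; exact: (smodD (smod_ispn _ sm)).
  - exact: (smod0 (smod_ispn _ sm)).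
  - by move=> x y xm hy; apply: (ispnZ (a := x) sm) => //; exact/s1E.
have /prime_chainP[p cp] := cd.
have s0A : idl (fun x : A => x = 0) by exact: smod1.
(* The e approximated parameters bound dim A by e, and e is at most [size ys], one less than dim
   A. *)
have := @height A nA _ lm zA _ s0A _ _ p (size ys).+1 (pchain_prm cp) _ cp.
suff -> : size zA = e.
  move=> H; have : (size ys < e)%N; last by rewrite ltnNge ed.
  apply: H.
  - move=> x xm; exists n1; exists 0 => //; rewrite subr0; apply: key.
    by elim: (n1) => [//|k IH]; rewrite exprS; exact: ideal_powE.
  - move=> _ /mapP[z zz ->]; apply/ideal_pow1E/filt_iot.
    rewrite -[iot m _](subKr z); have Fz : filt 1 (z - iot m (ap z)) by apply: filt_le (apP z).
    exact: (idlB (@idl_filt A m 1) (zF z zz) Fz).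
  - by move=> a ->; have [sp _ _] := pchain_prm cp; exact: idl0.
by rewrite size_map.
Qed.
End Unmixed.

(** * Dimension over the residue field as length *)

Section KDim.
Variable A : comNzRingType.
Variable m : A -> Prop.
Hypothesis lm : mloc m.

(** A basis of T/S over A/m, meaningful when m T lies in S; [kdim_len] and [len_kdim] identify h
    with the length of T/S. *)
Definition kdim (V : lmodType A) (S T : V -> Prop) h := exists e : 'I_h -> V,
  [/\ forall i, T (e i), forall x, T x -> exists c : 'I_h -> A, S (x - \sum_i c i *: e i)
    & forall c : 'I_h -> A, S (\sum_i c i *: e i) -> forall i, m (c i)].

Section Quo.
Variables (V : lmodType A) (S T : V -> Prop).
Hypotheses (sS : smod S) (sT : smod T) (ST : forall x, S x -> T x).
Hypothesis mT : forall a x, m a -> T x -> S (a *: x).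

Let mq : mulc m := prm_mulc lm.1.
Let S1 (x : V) := addS S (spn [:: x]).

Lemma spn1P (x y : V) : spn [:: x] y <-> exists a, y = a *: x.
Proof. by split=> [[a /eqP]|[a ->]]; [rewrite subr_eq0 => /eqP ->; exists a | exists a; rewrite /= subrr]. Qed.

Lemma notin_unit x a : T x -> ~ S x -> S (a *: x) -> m a.
Proof.
move=> Tx Sx Sax; have [_ mu] := lm; apply: contrapT => /mu[t ta]; apply: Sx.
by rewrite -[x]scale1r -ta -scalerA; exact: smodZ.
Qed.

Lemma has_len_one x : T x -> ~ S x -> has_len m S (S1 x) 1.
Proof.
move=> Tx Sx; have sx := smod_spn [:: x]; have s1 : smod (S1 x) by exact: smod_add.
have S1x y : spn [:: x] y -> S1 x y by move=> H; exists 0; [exact: smod0 | rewrite subr0].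
have xx : S1 x x by apply/S1x/spn1P; exists 1; rewrite scale1r.
have SS1 y : S y -> S1 x y by move=> Sy; exists y => //; rewrite subrr; exact: smod0.
split; first by exists (S1 x); split=> //; exists x => // /(mloc_qin lm sS).
case=> S' [sS' SS' S'1 [y S'y ny] [S'' [sS'' _ S''1 [z S''z nz] _]]]; apply: nz.
apply: (sub_qin mq).
have S'x : S' x.
  have [s Ss /spn1P[a ya]] := S'1 y S'y; have [_ mu] := lm.
  have [|t ta] := mu a.
    move=> ma; apply: ny; apply: (sub_qin mq); rewrite -(subrK s y) ya.
    by apply: smodD => //; exact: mT.
  rewrite -[x]scale1r -ta -scalerA -ya; apply: smodZ => //; apply: smodB => //; exact: SS'.
have [s Ss /spn1P[a za]] := S''1 z S''z; rewrite -(subrK s z) za; apply: smodD => //; last exact: SS'.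
exact: smodZ.
Qed.

End Quo.

Section Quo2.
Variables (V : lmodType A).
Let mq : mulc m := prm_mulc lm.1.
Implicit Types S T : V -> Prop.

Lemma kdim_len S T h : smod S -> smod T -> (forall x, S x -> T x) ->
  (forall a x, m a -> T x -> S (a *: x)) -> kdim S T h -> has_len m S T h.
Proof.
move=> + sT; elim: h S => [|h IH] S sS ST mT [e [eT espan eind]].
  split=> // -[S' [_ _ S'T [x /S'T/espan[c]]]]; rewrite big_ord0 subr0 => Sx; case; exact: sub_qin.
have e0 : ~ S (e ord0).
  move=> Se; have [pm _] := lm; have [_ m1 _] := pm; apply: m1.
  have := eind (fun i => (i == ord0)%:R) _ ord0; rewrite eqxx; apply.
  by rewrite (bigD1 ord0) //= scale1r big1 ?addr0 // => i /negPf->; rewrite scale0r.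
have sx := smod_spn [:: e ord0]; have s1 : smod (addS S (spn [:: e ord0])) by exact: smod_add.
have S1T x : addS S (spn [:: e ord0]) x -> T x.
  move=> [s Ss /spn1P[a xa]]; rewrite -(subrK s x) xa.
  by apply: smodD => //; [exact: smodZ | exact: ST].
have SS1 x : S x -> addS S (spn [:: e ord0]) x by move=> Sx; exists x => //; rewrite subrr; exact: smod0.
rewrite -add1n; apply: (has_len_add mq sS s1 sT SS1 S1T).
  exact: (has_len_one sS mT (eT ord0) e0).
apply: IH => //; first by move=> a x ma Tx; apply: SS1; exact: mT.
exists (e \o lift ord0); split=> [i|x Tx|c [s Ss /spn1P[a xa]] i]; first exact: eT.
  have [c Sc] := espan x Tx; exists (c \o lift ord0); exists (x - \sum_i c i *: e i) => //.
  apply/spn1P; exists (c ord0); rewrite big_ord_recl /=.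
  by rewrite opprB addrC addrA subrK addrK.
pose c' i := if unlift ord0 i is Some j then c j else - a.
have := eind c' _ (lift ord0 i); rewrite /c' liftK; apply.
rewrite big_ord_recl unlift_none; under eq_bigr => j _ do rewrite liftK.
rewrite scaleNr addrC -xa opprB addrC subrK //.
Qed.

Lemma len_kdim S T h : smod S -> smod T -> (forall x, S x -> T x) ->
  (forall a x, m a -> T x -> S (a *: x)) -> has_len m S T h -> kdim S T h.
Proof.
move=> + sT; elim: h S => [|h IH] S sS ST mT lh.
  exists (fun=> 0); split=> [i|x Tx|c _ []//]; first exact: smod0.
  exists (fun=> 0); rewrite big_ord0 subr0; apply: contrapT => Sx; have [_] := lh; apply.
  by exists T; split=> //; exists x => // /(mloc_qin lm sS).
have [S' [_ _ S'T [x /S'T Tx nx] _]] := lh.1.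
have Sx : ~ S x by move=> Sx; apply: nx; exact: sub_qin.
have sx := smod_spn [:: x]; have s1 : smod (addS S (spn [:: x])) by exact: smod_add.
have S1T y : addS S (spn [:: x]) y -> T y.
  move=> [s Ss /spn1P[a xa]]; rewrite -(subrK s y) xa.
  by apply: smodD => //; [exact: smodZ | exact: ST].
have SS1 y : S y -> addS S (spn [:: x]) y by move=> Sy; exists y => //; rewrite subrr; exact: smod0.
have [a [b [ab h1 h2]]] := has_len_inv mq sS s1 sT SS1 S1T lh.
have a1 := has_len_uniq h1 (has_len_one sS mT Tx Sx).
have bh : b = h by move: ab a1; lia.
rewrite bh in h2; have [|e [eT espan eind]] := IH _ s1 S1T _ h2.
  by move=> c y mc Ty; apply: SS1; exact: mT.
pose e' i := if unlift ord0 i is Some j then e j else x.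
have e'E (c : 'I_h.+1 -> A) : \sum_i c i *: e' i = c ord0 *: x + \sum_i c (lift ord0 i) *: e i.
  rewrite big_ord_recl /e' unlift_none; congr (_ + _).
  by apply: eq_bigr => j _; rewrite liftK.
exists e'; split=> [i|y Ty|c].
- by rewrite /e'; case: unliftP => [j _|_].
- have [c [s Ss /spn1P[d yd]]] := espan y Ty.
  exists (fun i => if unlift ord0 i is Some j then c j else d); rewrite e'E unlift_none.
  under eq_bigr => j _ do rewrite liftK.
  by rewrite opprD addrCA addrC -yd opprB addrC subrK.
rewrite e'E => Sc; have Hc : forall i, m (c (lift ord0 i)).
  apply: eind; exists (c ord0 *: x + \sum_i c (lift ord0 i) *: e i) => //.
  by apply/spn1P; exists (- c ord0); rewrite opprD addrCA subrr addr0 scaleNr.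
move=> i; case: (unliftP ord0 i) => [j ->|->]; first exact: Hc.
apply: (notin_unit sS Tx Sx); rewrite -[X in S X](addrK (\sum_i c (lift ord0 i) *: e i)).
by apply: smodB => //; apply: (smod_sum sS) => j _; exact: mT.
Qed.
End Quo2.
End KDim.

(** * Cohomology of V^a -> V^b -> V^c given by two matrices *)

Section Windows.
Variable A : comNzRingType.

Definition mact a b (K : 'M[A]_(a, b)) (V : lmodType A) (y : 'I_b -> V) : 'I_a -> V :=
  fun i => \sum_j K i j *: y j.

Lemma mact_linear a b (K : 'M[A]_(a, b)) V : linear (@mact a b K V).
Proof.
move=> c y z; apply/funext => i; rewrite [RHS](_ : _ = c *: mact K y i + mact K z i) //.
rewrite /mact scaler_sumr -big_split; apply: eq_bigr => j _ /=.
by rewrite [X in _ *: X](_ : _ = c *: y j + z j) // scalerDr scaleC.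
Qed.

Definition mactL a b (K : 'M[A]_(a, b)) (V : lmodType A) := mkL (@mact_linear a b K V).

Lemma mactM a b c (K : 'M[A]_(a, b)) (L : 'M[A]_(b, c)) (V : lmodType A) (y : 'I_c -> V) :
  mact (K *m L) y = mact K (mact L y).
Proof.
apply/funext => i; rewrite /mact; under [RHS]eq_bigr => j _ do rewrite scaler_sumr.
rewrite exchange_big; apply: eq_bigr => j _ /=; rewrite mxE scaler_suml.
by apply: eq_bigr => k _; rewrite scalerA.
Qed.

Lemma mactD a b (K L : 'M[A]_(a, b)) (V : lmodType A) (y : 'I_b -> V) : mact (K + L) y = mact K y + mact L y.
Proof.
apply/funext => i; rewrite [RHS](_ : _ = mact K y i + mact L y i) // /mact -big_split.
by apply: eq_bigr => j _; rewrite mxE scalerDl.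
Qed.

Lemma mact0 a b (V : lmodType A) (y : 'I_b -> V) : mact (0 : 'M[A]_(a, b)) y = 0.
Proof. by apply/funext => i; rewrite /mact big1 // => j _; rewrite mxE scale0r. Qed.

Lemma mactC b (x : A) (V : lmodType A) (y : 'I_b -> V) : mact (x%:M) y = x *: y.
Proof.
apply/funext => i; rewrite /mact (bigD1 i) //= big1 ?addr0 => [|j ij].
  by rewrite mxE eqxx.
by rewrite mxE eq_sym (negPf ij) scale0r.
Qed.

Lemma mact_map a b (K : 'M[A]_(a, b)) (U V : lmodType A) (f : {linear U -> V}) (y : 'I_b -> U) :
  mact K (f \o y) = f \o mact K y.
Proof. by apply/funext => i; rewrite /mact /= linear_sum; apply: eq_bigr => j _; rewrite linearZZ. Qed.

Lemma mactr0 a b (K : 'M[A]_(a, b)) (V : lmodType A) : mact K (0 : 'I_b -> V) = 0.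
Proof. exact: (linear0 (mactL K V)). Qed.
Lemma mactrB a b (K : 'M[A]_(a, b)) (V : lmodType A) (y z : 'I_b -> V) : mact K (y - z) = mact K y - mact K z.
Proof. exact: (linearB (mactL K V)). Qed.

(** With [Bw] and [hnull]: cocycles, boundaries and vanishing of cohomology at the middle of V^a ->
    V^b -> V^c. For the matrices of a free resolution of A/m, or their transposes, this is Ext or
    Tor. *)
Definition Zw b c (L : 'M[A]_(c, b)) (V : lmodType A) (y : 'I_b -> V) := mact L y = 0.
Definition Bw a b (K : 'M[A]_(b, a)) (V : lmodType A) (y : 'I_b -> V) := exists w : 'I_a -> V, y = mact K w.
Definition hnull a b c (K : 'M[A]_(b, a)) (L : 'M[A]_(c, b)) (V : lmodType A) :=
  forall y : 'I_b -> V, Zw L y -> Bw K y.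

Lemma smod_Zw b c (L : 'M[A]_(c, b)) (V : lmodType A) : smod (@Zw b c L V).
Proof. exact: (smod_preim (mactL L V) smod1). Qed.

Lemma smod_Bw a b (K : 'M[A]_(b, a)) (V : lmodType A) : smod (@Bw a b K V).
Proof.
split; first by exists 0; rewrite mactr0.
by move=> c _ _ [w ->] [w' ->]; exists (c *: w + w'); rewrite mact_linear.
Qed.

Lemma Bw_Zw a b c (K : 'M[A]_(b, a)) (L : 'M[A]_(c, b)) (V : lmodType A) : L *m K = 0 ->
  forall y : 'I_b -> V, Bw K y -> Zw L y.
Proof. by move=> LK _ [w ->]; rewrite /Zw -mactM LK mact0. Qed.

Section Ses.
Variables (U V W : lmodType A) (i : {linear U -> V}) (p : {linear V -> W}).
Hypothesis sip : ses i p.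

Lemma fun_surj b (w : 'I_b -> W) : exists v : 'I_b -> V, p \o v = w.
Proof.
have [_ ps _] := sip; have /choice[v vE] : forall j, exists x, p x = w j by move=> j.
by exists v; apply/funext.
Qed.

Lemma fun_ker b (v : 'I_b -> V) : p \o v = 0 -> exists u : 'I_b -> U, v = i \o u.
Proof.
move=> pv; have [_ _ ip] := sip; have /choice[u uE] : forall j, exists x, v j = i x.
  by move=> j; apply/ip; rewrite -[p (v j)]/((p \o v) j) pv.
by exists u; apply/funext.
Qed.

Lemma fun_inj b (u u' : 'I_b -> U) : i \o u = i \o u' -> u = u'.
Proof. move=> e; have [iI _ _] := sip; apply/funext => j; apply: iI; exact: (congr1 (@^~ j) e). Qed.

Lemma fun_pi b (u : 'I_b -> U) : p \o (i \o u) = 0.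
Proof. by apply/funext => j /=; rewrite (ses_pi sip). Qed.

Variables (a b c d : nat) (K : 'M[A]_(b, a)) (L : 'M[A]_(c, b)) (N : 'M[A]_(d, c)).

Lemma compB n (f : {linear V -> W}) (x y : 'I_n -> V) : f \o (x - y)%R = (f \o x : 'I_n -> W) - (f \o y : 'I_n -> W).
Proof. by apply/funext => j; rewrite [LHS](linearB f). Qed.

Lemma hnull_sub : L *m K = 0 -> hnull K L W -> (forall u : 'I_c -> U, Zw N u -> Bw L (i \o u)) -> hnull L N U.
Proof.
move=> LK hW iu u Nu; have [v vE] := iu u Nu.
have [w wE] : Bw K (p \o v) by apply: hW; rewrite /Zw mact_map -vE fun_pi.
have [w' w'E] := fun_surj w; have [|u' u'E] := @fun_ker b (v - mact K w').
  by rewrite compB -mact_map w'E wE subrr.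
by exists u'; apply: fun_inj; rewrite -mact_map -u'E mactrB -mactM LK mact0 subr0.
Qed.

Lemma hnull_quo : hnull K L V -> hnull L N U -> N *m L = 0 -> hnull K L W.
Proof.
move=> hV hU NL w Lw; have [v vw] := fun_surj w.
have [|u uE] := @fun_ker c (mact L v); first by rewrite -mact_map vw.
have [|u' u'E] := hU u.
  apply: fun_inj; rewrite -mact_map -uE -mactM NL mact0; apply/funext => j /=; by rewrite linear0.
have [|v' v'E] := hV (v - (i \o u' : 'I_b -> V)).
  by rewrite /Zw mactrB mact_map -u'E uE subrr.
exists (p \o v'); rewrite mact_map -v'E; apply/funext => j; rewrite -vw.
by rewrite [RHS](linearB p) [X in _ - X](ses_pi sip) subr0.
Qed.

(** The connecting isomorphism as a relation: w and u are related when some lift v of w satisfies L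
    v = i u. Acyclicity of V at K, L gives injectivity, and the vanishing of the map induced by i
    gives surjectivity. *)
Lemma hlen_conn m h : mulc m -> L *m K = 0 -> N *m L = 0 -> hnull K L V ->
  (forall u : 'I_c -> U, Zw N u -> Bw L (i \o u)) ->
  has_len m (@Bw _ _ K W) (@Zw _ _ L W) h <-> has_len m (@Bw _ _ L U) (@Zw _ _ N U) h.
Proof.
move=> mm LK NL hV iu.
pose r (w : 'I_b -> W) (u : 'I_c -> U) := exists v : 'I_b -> V, p \o v = w /\ mact L v = i \o u.
have r0 : r 0 0.
  by exists 0; split; [|rewrite mactr0]; apply/funext => j /=; rewrite linear0.
have rP x w u w' u' : r w u -> r w' u' -> r (x *: w + w') (x *: u + u').
  move=> [v [<- vu]] [v' [<- vu']]; exists (x *: v + v'); split.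
    by apply/funext => j; rewrite [LHS](linearP p).
  by rewrite mact_linear vu vu'; apply/funext => j; rewrite [RHS](linearP i).
have tot w : Zw L w -> exists2 u, Zw N u & r w u.
  move=> Lw; have [v vw] := fun_surj w; have [|u uE] := @fun_ker c (mact L v); first by rewrite -mact_map vw.
  exists u; last by exists v.
  apply: fun_inj; rewrite -mact_map -uE -mactM NL mact0; apply/funext => j /=; by rewrite linear0.
have tot' u : Zw N u -> exists2 w, Zw L w & r w u.
  move=> Nu; have [v vE] := iu u Nu; exists (p \o v); last by exists v.
  by rewrite /Zw mact_map -vE fun_pi.
have ref w u : r w u -> Bw L u -> Bw K w.
  move=> [v [<- vu]] [u' u'E]; have [|v' v'E] := hV (v - (i \o u' : 'I_b -> V)).
    by rewrite /Zw mactrB mact_map -u'E vu subrr.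
  exists (p \o v'); rewrite mact_map -v'E; apply/funext => j.
  by rewrite [RHS](linearB p) [X in _ - X](ses_pi sip) subr0.
have ref' w u : r w u -> Bw K w -> Bw L u.
  move=> [v [vw vu]] [w' w'E]; have [w2 w2E] := fun_surj w'; have [|u' u'E] := @fun_ker b (v - mact K w2).
    by rewrite compB -mact_map w2E vw w'E subrr.
  by exists u'; apply: fun_inj; rewrite -mact_map -u'E mactrB -mactM LK mact0 subr0.
have [[[sBK sZL] sBL] sZN] := (smod_Bw K W, smod_Zw L W, smod_Bw L U, smod_Zw N U).
split.
  apply: (@has_len_rel A m _ _ h r) => //; try exact: Bw_Zw.
  - by move=> w /tot[u Zu ru]; exists 1, u; rewrite scale1r; split=> //; exact: mm.1.
  - by move=> u /tot'[w Zu ru]; exists 1, w; rewrite scale1r; split=> //; exact: mm.1.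
  - by move=> w u _ ru Bu; apply: (sub_qin mm); exact: ref Bu.
  - by move=> w u _ ru Bu; apply: (sub_qin mm); exact: ref' Bu.
apply: (@has_len_rel A m _ _ h (fun u w => r w u)) => //; try exact: Bw_Zw.
- by move=> x u w u' w'; exact: rP.
- by move=> w /tot'[u Zu ru]; exists 1, u; rewrite scale1r; split=> //; exact: mm.1.
- by move=> u /tot[w Zu ru]; exists 1, w; rewrite scale1r; split=> //; exact: mm.1.
- by move=> w u _ ru Bu; apply: (sub_qin mm); exact: ref' Bu.
- by move=> w u _ ru Bu; apply: (sub_qin mm); exact: ref Bu.
Qed.
End Ses.
End Windows.

(** * A free resolution of the residue field *)

Section Resolution.
Variable A : comNzRingType.
Variable m : A -> Prop.

(* [kr_E i : A^(e_i) -> A^(e_(i+1))] is the transpose of the i-th differential of a free resolution of A/m,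
   shifted so that [e_0 = 0]: cohomology of Y^e at [e_(i+1)] is Ext^i(A/m, Y), homology of the transposes there is Tor_i. *)
Record kres := KRes {
  kr_e : nat -> nat;
  kr_E : forall i, 'M[A]_(kr_e i.+1, kr_e i);
  kr_e0 : kr_e 0 = 0%N;
  kr_e1 : kr_e 1 = 1%N;
  kr_EE : forall i, kr_E i.+1 *m kr_E i = 0;
  kr_H : forall x, m x -> forall i, exists S T, x%:M = kr_E i *m S + T *m kr_E i.+1;
  kr_T : forall i, hnull (kr_E i.+2)^T (kr_E i.+1)^T (A : comNzRingType)^o;
  kr_m : forall x : A, m x <-> Bw (kr_E 1)^T (fun=> x : A^o) }.

Lemma mulmx_lift a b c (K : 'M[A]_(b, a)) (L : 'M[A]_(c, b)) n (X : 'M[A]_(b, n)) :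
  hnull K L (A : comNzRingType)^o -> L *m X = 0 -> exists Y, X = K *m Y.
Proof.
move=> H LX; have /choice[y yE] : forall j, exists w : 'I_a -> A^o, (fun i => X i j) = mact K w.
  move=> j; apply: H; apply/funext => i; have := congr1 (fun M : 'M__ => M i j) LX.
  by rewrite !mxE => H0; exact: H0.
exists (\matrix_(i, j) y j i); apply/matrixP => i j.
rewrite -[LHS]/((fun i => X i j) i) yE mxE /mact; apply: eq_bigr => k _.
by rewrite mxE.
Qed.

Hypothesis nA : noeth A.
Hypothesis sm : idl m.

Lemma matrix_ker b c (L : 'M[A]_(c, b)) : exists a (K : 'M[A]_(b, a)), L *m K = 0 /\ hnull K L (A : comNzRingType)^o.
Proof.
have [s sE] := fgs_sub nA (fgm_free A b) (smod_Zw L (A : comNzRingType)^o).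
exists (size s), (\matrix_(i, j) (s`_j : 'I_b -> A) i); split.
  apply/matrixP => i j; rewrite !mxE.
  have /(sE _).2 : spn s s`_j by apply/spn_mem/mem_nth.
  move=> /(congr1 (@^~ i)) H0; transitivity (mact L (s`_j : 'I_b -> A^o) i); last exact: H0.
  by apply: eq_bigr => k _; rewrite mxE.
move=> y /sE/spnE[w ->]; exists w; apply/funext => i; rewrite sumfE /mact.
by apply: eq_bigr => j _; rewrite mxE [RHS]mulrC.
Qed.

(** Generators of m are followed by iterated syzygies, finitely generated by noetherianity; [st]
    bundles each matrix with its sizes so that the recursion typechecks. *)
Lemma kres_ex : inhabited kres.
Proof.
have [s sE] := nA sm.
pose D0 : 'M[A]_(1, size s) := \matrix_(i, j) s`_j.
have nxt_ex : forall st : {a : nat & {b : nat & 'M[A]_(a, b)}},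
    exists t : {c : nat & 'M[A]_(projT1 (projT2 st), c)},
      projT2 (projT2 st) *m projT2 t = 0 /\ hnull (projT2 t) (projT2 (projT2 st)) (A : comNzRingType)^o.
  move=> [a [b L]]; have [c [K KP]] := matrix_ker L; by exists (existT _ c K).
pose nxt st := projT1 (cid (nxt_ex st)); have nxtP st := projT2 (cid (nxt_ex st)).
pose st := fix st n : {a : nat & {b : nat & 'M[A]_(a, b)}} := if n is n'.+1 then
   existT (fun a => {b : nat & 'M[A]_(a, b)}) (projT1 (projT2 (st n'))) (nxt (st n'))
   else existT _ 1%N (existT _ (size s) D0).
pose e i := if i is i'.+1 then projT1 (st i') else 0%N.
pose E i : 'M[A]_(e i.+1, e i) := match i return 'M[A]_(e i.+1, e i) with
  | 0 => 0 | i'.+1 => (projT2 (projT2 (st i')))^T end.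
have EE i : E i.+1 *m E i = 0.
  case: i => [|i]; first by rewrite mulmx0.
  have [H _] := nxtP (st i); rewrite -[E i.+2]/((projT2 (nxt (st i)))^T) -[E i.+1]/((projT2 (projT2 (st i)))^T).
  by rewrite -trmx_mul H trmx0.
have ET i : hnull (E i.+2)^T (E i.+1)^T (A : comNzRingType)^o.
  have [_ H] := nxtP (st i); rewrite -[E i.+2]/((projT2 (nxt (st i)))^T) -[E i.+1]/((projT2 (projT2 (st i)))^T).
  by rewrite !trmxK.
have Em x : m x <-> Bw (E 1%N)^T (fun=> x : A^o).
  rewrite -[E 1%N]/(D0^T) trmxK; split=> [/sE/spnE[w xw]|[w xw]].
    exists w; apply/funext => i; rewrite xw /mact; apply: eq_bigr => j _; by rewrite mxE [RHS]mulrC.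
  apply/sE/spnE; exists w; rewrite [LHS](congr1 (@^~ ord0) xw) /mact; apply: eq_bigr => j _.
  by rewrite mxE [LHS]mulrC.
exists; apply: (@KRes e E) => // x mx.
have EEt i : (E i)^T *m (E i.+1)^T = 0 by rewrite -trmx_mul EE trmx0.
(* With D the i-th differential, D T D = x D makes x - T D take values in the kernel of D, so it
   lifts through the next differential. This continues the null-homotopy of multiplication by x. *)
have key i : exists T, (E i.+1)^T *m T *m (E i.+1)^T = x *: (E i.+1)^T.
  elim: i => [|i [T TE]].
    have [w wE] := (Em x).1 mx; exists (\matrix_(i, j) w i).
    rewrite -mul_scalar_mx; congr (_ *m _); apply/matrixP => i j.
    rewrite !ord1 !mxE eqxx [RHS](congr1 (@^~ ord0) wE) /mact; apply: eq_bigr => k _; by rewrite ?mxE.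
  have [|Y YE] := mulmx_lift (X := x%:M - T *m (E i.+1)^T) (ET i).
    by rewrite mulmxBr mulmxA TE mul_mx_scalar subrr.
  exists Y; rewrite -YE mulmxBl mul_scalar_mx -mulmxA EEt mulmx0 subr0 //.
move=> [|i].
  have [w wE] := (Em x).1 mx; exists 0, (\matrix_(i, j) w j).
  rewrite mul0mx add0r; apply/matrixP => i j.
  rewrite !ord1 !mxE eqxx [LHS](congr1 (@^~ ord0) wE) /mact; apply: eq_bigr => k _.
  by rewrite ?mxE [RHS]mulrC ?mxE.
have [T TE] := key i.
have [|Y YE] := mulmx_lift (X := x%:M - T *m (E i.+1)^T) (ET i).
  by rewrite mulmxBr mulmxA TE mul_mx_scalar subrr.
exists T^T, Y^T; have := congr1 trmx YE; rewrite linearB /= tr_scalar_mx !trmx_mul !trmxK => <-.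
by rewrite addrC subrK.
Qed.
End Resolution.

(** * Duality Hom(-, J) for an injective J *)

Section HomModule.
Variables (A : comNzRingType) (m : A -> Prop).
Hypothesis lm : mloc m.

Definition hom (M J : lmodType A) : lmodType A := subm (Submod (smod_lin M J)).
Definition hap (M J : lmodType A) (f : hom M J) : {linear M -> J} := mkL (sincP f : linear (sinc (Submod (smod_lin M J)) f)).

Arguments hap : simpl never.
Section Hap.
Variables M J : lmodType A.
Lemma hapP a (f g : hom M J) x : hap (a *: f + g) x = a *: hap f x + hap g x.
Proof. exact: (congr1 (@^~ x) (linearP (sinc (Submod (smod_lin M J))) a f g)). Qed.
Lemma hap_inj (f g : hom M J) : (forall x, hap f x = hap g x) -> f = g.
Proof. by move=> fg; apply: sinc_inj; apply/funext => x; exact: fg. Qed.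
Lemma hap_ex (f : {linear M -> J}) : exists g : hom M J, forall x, hap g x = f x.
Proof.
have [g gE] := @sinc_surj _ _ (Submod (smod_lin M J)) (f : M -> J) (linP f).
by exists g => x; rewrite /hap mkLE gE.
Qed.
Lemma hap0 x : hap (0 : hom M J) x = 0.
Proof. exact: (congr1 (@^~ x) (linear0 (sinc (Submod (smod_lin M J))))). Qed.
Lemma hapZ a (f : hom M J) x : hap (a *: f) x = a *: hap f x.
Proof. by rewrite -[a *: f]addr0 hapP hap0 addr0. Qed.
Lemma hapD (f g : hom M J) x : hap (f + g) x = hap f x + hap g x.
Proof. by rewrite -[f]scale1r hapP !scale1r. Qed.
Lemma hap_sum (I : Type) (r : seq I) (P : pred I) (F : I -> hom M J) x :
  hap (\sum_(i <- r | P i) F i) x = \sum_(i <- r | P i) hap (F i) x.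
Proof. by elim/big_rec2: _ => [|i y1 y2 _ <-]; rewrite ?hap0 ?hapD. Qed.

Definition ev b (f : 'I_b -> hom M J) (y : 'I_b -> M) : J := \sum_i hap (f i) (y i).

Lemma ev_linear b (f : 'I_b -> hom M J) : linear (ev f).
Proof.
move=> a y z; rewrite /ev scaler_sumr -big_split; apply: eq_bigr => i _ /=.
by rewrite [LHS](_ : _ = hap (f i) (a *: y i + z i)) // linearP.
Qed.

Lemma ev_ex b (F : {linear ('I_b -> M) -> J}) : exists f, forall y, ev f y = F y.
Proof.
pose s (i : 'I_b) (x : M) : 'I_b -> M := fun j => if j == i then x else 0.
have sL i : linear (s i).
  move=> a x y; apply/funext => j; rewrite [RHS](_ : _ = a *: s i x j + s i y j) // /s.
  by case: eqP => // _; rewrite scaler0 addr0.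
have /choice[f fE] : forall i, exists g : hom M J, forall x, hap g x = (F \o mkL (sL i)) x.
  by move=> i; exact: hap_ex.
exists f => y; rewrite /ev; under eq_bigr => i _ do rewrite fE /=.
rewrite -linear_sum; congr (F _); apply/funext => j; rewrite sumfE (bigD1 j) //= big1 => [|i ij].
  by rewrite addr0 /s eqxx.
by rewrite /s eq_sym (negPf ij).
Qed.

Lemma ev_inj b (f g : 'I_b -> hom M J) : (forall y, ev f y = ev g y) -> f = g.
Proof.
move=> fg; apply/funext => i; apply: hap_inj => x.
pose y j := if j == i then x else 0.
have yi (g' : 'I_b -> hom M J) : ev g' y = hap (g' i) x.
  rewrite /ev (bigD1 i) // {1}/y eqxx big1 => [|j /negPf ji]; first exact: addr0.
  by rewrite /y ji linear0.
by rewrite -!yi.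
Qed.

(** Matrices act on the two sides of the pairing by transposes of each other; this is why Hom(-, J)
    exchanges Ext and Tor. *)
Lemma ev_mact b c (L : 'M[A]_(c, b)) (f : 'I_c -> hom M J) y : ev (mact L^T f) y = ev f (mact L y).
Proof.
rewrite /ev /mact; under eq_bigr => i _ do rewrite hap_sum.
rewrite exchange_big; apply: eq_bigr => j _; rewrite linear_sum; apply: eq_bigr => i _.
by rewrite hapZ mxE linearZZ.
Qed.

Lemma ev_comb b a (f g : 'I_b -> hom M J) y : ev (a *: f + g) y = a *: ev f y + ev g y.
Proof.
rewrite /ev scaler_sumr -big_split; apply: eq_bigr => i _ /=.
by rewrite [LHS](_ : _ = hap (a *: f i + g i) (y i)) // hapP.
Qed.

Lemma ev_sum b k (c : 'I_k -> A) (f : 'I_k -> 'I_b -> hom M J) y : ev (\sum_i c i *: f i) y = \sum_i c i *: ev (f i) y.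
Proof.
have eL : linear (fun f : 'I_b -> hom M J => ev f y) by move=> a g h; exact: ev_comb.
rewrite -[LHS]/(mkL eL (\sum_i c i *: f i)) linear_sum; apply: eq_bigr => i _; by rewrite linearZZ.
Qed.
End Hap.

Section Duality.
Variables (M J : lmodType A).
Hypothesis Jinj : injective_module J.
Variables (a b c : nat) (K : 'M[A]_(b, a)) (L : 'M[A]_(c, b)).
Hypothesis LK : L *m K = 0.

Lemma factor_mact (X : lmodType A) (F : {linear ('I_b -> X) -> J}) : (forall y, Zw L y -> F y = 0) ->
  exists G : {linear ('I_c -> X) -> J}, forall y, G (mact L y) = F y.
Proof.
move=> F0; pose R := Submod (smod_img (mactL L X) smodT).
have [p pE] : exists p : {linear ('I_b -> X) -> subm R}, forall y, sinc R (p y) = mactL L X y.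
  apply: lin_lift; first exact: sinc_inj.
  by move=> y; apply: (@sinc_surj _ _ R); exists y.
have [||g gE] := @lin_factor _ _ _ _ p F.
- move=> z; have [y _ yE] := sincP z; exists y; apply: sinc_inj; by rewrite pE.
- by move=> v pv; apply: F0; have := pE v; rewrite pv linear0 => H; symmetry; exact: H.
have [G GE] := Jinj g (@sinc_inj _ _ R); exists G => y.
by rewrite -[mact L y]/(mactL L X y) -pE GE gE.
Qed.

(** A functional vanishing on the kernel of L factors through the image of L, and injectivity of J
    extends it to the whole target. *)
Lemma dual_Bw (f : 'I_b -> hom M J) : Bw L^T f <-> forall y, Zw L y -> ev f y = 0.
Proof.
split=> [[g ->] y Ly|f0]; first by rewrite ev_mact Ly -[ev g 0]/(mkL (ev_linear g) 0) linear0.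
have [G GE] := @factor_mact M (mkL (ev_linear f)) f0.
have [g gE] := ev_ex G; exists g; apply: ev_inj => y; by rewrite ev_mact gE GE.
Qed.

Lemma dual_Zw (f : 'I_b -> hom M J) : Zw K^T f <-> forall y, Bw K y -> ev f y = 0.
Proof.
split=> [Kf _ [w ->]|f0].
  by rewrite -ev_mact Kf /ev big1 // => i _; rewrite hap0.
apply: ev_inj => w; rewrite ev_mact f0; last by exists w.
by rewrite /ev big1 // => i _; rewrite hap0.
Qed.

Hypothesis KL : forall x, m x -> exists S T, x%:M = K *m S + T *m L.

Lemma killed X (V : lmodType A) (y : 'I_b -> V) : m X -> Zw L y -> Bw K (X *: y).
Proof.
move=> /KL[S [T e]] Ly; exists (mact S y).
by rewrite -mactC e mactD !mactM Ly mactr0 addr0.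
Qed.

(** On ker L a cocycle takes values in the socle of J, because m kills the cohomology of M; with
    zero socle it is a boundary. *)
Lemma dual_null : (forall y : J, soc m y -> y = 0) -> hnull L^T K^T (hom M J).
Proof.
move=> J0 f /dual_Zw f0; apply/dual_Bw => y Ly; apply: J0 => x mx.
by rewrite -[ev f y]/(mkL (ev_linear f) y) -linearZZ mkLE f0 //; exact: killed.
Qed.

(** A basis of the cohomology of M and a generator y0 of the socle give a dual basis: the i-th
    coordinate times y0, well defined on cocycles because m kills y0, and extended to all tuples by
    injectivity of J. *)
Lemma dual_len h : (exists y0 : J, [/\ soc m y0, y0 <> 0 & forall y, soc m y -> exists a, y = a *: y0]) ->
  has_len m (@Bw _ _ _ K M) (@Zw _ _ _ L M) h -> has_len m (@Bw _ _ _ L^T (hom M J)) (@Zw _ _ _ K^T (hom M J)) h.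
Proof.
move=> [y0 [sy0 y00 y0g]] hl.
have KtLt : K^T *m L^T = 0 by rewrite -trmx_mul LK trmx0.
have [sB sZ] := (smod_Bw K M, smod_Zw L M).
have BZ (y : 'I_b -> M) : Bw K y -> Zw L y by exact: Bw_Zw.
have [e [eZ espan eind]] : kdim m (@Bw _ _ _ K M) (@Zw _ _ _ L M) h.
  apply: (len_kdim lm sB sZ BZ _ hl) => x y mx; exact: killed.
have ann0 x : x *: y0 = 0 -> m x.
  move=> xy; have [_ mu] := lm; apply: contrapT => /mu[t tx]; apply: y00.
  by rewrite -[y0]scale1r -tx -scalerA xy scaler0.
pose Z := Submod sZ.
have /choice[cf cfP] : forall z : subm Z, exists c : 'I_h -> A, Bw K (sinc Z z - \sum_i c i *: e i).
  by move=> z; apply: espan; exact: (sincP z).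
have cfL i : linear (fun z : subm Z => cf z i *: y0).
  move=> x z z'; apply/eqP; rewrite -subr_eq0 scalerA -scalerDl -scalerBl; apply/eqP; apply: sy0.
  pose dd i := cf (x *: z + z') i - (x * cf z i + cf z' i).
  apply: (eind dd); have H := sB.2 x _ _ (cfP z) (cfP z').
  have := smodB sB H (cfP (x *: z + z')); congr (Bw K _); rewrite linearP.
  have -> : \sum_i dd i *: e i = \sum_i cf (x *: z + z') i *: e i - (x *: (\sum_i cf z i *: e i) + \sum_i cf z' i *: e i).
    rewrite scaler_sumr -big_split -sumrB; apply: eq_bigr => j _ /=.
    by rewrite scalerBl scalerDl scalerA.
  have gen (u v w t r : 'I_b -> M) : (u - v) + (w - t) - (u + w - r) = r - (v + t).
    by rewrite addrACA -opprD opprB [LHS]addrC subrKA.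
  by rewrite scalerBr gen.
have /choice[F FE] : forall i, exists F : {linear ('I_b -> M) -> J}, forall z, F (sinc Z z) = cf z i *: y0.
  by move=> i; have [F FE] := Jinj (mkL (cfL i)) (@sinc_inj _ _ Z); exists F.
have /choice[f fE] : forall i, exists f : 'I_b -> hom M J, forall y, ev f y = F i y by move=> i; exact: ev_ex.
have FB i y : Bw K y -> F i y = 0.
  move=> By; have [z zy] := @sinc_surj _ _ Z y (BZ _ By); rewrite -zy FE; apply: sy0.
  apply: (eind (cf z)); have := smodB sB By (cfP z); by rewrite zy subKr.
have Fe i j : F i (e j) = (i == j)%:R *: y0.
  have [z zy] := @sinc_surj _ _ Z (e j) (eZ j); rewrite -zy FE; apply/eqP.
  rewrite -subr_eq0 -scalerBl; apply/eqP/sy0.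
  pose dd i := (i == j)%:R - cf z i : A.
  have H : m (dd i).
    apply: (eind dd); have := cfP z; rewrite zy; congr (Bw K _).
    rewrite [in RHS](eq_bigr (fun i => (i == j)%:R *: e i - cf z i *: e i)) => [|k _]; last by rewrite scalerBl.
    rewrite sumrB; congr (_ - _); rewrite (bigD1 j) //= eqxx scale1r big1 ?addr0 // => k /negPf->.
    by rewrite scale0r.
  by rewrite -opprB -mulN1r; apply: idlMl => //; case: lm => -[].
apply: (kdim_len lm (smod_Bw _ _) (smod_Zw _ _) (Bw_Zw KtLt)).
  move=> x g mx /dual_Zw g0; apply/dual_Bw => y Ly.
  rewrite -[x *: g]addr0 ev_comb -[ev g y]/(mkL (ev_linear g) y) -linearZZ mkLE g0; last exact: killed.
  by rewrite add0r /ev big1 // => i _; rewrite hap0.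
exists f; split=> [i|g /dual_Zw g0|d /dual_Bw d0 i].
- by apply/dual_Zw => y By; rewrite fE FB.
- have /choice[d dE] : forall i, exists d, ev g (e i) = d *: y0.
    move=> i; apply: y0g => x mx; rewrite -[ev g _]/(mkL (ev_linear g) (e i)) -linearZZ mkLE g0 //.
    exact: killed.
  exists d; apply/dual_Bw => y /espan[cc /[dup] Hc].
  have evB u : Bw K u -> ev (g - \sum_i d i *: f i) u = 0.
    move=> Bu; rewrite -scaleN1r addrC ev_comb g0 // ev_sum big1 ?scaler0 ?addr0 // => i _.
    by rewrite fE FB // scaler0.
  move=> /evB; rewrite -[LHS]/(mkL (ev_linear (g - \sum_i d i *: f i)) (y - \sum_i cc i *: e i)).
  rewrite linearB => /eqP; rewrite subr_eq0 => /eqP; rewrite mkLE => ->.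
  rewrite linear_sum big1 // => i _; rewrite linearZZ mkLE -scaleN1r addrC ev_comb dE ev_sum.
  rewrite (bigD1 i) //= fE Fe eqxx scale1r big1 => [|k /negPf ki].
    by rewrite addr0 scaleN1r addNr scaler0.
  by rewrite fE Fe ki scale0r scaler0.
apply: ann0; rewrite -(d0 (e i) (eZ i)) ev_sum (bigD1 i) //= fE Fe eqxx scale1r big1 ?addr0 // => k /negPf ki.
by rewrite fE Fe ki scale0r scaler0.
Qed.
End Duality.
End HomModule.

(** * Lengths of finite powers *)

Section Powers.
Variables (A : comNzRingType) (m : A -> Prop).
Hypothesis mq : mulc m.

Lemma has_len_pow (X : lmodType A) (S T : X -> Prop) h r : smod S -> smod T -> (forall x, S x -> T x) -> has_len m S T h ->
  has_len m (fun y : 'I_r -> X => forall j, S (y j)) (fun y => forall j, T (y j)) (r * h).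
Proof.
move=> sS sT ST hl.
have sP k (Q : 'I_k -> X -> Prop) : (forall j, smod (Q j)) -> smod (fun y : 'I_k -> X => forall j, Q j (y j)).
  by move=> sQ; split=> [j|a x y Qx Qy j]; [exact: smod0 | exact: (sQ j).2].
elim: r => [|r IH].
  rewrite mul0n; split=> // -[S' [_ _ _ [x _ nx] _]]; apply: nx; apply: (sub_qin mq) => -[] //.
pose I (y : 'I_r.+1 -> X) := T (y ord0) /\ forall j, S (y (lift ord0 j)).
have sI : smod I.
  split; first by split=> [|j]; exact: smod0.
  by move=> a x y [Tx Sx] [Ty Sy]; split=> [|j]; [exact: sT.2 | exact: sS.2].
have sSr := sP r.+1 (fun=> S) (fun=> sS); have sTr := sP r.+1 (fun=> T) (fun=> sT).
have SI y : (forall j : 'I_r.+1, S (y j)) -> I y by move=> Sy; split=> // ; exact: ST.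
have IT y : I y -> forall j : 'I_r.+1, T (y j).
  by move=> [Ty Sy] j; case: (unliftP ord0 j) => [k ->|->//]; exact: ST.
rewrite mulSn; apply: (has_len_add mq sSr sI sTr SI IT).
  have fL : linear (fun x : X => (fun j : 'I_r.+1 => if j == ord0 then x else 0)).
    move=> a x y; apply/funext => j; rewrite [RHS](_ : _ = a *: (if j == ord0 then x else 0) + (if j == ord0 then y else 0)) //.
    by case: eqP => // _; rewrite scaler0 addr0.
  apply: (@len_img A m X ('I_r.+1 -> X) h (mkL fL) S T _ I mq sS sT sSr sI ST SI _ _ _ _ hl).
  - by move=> x Tx; split=> // j; exact: smod0.
  - move=> y [Ty Sy]; apply: (sub_qin mq); exists (y ord0) => // j.
    rewrite [X in S X](_ : _ = y j - (if j == ord0 then y ord0 else 0)) //.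
    by case: (unliftP ord0 j) => [k ->|->] /=; rewrite ?subr0 ?subrr //; exact: smod0.
  - by move=> x Sx j; rewrite mkLE; case: eqP => // _; exact: smod0.
  - by move=> x _ /(_ ord0); rewrite mkLE eqxx; exact: (sub_qin mq).
have fL : linear (fun y : 'I_r -> X => (fun j : 'I_r.+1 => if unlift ord0 j is Some k then y k else 0)).
  move=> a x y; apply/funext => j; rewrite [RHS](_ : _ = a *: (if unlift ord0 j is Some k then x k else 0)
     + (if unlift ord0 j is Some k then y k else 0)) //.
  by case: unliftP => // _; rewrite scaler0 addr0.
have sS' := sP r (fun=> S) (fun=> sS); have sT' := sP r (fun=> T) (fun=> sT).
apply: (@len_img A m ('I_r -> X) ('I_r.+1 -> X) _ (mkL fL) _ _ I _ mq sS' sT' sI sTr _ IT _ _ _ _ IH).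
- by move=> y Sy j; exact: ST.
- by move=> y Ty j; rewrite mkLE; case: unliftP => [k _|_]; [exact: Ty | exact: smod0].
- move=> y Ty; apply: (sub_qin mq); exists (y \o lift ord0); first by move=> j; exact: Ty.
  split.
    rewrite [X in T X](_ : _ = y ord0 - (if unlift ord0 (@ord0 r) is Some k then y (lift ord0 k) else 0)) //.
    by rewrite unlift_none subr0.
  move=> j; rewrite [X in S X](_ : _ = y (lift ord0 j) - (if unlift ord0 (lift ord0 j) is Some k then y (lift ord0 k) else 0)) //.
  by rewrite liftK subrr; exact: smod0.
- by move=> y Sy; split=> [|j]; rewrite mkLE ?unlift_none ?liftK //; exact: smod0.
- by move=> y _ [_ Sy]; apply: (sub_qin mq) => j; have := Sy j; rewrite mkLE liftK.
Qed.

Lemma ml_pow (X : lmodType A) a b : ml m X a -> ml m ('I_b -> X : lmodType A) (b * a).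
Proof.
move=> /(has_len_pow b (@smod1 A X) (@smodT A X) (fun _ _ => I)); congr has_len; apply/funext => y; apply/propext.
  by split=> [y0|->//]; apply/funext.
by split.
Qed.

Lemma ml_free a b : ml m (A : comNzRingType)^o a -> ml m (free A b) (b * a).
Proof. exact: ml_pow. Qed.
End Powers.

(** * Ext and Tor with the residue field *)

Section ExtTor.
Variables (A : comNzRingType) (m : A -> Prop).
Hypothesis lm : mloc m.
Variable G : kres m.
Local Notation e := (kr_e G).
Local Notation E := (kr_E G).
Implicit Types (U V W : lmodType A).
Let mq : mulc m := prm_mulc lm.1.
Let sm : idl m. Proof. by case: lm => -[]. Qed.

Lemma EEt i : (E i)^T *m (E i.+1)^T = 0. Proof. by rewrite -trmx_mul kr_EE trmx0. Qed.
Lemma kr_Ht x : m x -> forall i, exists S T, x%:M = (E i.+1)^T *m S + T *m (E i)^T.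
Proof.
move=> mx i; have [S [T e]] := kr_H G mx i; exists T^T, S^T.
by rewrite addrC -!trmx_mul -linearD /= -e tr_scalar_mx.
Qed.

(** [enull] and [tnull] are the vanishing of Ext^i(A/m, V) and Tor_i(A/m, V), [elen] and [tlen]
    their dimensions, and [ezero] and [tzero] say that f induces zero on them. *)
Definition enull i V := hnull (E i) (E i.+1) V.
Definition tnull i V := hnull (E i.+1)^T (E i)^T V.
Definition elen i V h := has_len m (@Bw _ _ _ (E i) V) (@Zw _ _ _ (E i.+1) V) h.
Definition tlen i V h := has_len m (@Bw _ _ _ (E i.+1)^T V) (@Zw _ _ _ (E i)^T V) h.
Definition ezero i U V (f : {linear U -> V}) := forall u : 'I_(e i.+1) -> U, Zw (E i.+1) u -> Bw (E i) (f \o u).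
Definition tzero i U V (f : {linear U -> V}) := forall u : 'I_(e i.+1) -> U, Zw (E i)^T u -> Bw (E i.+1)^T (f \o u).

Lemma Zw_map b c (L : 'M[A]_(c, b)) U V (f : {linear U -> V}) u : Zw L u -> Zw L (f \o u).
Proof. by move=> Lu; rewrite /Zw mact_map Lu; apply/funext => j /=; rewrite linear0. Qed.
Lemma Bw_map a b (K : 'M[A]_(b, a)) U V (f : {linear U -> V}) u : Bw K u -> Bw K (f \o u).
Proof. by move=> [w ->]; exists (f \o w); rewrite mact_map. Qed.

Lemma enull_zero i U V (f : {linear U -> V}) : enull i V -> ezero i f.
Proof. by move=> H u Zu; apply: H; exact: Zw_map. Qed.
Lemma tnull_zero i U V (f : {linear U -> V}) : tnull i V -> tzero i f.
Proof. by move=> H u Zu; apply: H; exact: Zw_map. Qed.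

Section Ses.
Variables (U V W : lmodType A) (i : {linear U -> V}) (p : {linear V -> W}).
Hypothesis sip : ses i p.
Lemma e_sub n : enull n W -> ezero n.+1 i -> enull n.+1 U.
Proof. exact: (hnull_sub sip (kr_EE G n)). Qed.
Lemma e_quo n : enull n V -> enull n.+1 U -> enull n W.
Proof. move=> h1 h2; exact: (hnull_quo sip h1 h2 (kr_EE G n.+1)). Qed.
Lemma e_conn n h : enull n V -> ezero n.+1 i -> elen n W h <-> elen n.+1 U h.
Proof. exact: (hlen_conn sip h mq (kr_EE G n) (kr_EE G n.+1)). Qed.
Lemma t_conn n h : tnull n.+1 V -> tzero n i -> tlen n.+1 W h <-> tlen n U h.
Proof. exact: (hlen_conn sip h mq (EEt n.+1) (EEt n)). Qed.
End Ses.

Section Prod.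
Variables (U V : lmodType A).
Let UV : lmodType A := (U * V)%type.
Lemma fst_linear : linear (fun x : UV => x.1). Proof. by []. Qed.
Lemma snd_linear : linear (fun x : UV => x.2). Proof. by []. Qed.
Definition pfst := mkL fst_linear.
Definition psnd := mkL snd_linear.
Lemma Bw_pair a b (K : 'M[A]_(b, a)) (y : 'I_b -> UV) : Bw K (pfst \o y) -> Bw K (psnd \o y) -> Bw K y.
Proof.
move=> [w1 e1] [w2 e2]; exists (fun j => (w1 j, w2 j)).
have p1 : pfst \o (mact K (fun j => (w1 j, w2 j) : UV)) = mact K w1 by rewrite -mact_map.
have p2 : psnd \o (mact K (fun j => (w1 j, w2 j) : UV)) = mact K w2 by rewrite -mact_map.
apply/funext => j; rewrite [LHS]surjective_pairing [RHS]surjective_pairing; congr pair.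
  by move: (congr1 (@^~ j) e1) (congr1 (@^~ j) p1) => /= -> ->.
by move: (congr1 (@^~ j) e2) (congr1 (@^~ j) p2) => /= -> ->.
Qed.
Lemma hnull_prod a b c (K : 'M[A]_(b, a)) (L : 'M[A]_(c, b)) : hnull K L U -> hnull K L V -> hnull K L UV.
Proof. by move=> hU hV y Ly; apply: Bw_pair; [apply: hU | apply: hV]; exact: Zw_map. Qed.
End Prod.

Section Power.
Variables (X : lmodType A) (r : nat).
Definition pr (j : 'I_r) : {linear ('I_r -> X) -> X} := mkL (fun a (x y : 'I_r -> X) => erefl (a *: x j + y j)).
Lemma Bw_pow a b (K : 'M[A]_(b, a)) (y : 'I_b -> 'I_r -> X) : (forall j, Bw K (pr j \o y)) -> Bw K y.
Proof.
move=> /choice[w wE]; exists (fun i j => w j i); apply/funext => i; apply/funext => j.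
have := congr1 (@^~ i) (wE j) => /= ->.
have -> : w j = pr j \o (fun i j => w j i) by [].
by rewrite mact_map.
Qed.
Lemma hnull_pow a b c (K : 'M[A]_(b, a)) (L : 'M[A]_(c, b)) : hnull K L X -> hnull K L ('I_r -> X).
Proof. by move=> hX y Ly; apply: Bw_pow => j; apply: hX; exact: Zw_map. Qed.
Lemma Zw_pow b c (L : 'M[A]_(c, b)) (y : 'I_b -> 'I_r -> X) : (forall j, Zw L (pr j \o y)) -> Zw L y.
Proof.
move=> H; apply/funext => i; apply/funext => j; have := congr1 (@^~ i) (H j).
by rewrite mact_map.
Qed.
End Power.
Arguments pr {X r}.

Lemma hlen_pow (X : lmodType A) a b c (K : 'M[A]_(b, a)) (L : 'M[A]_(c, b)) h r : L *m K = 0 ->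
  has_len m (@Bw _ _ _ K X) (@Zw _ _ _ L X) h -> has_len m (@Bw _ _ _ K ('I_r -> X)) (@Zw _ _ _ L ('I_r -> X)) (r * h).
Proof.
move=> LK /(has_len_pow mq r (smod_Bw K X) (smod_Zw L X) (Bw_Zw LK)).
have sP (Q : ('I_b -> X) -> Prop) : smod Q -> smod (fun y : 'I_r -> 'I_b -> X => forall j, Q (y j)).
  by move=> sQ; split=> [j|x u v Qx Qy j]; [exact: smod0 | exact: sQ.2].
have sw (y : 'I_r -> 'I_b -> X) j : pr j \o (fun i j => y j i) = y j by [].
have sw' (z : 'I_b -> 'I_r -> X) j : pr j \o z = (fun i => z i j) by [].
apply: (@has_len_rel A m _ _ (r * h) (fun (y : 'I_r -> 'I_b -> X) (z : 'I_b -> 'I_r -> X) => forall i j, z i j = y j i)).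
- exact: mq.
- exact: (sP _ (smod_Bw K X)).
- exact: (sP _ (smod_Zw L X)).
- exact: smod_Bw.
- exact: smod_Zw.
- by move=> y By j; exact: (Bw_Zw LK).
- exact: Bw_Zw.
- by [].
- by move=> x y z y' z' yz yz' i j; rewrite [LHS](_ : _ = x *: z i j + z' i j) // yz yz'.
- move=> y Zy; exists 1, (fun i j => y j i); rewrite scale1r; split=> //; first exact: mq.1.
  by apply: Zw_pow => j; exact: Zy.
- move=> z Zz; exists 1, (fun j i => z i j); rewrite scale1r; split=> //; first exact: mq.1.
  by move=> j; rewrite -sw'; exact: Zw_map.
- move=> y z _ yz Bz; apply: (sub_qin mq) => j; rewrite (_ : y j = pr j \o z); last by apply/funext => i /=; rewrite yz.
  exact: Bw_map.
- move=> y z _ yz By; apply: (sub_qin mq); apply: Bw_pow => j; rewrite (_ : pr j \o z = y j) //; by apply/funext => i; exact: yz.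
Qed.

Lemma hlen_iso U V (f : {linear U -> V}) a b c (K : 'M[A]_(b, a)) (L : 'M[A]_(c, b)) h : L *m K = 0 -> bijective f ->
  has_len m (@Bw _ _ _ K U) (@Zw _ _ _ L U) h -> has_len m (@Bw _ _ _ K V) (@Zw _ _ _ L V) h.
Proof.
move=> LK [g fK gK].
have gL : linear g by move=> x u v; apply: (can_inj fK); rewrite linearP !gK.
pose g' := mkL gL.
have fg b' (y : 'I_b' -> V) : f \o (g' \o y) = y by apply/funext => j /=; rewrite gK.
have gf b' (y : 'I_b' -> U) : g' \o (f \o y) = y by apply/funext => j /=; rewrite fK.
have FL : linear (fun y : 'I_b -> U => f \o y).
  by move=> x y z; apply/funext => j; rewrite [LHS](linearP f).
apply: (@len_img A m _ _ h (mkL FL) _ _ _ _ mq (smod_Bw K U) (smod_Zw L U) (smod_Bw K V) (smod_Zw L V)).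
- exact: Bw_Zw.
- exact: Bw_Zw.
- by move=> y; exact: Zw_map.
- move=> y Zy; apply: (sub_qin mq); exists (g' \o y); first exact: Zw_map.
  by rewrite mkLE fg subrr; exact: (smod0 (smod_Bw K V)).
- by move=> y; exact: Bw_map.
- by move=> y _ /(Bw_map g'); rewrite mkLE gf; exact: (sub_qin mq).
Qed.

Lemma elen0 V i h : enull i V -> elen i V h <-> h = 0%N.
Proof.
move=> H; have H0 : elen i V 0.
  by split=> // -[S' [_ _ S'Z [y /S'Z/H By ny] _]]; apply: ny; exact: (sub_qin mq).
by split=> [h1|->//]; exact: (has_len_uniq h1 H0).
Qed.

Lemma elen_null V i : elen i V 0 -> enull i V.
Proof.
move=> [_ H] y Zy; apply: contrapT => By; apply: H; exists (@Zw _ _ _ (E i.+1) V); split=> //.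
- exact: smod_Zw.
- exact: (Bw_Zw (kr_EE G i)).
- by exists y => // /(mloc_qin lm (smod_Bw _ _)).
Qed.

Lemma tnull_free b i : tnull i.+1 (free A b).
Proof. by apply: hnull_pow; exact: kr_T. Qed.

Lemma enull_free b i : enull i (A : comNzRingType)^o -> enull i (free A b).
Proof. exact: hnull_pow. Qed.

(** The generators are added one at a time, and each step has length 0 or 1. *)
Lemma len_gen V (S : V -> Prop) s : smod S -> (forall x a, x \in s -> m a -> S (a *: x)) ->
  exists h, has_len m S (addS S (spn s)) h.
Proof.
elim: s S => [|v s IH] S sS mS.
  exists 0%N; split=> // -[S' [_ _ S'Z [y /S'Z[x Sx yx] ny] _]]; apply: ny; apply: (sub_qin mq).
  by move: yx => /= /eqP; rewrite subr_eq0 => /eqP->.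
have sv := smod_spn [:: v]; have s1 : smod (addS S (spn [:: v])) by exact: smod_add.
have SS1 x : S x -> addS S (spn [:: v]) x by move=> Sx; exists x => //; rewrite subrr; exact: smod0.
have [|h hh] := IH _ s1.
  by move=> x a xs ma; apply: SS1; apply: mS => //; rewrite inE xs orbT.
have s2 : smod (addS (addS S (spn [:: v])) (spn s)) by exact: (smod_add s1 (smod_spn _)).
have s12 x : addS S (spn [:: v]) x -> addS (addS S (spn [:: v])) (spn s) x.
  by move=> Sx; exists x => //; rewrite subrr; exact: (smod0 (smod_spn _)).
have -> : addS S (spn (v :: s)) = addS (addS S (spn [:: v])) (spn s).
  apply/funext => x; apply/propext; split=> [[y Sy [a xs]]|[y [z Sz /spn1P[a yz]] xs]].
    exists (y + a *: v); last by rewrite opprD addrA.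
    by exists y => //; apply/spn1P; exists a; rewrite addrC addKr.
  by exists z => //; exists a; rewrite -yz opprB addrA subrK.
have [Sv|Sv] := pselect (S v).
  exists h; rewrite (_ : addS S (spn [:: v]) = S) in hh *; first exact: hh.
  apply/funext => x; apply/propext; split; last exact: SS1.
  by move=> [y Sy /spn1P[a xy]]; rewrite -(subrK y x) xy; apply: smodD => //; exact: smodZ.
exists (1 + h)%N; apply: (has_len_add mq sS s1 s2 SS1 s12) => //.
have sT : smod (addS S (spn [:: v])) := s1.
apply: (has_len_one (T := addS S (spn [:: v])) lm sS _ _ Sv).
  move=> a x ma [y Sy /spn1P[c xy]]; rewrite -(subrK y x) xy scalerDr scaleC.
  by apply: smodD => //; apply: smodZ => //; apply: mS => //; exact: mem_head.
by exists 0; [exact: smod0 | apply/spn1P; exists 1; rewrite scale1r subr0].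
Qed.

Lemma fgm_pow V b' : fgm V -> fgm ('I_b' -> V : lmodType A).
Proof.
move=> fV; have [b [f fs]] := free_cover fV.
  elim: b' => [|b' _].
    by exists [::] => y; split=> // _ /=; apply/funext => -[].
  have fL : linear (fun y : 'I_b'.+1 -> 'I_b -> A^o => (fun j => f (y j))).
    by move=> a x y; apply/funext => j; rewrite [LHS](linearP f).
  apply: (fgm_img (f := mkL fL)); last first.
    by move=> v; have /choice[y yv] := fun j => fs (v j); exists y; apply/funext.
  apply/fgmP; exists #|{: 'I_b'.+1 * 'I_b}|, (fun k => fun i j => (enum_val k == (i, j))%:R) => y.
  exists (fun k => y (enum_val k).1 (enum_val k).2).
  apply/funext => i1; apply/funext => j; rewrite sumfE sumfE (bigD1 (enum_rank (i1, j))) //= big1 => [|k kn].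
    by rewrite addr0 [RHS](_ : _ = y (enum_val (enum_rank (i1, j))).1 (enum_val (enum_rank (i1, j))).2 * (enum_val (enum_rank (i1, j)) == (i1, j))%:R) //
      enum_rankK eqxx mulr1.
  rewrite [LHS](_ : _ = y (enum_val k).1 (enum_val k).2 * (enum_val k == (i1, j))%:R) //.
  by rewrite -(inj_eq enum_rank_inj) enum_valK (negPf kn) mulr0.
Qed.

Lemma elen_ex V i : noeth A -> fgm V -> exists h, elen i V h.
Proof.
move=> nA fV.
have [s sE] := fgs_sub nA (fgm_pow (e i.+1) fV) (smod_Zw (E i.+1) V).
have [|h hh] := @len_gen _ (@Bw _ _ _ (E i) V) s (smod_Bw _ _).
  move=> x a xs ma; apply: (killed (fun x mx => kr_H G mx i) ma); exact/sE/spn_mem.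
exists h; rewrite /elen (_ : @Zw _ _ _ (E i.+1) V = addS (@Bw _ _ _ (E i) V) (spn s)) //.
apply/funext => y; apply/propext; split=> [/sE sy|[z Bz sy]].
  by exists 0; [exact: (smod0 (smod_Bw _ _)) | rewrite subr0].
rewrite -(subrK z y); apply: (smodD (smod_Zw _ _)); first exact/sE.
exact: (Bw_Zw (kr_EE G i)).
Qed.

(* The single index of positions 1, where Ext^0 and Tor_0 live. *)
Lemma e1_const (T : Type) (y : 'I_(e 1) -> T) i j : y i = y j.
Proof. by have H n : n = 1%N -> forall k l : 'I_n, k = l; [move=> -> k l; rewrite !ord1 | congr y; exact: (H _ (kr_e1 G))]. Qed.

Lemma e0_empty (j : 'I_(e 0)) : False.
Proof. by have H n : n = 0%N -> 'I_n -> False; [move=> -> [] | exact: (H _ (kr_e0 G) j)]. Qed.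

Definition i0 : 'I_(e 1) := cast_ord (esym (kr_e1 G)) ord0.

Lemma Zw_soc V (y : V) : Zw (E 1) (fun=> y) <-> soc m y.
Proof.
have yE k : mact (E 1) (fun=> y) k = E 1 k i0 *: y.
  rewrite /mact (bigD1 i0) //= big1 ?addr0 // => j ji; exfalso.
  by move/eqP: ji; apply; exact: (e1_const id).
have eE (w : 'I_(e 2) -> A^o) : mact (E 1)^T w i0 = \sum_k E 1 k i0 * w k.
  by apply: eq_bigr => k _; rewrite mxE.
split=> [Zy a /(kr_m G)[w aw]|sy].
  rewrite [a](congr1 (@^~ i0) aw) eE scaler_suml big1 // => k _.
  by rewrite mulrC -scalerA -yE Zy scaler0.
apply/funext => k; rewrite yE; apply: sy; apply/(kr_m G); exists (fun j => (j == k)%:R : A^o).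
apply: funext => i; rewrite (e1_const (mact _ _) i i0) eE (bigD1 k) //= eqxx mulr1 big1 ?addr0 // => j /negPf->.
by rewrite mulr0.
Qed.

Lemma Bw_e0 V (y : 'I_(e 1) -> V) : Bw (E 0) y <-> y = 0.
Proof.
split=> [[w ->]|->]; last by exists 0; rewrite mactr0.
apply/funext => i; rewrite /mact; apply: big1 => j _; exfalso.
exact: e0_empty j.
Qed.

Lemma enull0P V : enull 0 V <-> forall y : V, soc m y -> y = 0.
Proof.
split=> [H y /Zw_soc/H/Bw_e0 y0|H y Zy]; first exact: (congr1 (@^~ i0) y0).
apply/Bw_e0/funext => i; apply: H; apply/Zw_soc.
by rewrite (_ : (fun=> _) = y) //; apply/funext => j; exact: e1_const.
Qed.

Lemma elen0P V h : elen 0 V h <-> has_len m (fun y : V => y = 0) (soc m (V := V)) h.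
Proof.
have s1 := @smod1 _ V; have s2 := @soc_smod _ m V.
have s3 := smod_Bw (E 0) V; have s4 := smod_Zw (E 1) V.
have BZ := @Bw_Zw _ _ _ _ (E 0) (E 1) V (kr_EE G 0).
have s0 (y : V) : y = 0 -> soc m y by move=> ->; exact: smod0.
have cst (y : 'I_(e 1) -> V) : (fun=> y i0) = y by apply/funext => j; exact: e1_const.
split.
  apply: (@has_len_rel A m _ _ h (fun y x => y i0 = x)) => //.
  - by move=> a x y x' y' <- <-.
  - move=> y Zy; exists 1, (y i0); rewrite scale1r; split=> //; first exact: mq.1.
    by apply/Zw_soc; rewrite cst.
  - move=> y /Zw_soc Zy; exists 1, (fun=> y); rewrite scale1r; split=> //; exact: mq.1.
  - move=> y x _ <- y0; apply: (sub_qin mq); apply/Bw_e0; rewrite -(cst y) y0 //.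
  - by move=> x y _ <- /Bw_e0 ->; apply: (sub_qin mq).
apply: (@has_len_rel A m _ _ h (fun x y => y i0 = x)) => //.
- by move=> a x y x' y' <- <-.
- move=> y /Zw_soc Zy; exists 1, (fun=> y); rewrite scale1r; split=> //; exact: mq.1.
- move=> y Zy; exists 1, (y i0); rewrite scale1r; split=> //; first exact: mq.1.
  by apply/Zw_soc; rewrite cst.
- by move=> x y _ <- /Bw_e0 ->; apply: (sub_qin mq).
- move=> y x _ <- y0; apply: (sub_qin mq); apply/Bw_e0; rewrite -(cst x) y0 //.
Qed.

(** The submodule m V, written as an image under the transpose of the first matrix of the
    resolution, so that it is directly the boundary module of Tor_0. *)
Definition mmul V (y : V) := Bw (E 1)^T (fun=> y : V).

Lemma Zw_e0 V (y : 'I_(e 1) -> V) : Zw (E 0)^T y.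
Proof. by apply/funext => i; exfalso; exact: e0_empty i. Qed.

Lemma smod_mmul V : smod (@mmul V).
Proof. by have [B0 BP] := smod_Bw (E 1)^T V; split=> // a x y hx hy; exact: BP. Qed.

Lemma mmulZ V a (y : V) : m a -> mmul (a *: y).
Proof.
move=> /(kr_m G)[w aw]; exists (fun k => w k *: y); apply/funext => i.
rewrite [a](congr1 (@^~ i) aw) /mact scaler_suml; apply: eq_bigr => k _; by rewrite scalerA.
Qed.

Lemma mmul_min V (S : V -> Prop) y : smod S -> (forall a x, m a -> S (a *: x)) -> mmul y -> S y.
Proof.
move=> sS mS [w wE]; rewrite [y](congr1 (@^~ i0) wE) /mact; apply: (smod_sum sS) => k _; apply: mS.
rewrite mxE; apply/(kr_m G); exists (fun j => (j == k)%:R : A^o).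
apply: funext => i; rewrite (e1_const (mact _ _) i i0) /mact (bigD1 k) //= eqxx big1 => [|j /negPf->].
  by rewrite mxE addr0 [RHS]mulr1.
by rewrite scaler0.
Qed.

Lemma mmul_free b (y : free A b) : mmul y <-> forall j, m (y j).
Proof.
split=> [|my].
  apply: (@mmul_min (free A b) (fun y => forall j, m (y j))) => [|a x ma j].
    split=> [j|a x z mx mz j]; first exact: idl0.
    by apply: (idlD sm) => //; exact: (idlMl _ sm).
  exact: (idlMr (x j) sm ma).
apply: Bw_pow => j; have /(kr_m G)[w yw] := my j; exists w; exact: yw.
Qed.

Lemma tlen0P V h : tlen 0 V h <-> has_len m (@mmul V) (fun=> True) h.
Proof.
have s1 := smod_mmul V; have s2 := @smodT _ V.
have s3 := smod_Bw (E 1)^T V; have s4 := smod_Zw (E 0)^T V.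
have BZ (y : 'I_(e 1) -> V) : Bw (E 1)^T y -> Zw (E 0)^T y by move=> _; exact: Zw_e0.
have cst (y : 'I_(e 1) -> V) : (fun=> y i0) = y by apply/funext => j; exact: e1_const.
split.
  apply: (@has_len_rel A m _ _ h (fun y x => y i0 = x)) => //.
  - by move=> a x y x' y' <- <-.
  - move=> y Zy; exists 1, (y i0); rewrite scale1r; split=> //; first exact: mq.1.
  - move=> y _; exists 1, (fun=> y); rewrite scale1r; split=> //; [exact: mq.1 | exact: Zw_e0].
  - by move=> y x _ <- y0; apply: (sub_qin mq); rewrite -(cst y).
  - by move=> x y _ <- y0; apply: (sub_qin mq); rewrite /mmul cst.
apply: (@has_len_rel A m _ _ h (fun x y => y i0 = x)) => //.
- by move=> a x y x' y' <- <-.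
- move=> y _; exists 1, (fun=> y); rewrite scale1r; split=> //; [exact: mq.1 | exact: Zw_e0].
- move=> y Zy; exists 1, (y i0); rewrite scale1r; split=> //; first exact: mq.1.
- by move=> x y _ <- y0; apply: (sub_qin mq); rewrite /mmul cst.
- by move=> y x _ <- y0; apply: (sub_qin mq); rewrite -(cst x).
Qed.

Lemma tzero_mmul U V (f : {linear U -> V}) : (forall x, mmul (f x)) -> tzero 0 f.
Proof.
move=> fm u _; have := fm (u i0); rewrite /mmul (_ : (fun=> _) = f \o u) //.
by apply/funext => j /=; congr (f _); exact: e1_const.
Qed.

(** f is a sum of maps through a single coordinate, multiplied by entries in m, and m kills Ext. *)
Lemma ezero_matrix b c i (f : {linear free A c -> free A b}) : (forall x, mmul (f x)) -> ezero i f.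
Proof.
move=> fm u Zu; pose a j k := f (fe A j) k.
have am j k : m (a j k) by have /mmul_free H := fm (fe A j); exact: H.
have eL k : linear (fun x : A^o => x *: fe A k : free A b).
  by move=> x y z; rewrite scalerDl -scalerA.
have -> : f \o u = \sum_j \sum_k a j k *: (mkL (eL k) \o (pr j \o u) : 'I_(e i.+1) -> free A b).
  apply/funext => n; apply/funext => k0 /=.
  rewrite [in LHS](free_sum (u n)) linear_sum sumfE sumfE sumfE; apply: eq_bigr => j _.
  rewrite linearZZ sumfE sumfE (bigD1 k0) //= big1 => [|k kn].
    rewrite addr0 [LHS](_ : _ = u n j * a j k0) // [RHS](_ : _ = a j k0 * (u n j * (k0 == k0)%:R)) //.
    by rewrite eqxx mulr1 mulrC.
  by rewrite [LHS](_ : _ = a j k * (u n j * (k == k0)%:R)) // (negPf kn) !mulr0.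
apply: (smod_sum (smod_Bw _ _)) => j _; apply: (smod_sum (smod_Bw _ _)) => k _.
by apply: (killed (fun x mx => kr_H G mx i) (am j k)); do 2!apply: Zw_map.
Qed.
End ExtTor.
Arguments pr {A X r}.

(** * The complex Hom(M, J) with reversed indexing *)

Section Reversal.
Variable A : comNzRingType.

Definition zmd : lmodType A := free A 0.
Lemma zmd0 (x : zmd) : x = 0. Proof. by apply/funext => -[]. Qed.

Section Def.
Variables (J : nat -> lmodType A) (dl : forall i, {linear J i -> J i.+1}).

(** J read downwards from index e, by recursion rather than as J (e - j), so that the differentials
    typecheck without casts. [rev_ind] transfers a statement about two consecutive differentials. *)
Fixpoint rev e j : lmodType A :=
  match e, j with e, 0 => J e | 0, j'.+1 => zmd | e'.+1, j'.+1 => rev e' j' end.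

Fixpoint dr e j : {linear rev e j.+1 -> rev e j} :=
  match e, j return {linear rev e j.+1 -> rev e j} with
  | 0, j => \0
  | e'.+1, 0 => match e' return {linear rev e' 0 -> J e'.+1} with 0 => dl 0 | e''.+1 => dl e''.+1 end
  | e'.+1, j'.+1 => dr e' j' end.

Lemma rev_ind (Q : forall U V W : lmodType A, {linear U -> V} -> {linear V -> W} -> Prop) e j :
  (j.+2 <= e)%N -> (forall n, (n + j.+2)%N = e -> Q _ _ _ (dl n) (dl n.+1)) -> Q _ _ _ (dr e j.+1) (dr e j).
Proof.
elim: j e => [|j IH] [|e] //; last first.
  by move=> je H; apply: IH => // n ne; apply: H; rewrite -ne addnS.
by case: e => [|[|e]] // _; [apply | move=> H; apply: (H e.+1); rewrite addn2].
Qed.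

Lemma rev_zero e j : (forall x : J 0, x = 0) -> (e <= j)%N -> forall x : rev e j, x = 0.
Proof.
move=> J0; elim: e j => [|e IH] [|j] //=; first by move=> _ x; exact: zmd0.
by move=> ej; exact: IH.
Qed.
End Def.

Variables (m : A -> Prop) (d : nat) (J : nat -> lmodType A) (dl : forall i, {linear J i -> J i.+1}).
Hypothesis lm : mloc m.
Hypothesis du : dualizing m d dl.
Variable M : lmodType A.

(** A zero module is put before J^0, and the reversal starts at d.+2, so that [K j.+1] is J^(d-j)
    for j <= d: the term Hom(M, J^0) gets an incoming map from zero, and below J^d there is still
    J^(d+1) = 0. *)
Let J' n := if n is n'.+1 then J n' else zmd.
Let dl' n : {linear J' n -> J' n.+1} := match n return {linear J' n -> J' n.+1} with 0 => \0 | n'.+1 => dl n' end.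

Let K j := rev J' d.+2 j.
Let dK j : {linear K j.+1 -> K j} := dr dl' d.+2 j.

Definition dcx j : lmodType A := hom M (K j.+1).

Lemma postcomp_ex (U V : lmodType A) (f : {linear U -> V}) :
  exists g : {linear hom M U -> hom M V}, forall x y, hap (g x) y = f (hap x y).
Proof.
have /choice[g gE] : forall x : hom M U, exists z : hom M V, forall y, hap z y = f (hap x y).
  by move=> x; have [z zE] := hap_ex (f \o hap x); exists z.
have gL : linear g by move=> a x z; apply: hap_inj => y; rewrite gE !hapP linearP !gE.
by exists (mkL gL).
Qed.

Definition dcd j : {linear dcx j.+1 -> dcx j} := sval (cid (postcomp_ex (dK j.+1))).
Lemma dcdE j x y : hap (dcd j x) y = dK j.+1 (hap x y).
Proof. by rewrite /dcd; case: cid => g gE; exact: gE. Qed.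

Definition cycX (X : nat -> lmodType A) (dX : forall j, {linear X j.+1 -> X j}) j : X j -> Prop :=
  match j return X j -> Prop with 0 => fun=> True | j'.+1 => fun x => dX j' x = 0 end.

Lemma dcx_zero j : (d < j)%N -> forall x : dcx j, x = 0.
Proof.
move=> dj x; apply: hap_inj => y; rewrite hap0; apply: rev_zero => //; exact: zmd0.
Qed.

(* X_j is Hom(M, J^(d-j)), so its homology at j is D^(d-j)(M). *)
Lemma dcx_spec n j : (n + j)%N = d -> exists t : dcx j -> M -> J n,
  [/\ (forall a x y, t (a *: x + y) = a *: t x + t y),
      injective t, forall x, cycX dcd x <-> Zc dl (t x),
      forall x, (exists y, x = dcd j y) <-> Bc dl (t x)
    & forall z, Zc dl z -> exists x, t x = z].
Proof.
move=> nj.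
pose Q (U V W : lmodType A) (f : {linear U -> V}) (g : {linear V -> W}) := exists t : {linear V -> J n},
  [/\ injective t, forall y, exists x, t x = y, forall x, g x = 0 <-> dl n (t x) = 0 &
   forall z : {linear M -> V}, (exists w : {linear M -> U}, forall y, z y = f (w y)) <-> Bc dl (t \o z)].
have : Q _ _ _ (dK j.+1) (dK j).
  apply: (@rev_ind J' dl' Q d.+2 j); first by move: nj; lia.
  move=> n' n'j; have -> : n' = n by lia.
  case: n nj @Q n'j => [|k] nj Q n'j; exists idfun; split=> //.
  - by move=> y; exists y.
  - move=> z; split=> [[w zw] y|z0].
      by rewrite /= zw.
    by exists \0 => y; rewrite -[LHS]/(idfun (z y)) [LHS]z0.
  - by move=> y; exists y.
case=> t [tI ts tZ tB].
exists (fun x y => t (hap x y)); split.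
- by move=> a x y; apply/funext => v; rewrite hapP linearP.
- by move=> x y /= xy; apply: hap_inj => v; apply: tI; exact: (congr1 (@^~ v) xy).
- have tL (x : dcx j) : linear (fun y => t (hap x y)) by move=> a u v; rewrite !linearP.
  move: t tI ts tZ {tB} tL; clear Q; case: j nj => [|j] nj t tI ts tZ tL x.
    split=> // _; split; first exact: tL.
    by move=> y; apply: (du_bd du); lia.
  split=> [x0|[_ x0]].
    split; first exact: tL.
    by move=> y; apply/tZ; rewrite -dcdE [dcd j x]x0 hap0.
  by apply: hap_inj => y; rewrite hap0 dcdE; apply/tZ.
- move=> x; have [H1 H2] := tB (hap x); split=> [[y yE]|/H2[w xw]].
    by apply: H1; exists (hap y) => v; rewrite yE dcdE.
  have [y yE] := hap_ex w; exists y; apply: hap_inj => v; by rewrite dcdE yE xw.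
- move=> z [zL _]; have [w wE] : exists w : {linear M -> K j.+1}, forall y, t (w y) = mkL zL y.
    by apply: lin_lift.
  have [x xE] := hap_ex w; exists x; apply/funext => y; by rewrite xE wE.
Qed.

Lemma dcd_dd j x : dcd j (dcd j.+1 x) = 0.
Proof.
have [jd|jd] := leqP j.+1 d; last first.
  have jd2 : (d < j.+2)%N by lia.
  by rewrite (dcx_zero jd2 x) !linear0.
have [t [_ _ tZ tB _]] := @dcx_spec (d - j.+1) j.+1 (subnK jd).
apply/(tZ (dcd j.+1 x)); apply: (Bc_Zc (du_dd du)); apply/tB; by exists x.
Qed.

Lemma dcd_fg j : fgm M -> exists s : seq (dcx j), (forall x, x \in s -> cycX dcd x) /\
  forall x, cycX dcd x -> exists y, spn s (x - dcd j y).
Proof.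
move=> fM; have [jd|jd] := leqP j d; last first.
  by exists [::]; split=> // x _; exists 0; rewrite (dcx_zero jd (x - _)).
have [t [tP tI tZ tB tE]] := @dcx_spec (d - j) j (subnK jd).
have [s [sZ sB]] := du_fg du (d - j) fM.
have /choice[u uE] : forall z, exists x, Zc dl z -> t x = z.
  by move=> z; have [/tE[x xz]|nz] := pselect (Zc dl z); [exists x | exists 0].
exists [seq u z | z <- s]; split=> [_ /mapP[z zs ->]|x /tZ/sB[z sz]].
  by apply/tZ; rewrite uE; exact: sZ.
have [x' sx' x'z] : exists2 x', spn [seq u z | z <- s] x' & t x' = z.
  elim: s z sZ sz {sB} => [|v s IH] z sZ /=.
    by move=> ->; exists 0 => //; have := tP (-1) 0 0; rewrite scaler0 addr0 => ->; rewrite scaleN1r addNr.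
  case=> a /IH[w ws|x' sx' x'E]; first by apply: sZ; rewrite inE ws orbT.
  exists (a *: u v + x'); first by exists a; rewrite addrC addKr.
  by rewrite tP x'E (uE v (sZ v (mem_head _ _))) addrC subrK.
rewrite -x'z => Bx; have tB' : t (x - x') = t x - t x'.
  by have := tP (-1) x' x; rewrite !scaleN1r ![- _ + _]addrC.
by have [|y yE] := (tB (x - x')).2; [rewrite tB' | exists y; rewrite -yE subKr].
Qed.

Lemma dK_soc j : injective_module (K j.+1) /\ (j <> 0 -> forall y : K j.+1, soc m y -> y = 0) /\
  (j = 0 -> exists y0 : K j.+1, [/\ soc m y0, y0 <> 0 & forall y, soc m y -> exists a, y = a *: y0]).
Proof.
have [jd|jd] := leqP j d; last first.
  have K0 : forall x : K j.+1, x = 0 by apply: rev_zero => //; exact: zmd0.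
  by split; [exact: injective_zero | split=> // j0; move: jd; rewrite j0].
pose Q (U V W : lmodType A) (f : {linear U -> V}) (g : {linear V -> W}) :=
  injective_module V /\ (j <> 0%N -> forall y : V, soc m y -> y = 0) /\
  (j = 0%N -> exists y0 : V, [/\ soc m y0, y0 <> 0 & forall y, soc m y -> exists a, y = a *: y0]).
apply: (@rev_ind J' dl' Q d.+2 j) => // n nj; split; first exact: (du_inj du).
split=> [j0|j0]; first by apply: (du_soc0 du); lia.
have -> : n = d by lia.
exact: (du_soc1 du).
Qed.

Variable G : kres m.
(** In positive index the injective J^(d-j) has zero socle, so by duality Hom(M, J^(d-j)) has
    neither Ext nor Tor with A/m. *)
Lemma enull_dcx i j : enull G i (dcx j.+1).
Proof.
have [Ki [K0 _]] := dK_soc j.+1; have := dual_null (M := M) Ki (fun x (mx : m x) => kr_Ht G mx i) (K0 _).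
by rewrite !trmxK; apply.
Qed.

Lemma tnull_dcx i j : tnull G i (dcx j.+1).
Proof.
have [Ki [K0 _]] := dK_soc j.+1; exact: (dual_null (M := M) Ki (fun x (mx : m x) => kr_H G mx i) (K0 _)).
Qed.

(** Since J^d has a one-dimensional socle, Tor_i(A/m, Hom(M, J^d)) is dual to Ext^i(A/m, M); dually,
    in [elen_dcx], Ext^i of this module matches Tor_i(A/m, M). *)
Lemma tlen_dcx i h : elen G i M h -> tlen G i (dcx 0) h.
Proof.
have [Ki [_ /(_ erefl) K0]] := dK_soc 0%N.
exact: (dual_len lm Ki (kr_EE G i) (fun x (mx : m x) => kr_H G mx i) K0).
Qed.

Lemma elen_dcx i h : tlen G i M h -> elen G i (dcx 0) h.
Proof.
have [Ki [_ /(_ erefl) K0]] := dK_soc 0%N.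
have := dual_len (M := M) lm Ki (EEt G i) (fun x (mx : m x) => kr_Ht G mx i) K0 (h := h).
by rewrite !trmxK; apply.
Qed.
End Reversal.

(** * Minimal free resolution of a complex *)

Section Stages.
Variables (A : comNzRingType) (m : A -> Prop).
Hypothesis lm : mloc m.
Hypothesis nA : noeth A.
Variable G : kres m.
Let mq : mulc m := prm_mulc lm.1.
Let sm : idl m. Proof. by case: lm => -[]. Qed.

Variables (X : nat -> lmodType A) (dX : forall j, {linear X j.+1 -> X j}).
Hypothesis dXX : forall j x, dX j (dX j.+1 x) = 0.
Hypothesis dXfg : forall j, exists s : seq (X j), (forall x, x \in s -> cycX dX x) /\
  forall x, cycX dX x -> exists y, spn s (x - dX j y).

(** W_j is what remains to be covered by free modules after j steps, starting from W_0 = X_0. It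
    receives X_(j+1) by a map with the kernel of the differential. It is finitely generated only
    modulo that image, because the X_j need not be finitely generated. *)
Record stage j := Stage {
  st_W : lmodType A;
  st_e : {linear X j.+1 -> st_W};
  st_ker : forall x, st_e x = 0 <-> dX j x = 0;
  st_fg : exists s : seq st_W, forall w, exists y, spn s (w - st_e y) }.

Definition addm (U V W : lmodType A) (f : {linear U -> W}) (g : {linear V -> W}) (x : (U * V)%type) := f x.1 + g x.2.
Lemma addm_linear (U V W : lmodType A) (f : {linear U -> W}) (g : {linear V -> W}) : linear (addm f g : (U * V)%type -> W).
Proof. by move=> a x y; rewrite /addm !linearP scalerDr addrACA. Qed.
Definition addl (U V W : lmodType A) (f : {linear U -> W}) (g : {linear V -> W}) : {linear (U * V)%type -> W} :=
  mkL (addm_linear f g).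

(* One step of a minimal free resolution F of the complex X. *)
Record link j (s : stage j) (s' : stage j.+1) := Link {
  lk_b : nat;
  lk_g : {linear free A lk_b -> st_W s};
  lk_i : {linear st_W s' -> (free A lk_b * X j.+1)%type};
  lk_ses : ses lk_i (addl lk_g (st_e s));
  lk_e : forall x, lk_i (st_e s' x) = (0, dX j.+1 x);
  lk_min : forall w, mmul G (lk_i w).1;
  lk_len : has_len m (addS (@mmul A m G (st_W s)) (fun w => exists2 y, True & w = st_e s y)) (fun=> True) lk_b }.

(** W_(j+1) is the kernel of F_j + X_(j+1) -> W_j, where a basis of F_j goes to a basis of W_j
    modulo m W_j and the image of e. Nakayama's lemma gives surjectivity. The kernel is finitely
    generated modulo the new e: its projection to F_j is, and so are the cycles of X_(j+1) modulo
    boundaries. *)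
Lemma link_ex j (s : stage j) : exists s' : stage j.+1, inhabited (link s s').
Proof.
case: s => W e ke [s sW].
pose S := addS (@mmul A m G W) (fun w => exists2 y, True & w = e y).
have sIe : smod (fun w : W => exists2 y, True & w = e y) by exact: (smod_img e smodT).
have sS : smod S by exact: (smod_add (smod_mmul G W) sIe).
have mS a (x : W) : m a -> S (a *: x).
  by move=> ma; exists (a *: x); [exact: mmulZ | rewrite subrr; exact: (smod0 sIe)].
have eS y : S (e y) by exists 0; [exact: (smod0 (smod_mmul G W)) | rewrite subr0; exists y].
have [h hS] : exists h, has_len m S (fun=> True) h.
  have [h hh] := len_gen lm (s := s) sS (fun x a _ ma => mS a x ma).
  exists h; rewrite (_ : (fun=> True) = addS S (spn s)) //; apply/funext => w; apply/propext; split=> // _.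
  by have [y sy] := sW w; exists (e y) => //.
have [c [_ cspan cind]] := len_kdim lm sS (@smodT _ W) (fun _ _ => I) (fun a x ma _ => mS a x ma) hS.
have [g gE] := free_map c.
have gsurj w : exists x : (free A h * X j.+1)%type, addl g e x = w.
  pose T := fun w => exists2 x, True & w = addl g e x.
  have sT : smod T by exact: (smod_img (addl g e) smodT).
  have eT y : T (e y) by exists (0, y) => //; rewrite mkLE /addm /= linear0 add0r.
  have gT x : T (g x) by exists (x, 0) => //; rewrite mkLE /addm /= linear0 addr0.
  suff sub v : spn s v -> T v.
    have [y /sub sy] := sW w; have [x _ xE] : T w by rewrite -(subrK (e y) w); apply: smodD.
    by exists x.
  move=> sv; apply: (mloc_qin lm sT); move: v sv; apply: (nakayama lm.1 sm) => // v vs.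
  exists 1; first exact: mq.1.
  rewrite scale1r; have [cc [u mu [y _ uy]]] := cspan v I.
  have [t [z _ tz] ut] : addS (fun w => exists2 y, True & w = e y) (ispn m s) u.
    apply: (mmul_min (smod_add sIe (smod_ispn _ sm))) mu => a x ma.
    have [z sz] := sW x; exists (a *: e z); first by exists (a *: z) => //; rewrite linearZZ.
    by rewrite -scalerBr; exact: ispnZ.
  exists (g cc + e y + t); last first.
    have e1 : g cc + e y = v - u by rewrite gE -uy addrA [_ + (v - _)]addrC subrK.
    by rewrite e1 opprD addrA subKr.
  by apply: smodD => //; [apply: smodD | rewrite tz].
pose ker := Submod (smod_preim (addl g e) smod1).
have [e' e'E] : exists e' : {linear X j.+2 -> subm ker}, forall x, sinc ker (e' x) = (0, dX j.+1 x).
  have fL : linear (fun x => (0, dX j.+1 x) : (free A h * X j.+1)%type).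
    by move=> a x y; rewrite linearP; congr pair; rewrite [RHS](_ : _ = a *: 0 + 0) // scaler0 addr0.
  apply: (lin_lift (f := mkL fL)) => [|x]; first exact: sinc_inj.
  apply: (@sinc_surj _ _ ker); rewrite /= /addm /= linear0 add0r; apply/ke; exact: dXX.
have ke' x : e' x = 0 <-> dX j.+1 x = 0.
  split=> [ex|dx]; first by have := e'E x; rewrite ex linear0 => -[].
  by apply: sinc_inj; rewrite e'E dx linear0.
have ker0 u : addl g e (sinc ker u) = 0 by exact: (sincP u).
have mink u : mmul G (sinc ker u).1.
  apply/(mmul_free lm G) => i; apply: (cind (sinc ker u).1); rewrite -gE.
  have := ker0 u; rewrite mkLE /addm => /eqP; rewrite addr_eq0 => /eqP ->.
  by rewrite -linearN.
have fg' : exists s' : seq (subm ker), forall w, exists y, spn s' (w - e' y).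
  pose q := pfst (free A h) (X j.+1) \o sinc ker : {linear _ -> _}.
  have [t tE] := fgs_sub nA (fgm_free A h) (smod_img q (@smodT _ (subm ker))).
  have [s1 [s1c s1E]] := dXfg j.+1.
  have /choice[l lE] : forall x, exists u, x \in t -> q u = x.
    move=> x; have [xt|] := boolP (x \in t); last by exists 0.
    by have /tE[u _ ->] := spn_mem xt; exists u.
  have /choice[k kE] : forall x, exists u, x \in s1 -> sinc ker u = (0, x).
    move=> x; have [xs|] := boolP (x \in s1); last by exists 0.
    have [|u uE] := @sinc_surj _ _ ker (0, x); last by exists u.
    by rewrite /= /addm /= linear0 add0r; apply/ke; exact: (s1c x xs).
  exists ([seq l x | x <- t] ++ [seq k x | x <- s1]) => w; set s2 := _ ++ _.
  have ss2 := smod_spn s2.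
  have [v sv qv] : exists2 v, spn s2 v & q v = q w.
    have : spn t (q w) by apply/tE; exists w.
    have sP : smod (fun z : free A h => exists2 v, spn s2 v & q v = z).
      split; first by exists 0; [exact: smod0 | rewrite linear0].
      by move=> a _ _ [v1 h1 <-] [v2 h2 <-]; exists (a *: v1 + v2); [exact: ss2.2 | rewrite linearP].
    apply: (spn_min sP) => x xt; exists (l x); last exact: lE.
    by apply: spn_mem; rewrite mem_cat map_f.
  pose x := (sinc ker (w - v)).2.
  have wv : sinc ker (w - v) = (0, x).
    rewrite [LHS]surjective_pairing; congr pair.
    by have := linearB q w v; rewrite qv subrr => H; exact: H.
  have /s1E[y sy] : cycX dX (x : X j.+1).
    by apply/ke; have := ker0 (w - v); rewrite wv mkLE /addm /= linear0 add0r.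
  have [u su uE] : exists2 u, spn s2 u & sinc ker u = (0, x - dX j.+1 y).
    have sP : smod (fun z : X j.+1 => exists2 u, spn s2 u & sinc ker u = (0, z)).
      split; first by exists 0; [exact: smod0 | rewrite linear0].
      move=> a z1 z2 [u1 h1 e1] [u2 h2 e2]; exists (a *: u1 + u2); first exact: ss2.2.
      by rewrite linearP e1 e2; congr pair; rewrite [LHS](_ : _ = a *: 0 + 0) // scaler0 addr0.
    apply: (spn_min sP) sy => z zs; exists (k z); last exact: kE.
    by apply: spn_mem; rewrite mem_cat orbC map_f.
  exists y; rewrite (_ : w - e' y = v + u); first exact: smodD.
  suff H : w - v = u + e' y by rewrite -{1}(subrK v w) H addrAC addrK addrC.
  apply: sinc_inj; rewrite wv linearD uE e'E; congr pair; last by rewrite [RHS]subrK.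
  by rewrite [RHS](_ : _ = 0 + 0) // addr0.
exists (Stage ke' fg'); constructor.
apply: (@Link j (Stage ke (ex_intro _ s sW)) (Stage ke' fg') h g (sinc ker)) => //.
split; [exact: sinc_inj | exact: gsurj |].
move=> y; split=> [y0|[u ->]]; last exact: ker0.
by have [u <-] := @sinc_surj _ _ ker y y0; exists u.
Qed.

Lemma stage0_ker (x : X 1) : dX 0 x = 0 <-> dX 0 x = 0. Proof. by []. Qed.
Lemma stage0_fg : exists s : seq (X 0), forall w, exists y, spn s (w - dX 0 y).
Proof. by have [s [_ sE]] := dXfg 0; exists s => w; exact: sE. Qed.
Definition stage0 : stage 0 := Stage stage0_ker stage0_fg.

Fixpoint tower j : stage j := if j is j'.+1 then projT1 (cid (link_ex (tower j'))) else stage0.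
Lemma tower_link j : inhabited (link (tower j) (tower j.+1)).
Proof. exact: (projT2 (cid (link_ex (tower j)))). Qed.
Definition tlink j : link (tower j) (tower j.+1) := projT1 (cid (let: inhabits l := tower_link j in ex_intro (fun=> True) l I)).
End Stages.

(** * Lengths of D^0(N) at primes of maximal dimension *)

Section DualRank.
Variables (A : comNzRingType) (m : A -> Prop) (d : nat) (J : nat -> lmodType A).
Variable dl : forall i, {linear J i -> J i.+1}.
Hypothesis du : dualizing m d dl.
Hypothesis nA : noeth A.
Hypothesis lm : mloc m.
Hypothesis dmax : forall p l, @pchain A l p -> (l <= d)%N.
Variable P : A -> Prop.
Hypothesis cP : pchain d P.
Let pP : prm P := pchain_prm cP.
Let mP : mulc P := prm_mulc pP.

Lemma top_minimal p : prm p -> (forall a, p a -> P a) -> p = P.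
Proof.
move=> pp pP'; apply: contrapT => np.
have [x Px px] : exists2 x, P x & ~ p x.
  apply: contrapT => H; apply: np; apply/funext => a; apply/propext; split; first exact: pP'.
  by move=> Pa; apply: contrapT => pa; apply: H; exists a.
have := dmax (pchainS pp pP' (ex_intro2 _ _ x Px px) cP).
by rewrite ltnn.
Qed.

Lemma Dnull_top n N : fgm N -> (0 < n)%N -> Dnull dl P n N.
Proof.
move=> fN n0; apply: contrapT => nN; have := Dnull_dim du nA lm pP fN nN cP; lia.
Qed.

(** Both lengths are additive because D^1 vanishes at P. Among the factors A/p only A/P survives at
    P, and D^0(A/P) has length one there, since the degree h of [du_prime] must be 0. *)
Lemma dual_rank N : fgm N -> exists2 n, ml P N n & has_len P (@Bc _ _ dl N 0) (@Zc _ _ dl N 0) n.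
Proof.
move=> fN.
pose PP (V : lmodType A) := fgm V -> exists2 n, ml P V n & has_len P (@Bc _ _ dl V 0) (@Zc _ _ dl V 0) n.
suff : PP N by apply.
have zero V s : ~ P s -> (forall z, @Zc _ _ dl V 0 z -> s *: z = 0) -> has_len P (@Bc _ _ dl V 0) (@Zc _ _ dl V 0) 0.
  move=> Ps H; split=> // -[S [_ _ SZ [z /SZ/H sz nz] _]]; apply: nz; exists s => //.
  by rewrite sz; exact: (smod0 (sBc dl V 0)).
apply: (@devissage A (fun=> False) PP nA _ _ _ N fN) => //.
- move=> V V0 _; exists 0%N; first by apply: (ml0 V mP).1 => x; exists 1; [exact: mP.1 | exact: V0].
  apply: (zero V 1 mP.1) => z [zL _]; rewrite scale1r; apply/funext => x.
  by rewrite (V0 x) -[z 0]/(mkL zL 0) linear0.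
- move=> U V W i p sip hU hW fV.
  have fU : fgm U.
    have [iI _ ip] := sip; have sI := smod_img i (@smodT _ U).
    have [g gE] : exists g : {linear subm (Submod sI) -> U}, forall x, i (g x) = sinc (Submod sI) x.
      by apply: (lin_lift (i := i)) => // x; have [u _ uE] := sincP x; exists u.
    apply: (fgm_img (f := g)); first exact: (fgs_subm (S := Submod sI) (fgs_sub nA fV sI)).
    move=> u; have [x xE] := @sinc_surj _ _ (Submod sI) (i u) (ex_intro2 _ _ u I erefl).
    by exists x; apply: iI; rewrite gE xE.
  have fW : fgm W by have [_ ps _] := sip; exact: fgm_img fV ps.
  have [a ha da] := hU fU; have [b hb db] := hW fW; exists (b + a)%N.
    by rewrite addnC; exact: (ml_ses mP sip ha hb).
  pose T (z : V -> J 0) := Zc dl z /\ z \o i = 0.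
  have sT : smod T.
    split; first by split; [exact: (smod0 (sZc dl V 0)) | exact/funext].
    move=> c z w [Zz zi] [Zw wi]; split; first exact: (sZc dl V 0).2.
    apply/funext => x; rewrite [LHS](_ : _ = c *: (z \o i) x + (w \o i) x) // zi wi.
    by rewrite [LHS](_ : _ = c *: 0 + 0) // scaler0 addr0.
  have TZ z : T z -> Zc dl z by case.
  have BT z : Bc dl z -> T z by move=> z0; split; [exact: (Bc_Zc (du_dd du)) | apply/funext => x; exact: z0].
  apply: (has_len_add mP (sBc dl V 0) sT (sZc dl V 0) BT TZ).
    have pL : linear (fun z : W -> J 0 => z \o p) by move=> c z w; apply/funext.
    apply: (@len_img A P _ _ b (mkL pL) _ _ _ _ mP (sBc dl W 0) (sZc dl W 0) (sBc dl V 0) sT) db => //.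
    - by move=> z Bz; exact: (@Bc_Zc _ _ _ (du_dd du) _ 0 z Bz).
    - move=> z Zz; split; first exact: Zc_comp.
      by apply/funext => x /=; rewrite (ses_pi sip) -[z 0]/(mkL Zz.1 0) linear0.
    - move=> z [Zz zi]; apply: (sub_qin mP); have [g gE] := ses_fac (f := mkL Zz.1) sip (fun x => congr1 (@^~ x) zi).
      exists (g : _ -> _); last by move=> x; rewrite [LHS](_ : _ = z x - g (p x)) // gE subrr.
      split=> [|y]; first exact: linP.
      by have [_ ps _] := sip; have [x <-] := ps y; rewrite gE; exact: Zz.2.
    - by move=> z Bz x; exact: Bz.
    - move=> z Zz z0; apply: (sub_qin mP) => y; have [_ ps _] := sip; have [x <-] := ps y; exact: z0.
  have iL : linear (fun z : V -> J 0 => z \o i) by move=> c z w; apply/funext.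
  have Zs (u : U -> J 0) : Zc dl u -> qin P (fun u => exists2 z : V -> J 0, Zc dl z & u = z \o i) u.
    move=> Zu; have [z Zz [w [wu wz]]] := conn_ex (du_inj du) (du_dd du) sip Zu.
    have [s Ps [v vE]] := @Dnull_top 1 W fW isT z Zz.
    exists s => //; exists (s \*: w \- (v \o p)); last first.
      by apply/funext => x /=; rewrite wu (ses_pi sip) linear0 subr0.
    split=> [|y]; first exact: linP.
    rewrite /= linearB linearZZ wz -[s *: z _]/((s *: z) (p y)) vE subrr //.
  (* the quotient of the cocycles of V by T is P-locally the cocycles of U *)
  have H : has_len P T (@Zc _ _ dl V 0) a; last exact: H.
  have TB (z : V -> J 0) : Bc dl (z \o i) -> Zc dl z -> T z by move=> z0 Zz; split=> //; exact/funext.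
  apply: (@has_len_rel A P _ _ a (fun (u : U -> J 0) (z : V -> J 0) => u = z \o i)) da => //.
  - exact: sBc.
  - exact: sZc.
  - exact: sZc.
  - by move=> z Bz; exact: (@Bc_Zc _ _ _ (du_dd du) _ 0 z Bz).
  - by move=> c u z u' z' -> ->; apply/funext.
  - by move=> u /Zs[s Ps [z Zz e]]; exists s, z.
  - move=> z Zz; exists 1, (z \o i); rewrite scale1r; split=> //; [exact: mP.1 | exact: Zc_comp].
  - by move=> u z _ -> [_ zi]; rewrite zi; apply: (sub_qin mP); exact: (smod0 (sBc dl U 0)).
  - by move=> u z Zz -> zi; apply: (sub_qin mP); exact: TB.
move=> V x xg px _ fV; have [pP'|] := pselect (forall a, ann x a -> P a).
  have xP := top_minimal px pP'; exists 1%N; first exact: (ml_cyc xg pP).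
  have [h [nz _ l2]] := du_prime du pP.
  have h0 : h = 0%N by have := NZ_dim du nA lm pP nz cP; lia.
  rewrite h0 in nz l2; split; last exact: (l2 V x xg xP).
  apply: contrapT => n1; have [V' [x' [xg' xp' nV]]] := nz; apply: nV.
  apply: (Dnull_cyc (du_dd du) mP xg xg' (etrans xP (esym xp'))).
  exact/(Dnull_len (du_dd du)).
move=> /existsNP[s /not_implyP[xs Ps]]; exists 0%N; first exact/(ml0 V mP)/(ml_cyc_lt xg mP xs Ps).
apply: (zero V s Ps) => z [zL _]; apply/funext => y; have [a ->] := xg y.
rewrite -[LHS]/(s *: z (a *: x)) -[z _]/(mkL zL (a *: x)) -linearZZ scaleC.
by rewrite (xs : s *: x = 0) scaler0 linear0.
Qed.
End DualRank.

(** * From rank to length *)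

Section RankLength.
Variables (A : comNzRingType) (P : prime_idealr A).
Let p : A -> Prop := fun x => x \in P.
Let mp : mulc p := prm_mulc (prm_of P).
Local Notation "1d" := (denom1 P).

Lemma prod_notin (I : Type) (r : seq I) (Q : pred I) (F : I -> A) : (forall i, ~ p (F i)) -> ~ p (\prod_(i <- r | Q i) F i).
Proof.
move=> H; apply: (big_ind (fun x => ~ p x)) => // [|x y]; first exact: mp.1.
exact: mp.2.
Qed.

Lemma frac0 (V : lmodType A) (x : V) : Defs.frac x 1d = 0 <-> exists2 s, ~ p s & s *: x = 0.
Proof.
split=> [/frac_eqP[u e]|[s ps sx]].
  exists (dval u); first exact/negP/(valP u).
  by move: e; rewrite /= mulr1 scaler0.
have ps' : s \notin P by exact/negP.
by apply/frac_eqP; exists (exist _ s ps'); rewrite /= mulr1 scaler0.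
Qed.

Lemma frac_lin (V : lmodType A) a (x y : V) : Defs.frac (a *: x + y) 1d = (Defs.frac (a : A^o) 1d : locring P) *: Defs.frac x 1d + Defs.frac y 1d.
Proof.
rewrite [_ *: Defs.frac x 1d](loc_scaleE (a : A^o) 1d x 1d) [RHS]loc_addE.
by apply/frac_eqP; exists 1d; rewrite /= !mul1r !scale1r.
Qed.

Lemma frac_den (V : lmodType A) (x : V) s : Defs.frac x 1d = (Defs.frac (dval s : A^o) 1d : locring P) *: Defs.frac x s.
Proof.
rewrite [RHS](loc_scaleE (dval s : A^o) 1d x s).
by apply/frac_eqP; exists 1d; rewrite /= !mul1r scale1r.
Qed.

Lemma fracM (a b : A) : (Defs.frac (a : A^o) 1d : locring P) * Defs.frac (b : A^o) 1d = Defs.frac (a * b : A^o) 1d.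
Proof.
rewrite [LHS](loc_mulE (a : A^o) b 1d 1d); apply/frac_eqP; exists 1d.
by rewrite /= !mul1r.
Qed.

(** y in A^r and x in V are related when y/1 and x/1 correspond under the isomorphism of V_P with
    A_P^r; clearing denominators makes the relation bijective up to denominators. *)
Lemma rank_ml (V : lmodType A) r a : @isomorphic (locring P) (locmod P V) {ffun 'I_r -> (locring P)^o} ->
  ml p (A : comNzRingType)^o a -> ml p V (r * a).
Proof.
move=> [f [g fK gK]] /(ml_free mp r).
pose Y (y : free A r) : {ffun 'I_r -> (locring P)^o} := [ffun j => Defs.frac (y j : A^o) 1d].
have Ylin c y z : Y (c *: y + z) = (Defs.frac (c : A^o) 1d : locring P) *: Y y + Y z.
  apply/ffunP => j; rewrite !ffunE [LHS](_ : _ = Defs.frac ((c *: (y j) + z j) : A^o) 1d) //.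
  by rewrite (frac_lin (V := A^o)).
have Y0 y : Y y = 0 -> exists2 s, ~ p s & s *: y = 0.
  move=> y0; have /choice[s sP] : forall j, exists s, ~ p s /\ s * y j = 0.
    move=> j; have := congr1 (fun h : {ffun 'I_r -> (locring P)^o} => h j) y0; rewrite !ffunE.
    by move=> /(frac0 (y j : A^o))[s ps sy]; exists s.
  exists (\prod_j s j); first by apply: prod_notin => j; exact: (sP j).1.
  apply/funext => j; rewrite [LHS](_ : _ = (\prod_j s j) * y j) // (bigD1 j) //=.
  by rewrite mulrC mulrA [y j * _]mulrC (sP j).2 mul0r.
have f0 x : f (Defs.frac x 1d) = 0 <-> exists2 s, ~ p s & s *: x = 0.
  rewrite -frac0; split=> [fx|->]; last exact: linear0.
  by apply: (can_inj fK); rewrite fx linear0.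
have Y00 : Y 0 = 0.
  apply/ffunP => j; rewrite !ffunE; apply/(frac0 (0 : A^o)).
  by exists 1; [exact: mp.1 | rewrite scaler0].
apply: (@has_len_rel A p _ _ _ (fun y x => f (Defs.frac x 1d) = Y y)) => //; try exact: smod1; try exact: smodT.
- rewrite (f0 0).2; last by exists 1; [exact: mp.1 | rewrite scaler0].
  apply/ffunP => j; rewrite !ffunE; symmetry; apply/(frac0 (0 : A^o)).
  by exists 1; [exact: mp.1 | rewrite scaler0].
- by move=> c y x y' x' h h'; rewrite frac_lin linearP h h' Ylin.
- move=> y _; have [x [s xs]] := locP (g (Y y)); exists (dval s), x; split=> //; first exact/negP/(valP s).
  rewrite (frac_den x s) linearZ /= -xs gK -[dval s *: y]addr0 Ylin.
  by rewrite Y00 addr0.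
- move=> x _; have /choice[s sP] : forall j, exists s, ~ p s /\ exists b : A^o, (Defs.frac (s : A^o) 1d : locring P) * (f (Defs.frac x 1d) j) = Defs.frac b 1d.
    move=> j; have [b [t bt]] := locP (f (Defs.frac x 1d) j : locring P); exists (dval t); split; first exact/negP/(valP t).
    by exists b; rewrite bt (frac_den b t).
  have /choice[b bP] := fun j => (sP j).2.
  exists (\prod_j s j), (fun j => (\prod_(k | k != j) s k) * b j); split=> //.
    by apply: prod_notin => j; exact: (sP j).1.
  rewrite -[_ *: x]addr0 frac_lin linearP [f (Defs.frac 0 1d)](f0 0).2; last by exists 1; [exact: mp.1 | rewrite scaler0].
  rewrite addr0; apply/ffunP => j; rewrite !ffunE.
  rewrite -[RHS]fracM -bP [RHS]mulrA fracM -[LHS]/((Defs.frac (\prod_j s j : A^o) 1d : locring P) * (f (Defs.frac x 1d) j)).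
  by rewrite [in LHS](bigD1 j) //= [s j * _]mulrC.
- by move=> y x _ fx x0; apply: Y0; rewrite -fx x0; apply/f0; exists 1; [exact: mp.1 | rewrite scaler0].
- move=> x y _ fx y0; apply/f0; rewrite fx y0; apply/ffunP => j; rewrite !ffunE; apply/(frac0 (0 : A^o)).
  by exists 1; [exact: mp.1 | rewrite scaler0].
Qed.
End RankLength.

(** * The minimal free resolution of Hom(M, J) *)

Section TowerCore.
Variables (A : comNzRingType) (m : A -> Prop) (d : nat) (J : nat -> lmodType A).
Variable dl : forall i, {linear J i -> J i.+1}.
Hypothesis du : dualizing m d dl.
Hypothesis nA : noeth A.
Hypothesis lm : mloc m.
Variable G : kres m.
Variable M : lmodType A.
Hypothesis fM : fgm M.
Let mq : mulc m := prm_mulc lm.1.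

Definition tX := dcx d J M.
Definition tdX : forall j, {linear tX j.+1 -> tX j} := dcd d dl M.
Let dd := @dcd_dd _ _ _ _ _ du M.
Let dfg j := dcd_fg du j fM.
Definition tw j : stage tdX j := tower lm nA G dd dfg j.
Definition tl j := tlink lm nA G dd dfg j.
Local Notation W j := (st_W (tw j)).
Local Notation e j := (st_e (tw j)).
Definition tb j := lk_b (tl j).
Definition tg j : {linear free A (tb j) -> W j} := lk_g (tl j).
Definition ti j : {linear W j.+1 -> (free A (tb j) * tX j.+1)%type} := lk_i (tl j).
Let F j : lmodType A := (free A (tb j) * tX j.+1)%type.

Lemma tses j : ses (ti j) (addl (tg j) (e j)). Proof. exact: lk_ses. Qed.
Lemma tX0 j : (d < j)%N -> forall x : tX j, x = 0. Proof. exact: dcx_zero. Qed.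

(** Minimality places the free component in m F, which is zero on Tor_0; higher Tor of F vanishes,
    and X_(j+1) has no Tor at all. *)
Lemma tzero_ti k j : tzero G k (ti j).
Proof.
case: k => [|k]; last first.
  by apply: tnull_zero; apply: hnull_prod; [exact: tnull_free | exact: (tnull_dcx du)].
move=> u Zu; apply: Bw_pair; last by apply: (tnull_dcx du); apply: Zw_map; exact: Zw_map.
apply: (tzero_mmul (f := pfst _ _ \o ti j : {linear _ -> _})) Zu => x; exact: (lk_min (tl j)).
Qed.

Lemma tlen_ti k j h : tlen G k.+1 (W j) h -> tlen G k (W j.+1) h.
Proof.
move=> H; apply/(t_conn lm (tses j)) => //; last exact: tzero_ti.
by apply: hnull_prod; [exact: tnull_free | exact: (tnull_dcx du)].
Qed.

(** The Bass number is the dimension of Tor_j(A/m, X_0), which shifts along 0 -> W_(k+1) -> F_k +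
    X_(k+1) -> W_k -> 0 to Tor_0(A/m, W_j). As Tor_0 of X_(j+1) is zero, the image of e lies in m
    W_j, so this dimension is b_j. *)
Lemma tb_bass j h : elen G j M h -> h = tb j.
Proof.
move=> /(tlen_dcx lm du).
have H n k l : (n + k)%N = l -> tlen G n (W k) h -> tlen G 0 (W l) h.
  by elim: n k => [|n IH] k; [move=> <- | rewrite addSnnS => /IH H /tlen_ti/H].
move=> /(H j 0%N j (addn0 j))/(tlen0P lm) h1; have := lk_len (tl j).
rewrite (_ : addS _ _ = @mmul A m G (W j)); first by move=> h2; exact: (has_len_uniq h1 h2).
apply/funext => w; apply/propext; split=> [[u mu [x _ wx]]|mw]; last first.
  by exists w => //; exists 0 => //; rewrite subrr linear0.
rewrite -(subrK u w) wx; apply: (smodD (smod_mmul G _)) => //.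
have /(Bw_map (e j)) := @tnull_dcx A m d J dl du M G 0 j (fun=> x) (Zw_e0 _); exact.
Qed.

Section Depth.
Variable t : nat.
Hypothesis nullA : forall i, (i < t)%N -> enull G i (A : comNzRingType)^o.

Lemma enull_F i j : (i < t)%N -> enull G i (F j).
Proof. by move=> it; apply: hnull_prod; [apply: hnull_pow; exact: nullA | exact: (enull_dcx du)]. Qed.

Lemma enull_mono (U V : lmodType A) (f : {linear U -> V}) : injective f -> ezero G 0 f -> enull G 0 U.
Proof.
move=> fI fz u /fz/Bw_e0 fu; apply/Bw_e0/funext => k; apply: fI; rewrite linear0.
exact: (congr1 (@^~ k) fu).
Qed.

(** F_j + X_(j+1) has no Ext below t, so a class in Ext^i(A/m, W_(j+1)) comes from Ext^(i-1)(A/m,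
    W_j); in degree 0 a submodule inherits the vanishing. *)
Lemma enull_W j i : (i < t)%N -> (i < j)%N -> enull G i (W j).
Proof.
elim: j i => [|j IH] [|i] it ij //.
  by apply: (enull_mono (f := ti j)); [have [] := tses j | apply: enull_zero; exact: enull_F].
apply: (e_sub (tses j)); first by apply: IH => //; exact: ltnW.
by apply: enull_zero; exact: enull_F.
Qed.

Lemma elen_ti i h : (i < t)%N -> ezero G i.+1 (ti i) -> elen G i (W i) h -> elen G i.+1 (W i.+1) h.
Proof. by move=> it ez H; exact: ((e_conn lm (tses i) h (@enull_F i i it) ez).1 H). Qed.

Lemma elen_climb i h : (i < t)%N -> elen G 0 (tX 0) h -> elen G i (W i) h.
Proof.
elim: i => [//|i IH] it H; apply: elen_ti; first exact: ltnW.
  by apply: enull_zero; exact: enull_F.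
by apply: IH => //; exact: ltnW.
Qed.
End Depth.

Section Last.
Variable N : nat.
Hypothesis dN : (d <= N)%N.
Hypothesis W0 : forall w : W N.+1, w = 0.

(** Beyond index d the complex X is zero, so with W_(N+1) = 0 the sequence of stage N is an
    isomorphism of F_N with W_N. *)
Lemma tg_bij : bijective (tg N).
Proof.
have [iI ps ip] := tses N.
have XN : forall x : tX N.+1, x = 0 by apply: tX0; rewrite ltnS.
have ker x : tg N x = 0 -> x = 0.
  move=> gx; have [|w wE] := (ip (x, 0)).1; first by rewrite mkLE /addm /= gx linear0 addr0.
  by move: wE; rewrite (W0 w) linear0 => -[].
have surj w : exists x, tg N x = w.
  by have [[x y] <-] := ps w; exists x; rewrite mkLE /addm /= (XN y) linear0 addr0.
have /choice[g gE] := surj; exists g => x //.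
apply/eqP; rewrite -subr_eq0; apply/eqP/ker; by rewrite linearB gE subrr.
Qed.

(** W_N is free, so a map from it with free component in m F_j is there a matrix over m and kills
    Ext; the other component goes to X_N, which has no Ext. *)
Lemma ezero_last j i : N = j.+1 -> forall (f : {linear W N -> F j}), (forall w, mmul G (f w).1) -> ezero G i f.
Proof.
move=> Nj f fm u Zu; have [g gK Kg] := tg_bij.
have gL : linear g by move=> a x y; apply: (can_inj gK); rewrite linearP !Kg.
have -> : f \o u = f \o (tg N \o (mkL gL \o u)) by apply/funext => k /=; rewrite Kg.
apply: Bw_pair; last by apply: (enull_dcx du); do 3!apply: Zw_map; exact: Zw_map.
apply: (ezero_matrix lm (f := pfst _ _ \o (f \o tg N) : {linear _ -> _})); last exact: Zw_map.
by move=> x; exact: fm.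
Qed.

Lemma enull_last i : (0 < tb N)%N -> enull G i (W N) -> enull G i (A : comNzRingType)^o.
Proof.
move=> b0 HW y Zy; have [g gK Kg] := tg_bij.
have gL : linear g by move=> a u v; apply: (can_inj gK); rewrite linearP !Kg.
pose k0 : 'I_(tb N) := Ordinal b0; pose y' : _ -> free A (tb N) := fun n => fun=> y n.
have Zy' : Zw (kr_E G i.+1) y'.
  by apply: Zw_pow => k; rewrite (_ : pr k \o y' = y).
have /(Bw_map (mkL gL))/(Bw_map (pr k0)) := HW _ (Zw_map (tg N) Zy').
by congr Bw; apply/funext => n /=; rewrite gK.
Qed.

Lemma elen_last i h : elen G i (W N) h -> forall tau, elen G i (A : comNzRingType)^o tau -> h = (tb N * tau)%N.
Proof.
move=> hW tau /(hlen_pow lm (tb N) (kr_EE G i)) hF.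
exact: (has_len_uniq hW (hlen_iso lm (kr_EE G i) tg_bij hF)).
Qed.
End Last.
End TowerCore.

(** * Ranks of the syzygies *)

Section TowerRank.
Variables (A : comNzRingType) (m : A -> Prop) (d : nat) (J : nat -> lmodType A).
Variable dl : forall i, {linear J i -> J i.+1}.
Hypothesis du : dualizing m d dl.
Hypothesis nA : noeth A.
Hypothesis lm : mloc m.
Variable G : kres m.
Variable M : lmodType A.
Hypothesis fM : fgm M.
Hypothesis dmax : forall p l, @pchain A l p -> (l <= d)%N.
Hypothesis ass_top : forall a : A, prm (ann (a : A^o)) -> pchain d (ann (a : A^o)).
Variable r : nat.
Hypothesis rM : forall (b : A) a, prm (ann (b : A^o)) -> ml (ann (b : A^o)) (A : comNzRingType)^o a -> ml (ann (b : A^o)) M (r * a).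
Local Notation tX := (tX d J M).
Local Notation tdX := (tdX d dl M).
Local Notation W j := (st_W (tw du nA lm G fM j)).
Local Notation e j := (st_e (tw du nA lm G fM j)).
Local Notation b j := (tb du nA lm G fM j).
Local Notation g j := (tg du nA lm G fM j).
Local Notation i j := (ti du nA lm G fM j).

(** The rank of the j-th homology of X, that is, of D^(d-j)(M): r for D^0(M), and 0 otherwise
    because positive degrees vanish at primes of dimension d. *)
Definition hrk j := if j == d then r else 0%N.
(** The rank c_j of C_j = W_j / e(X_(j+1)), from the exact sequence 0 -> H_(j+1)(X) -> C_(j+1) ->
    F_j -> C_j -> 0. The subtraction of natural numbers does not truncate, by [crk_le]. *)
Fixpoint crk j := if j is j'.+1 then (hrk j + (b j' - crk j'))%N else hrk 0%N.

Section AtP.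
Variable u : A.
Hypothesis pu : prm (ann (u : A^o)).
Let P := ann (u : A^o).
Let mP : mulc P := prm_mulc pu.
Let cP : pchain d P := ass_top pu.

Lemma hrk_len a : ml P (A : comNzRingType)^o a ->
  forall j, has_len P (fun x => exists2 y, True & x = tdX j y) (cycX tdX (j := j)) (hrk j * a).
Proof.
move=> ha j; have [jd|jd] := leqP j d; last first.
  rewrite /hrk gtn_eqF // mul0n; split=> // -[S [_ _ _ [x _ nx] _]]; apply: nx; apply: (sub_qin mP).
  by exists 0; rewrite // (tX0 jd x) // linear0.
have [t [tP tI tZ tB tE]] := dcx_spec du M (subnK jd).
have sB : smod (fun x => exists2 y, True & x = tdX j y) by exact: (smod_img (tdX j) smodT).
have sC : smod (cycX tdX (j := j)).
  by case: (j) => [|j']; [exact: smodT | exact: (smod_preim (tdX j') smod1)].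
have BC x : (exists2 y, True & x = tdX j y) -> cycX tdX x.
  by move=> [y _ ->]; apply/tZ; apply: (Bc_Zc (du_dd du)); apply/tB; exists y.
suff H : has_len P (@Bc _ _ dl M (d - j)) (@Zc _ _ dl M (d - j)) (hrk j * a).
  have t0 : t 0 = 0 by have := tP (-1) 0 0; rewrite scaler0 addr0 scaleN1r addNr.
  apply: (@has_len_rel A P _ _ _ (fun z x => t x = z)) H => //.
  - exact: sBc.
  - exact: sZc.
  - by move=> z; exact: (Bc_Zc (du_dd du)).
  - by move=> c z x z' x' <- <-.
  - by move=> z Zz; exists 1; have [x xz] := tE z Zz; exists x; rewrite scale1r; split=> //; [exact: mP.1 | apply/tZ; rewrite xz].
  - by move=> x Cx; exists 1, (t x); rewrite scale1r; split=> //; [exact: mP.1 | exact/tZ].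
  - by move=> z x _ <- [y _ xy]; apply: (sub_qin mP); apply/tB; exists y.
  - by move=> z x _ <- /tB[y xy]; apply: (sub_qin mP); exists y.
have [jd'|jd'] := eqVneq j d.
  rewrite /hrk jd' eqxx subnn; have [n hn dn] := dual_rank du nA lm dmax cP fM.
  by rewrite (has_len_uniq (rM pu ha) hn).
have dj : (0 < d - j)%N by rewrite subn_gt0 ltn_neqAle jd' jd.
rewrite /hrk (negPf jd') mul0n; split=> // -[S [_ _ SZ [z /SZ Zz nz] _]]; apply: nz.
exact: (Dnull_top du nA lm cP fM dj Zz).
Qed.

Lemma crk_len a : ml P (A : comNzRingType)^o a -> forall j,
  has_len P (fun w : W j => exists2 y, True & w = e j y) (fun=> True) (crk j * a) /\ (crk j * a <= b j * a)%N.
Proof.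
move=> ha j.
have step k : has_len P (fun w : W k => exists2 y, True & w = e k y) (fun=> True) (crk k * a) ->
   (crk k * a <= b k * a)%N /\ has_len P (fun w : W k.+1 => exists2 y, True & w = e k.+1 y) (fun=> True) (crk k.+1 * a).
  move=> IH; have [iI ps ip] := tses du nA lm G fM k.
  have sie n : smod (fun w : W n => exists2 y, True & w = e n y) by exact: (smod_img (e n) smodT).
  pose R (f : free A (b k)) := exists2 y, True & g k f = e k y.
  have sR : smod R := smod_preim (g k) (sie k).
  have zR x : x = 0 -> R x by move=> ->; exact: smod0.
  have [al [be [ab hR hq]]] := has_len_inv mP (@smod1 _ _) sR (@smodT _ _) zR (fun _ _ => I) (ml_free mP (b k) ha).
  have he : has_len P (fun w : W k => exists2 y, True & w = e k y) (fun=> True) be.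
    apply: (@len_img A P _ _ be (g k) R (fun=> True) _ (fun=> True) mP sR (@smodT _ _) (sie k) (@smodT _ _)) hq => //.
    - move=> w _; have [[f x] <-] := ps w; apply: (sub_qin mP); exists f => //; exists x => //.
      by rewrite mkLE /addm addrC addKr.
    - by move=> f _ H; exact: (sub_qin mP).
  have bE := has_len_uniq he IH.
  split; first by rewrite -ab bE leq_addl.
  have aE : al = ((b k - crk k) * a)%N by rewrite mulnBl -ab bE addnK.
  (* The kernel of W_(k+1) -> F_k consists of the pairs (0, x) with x a cycle; modulo the image of e
     it is the homology of X at k + 1. *)
  pose Kr (w : W k.+1) := (i k w).1 = 0.
  have sKr : smod Kr by exact: (smod_preim (pfst _ _ \o i k : {linear _ -> _}) smod1).
  have ie x : i k (e k.+1 x) = (0, tdX k.+1 x) by exact: lk_e.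
  have eKr w : (exists2 y, True & w = e k.+1 y) -> Kr w by move=> [y _ ->]; rewrite /Kr ie.
  have kerE x : tdX k x = 0 <-> e k x = 0 by rewrite (st_ker (tw du nA lm G fM k) x).
  rewrite /= mulnDl -aE.
  apply: (has_len_add mP (sie k.+1) sKr (@smodT _ _) eKr (fun _ _ => I)).
    have h1 := hrk_len ha k.+1.
    apply: (@has_len_rel A P _ _ _ (fun x w => i k w = (0, x))) h1 => //.
    - exact: (smod_img (tdX k.+1) smodT).
    - exact: (smod_preim (tdX k) smod1).
    - by move=> x [y _ ->]; rewrite /cycX; exact: (dcd_dd du).
    - by rewrite linear0.
    - move=> c x w x' w' h h'; rewrite linearP h h'; congr pair.
      by rewrite [LHS](_ : _ = c *: 0 + 0) // scaler0 addr0.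
    - move=> x /kerE ex; have [|w wE] := (ip (0, x)).1; first by rewrite mkLE /addm /= linear0 add0r.
      by exists 1, w; rewrite scale1r; split=> //; [exact: mP.1 | rewrite /Kr -wE].
    - move=> w Kw; exists 1, (i k w).2; rewrite scale1r; split=> //; first exact: mP.1.
        apply/kerE; have := (ip (i k w)).2 (ex_intro _ w erefl).
        by rewrite mkLE /addm [(i k w).1]Kw linear0 add0r.
      by rewrite [LHS]surjective_pairing [(i k w).1]Kw.
    - move=> x w _ xw [y _ wy]; apply: (sub_qin mP); exists y => //; move: xw; rewrite wy ie => -[//].
    - move=> x w _ xw [y _ xy]; apply: (sub_qin mP); exists y => //; apply: iI; by rewrite xw ie xy.
  apply: (@has_len_rel A P _ _ _ (fun f w => (i k w).1 = f)) hR => //; try exact: smod1; try exact: smodT.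
  - by rewrite linear0.
  - by move=> c f w f' w' <- <-; rewrite linearP.
  - move=> f [y _ gy]; have [|w wE] := (ip (f, - y)).1; first by rewrite mkLE /addm /= gy linearN subrr.
    by exists 1, w; rewrite scale1r; split=> //; [exact: mP.1 | rewrite -wE].
  - move=> w _; exists 1, (i k w).1; rewrite scale1r; split=> //; first exact: mP.1.
    exists (- (i k w).2) => //; apply/eqP; rewrite linearN -addr_eq0; apply/eqP.
    exact: ((ip (i k w)).2 (ex_intro _ w erefl)).
  - by move=> f w _ <- Kw; apply: (sub_qin mP).
  - by move=> f w _ fw f0; apply: (sub_qin mP); rewrite /Kr fw.
have rec k : has_len P (fun w : W k => exists2 y, True & w = e k y) (fun=> True) (crk k * a).
  elim: k => [|k /step[_ //]].
  exact: (hrk_len ha 0%N).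
by split; [exact: rec | exact: (step j (rec j)).1].
Qed.
End AtP.

(** The length is positive because the annihilator of u is P itself, so u survives in A_P. *)
Lemma ml_ann (u : A) : prm (ann (u : A^o)) -> exists2 a, (0 < a)%N & ml (ann (u : A^o)) (A : comNzRingType)^o a.
Proof.
move=> pu; have mP := prm_mulc pu.
have fA : fgm (A : comNzRingType)^o by exists [:: 1] => y; split=> // _; exists y; rewrite [_ *: _]mulr1 subrr.
have [a ha _] := dual_rank du nA lm dmax (ass_top pu) fA; exists a => //.
rewrite lt0n; apply/eqP => a0; rewrite a0 in ha.
have [s Ps s1] := (ml0 (A : comNzRingType)^o mP).2 ha u; exact: Ps.
Qed.

Lemma crk_le j : (crk j <= b j)%N.
Proof.
have [c pc] := assoc_ex1 nA ((elimN eqP (oner_neq0 A)) : (1 : A^o) <> 0).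
have [a a0 ha] := ml_ann pc; have [_] := crk_len pc ha j; by rewrite leq_pmul2r.
Qed.

(** Past degree d, W_(j+1) embeds in the free module F_j. A nonzero element has a nonzero
    coordinate, with a multiple whose annihilator is an associated prime of A; rank 0 would kill the
    element at that prime. *)
Lemma crk_zero j : (d < j)%N -> crk j = 0%N -> forall w : W j, w = 0.
Proof.
case: j => // j; rewrite ltnS => dj c0 w; apply: contrapT => w0.
have [iI ps ip] := tses du nA lm G fM j.
have iw : i j w = ((i j w).1, 0) by rewrite [LHS]surjective_pairing; congr pair; exact: tX0.
have [k fk] : exists k, (i j w).1 k <> 0.
  apply: contrapT => H; apply: w0; apply: iI; rewrite linear0 iw; congr pair; apply/funext => k.
  by apply: contrapT => fk; apply: H; exists k.
have [c pc] := assoc_ex1 nA fk; have [a a0 ha] := ml_ann pc.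
have [+ _] := crk_len pc ha j.+1; rewrite c0 mul0n => -[_ n1].
have : qin (ann (c *: ((i j w).1 k : A^o))) (fun w : W j.+1 => exists2 y, True & w = e j.+1 y) w.
  apply: contrapT => nw; apply: n1; exists (fun=> True); split=> //; by exists w.
case=> s Ps [y _ sw]; apply: Ps; rewrite /ann scaleC.
have : s *: w = 0 by rewrite sw (tX0 _ y) ?linear0 //; lia.
move=> /(congr1 (fun w => (i j w).1 k)); rewrite linearZZ linear0 => H.
by rewrite (_ : s *: _ = 0) ?scaler0.
Qed.

Lemma crk_top : (r <= crk d)%N.
Proof.
suff H k : k = d -> (r <= crk k)%N by exact: H.
have hd : hrk d = r by rewrite /hrk eqxx.
case: k => [|k] kd.
  have h0 : hrk 0%N = r by rewrite -[RHS]hd kd.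
  exact: (eq_leq (esym h0)).
by rewrite -[crk _]/(hrk k.+1 + (b k - crk k))%N kd hd leq_addr.
Qed.

(* If c_k = b_k then F_k -> C_k is injective, because F_k is torsion-free over Ass A. *)
Lemma ker_zero k : crk k = b k -> forall w : W k.+1, (i k w).1 = 0.
Proof.
move=> cb w; have [iI ps ip] := tses du nA lm G fM k; apply: contrapT => f0.
have [l fl] : exists l, (i k w).1 l <> 0.
  apply: contrapT => H; apply: f0; apply/funext => l.
  by apply: contrapT => fl; apply: H; exists l.
have [c pc] := assoc_ex1 nA fl; have [a a0 ha] := ml_ann pc; have mP := prm_mulc pc.
have [IH _] := crk_len pc ha k.
have sie : smod (fun w : W k => exists2 y, True & w = e k y) by exact: (smod_img (e k) smodT).
pose R (f : free A (b k)) := exists2 y, True & g k f = e k y.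
have sR : smod R := smod_preim (g k) sie.
have zR x : x = 0 -> R x by move=> ->; exact: smod0.
have [al [be [ab hR hq]]] := has_len_inv mP (@smod1 _ _) sR (@smodT _ _) zR (fun _ _ => I) (ml_free mP (b k) ha).
have he : has_len (ann (c *: ((i k w).1 l : A^o))) (fun w : W k => exists2 y, True & w = e k y) (fun=> True) be.
  apply: (@len_img A _ _ _ be (g k) R (fun=> True) _ (fun=> True) mP sR (@smodT _ _) sie (@smodT _ _)) hq => //.
  - move=> v _; have [[f x] <-] := ps v; apply: (sub_qin mP); exists f => //; exists x => //.
    by rewrite mkLE /addm addrC addKr.
  - by move=> f _ H; exact: (sub_qin mP).
have bE := has_len_uniq he IH.
have al0 : al = 0%N by move: ab; rewrite bE cb; lia.
have [s Ps sf] : qin (ann (c *: ((i k w).1 l : A^o))) (fun x => x = 0) (i k w).1.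
  apply: contrapT => nf; have [_] := hR; rewrite al0; apply; exists R; split=> //; exists (i k w).1 => //.
  exists (- (i k w).2) => //; apply/eqP; rewrite linearN -addr_eq0; apply/eqP.
  exact: ((ip (i k w)).2 (ex_intro _ w erefl)).
apply: Ps; rewrite /ann scaleC.
have -> : s *: ((i k w).1 l : A^o) = 0 by exact: (congr1 (@^~ l) sf).
by rewrite scaler0.
Qed.

(** N + 1 is the first index after d at which c vanishes. For N = d, c_N > 0 comes from c_d >= r,
    otherwise from the choice of N; then b_N - c_N = c_(N+1) = 0 and [crk_le] give b_N = c_N. *)
Lemma tower_stops n : (0 < r)%N -> (d <= n)%N -> (b n <= 1)%N ->
  exists N, [/\ (d <= N)%N, forall w : W N.+1, w = 0, (0 < b N)%N & crk N = b N].
Proof.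
move=> r0 dn bn.
have cS k : (d <= k)%N -> crk k.+1 = (b k - crk k)%N by move=> dk; rewrite /= /hrk gtn_eqF //.
have cd := crk_top.
have [k dk ck] : exists2 k, (d < k)%N & crk k = 0%N.
  have [c1|c1] := posnP (crk n); last by exists n.+1 => //; rewrite (cS n dn); have := crk_le n; lia.
  by exists n => //; rewrite ltn_neqAle dn andbT; apply/eqP => dn'; move: cd; rewrite dn' c1; lia.
have exk : exists k, (d < k)%N && (crk k == 0%N) by exists k; rewrite dk ck eqxx.
case: (ex_minnP exk) => -[|N] /andP[dN /eqP cN] Nmin //; exists N.
have cN0 : crk N <> 0%N.
  move=> cN0; have [Nd|Nd] := eqVneq d N; first by move: cd; rewrite Nd cN0; lia.
  by have := Nmin N; rewrite cN0 eqxx andbT ltn_neqAle Nd -ltnS dN => /(_ isT); rewrite ltnn.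
have := cS N dN; rewrite cN => /esym/eqP; rewrite subn_eq0 => bc.
have cb := crk_le N; split=> //; [exact: crk_zero | lia | by apply/eqP; rewrite eqn_leq cb].
Qed.
End TowerRank.

(** * Regular sequences and depth *)

Section RegularSequences.
Variables (A : comNzRingType) (m : idealr A).
Let M := fun a : A => a \in m.
Hypothesis nA : noeth A.
Hypothesis lm : mloc M.
Let mq : mulc M := prm_mulc lm.1.
Let sm : idl M. Proof. by case: lm => -[]. Qed.

Section Module.
Variable V : lmodType A.

Lemma in_ideal_mulE (xs : seq A) (y : V) :
  in_ideal_mul xs y <-> exists z : nat -> V, y = \sum_(i < size xs) xs`_i *: z i.
Proof.
split=> [[z ->]|[z ->]]; last by exists (fun i => z i).
exists (fun i => if insub i is Some j then z j else 0); apply: eq_bigr => i _.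
by rewrite valK.
Qed.

Lemma smod_iim xs : smod (@in_ideal_mul A V xs).
Proof.
split; first by exists (fun=> 0); rewrite big1 // => i _; rewrite scaler0.
move=> a _ _ [z ->] [w ->]; exists (fun i => a *: z i + w i).
rewrite scaler_sumr -big_split; apply: eq_bigr => i _ /=.
by rewrite scalerDr scaleC.
Qed.

Lemma iim_rcons xs x (y : V) : in_ideal_mul (rcons xs x) y <-> exists v, in_ideal_mul xs (y - x *: v).
Proof.
rewrite in_ideal_mulE; split=> [[z ->]|[v /in_ideal_mulE[z e]]].
  exists (z (size xs)); apply/in_ideal_mulE; exists z; rewrite size_rcons big_ord_recr /=.
  rewrite nth_rcons ltnn eqxx addrK; apply: eq_bigr => i _; by rewrite nth_rcons ltn_ord.
exists (fun i => if i == size xs then v else z i); rewrite size_rcons big_ord_recr /=.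
rewrite nth_rcons ltnn !eqxx -[LHS](subrK (x *: v)) e; congr (_ + _); apply: eq_bigr => i _.
by rewrite nth_rcons ltn_ord ltn_eqF.
Qed.

Lemma iim_take k xs (y : V) : (k < size xs)%N ->
  in_ideal_mul (take k.+1 xs) y <-> exists v, in_ideal_mul (take k xs) (y - xs`_k *: v).
Proof. by move=> kx; rewrite (take_nth 0 kx) iim_rcons. Qed.

Lemma iim_proper (xs : seq A) : {subset xs <= m} -> fgm V -> (exists x : V, x <> 0) -> exists y : V, ~ in_ideal_mul xs y.
Proof.
move=> xm [s sE] [x x0]; apply: contrapT => H; apply: x0.
have all (y : V) : in_ideal_mul xs y by apply: contrapT => Hy; apply: H; exists y.
have sT := @smod1 A V; apply: (mloc_qin lm sT).
have sx : spn s x by apply/sE.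
apply: (nakayama lm.1 sm (fun a ma => ma) sT _ sx) => v vs; exists 1; first exact: mq.1.
rewrite scale1r; exists 0 => //; rewrite subr0; have [z ->] := all v.
apply: (smod_sum (smod_ispn _ sm)) => i _; apply: ispnZ => //; last exact/sE.
by apply: xm; exact: mem_nth.
Qed.

(** Without socle m is not associated to V, so prime avoidance finds an element of m outside all
    associated primes; [g] fills the places of the covering list that hold no suitable prime. *)
Lemma nonzerodiv (s : V -> Prop) : fgm V -> (forall y : V, soc M y -> y = 0) ->
  exists2 x, M x & forall y : V, x *: y = 0 -> y = 0.
Proof.
move=> fV soc0; pose good p := prm p /\ exists2 x, M x & ~ p x.
have goodann (y : V) : prm (ann y) -> good (ann y).
  move=> py; split=> //; apply: contrapT => H; have [_ p1 _] := py; apply: p1.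
  rewrite /ann scale1r; apply: soc0 => a ma; apply: contrapT => ay; apply: H; by exists a.
have [[g gg]|nog] := pselect (exists g, good g); last first.
  exists 0; first by case: sm.
  move=> y _; apply: contrapT => y0; have [a pa] := assoc_ex1 nA y0.
  by apply: nog; exists (ann (a *: y)); exact: goodann.
have [n [L LP]] := ass_fin nA fV.
pose L' i := if pselect (good (L i)) then L i else g.
have gL i : good (L' i) by rewrite /L'; case: pselect.
have [||x mx xL] := @prime_avoid A n L' M sm; first by move=> i _; case: (gL i).
  by move=> i _; case: (gL i).
exists x => // y xy; apply: contrapT => y0; have [a pa] := assoc_ex1 nA y0.
have [i il Li] := LP _ pa; apply: (xL i il); rewrite /L'; case: pselect => [?|] /=.
  by rewrite Li /ann scaleC xy scaler0.
by case; rewrite Li; exact: goodann.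
Qed.

Lemma quo_ann (S : submod V) (w : V) a : ann (qpi S w) a <-> sset S (a *: w).
Proof. by rewrite /ann -linearZZ qpi0. Qed.
End Module.

(** A nonzerodivisor x on the quotient Q built so far exists by the vanishing of Ext^0, and 0 -> Q
    -> Q -> Q/xQ -> 0 shortens the range of vanishing by one. *)
Lemma regular_of_ext (G : kres M) (V : lmodType A) s : fgm V -> (exists x : V, x <> 0) ->
  (forall i, (i < s)%N -> enull G i V) -> exists xs, [/\ size xs = s, {subset xs <= m} & regular_seq V xs].
Proof.
move=> fV V0 nV.
suff H k : (k <= s)%N -> exists xs, [/\ size xs = k, {subset xs <= m},
    forall i, (i < size xs)%N -> forall y : V, in_ideal_mul (take i xs) (xs`_i *: y) -> in_ideal_mul (take i xs) y
    & forall i, (i < s - k)%N -> enull G i (quom (Submod (smod_iim V xs)))].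
  have [xs [xss xm xr _]] := H s (leqnn s); exists xs; split=> //; split=> //; exact: iim_proper.
elim: k => [_|k IH ks].
  exists [::]; split=> // i; rewrite subn0 => /nV H; set S := Submod _.
  have S0 y : sset S y <-> y = 0 by split=> [[z ->]|->]; [rewrite big_ord0 | exact: (smod0 (smod_iim V [::]))].
  move=> y Zy; have /choice[v vE] : forall j, exists v, qpi S v = y j by move=> j; exact: qpi_surj.
  have yE : y = qpi S \o v by apply/funext => j; exact: (esym (vE j)).
  move: Zy; rewrite yE /Zw mact_map => Zy; apply: Bw_map; apply: H; apply/funext => j.
  by apply/S0/(qpi0 S); exact: (congr1 (@^~ j) Zy).
have [xs [xss xm xr xn]] := IH (ltnW ks); set S := Submod _ in xn.
have fQ : fgm (quom S) by exact: fgm_img fV (@qpi_surj _ _ S).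
have [|x mx xr'] := nonzerodiv (fun=> True) fQ; first by apply/(enull0P G)/xn; rewrite subn_gt0.
exists (rcons xs x); rewrite size_rcons xss; pose S' := Submod (smod_iim V (rcons xs x)); split=> //.
- by move=> v; rewrite mem_rcons inE => /orP[/eqP->|/xm].
- move=> i; rewrite ltnS leq_eqVlt => /orP[/eqP->|ik] y.
    rewrite -xss -cats1 take_size_cat // nth_cat ltnn subnn /= => Sxy.
    by apply/(qpi0 S y)/xr'; rewrite -linearZZ; apply/(qpi0 S).
  rewrite -cats1 takel_cat ?nth_cat ?xss ?ik //; last exact: ltnW.
  by apply: xr; rewrite xss.
move=> i ik; have SS' y : sset S y -> sset S' y.
  by move=> Sy; apply/iim_rcons; exists 0; rewrite scaler0 subr0.
have [||p pE] := @lin_factor _ _ _ _ (qpi S) (qpi S'); first exact: qpi_surj.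
  by move=> v /(qpi0 S) /SS' /(qpi0 S').
have mL : linear (fun y : quom S => x *: y) by move=> a u v; rewrite scalerDr scaleC.
have sxp : ses (mkL mL) p.
  split.
  - move=> u v; rewrite !mkLE => uv; apply/eqP; rewrite -subr_eq0; apply/eqP/xr'.
    by rewrite scalerBr uv subrr.
  - by move=> z; have [v <-] := qpi_surj z; exists (qpi S v).
  - move=> y; have [v <-] := qpi_surj y; rewrite pE (qpi0 S'); split=> [/iim_rcons[u Su]|[w]].
      exists (qpi S u); rewrite mkLE -linearZZ; apply/eqP; rewrite -subr_eq0 -linearB; apply/eqP; exact/(qpi0 S).
    have [u <-] := qpi_surj w; rewrite mkLE -linearZZ => /eqP; rewrite -subr_eq0 -linearB => /eqP/(qpi0 S) Su.
    by apply/iim_rcons; exists u.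
apply: (e_quo sxp); apply: xn; lia.
Qed.

(** Let p annihilate w modulo the first k elements, let y be the next one, and N0 the elements
    killed by p modulo the first k. If adding y swallowed N0, regularity would give N0 = y N0 modulo
    the first k, and Nakayama's lemma would put w there. An element of N0 that is not swallowed
    yields a prime containing p and y, and y is outside p. *)
Lemma regular_chain (V : lmodType A) xs (x : V) : fgm V -> {subset xs <= m} -> regular_seq V xs ->
  prm (ann x) -> pchain (size xs) (ann x).
Proof.
move=> fV xm [xr _] px.
suff H j k : (k + j)%N = size xs -> forall w : V, prm (fun a => in_ideal_mul (take k xs) (a *: w)) ->
    pchain j (fun a => in_ideal_mul (take k xs) (a *: w)).
  have e : ann x = (fun a => in_ideal_mul (take 0 xs) (a *: x)).
    apply/funext => a; apply/propext; rewrite take0; split=> [ax|[z e]]; last by rewrite /ann e big_ord0.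
    by exists (fun=> 0); rewrite big_ord0.
  by rewrite e; apply: (H (size xs) 0%N); rewrite -?e.
elim: j k => [|j IH] k kj w pw; first exact: pchain0.
have kx : (k < size xs)%N by lia.
pose S y := in_ideal_mul (take k xs) (y : V); pose p a := in_ideal_mul (take k xs) (a *: w); pose y := xs`_k.
have sS : smod S := smod_iim V (take k xs).
have yS v : S (y *: v) -> S v by exact: xr.
have [sp p1 _] : prm p := pw; pose N0 v := forall a, p a -> S (a *: v).
have sN0 : smod N0.
  split=> [a _|b u v Nu Nv a pa]; first by rewrite scaler0; exact: smod0.
  by rewrite scalerDr scaleC; apply: sS.2; [exact: Nu | exact: Nv].
have N0w : N0 w by move=> a.
have my : M y by apply: xm; exact: mem_nth.
have [v Nv Sv] : exists2 v, N0 v & ~ in_ideal_mul (take k.+1 xs) v.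
  apply: contrapT => H; apply: p1; rewrite /p scale1r.
  have [s sE] := fgs_sub nA fV sN0.
  apply: (mloc_qin lm sS); move/sE: N0w; apply: (nakayama lm.1 sm (fun a ma => ma) sS) => v vs.
  have Nv : N0 v by apply/sE/spn_mem.
  exists 1; first exact: mq.1.
  rewrite scale1r; have /(iim_take _ kx)[u Su] : in_ideal_mul (take k.+1 xs) v.
    by apply: contrapT => nv; apply: H; exists v.
  exists (v - y *: u) => //; rewrite subKr; apply: ispnZ => //; apply/sE => a pa; apply: yS.
  rewrite scaleC -[y *: u](subKr v) scalerBr; apply: smodB => //; [exact: Nv | exact: smodZ].
pose S1 := Submod (smod_iim V (take k.+1 xs)).
have [|a pa] := @assoc_ex1 A _ (qpi S1 v) nA; first by move=> /(qpi0 S1).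
have e : ann (a *: qpi S1 v) = (fun b => in_ideal_mul (take k.+1 xs) (b *: (a *: v))).
  by apply/funext => b; apply/propext; rewrite -linearZZ; exact: quo_ann.
rewrite e in pa; have SS1 u : S u -> in_ideal_mul (take k.+1 xs) u.
  by move=> Su; apply/iim_take => //; exists 0; rewrite scaler0 subr0.
apply: (pchainS pw _ _ (IH k.+1 _ _ pa)); last by rewrite addSnnS.
- by move=> b pb; apply: SS1; rewrite scaleC; apply: smodZ => //; exact: Nv.
- exists y; first by apply/iim_take => //; exists (a *: v); rewrite subrr; exact: smod0.
  by move=> py; apply: p1; rewrite /p scale1r; apply: yS.
Qed.

Lemma regular_bound (V : lmodType A) xs d : (forall p l, @pchain A l p -> (l <= d)%N) -> fgm V ->
  {subset xs <= m} -> regular_seq V xs -> (size xs <= d)%N.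
Proof.
move=> dmax fV xm rs; have [_ [y ny]] := rs.
have y0 : y <> 0 by move=> y0; apply: ny; rewrite y0; exact: (smod0 (smod_iim V xs)).
have [a pa] := assoc_ex1 nA y0; exact: dmax (regular_chain fV xm rs pa).
Qed.

Lemma depth_of_ext (G : kres M) (V : lmodType A) d : (forall p l, @pchain A l p -> (l <= d)%N) ->
  fgm V -> (exists x : V, x <> 0) -> (forall i, (i < d)%N -> enull G i V) -> depth m V d.
Proof.
move=> dmax fV V0 nV; split; first by have [xs [? ? ?]] := regular_of_ext fV V0 nV; exists xs.
move=> xs xm rs; exact: regular_bound dmax fV xm rs.
Qed.
End RegularSequences.

(** * Comparison of projective resolutions *)

Section Comparison.
Variables (A : comNzRingType) (V : lmodType A).
Implicit Types P Q : projective_resolution V.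

Definition cycP P n : P n -> Prop :=
  match n return P n -> Prop with 0 => fun x => proj_aug P x = 0 | n'.+1 => fun x => proj_diff P n' x = 0 end.

Lemma cycPE P n x : cycP (P := P) (n := n) x <-> exists y, x = proj_diff P n y.
Proof. by case: n x => [|n] x; [exact: proj_exact0 | exact: proj_exactS]. Qed.

Lemma proj_dd P n x : cycP (proj_diff P n x).
Proof. by apply/cycPE; exists x. Qed.

Lemma proj_lift (P X Y : lmodType A) (g : {linear X -> Y}) (f : {linear P -> Y}) : projective P ->
  (forall p, exists x, g x = f p) -> exists h : {linear P -> X}, forall p, g (h p) = f p.
Proof.
move=> pP gf; pose S := Submod (smod_img g (@smodT _ X)).
have [f' f'E] : exists f' : {linear P -> subm S}, forall p, sinc S (f' p) = f p.
  apply: lin_lift; first exact: sinc_inj.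
  by move=> p; apply: (@sinc_surj _ _ S); have [x <-] := gf p; exists x.
have [g' g'E] : exists g' : {linear X -> subm S}, forall x, sinc S (g' x) = g x.
  by apply: lin_lift; [exact: sinc_inj | move=> x; apply: (@sinc_surj _ _ S); exists x].
have [|h hE] := pP X (subm S) g' f'.
  move=> y; have [x _ xE] := sincP y; exists x; apply: sinc_inj; by rewrite g'E.
by exists h => p; rewrite -g'E hE f'E.
Qed.

(** [f] is the n-th component of a chain map over the identity of V. The lower components are kept
    existentially, so that no coherent family has to be chosen. *)
Fixpoint chm P Q n : {linear P n -> Q n} -> Prop :=
  match n return {linear P n -> Q n} -> Prop with
  | 0 => fun f => forall x, proj_aug Q (f x) = proj_aug P x
  | n'.+1 => fun f => exists2 f' : {linear P n' -> Q n'}, chm f' & forall x, proj_diff Q n' (f x) = f' (proj_diff P n' x)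
  end.

Lemma chm_cyc P Q n (f : {linear P n -> Q n}) x : chm f -> cycP x -> cycP (f x).
Proof.
case: n f x => [|n] f x /=; first by move=> ->.
by move=> [f' _ fE] x0; rewrite fE x0 linear0.
Qed.

Lemma chm_ext P Q n (f' : {linear P n -> Q n}) : chm f' ->
  exists f : {linear P n.+1 -> Q n.+1}, forall x, proj_diff Q n (f x) = f' (proj_diff P n x).
Proof.
move=> cf; apply: (proj_lift (g := proj_diff Q n) (f := f' \o proj_diff P n)); first exact: proj_projective.
move=> x; have /cycPE[y yE] := chm_cyc cf (proj_dd x).
by exists y; rewrite -yE.
Qed.

Lemma chm_ex P Q n : exists f : {linear P n -> Q n}, chm f.
Proof.
elim: n => [|n [f' cf]]; last by have [f fE] := chm_ext cf; exists f, f'.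
apply: (proj_lift (g := proj_aug Q) (f := proj_aug P)); first exact: proj_projective.
by move=> x; exact: proj_aug_surj.
Qed.

Definition nullh Q n (t : {linear Q n -> Q n}) : Prop :=
  match n return {linear Q n -> Q n} -> Prop with
  | 0 => fun t => forall x, t x = 0
  | n'.+1 => fun t => exists s : {linear Q n' -> Q n'.+1}, forall x, t x = s (proj_diff Q n' x)
  end t.

Lemma nullh_d Q n (t : {linear Q n -> Q n}) x : nullh t -> t (proj_diff Q n x) = 0.
Proof.
case: n t x => [|n] t x /=; first by move=> ->.
by move=> [s ->]; rewrite [proj_diff Q n _](proj_dd x) linear0.
Qed.

(** Here t = s d is the lower half of a homotopy. That f g - 1 - t takes cycles as values is exactly
    what allows the next component of the homotopy to be lifted. *)
Lemma chm_homotopy P Q n (f : {linear P n -> Q n}) (g : {linear Q n -> P n}) : chm f -> chm g ->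
  exists2 t : {linear Q n -> Q n}, nullh t & forall x, cycP (f (g x) - x - t x).
Proof.
elim: n f g => [|n IH] f g /=.
  by move=> cf cg; exists \0 => // x; rewrite subr0 linearB cf cg subrr.
move=> [f' cf fE] [g' cg gE]; have [t th tc] := IH f' g' cf cg.
have [s sE] : exists s : {linear Q n -> Q n.+1}, forall x, proj_diff Q n (s x) = ((f' \o g') \- idfun \- t) x.
  apply: proj_lift; first exact: proj_projective.
  by move=> x; have /cycPE[y yE] := tc x; exists y; rewrite -yE.
exists (s \o proj_diff Q n); first by exists s.
by move=> x; rewrite !linearB /= fE gE sE /= (nullh_d _ th) subr0 subrr.
Qed.

Lemma chm_cobound P Q (M : lmodType A) n (f : {linear P n -> Q n}) (y : Q n -> M) : chm f ->
  is_coboundary y -> is_coboundary (y \o f).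
Proof.
case: n f y => [|n] f y /=; first by move=> _ ->.
by move=> [f' _ fE] [g ->]; exists (g \o f'); apply/funext => x /=; rewrite fE.
Qed.

(* Composition with f followed by g changes a cocycle only by a coboundary. *)
Lemma chm_reflect P Q (M : lmodType A) n (f : {linear P n -> Q n}) (y : {linear Q n -> M}) : chm f ->
  (forall x, y (proj_diff Q n x) = 0) -> is_coboundary (P := P) (y \o f) -> is_coboundary (P := Q) (y : Q n -> M).
Proof.
move=> cf y0 yf; have [g cg] := chm_ex Q P n; have [t th tc] := chm_homotopy cf cg.
have yE x : y x = y (f (g x)) - y (t x).
  have /cycPE[z zE] := tc x; have := y0 z; rewrite -zE (linearB y) (linearB y) => H.
  by apply/eqP; rewrite eq_sym -subr_eq0 addrAC; apply/eqP.
have := chm_cobound cg yf.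
case: n f y cf y0 yf g cg t th tc yE => [|n] f y cf y0 yf g cg t th tc yE /=.
  move=> H; apply/funext => x; rewrite yE th linear0 subr0; exact: (congr1 (@^~ x) H).
move=> [h hE]; have [s sE] := th; exists (h \- (y \o s)); apply/funext => x /=.
rewrite yE sE; congr (_ - _); exact: (congr1 (@^~ x) hE).
Qed.
End Comparison.

Section Quotmod.
Variables (A : comNzRingType) (V : lmodType A) (N : submodClosed V).
Definition qmp_fun (v : V) : quotmod N := (\pi_(Quotient.quot (submod_zmod N)) v)%qT.
Lemma qmp_linear : linear qmp_fun.
Proof.
move=> a x y; rewrite [a *: qmp_fun x](_ : _ = qmp_fun (a *: x)); last exact: quotmod_scaleE.
by rewrite /qmp_fun piE.
Qed.
Definition qmp : {linear V -> quotmod N} := mkL qmp_linear.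
Lemma qmp_surj z : exists v, qmp v = z.
Proof. by exists (repr (z : Quotient.quot (submod_zmod N))); rewrite /= /qmp_fun reprK. Qed.
Lemma qmp0 v : qmp v = 0 <-> v \in N.
Proof.
rewrite -(linear0 qmp) /= /qmp_fun; split=> [/eqP|Sv]; last apply/eqP.
  by rewrite -Quotient.idealrBE subr0.
by rewrite -Quotient.idealrBE subr0.
Qed.
End Quotmod.

(** * Bass numbers from the matrix resolution *)

Section BassNumbers.
Variables (A : comNzRingType) (m : idealr A).
Let Mm := fun a : A => a \in m.
Hypothesis lm : mloc Mm.
Variable G : kres Mm.
Local Notation e := (kr_e G).
Local Notation E := (kr_E G).
Let k : lmodType A := {ideal_quot m}.

Definition kpi (a : A) : k := (\pi_{ideal_quot m} a)%qT.
Lemma kpi0 a : kpi a = 0 <-> a \in m.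
Proof.
split=> [/eqP|am]; last apply/eqP; rewrite /kpi -[0](rmorph0 (\pi_{ideal_quot m})%qT) -Quotient.idealrBE subr0 //.
Qed.
Lemma kpi_surj z : exists a, kpi a = z. Proof. by exists (repr z); rewrite /kpi reprK. Qed.
Lemma kpi_lin c a b : kpi (c * a + b) = c *: kpi a + kpi b.
Proof. by rewrite /kpi rmorphD rmorphM. Qed.

Lemma free_proj b : projective (free A b).
Proof.
move=> X Y g f gs; have /choice[x xE] := fun i => gs (f (fe A i)); have [h hE] := free_map x.
exists h => c; rewrite hE linear_sum [in RHS](free_sum c) linear_sum; apply: eq_bigr => i _.
by rewrite !linearZZ xE.
Qed.

Let aug_fun (x : free A (e 1)) : k := kpi (x (i0 G)).
Lemma aug_linear : linear aug_fun. Proof. by move=> a x y; exact: kpi_lin. Qed.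

Definition kproj : projective_resolution {ideal_quot m}.
Proof.
apply: (@ProjectiveResolution A {ideal_quot m} (fun i => free A (e i.+1))
  (fun i => mactL (E i.+1)^T (A : comNzRingType)^o) (mkL aug_linear)).
- by move=> n; exact: free_proj.
- by move=> v; have [a av] := kpi_surj v; exists (fun=> a).
- move=> x; rewrite mkLE /aug_fun kpi0; have cst : (fun=> x (i0 G)) = x by apply/funext => j; exact: e1_const.
  by split=> [/(kr_m G)|[w xw]]; [rewrite cst => -[w xw]; exists w | apply/(kr_m G); rewrite cst; exists w].
- move=> n x; split=> [x0|[y ->]]; first by have [w xw] := @kr_T _ _ G n x x0; exists w.
  rewrite !mkLE -mactM -trmx_mul kr_EE trmx0 mact0 //.
Defined.

Section Module.
Variable V : lmodType A.

Definition yv n (f : kproj n -> V) : 'I_(e n.+1) -> V := fun j => f (fe A j).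

Lemma yv_ex n (y : 'I_(e n.+1) -> V) : exists f : {linear kproj n -> V}, yv f = y.
Proof.
have [f fE] := free_map y; exists f; apply/funext => j; rewrite /yv fE (bigD1 j) //= big1 => [|i ij].
  by rewrite /fe eqxx scale1r addr0.
by rewrite /fe eq_sym (negPf ij) scale0r.
Qed.

Lemma yvE n (f : {linear kproj n -> V}) x : f x = \sum_j x j *: yv f j.
Proof. by rewrite [in LHS](free_sum x) linear_sum; apply: eq_bigr => j _; rewrite linearZZ. Qed.

Lemma yv_d n (f : {linear kproj n -> V}) : yv (f \o proj_diff kproj n) = mact (E n.+1) (yv f).
Proof.
apply/funext => j; rewrite /yv /= yvE; apply: eq_bigr => i _; congr (_ *: _).
rewrite /mact (bigD1 j) //= big1 => [|l lj]; first by rewrite mxE /fe eqxx addr0 [LHS]mulr1.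
by rewrite /fe eq_sym (negPf lj) [LHS]mulr0.
Qed.

Lemma yv_inj n (f g : {linear kproj n -> V}) : yv f = yv g -> (f : kproj n -> V) = g.
Proof. by move=> fg; apply/funext => x; rewrite !yvE fg. Qed.

Lemma cocycle_Zw n (f : {linear kproj n -> V}) : (forall x, f (proj_diff kproj n x) = 0) <-> Zw (E n.+1) (yv f).
Proof.
rewrite /Zw -yv_d; split=> [f0|f0 x]; first by apply/funext => j; exact: f0.
have := yv_inj (f := f \o proj_diff kproj n) (g := \0) f0; by move=> /(congr1 (@^~ x)).
Qed.

Lemma cobound_Bw n (f : {linear kproj n -> V}) : is_coboundary (f : kproj n -> V) <-> Bw (E n) (yv f).
Proof.
case: n f => [|n] f.
  rewrite Bw_e0; split=> [f0|f0]; first by apply/funext => j; rewrite /yv [f _](congr1 (@^~ (fe A j)) f0).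
  exact: (yv_inj (g := \0) f0).
split=> [[g gE]|[w wE]].
  by exists (yv g); rewrite -yv_d; apply/funext => j; exact: (congr1 (@^~ (fe A j)) gE).
have [g gw] := yv_ex w; exists g; apply: (yv_inj (g := g \o proj_diff kproj n)); by rewrite yv_d gw.
Qed.

(** Coordinates of a cocycle in a basis of the matrix cohomology are well defined modulo m, and they
    form the isomorphism of Ext with (A/m)^h. *)
Lemma bass_of_elen n h : elen G n V h -> bass_number m V n h.
Proof.
move=> /(len_kdim lm (smod_Bw _ _) (smod_Zw _ _) (Bw_Zw (kr_EE G n)) (fun a x ma => killed (fun x mx => kr_H G mx n) ma)).
move=> [y [yZ yspan yind]]; exists kproj.
pose C := cocycles kproj V n.
have CL (z : C) : linear (val z : kproj n -> V) by case: z => f /= /asboolP[].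
have C0 (z : C) x : val z (proj_diff kproj n x) = 0 by case: z => f /= /asboolP[_]; exact.
have CZ (z : C) : Zw (E n.+1) (yv (val z)) by apply: ((cocycle_Zw (mkL (CL z))).1); exact: C0.
have Cmk (u : 'I_(e n.+1) -> V) : Zw (E n.+1) u -> exists z : C, yv (val z) = u.
  move=> Zu; have [f fu] := yv_ex u.
  have fc : (f : kproj n -> V) \in @cocycle A _ kproj V n.
    by apply/asboolP; split; [exact: linP | apply/cocycle_Zw; rewrite fu].
  by exists (exist (fun f => f \in @cocycle A _ kproj V n) _ fc).
have cobE (z : C) : z \in @coboundary A _ kproj V n <-> Bw (E n) (yv (val z)).
  rewrite -(cobound_Bw (mkL (CL z))); split=> [/asboolP//|H]; exact/asboolP.
have /choice[c cP] : forall z : C, exists c : 'I_h -> A, Bw (E n) (yv (val z) - \sum_i c i *: y i).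
  by move=> z; exact: yspan.
have sB := smod_Bw (E n) V.
have cu (z : C) (c' : 'I_h -> A) : Bw (E n) (yv (val z) - \sum_i c' i *: y i) -> forall i, c z i - c' i \in m.
  move=> H; apply: (yind (fun i => c z i - c' i)); have := smodB sB H (cP z); congr (Bw _ _).
  rewrite opprB addrC addrA subrK -sumrB; by apply: eq_bigr => i _; rewrite scalerBl.
pose F (z : C) : {ffun 'I_h -> k} := [ffun i => kpi (c z i)].
have kpi_eq a b : a - b \in m -> kpi a = kpi b.
  by move=> /kpi0 H; rewrite -[a](subrK b) -[a - b]mul1r kpi_lin scale1r H add0r.
have FL : linear F.
  move=> a z w; apply/ffunP => i; rewrite !ffunE -kpi_lin; apply: kpi_eq.
  apply: (cu (a *: z + w) (fun i => a * c z i + c w i)).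
  have := sB.2 a _ _ (cP z) (cP w); congr (Bw _ _).
  rewrite (_ : yv (val (a *: z + w)) = a *: yv (val z) + yv (val w)) //.
  under [in RHS]eq_bigr => j _ do rewrite scalerDl -scalerA.
  by rewrite big_split /= -scaler_sumr scalerBr opprD !addrA; congr (_ - _); rewrite addrAC.
have [||f fE] := @lin_factor A C (quotmod (@coboundary A _ kproj V n)) {ffun 'I_h -> k} (qmp _) (mkL FL).
- exact: qmp_surj.
- move=> z /qmp0/cobE Bz; apply/ffunP => i; rewrite mkLE !ffunE; apply/kpi0.
  rewrite -[c z i]subr0; apply: (cu z (fun=> 0)); rewrite big1 ?subr0 // => j _; exact: scale0r.
have finj q : f q = 0 -> q = 0.
  have [z <-] := qmp_surj q; rewrite fE => Fz; apply/qmp0/cobE.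
  rewrite -(subrK (\sum_i c z i *: y i) (yv (val z))); apply: (smodD sB) => //.
  apply: (smod_sum sB) => i _; apply: (killed (fun x mx => kr_H G mx n)) => //.
  by apply/kpi0; have := congr1 (fun u : {ffun 'I_h -> k} => u i) Fz; rewrite mkLE !ffunE.
have /choice[g gE] : forall u, exists q, f q = u.
  move=> u; have /choice[a aE] := fun i => kpi_surj (u i).
  have [|z zE] := Cmk (\sum_i a i *: y i); first by apply: (smod_sum (smod_Zw _ _)) => i _; exact: (smodZ (smod_Zw _ _)).
  exists (qmp _ z); rewrite fE mkLE; apply/ffunP => i; rewrite ffunE -aE; apply: kpi_eq; apply: cu.
  by rewrite zE subrr; exact: smod0.
exists f; exists g => // q; apply/eqP; rewrite -subr_eq0; apply/eqP/finj; by rewrite linearB gE subrr.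
Qed.

(** Two independent classes, pulled back to the given resolution P, satisfy a relation with
    coefficients not both in m because Ext is at most one-dimensional there; [chm_reflect] carries
    the relation back. *)
Lemma elen_le1 n h mu : bass_number m V n mu -> (mu <= 1)%N -> elen G n V h -> (h <= 1)%N.
Proof.
move=> [P [f [g fK gK]]] mu1 /(len_kdim lm (smod_Bw _ _) (smod_Zw _ _) (Bw_Zw (kr_EE G n)) (fun a x ma => killed (fun x mx => kr_H G mx n) ma)).
move=> [y [yZ _ yind]]; rewrite leqNgt; apply/negP => h2.
have h0 : (0 < h)%N by exact: ltnW.
pose j0 := Ordinal h0; pose j1 := Ordinal h2.
have [F' [F cF FE]] := chm_ex P kproj n.+1.
have /choice[y' y'E] := fun i => yv_ex (y i).
have y'0 i x : y' i (proj_diff kproj n x) = 0.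
  by move: x; apply/cocycle_Zw; rewrite y'E.
have zc i : (y' i \o F : P n -> V) \in @cocycle A _ P V n.
  by apply/asboolP; split=> [|x]; [exact: linP | rewrite /= -FE].
pose z i : cocycles P V n := exist (fun f => f \in @cocycle A _ P V n) _ (zc i).
pose q i : Ext P V n := qmp _ (z i).
have [a [b [ab abq]]] : exists a b, ~ (a \in m /\ b \in m) /\ a *: f (q j0) + b *: f (q j1) = 0.
  have m1 : ~ (1 \in m) by have [[]] := lm.
  case: mu mu1 f g fK gK => [|[|//]] _ f g fK gK.
    by exists 1, 0; split; [case | apply/ffunP => -[]].
  have [a0 a0E] := kpi_surj (f (q j0) ord0); have [a1 a1E] := kpi_surj (f (q j1) ord0).
  have [am|am] := pselect (a0 \in m).
    exists 1, 0; split; first by case.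
    apply/ffunP => i; rewrite ord1 scale1r scale0r addr0 -a0E ffunE; exact/kpi0.
  exists a1, (- a0); split; first by move=> [_ H]; apply: am; rewrite -rpredN.
  apply/ffunP => i; rewrite ord1 !ffunE -a0E -a1E -[_ *: kpi a1]addr0.
  rewrite [X in _ + X](_ : _ = kpi (- a0 * a1 + 0)); last by rewrite kpi_lin /kpi rmorph0.
  by rewrite -kpi_lin (_ : _ + _ = 0) /kpi ?rmorph0 //; ring.
have : a *: q j0 + b *: q j1 = 0.
  by apply: (can_inj fK); rewrite linear0 linearD !linearZZ.
rewrite -!linearZZ -linearD => /qmp0/asboolP cb.
have := @chm_reflect A _ P kproj V n F (a \*: y' j0 \+ b \*: y' j1) cF _ cb.
move=> /(_ _)/cobound_Bw => H; apply: ab.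
have {}H : Bw (E n) (a *: y j0 + b *: y j1).
  rewrite -!y'E; apply: H => x /=; by rewrite !y'0 !scaler0 addr0.
pose c i := if i == j0 then a else if i == j1 then b else 0.
have cm : forall i, Mm (c i).
  apply: yind; rewrite (bigD1 j0) //= (bigD1 j1) //= big1 => [|i /andP[/negPf i0 /negPf i1]].
    by rewrite addr0 /c !eqxx.
  by rewrite /c i0 i1 scale0r.
by split; [exact: (cm j0) | exact: (cm j1)].
Qed.
End Module.
End BassNumbers.

(** * Minimal numbers of generators *)

Section Minimal.
Variables (A : comNzRingType) (m : A -> Prop).
Hypothesis lm : mloc m.
Variable G : kres m.
Let mq : mulc m := prm_mulc lm.1.

Lemma tlen0_ex (V : lmodType A) : fgm V -> exists h, tlen G 0 V h.
Proof.
move=> [s sE]; have [h hh] := len_gen lm (s := s) (smod_mmul G V) (fun x a _ ma => mmulZ G x ma).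
exists h; apply/(tlen0P lm); rewrite (_ : (fun=> True) = addS (@mmul A m G V) (spn s)) //.
apply/funext => w; apply/propext; split=> // _; exists 0; first exact: (smod0 (smod_mmul G V)).
by rewrite subr0; apply/sE.
Qed.

Lemma tlen0_nz (V : lmodType A) : fgm V -> tlen G 0 V 0 -> forall x : V, x = 0.
Proof.
move=> [s sE] /(tlen0P lm)[_ n1] x.
have mm (y : V) : mmul G y.
  apply: contrapT => ny; apply: n1; exists (fun=> True); split=> //; exists y => //.
  by move/(mloc_qin lm (smod_mmul G V)).
have sm : idl m by case: lm => -[].
apply: (mloc_qin lm smod1); have sx : spn s x by apply/sE.
apply: (nakayama lm.1 sm (fun a ma => ma) smod1 _ sx) => v vs; exists 1; first exact: mq.1.
rewrite scale1r; exists 0 => //; rewrite subr0.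
apply: (mmul_min (smod_ispn _ sm) _ (mm v)) => a y ma; apply: ispnZ => //; exact/sE.
Qed.

(** Nakayama's lemma lifts a basis of V/mV to generators. Conversely n generators give a surjection
    from A^n/mA^n, of dimension n, onto V/mV. *)
Lemma min_gen (V : lmodType A) h : fgm V -> tlen G 0 V h -> min_generators V h.
Proof.
move=> [s sE] /(tlen0P lm) hh; have sM := smod_mmul G V.
have sm : idl m by case: lm => -[].
split.
  have [e [_ espan _]] := len_kdim lm sM (@smodT _ V) (fun _ _ => I) (fun a x ma _ => mmulZ G x ma) hh.
  exists e => x; have sT := smod_in_span e; apply: (mloc_qin lm sT); have sx : spn s x by apply/sE.
  apply: (nakayama lm.1 sm (fun a ma => ma) sT _ sx) => v vs; exists 1; first exact: mq.1.
  rewrite scale1r; have [c mc] := espan v I; exists (\sum_i c i *: e i); first by exists c.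
  apply: (mmul_min (smod_ispn _ sm) _ mc) => a y ma; apply: ispnZ => //; exact/sE.
move=> n e eg; have [f fE] := free_map e; have fs y : exists x, f x = y.
  by have [c ->] := eg y; exists c; rewrite fE.
have sF := smod_mmul G (free A n); have sT := @smodT A (free A n).
have hF : has_len m (@mmul A m G (free A n)) (fun=> True) n.
  apply: (kdim_len lm sF sT) => //; first by move=> a x ma _; exact: mmulZ.
  exists (@fe A n); split=> // [x _|c]; first by exists x; rewrite -free_sum subrr; exact: smod0.
  by rewrite -(free_sum (c : free A n)) => /(mmul_free lm).
have sS := smod_preim f sM.
have FS x : mmul G x -> mmul G (f x) by move=> mx; exact: (Bw_map f mx).
have [a [b [ab _ hb]]] := has_len_inv mq sF sS sT FS (fun _ _ => I) hF.
suff h2 : has_len m (@mmul A m G V) (fun=> True) b by rewrite (has_len_uniq hh h2) -ab leq_addl.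
apply: (@len_img A m _ _ b f _ (fun=> True) _ (fun=> True) mq sS sT sM (@smodT _ V)) hb => //.
- move=> y _; have [x xy] := fs y; apply: (sub_qin mq); exists x => //; rewrite xy subrr; exact: smod0.
- by move=> x _ mx; apply: (sub_qin mq).
Qed.

Lemma hnull_bij (U V : lmodType A) (f : {linear U -> V}) a b c (K : 'M[A]_(b, a)) (L : 'M[A]_(c, b)) :
  bijective f -> hnull K L U -> hnull K L V.
Proof.
move=> [g fK gK] HU y Zy.
have gL : linear g by move=> x u v; apply: (can_inj fK); rewrite linearP !gK.
have := Bw_map f (HU _ (Zw_map (mkL gL) Zy)); rewrite (_ : f \o _ = y) //.
by apply/funext => j /=; rewrite gK.
Qed.

Lemma bij_of (U V : lmodType A) (f : {linear U -> V}) : (forall x, f x = 0 -> x = 0) -> (forall y, exists x, f x = y) -> bijective f.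
Proof.
move=> f0 fs; have /choice[g gE] := fs; exists g => // x; apply/eqP; rewrite -subr_eq0; apply/eqP/f0.
by rewrite linearB gE subrr.
Qed.

(** This is [dual_null] for M = A, since Hom(A, J) is J by evaluation at 1. *)
Lemma enull_soc0 (J : lmodType A) i : injective_module J -> (forall y : J, soc m y -> y = 0) -> enull G i J.
Proof.
move=> Ji J0; have := dual_null (M := (A : comNzRingType)^o) Ji (fun x (mx : m x) => kr_Ht G mx i) J0.
rewrite !trmxK; have evL : linear (fun f : hom (A : comNzRingType)^o J => hap f (1 : A^o)) by move=> a f g; rewrite hapP.
apply: (hnull_bij (f := mkL evL)); apply: bij_of => [f f1|y].
  by apply: hap_inj => x; rewrite hap0 -[x]mulr1 -[x * 1]/(x *: (1 : A^o)) linearZZ [hap f _]f1 scaler0.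
have [f fE] := @lin_ring A J y; have [g gE] := hap_ex f; exists g.
by rewrite mkLE gE fE scale1r.
Qed.
End Minimal.

(** * Vanishing of b_j and acyclicity *)

Section TowerMore.
Variables (A : comNzRingType) (m : A -> Prop) (d : nat) (J : nat -> lmodType A).
Variable dl : forall i, {linear J i -> J i.+1}.
Hypothesis du : dualizing m d dl.
Hypothesis nA : noeth A.
Hypothesis lm : mloc m.
Variable G : kres m.
Variable M : lmodType A.
Hypothesis fM : fgm M.
Let mq : mulc m := prm_mulc lm.1.
Local Notation tX := (tX d J M).
Local Notation tdX := (tdX d dl M).
Local Notation W j := (st_W (tw du nA lm G fM j)).
Local Notation e j := (st_e (tw du nA lm G fM j)).
Local Notation b j := (tb du nA lm G fM j).
Local Notation g j := (tg du nA lm G fM j).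
Local Notation i j := (ti du nA lm G fM j).
Let F j : lmodType A := (free A (b j) * tX j.+1)%type.

Lemma tie j x : i j (e j.+1 x) = (0, tdX j.+1 x). Proof. exact: lk_e. Qed.
Lemma tke j x : e j x = 0 <-> tdX j x = 0. Proof. exact: st_ker. Qed.

Lemma free0 n (x : free A n) : n = 0%N -> x = 0.
Proof. by move=> n0; apply/funext => -[k kn]; exfalso; move: kn; rewrite n0. Qed.

Lemma tb0_im j : b j = 0%N -> forall w : W j, exists x, w = e j x.
Proof.
move=> b0 w; have [_ ps _] := tses du nA lm G fM j; have [[f x] <-] := ps w.
by exists x; rewrite mkLE /addm /= (free0 f b0) linear0 add0r.
Qed.

Lemma im_tb0 j : (forall w : W j, exists x, w = e j x) -> b j = 0%N.
Proof.
move=> H; apply: (has_len_uniq (lk_len (tl du nA lm G fM j))).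
split=> // -[S [_ _ _ [w _ nw] _]]; apply: nw; apply: (sub_qin mq).
by have [x xE] := H w; exists 0; [exact: (smod0 (smod_mmul G _)) | exists x; rewrite // subr0].
Qed.

(* exactness of X at j lifts the vanishing of F_(j-1) to F_j *)
Lemma tb_up j : b j = 0%N -> (forall x, cycX tdX (j := j.+1) x -> exists y, x = tdX j.+1 y) -> b j.+1 = 0%N.
Proof.
move=> b0 H; apply: im_tb0 => w; have [iI ps ip] := tses du nA lm G fM j.
have w1 : (i j w).1 = 0 by exact: free0.
have [|y yE] := H (i j w).2.
  apply/tke; have := (ip (i j w)).2 (ex_intro _ w erefl); by rewrite mkLE /addm w1 linear0 add0r.
by exists y; apply: iI; rewrite tie -yE [LHS]surjective_pairing w1.
Qed.

Lemma tb0_H j : b j = 0%N -> forall x, cycX tdX (j := j) x -> exists y, x = tdX j y.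
Proof.
case: j => [|j] b0 x; first by move=> _; exact: (tb0_im b0).
move=> /tke ex; have [iI ps ip] := tses du nA lm G fM j.
have [|w wE] := (ip (0, x)).1; first by rewrite mkLE /addm /= linear0 add0r.
have [y wy] := tb0_im b0 w; exists y; by move: wE; rewrite wy tie => -[].
Qed.

Lemma tb0_D j n : (n + j)%N = d -> b j = 0%N -> forall z : M -> J n, Zc dl z -> Bc dl z.
Proof.
move=> nj b0 z Zz; have [t [_ _ tZ tB tE]] := dcx_spec du M nj.
by have [x xz] := tE z Zz; rewrite -xz; apply/tB; apply: tb0_H => //; apply/tZ; rewrite xz.
Qed.

Lemma H_of_D j n : (n + j)%N = d -> (forall z : M -> J n, Zc dl z -> Bc dl z) ->
  forall x, cycX tdX (j := j) x -> exists y, x = tdX j y.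
Proof. by move=> nj H x; have [t [_ _ tZ tB _]] := dcx_spec du M nj; move=> /tZ/H/tB. Qed.

(** If X is exact, all b_j vanish and every F_j + X_(j+1) is without Ext. So the dimension of
    Tor_0(A/m, M), which is that of Ext^0(A/m, X_0), equals that of Ext^(d+1)(A/m, W_(d+1)), where
    W_(d+1) = 0. *)
Lemma acyclic_zero : (forall n (z : M -> J n), (n <= d)%N -> Zc dl z -> Bc dl z) -> forall x : M, x = 0.
Proof.
move=> H; have HX j x : cycX tdX (j := j) x -> exists y, x = tdX j y.
  have [jd|jd] := leqP j d; first by apply: (H_of_D (subnK jd)) => z; apply: H; exact: leq_subr.
  by move=> _; exists 0; rewrite (tX0 jd x) linear0.
have b0 j : b j = 0%N.
  elim: j => [|j IH]; last by apply: tb_up => // x; exact: HX.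
  by apply: im_tb0 => w; exact: (HX 0%N w).
have HF n j : enull G n (F j).
  apply: hnull_prod; last exact: (enull_dcx du).
  by move=> y _; exists 0; rewrite mactr0; apply/funext => k; exact: free0.
have [h hh] := tlen0_ex lm G fM; have h1 := elen_dcx lm du hh.
have cl j : elen G j (W j) h.
  elim: j => [//|j IH].
  have ez : ezero G j.+1 (i j) by apply: enull_zero; exact: HF.
  exact: ((e_conn lm (tses du nA lm G fM j) h (HF j j) ez).1 IH).
have Wz (w : W d.+1) : w = 0.
  have [x ->] := tb0_im (b0 d.+1) w; by rewrite (tX0 _ x) ?linear0 //; lia.
have h0 : h = 0%N.
  have en : enull G d.+1 (W d.+1).
    by move=> y _; exists 0; rewrite mactr0; apply/funext => k; exact: Wz.
  exact: ((elen0 lm h en).1 (cl d.+1)).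
by rewrite h0 in hh; exact: (tlen0_nz lm fM hh).
Qed.
End TowerMore.

(** * The canonical module as the kernel of J^0 -> J^1 *)

Section Omega.
Variables (A : comNzRingType) (m : idealr A) (d : nat) (J : nat -> lmodType A).
Let Mm : A -> Prop := fun a => a \in m.
Variable dl : forall i, {linear J i -> J i.+1}.
Hypothesis du : dualizing Mm d dl.
Hypothesis nA : noeth A.
Hypothesis lm : mloc Mm.
Variable G : kres Mm.
Hypothesis HD : forall n (z : (A : comNzRingType)^o -> J n.+1), Zc dl z -> Bc dl z.

(** The cocycle modules Z^i of J. [HD] makes J exact in positive degrees, hence an injective
    resolution of Z^0, which becomes the canonical module. *)
Definition zmodJ i : lmodType A := subm (Submod (smod_preim (dl i) smod1)).
Definition zi i : {linear zmodJ i -> J i} := sinc (Submod (smod_preim (dl i) smod1)).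
Arguments zi {i}.

Lemma fgm_ring : fgm (A : comNzRingType)^o.
Proof. by exists [:: 1] => y; split=> // _; exists y; rewrite [_ *: _]mulr1 subrr. Qed.

Lemma ziP i x : dl i (zi x) = 0. Proof. exact: (sincP x). Qed.
Lemma zi_surj i x : dl i x = 0 -> exists z, zi (i := i) z = x.
Proof. exact: (@sinc_surj _ _ (Submod (smod_preim (dl i) smod1))). Qed.
Lemma zi_inj i : injective (zi (i := i)). Proof. exact: sinc_inj. Qed.

Lemma dual_exact n (x : J n.+1) : dl n.+1 x = 0 -> exists y, x = dl n y.
Proof.
move=> x0; have [f fE] := @lin_ring A (J n.+1) x.
have [|w wE] := HD (z := f).
  by split=> [|y]; [exact: linP | rewrite fE linearZZ x0 scaler0].
by exists (w (1 : A^o)); rewrite -wE fE scale1r.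
Qed.

Lemma zses i : exists p : {linear J i -> zmodJ i.+1}, ses (zi (i := i)) p.
Proof.
have [p pE] : exists p : {linear J i -> zmodJ i.+1}, forall x, zi (p x) = dl i x.
  apply: (lin_lift (i := zi (i := i.+1))); first exact: zi_inj.
  by move=> x; apply: zi_surj; exact: (du_dd du).
exists p; split; first exact: zi_inj.
  by move=> z; have [y yz] := dual_exact (ziP z); exists y; apply: zi_inj; rewrite pE.
move=> y; split=> [py|[x ->]]; last by apply: zi_inj; rewrite pE ziP linear0.
by have [|z <-] := @zi_surj i y; [rewrite -pE py linear0 | exists z].
Qed.

Lemma enull_J n i : (i < d)%N -> enull G n (J i).
Proof.
move=> id'; have H : forall y : J i, soc Mm y -> y = 0 by apply: (du_soc0 du); move: id'; lia.
exact: (@enull_soc0 A Mm G (J i) n (@du_inj _ _ _ _ _ du i) H).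
Qed.

Lemma enull_zmodJ n i : (n + i < d)%N -> enull G n (zmodJ i).
Proof.
elim: n i => [|n IH] i ni.
  by apply: (enull_mono (f := zi (i := i))); [exact: zi_inj | apply: enull_zero; exact: enull_J].
have [p sp] := zses i; apply: (e_sub sp); first by apply: IH; rewrite addnS -addSn.
by apply: enull_zero; apply: enull_J; move: ni; lia.
Qed.

(** Shift along 0 -> Z^i -> J^i -> Z^(i+1) -> 0, the terms J^i with i < d having no Ext. It ends at
    Z^d = J^d, whose socle is one-dimensional ([elen_top]). *)
Lemma elen_zmodJ n i h : (n + i)%N = d -> elen G 0 (zmodJ d) h -> elen G n (zmodJ i) h.
Proof.
elim: n i => [|n IH] i ni H; first by move: H; rewrite -ni.
have [p sp] := zses i; have id' : (i < d)%N by move: ni; lia.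
have ez : ezero G n.+1 (zi (i := i)) by apply: enull_zero; exact: enull_J.
apply: ((e_conn lm sp h (@enull_J n i id') ez).1 _); apply: IH => //; by rewrite addnS -addSn.
Qed.

Lemma elen_top : elen G 0 (zmodJ d) 1.
Proof.
have sm : idl Mm by case: lm => -[].
apply/(elen0P lm); apply: (kdim_len lm smod1 (@soc_smod _ Mm (zmodJ d))).
- by move=> x ->; exact: (smod0 (@soc_smod _ Mm _)).
- by move=> a x ma; apply.
have [y0 [sy0 y00 y0g]] := du_soc1 du.
have [z0 z0E] : exists z, zi (i := d) z = y0 by apply: zi_surj; apply: (du_bd du).
have zsoc z : soc Mm z <-> soc Mm (zi (i := d) z).
  split=> sz a ma; first by rewrite -linearZZ sz // linear0.
  by apply: zi_inj; rewrite linearZZ sz // linear0.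
exists (fun=> z0); split=> [_|z /zsoc/y0g[a za]|c cz i].
- by apply/zsoc; rewrite z0E.
- by exists (fun=> a); rewrite big_ord1; apply: zi_inj; rewrite (linearB zi) (linearZZ zi) z0E za subrr linear0.
rewrite big_ord1 in cz; rewrite ord1; have [_ mu] := lm; apply: contrapT => /mu[t tc]; apply: y00.
have cy : c ord0 *: y0 = 0 by rewrite -z0E -linearZZ cz linear0.
by rewrite -[y0]scale1r -tc -scalerA cy scaler0.
Qed.

(** Evaluation at 1 identifies the finitely generated D^0(A) with this kernel. *)
Lemma omega_fg : fgm (zmodJ 0).
Proof.
have [s [sZ sB]] := du_fg du 0 fgm_ring.
have /choice[u uE] : forall z : (A : comNzRingType)^o -> J 0, exists x : zmodJ 0, Zc dl z -> zi x = z 1.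
  move=> z; have [Zz|nz] := pselect (Zc dl z); last by exists 0.
  by have [|x xE] := @zi_surj 0 (z 1); [exact: Zz.2 | exists x].
exists [seq u z | z <- s] => x; split=> // _; have [f fE] := @lin_ring A (J 0) (zi x).
have Zf : Zc dl (f : (A : comNzRingType)^o -> J 0).
  by split=> [|y]; [exact: linP | rewrite fE linearZZ ziP scaler0].
have [z sz Bz] := sB _ Zf.
have : exists2 x', spn [seq u z | z <- s] x' & zi x' = z 1.
  elim: s z sZ sz {sB Bz} => [|v s IH] z sZ /=.
    by move=> ->; exists 0 => //; rewrite linear0.
  case=> a /IH[w ws|x' sx' x'E]; first by apply: sZ; rewrite inE ws orbT.
  exists (a *: u v + x'); first by exists a; rewrite addrC addKr.
  transitivity (a *: zi (i := 0) (u v) + zi (i := 0) x'); first exact: linearP.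
  rewrite x'E (uE v (sZ v (mem_head _ _))).
  by rewrite [(z - a *: v) 1](_ : _ = z 1 - a *: v 1) // addrC subrK.
move=> [x' sx' x'E]; rewrite (_ : x = x') //; apply: zi_inj; rewrite x'E.
have := Bz (1 : A^o); rewrite [LHS](_ : _ = f (1 : A^o) - z 1) // fE scale1r => /eqP.
by rewrite subr_eq0 => /eqP.
Qed.

Lemma omega_injdim : finite_injective_dim (zmodJ 0).
Proof.
have e0 x : dl 0 x = 0 <-> exists y, x = zi (i := 0) y.
  split=> [/zi_surj[y <-]|[y ->]]; [by exists y | exact: ziP].
have eS n x : dl n.+1 x = 0 <-> exists y, x = dl n y.
  split=> [/dual_exact//|[y ->]]; exact: (du_dd du).
exists (@InjectiveResolution A (zmodJ 0) J dl (zi (i := 0)) (du_inj du) (@zi_inj 0) e0 eS), d.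
exact: (du_bd du).
Qed.

Lemma omega_canonical : krull_dim A d -> depth m (A : comNzRingType)^o d ->
  (forall p l, @pchain A l p -> (l <= d)%N) -> (exists x : J 0, x <> 0) -> canonical_module m (zmodJ 0).
Proof.
move=> kd da dmax [x x0]; split.
- by exists d.
- by apply/fgmP; exact: omega_fg.
- exists d; split=> //.
    apply: (depth_of_ext nA lm (G := G) dmax omega_fg).
      have [a [ax dax]] := du_ess du x0; have [z zE] := zi_surj dax; exists z => z0.
      by apply: ax; rewrite -zE z0 linear0.
    by move=> i id'; apply: enull_zmodJ; rewrite addn0.
  apply: (bass_of_elen lm (G := G)); apply: elen_zmodJ; first exact: addn0.
  exact: elen_top.
- exact: omega_injdim.
Qed.
End Omega.

(** * Vanishing of b_j below d *)

Section Vanishing.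
Variables (A : comNzRingType) (m : idealr A) (d : nat) (J : nat -> lmodType A).
Let Mm : A -> Prop := fun a => a \in m.
Variable dl : forall i, {linear J i -> J i.+1}.
Hypothesis du : dualizing Mm d dl.
Hypothesis nA : noeth A.
Hypothesis lm : mloc Mm.
Variable G : kres Mm.
Variable M : lmodType A.
Hypothesis fM : fgm M.
Hypothesis dmax : forall p l, @pchain A l p -> (l <= d)%N.
Hypothesis nullA : forall i, (i < d)%N -> enull G i (A : comNzRingType)^o.
Local Notation tX := (tX d J M).
Local Notation tdX := (tdX d dl M).
Local Notation W j := (st_W (tw du nA lm G fM j)).
Local Notation e j := (st_e (tw du nA lm G fM j)).
Local Notation b j := (tb du nA lm G fM j).
Local Notation g j := (tg du nA lm G fM j).
Local Notation i j := (ti du nA lm G fM j).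

Let Se j := Submod (smod_img (e j) smodT).
(** The module whose rank is [crk j]. In terms of Ext, [QN j] says that its depth is at least j +
    1. *)
Let C j : lmodType A := quom (Se j).
Let QN j := forall n, (n <= j)%N -> enull G n (C j).

Lemma C_fg j : fgm (C j).
Proof.
have [s sE] := st_fg (tw du nA lm G fM j); exists [seq qpi (Se j) x | x <- s] => q; split=> // _.
have [w <-] := qpi_surj q; have [y sy] := sE w.
have -> : qpi (Se j) w = qpi (Se j) (w - e j y).
  apply/eqP; rewrite -subr_eq0 -linearB subKr; apply/eqP/(qpi0 (Se j)); by exists y.
exact: spn_map.
Qed.

(** Suppose x is no boundary. An associated prime P of C_j below the class of w starts a chain of
    length j + 1, by depth. The class of x in D^(d-j)(M) is killed by the same scalars as that of w,
    so it is nonzero at P, and the dimension bound would give (d - j) + (j + 1) <= d. *)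
Lemma QN_exact j (x : tX j) (w : W j) : (j <= d)%N -> QN j -> cycX tdX x ->
  (forall s : A, (exists y, s *: x = tdX j y) <-> exists y, s *: w = e j y) -> exists y, x = tdX j y.
Proof.
move=> jd q cx xw; apply: contrapT => nx.
have w0 : qpi (Se j) w <> 0.
  move=> /(qpi0 (Se j))[y _ wy]; apply: nx.
  have [|y' y'E] := (xw 1).2; first by exists y; rewrite scale1r.
  by exists y'; rewrite -y'E scale1r.
have [a pa] := assoc_ex1 nA w0; set P := ann _ in pa.
have [xs [xss xm xr]] : exists xs, [/\ size xs = j.+1, {subset xs <= m} & regular_seq (C j) xs].
  apply: (regular_of_ext nA lm (G := G) (C_fg j)); first by exists (qpi (Se j) w).
  by move=> n nj; apply: q.
have cP : pchain j.+1 P by rewrite -xss; exact: (regular_chain nA lm (C_fg j) xm xr pa).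
have [t [tP _ tZ tB _]] := dcx_spec du M (subnK jd).
have t0 : t 0 = 0 by have := tP (-1) 0 0; rewrite scaler0 addr0 scaleN1r addNr.
have nD : ~ Dnull dl P (d - j) M.
  move=> /(_ _ ((tZ x).1 cx))[s Ps Bs]; apply: Ps.
  have [|y yE] := (tB (s *: x)).2; first by rewrite -[s *: x]addr0 tP t0 addr0.
  have [|y' y'E] := (xw s).1; first by exists y.
  have q0 : s *: qpi (Se j) w = 0 by rewrite -linearZZ; apply/(qpi0 (Se j)); exists y'.
  by rewrite /P /ann scaleC q0 scaler0.
have := Dnull_dim du nA lm pa fM nD cP; move: jd; lia.
Qed.

Lemma QN_H0 : QN 0 -> forall x, exists y, x = tdX 0 y.
Proof. by move=> q x; apply: (@QN_exact 0 x x) => // . Qed.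

Lemma QN_HS j : (j.+1 <= d)%N -> QN j.+1 -> forall x, tdX j x = 0 -> exists y, x = tdX j.+1 y.
Proof.
move=> jd q x x0; have [iI ps ip] := tses du nA lm G fM j.
have [|w wE] := (ip (0, x)).1.
  by rewrite mkLE /addm /= linear0 add0r; exact/(tke du nA lm G fM).
apply: (@QN_exact j.+1 x w) => // s; split=> [[y sy]|[y sy]]; exists y.
  by apply: iI; rewrite tie linearZZ -wE -sy; congr pair; exact: scaler0.
by have := tie du nA lm G fM y; rewrite -sy linearZZ -wE => -[].
Qed.

(** Exactness of X at j + 1 makes 0 -> C_(j+1) -> F_j -> C_j -> 0 exact, and F_j has no Ext below
    d. *)
Lemma QN_step j : (j.+1 < d)%N -> QN j.+1 -> QN j.
Proof.
move=> jd q n nj; have HS := QN_HS (ltnW jd) q; have [iI ps ip] := tses du nA lm G fM j.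
pose i1 : {linear W j.+1 -> free A (b j)} := pfst _ _ \o i j.
have [||f fE] := @lin_factor A _ _ _ (qpi (Se j.+1)) i1; first exact: qpi_surj.
  by move=> w /(qpi0 (Se j.+1))[y _ ->]; have := tie du nA lm G fM y; move=> /(congr1 (fun p => p.1)).
have iwP w : g j (i j w).1 + e j (i j w).2 = 0 by have := (ip (i j w)).2 (ex_intro _ w erefl).
have sf : ses f (qpi (Se j) \o g j : {linear free A (b j) -> C j}).
  split.
  - move=> u v uv; apply/eqP; rewrite -subr_eq0; apply/eqP; move: uv; move=> /eqP; rewrite -subr_eq0 -linearB.
    have [w <-] := qpi_surj (u - v); rewrite fE => /eqP w1; apply/(qpi0 (Se j.+1)).
    have w1' : (i j w).1 = 0 := w1.
    have [|y yE] := HS (i j w).2; first by apply/(tke du nA lm G fM); have := iwP w; rewrite w1' linear0 add0r.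
    by exists y => //; apply: iI; rewrite tie -yE [LHS]surjective_pairing w1'.
  - move=> z; have [w <-] := qpi_surj z; have [[x y] <-] := ps w; exists x.
    apply/eqP; rewrite -subr_eq0 -[X in X - _]/(qpi (Se j) (g j x)) -linearB; apply/eqP/(qpi0 (Se j)); exists (- y) => //.
    by rewrite mkLE /addm /= opprD addrA subrr add0r linearN.
  - move=> x; split=> [/(qpi0 (Se j))[y _ gy]|[u ->]].
      have [|w wE] := (ip (x, - y)).1; first by rewrite mkLE /addm /= gy linearN subrr.
      by exists (qpi (Se j.+1) w); rewrite fE /= -wE.
    have [w <-] := qpi_surj u; rewrite fE; apply/(qpi0 (Se j)); exists (- (i j w).2) => //.
    by apply/eqP; rewrite linearN -addr_eq0; apply/eqP; exact: iwP.
apply: (e_quo sf); last by apply: q.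
by apply: enull_free; apply: nullA; move: nj jd; lia.
Qed.

(** When the map into F_(d-1) is zero, C_(d-1) is F_(d-1) itself, of depth d. *)
Lemma QN_base j : j.+1 = d -> (forall w : W j.+1, (i j w).1 = 0) -> QN j.
Proof.
move=> jd w1 n nj; have [iI ps ip] := tses du nA lm G fM j.
apply: (hnull_bij (f := qpi (Se j) \o g j : {linear free A (b j) -> C j})); last first.
  by apply: enull_free; apply: nullA; move: nj jd; lia.
apply: bij_of => [x /(qpi0 (Se j))[y _ gy]|z].
  have [|w wE] := (ip (x, - y)).1; first by rewrite mkLE /addm /= gy linearN subrr.
  by have := w1 w; rewrite -wE.
have [w <-] := qpi_surj z; have [[x y] <-] := ps w; exists x.
apply/eqP; rewrite -subr_eq0 -[X in X - _]/(qpi (Se j) (g j x)) -linearB; apply/eqP/(qpi0 (Se j)); exists (- y) => //.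
by rewrite mkLE /addm /= opprD addrA subrr add0r linearN.
Qed.

(** The depth estimates descend from C_(d-1) to C_0; the resulting exactness of X is then used
    upwards, carrying the vanishing of b_j from index to index. *)
Lemma tb_vanish : (forall j, j.+1 = d -> forall w : W j.+1, (i j w).1 = 0) -> forall j, (j < d)%N -> b j = 0%N.
Proof.
move=> w1; have QA k : forall j, (j + k.+1)%N = d -> QN j.
  elim: k => [|k IH] j jk; first by rewrite addn1 in jk; apply: QN_base => //; exact: w1.
  by apply: QN_step; [move: jk; lia | apply: IH; rewrite addSnnS].
have Q j : (j < d)%N -> QN j by move=> jd; apply: (QA (d - j.+1)%N); move: jd; lia.
elim=> [|j IH] jd; first by apply: im_tb0 => w; exact: (QN_H0 (Q 0%N jd)).
by apply: tb_up; [apply: IH; exact: ltnW | apply: (QN_HS (ltnW jd)); exact: Q].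
Qed.
End Vanishing.

(** * Cohen-Macaulayness, number of generators, biduality *)

Section Towers.
Variables (A : comNzRingType) (m : idealr A) (d : nat) (J : nat -> lmodType A).
Let Mm : A -> Prop := fun a => a \in m.
Variable dl : forall i, {linear J i -> J i.+1}.
Hypothesis du : dualizing Mm d dl.
Hypothesis nA : noeth A.
Hypothesis lm : mloc Mm.
Variable G : kres Mm.
Hypothesis dmax : forall p l, @pchain A l p -> (l <= d)%N.
Let om : lmodType A := zmodJ dl 0.
Let zo : {linear om -> J 0} := sinc (Submod (smod_preim (dl 0) smod1)).

(** Ext^i(A/m, V) = 0 means b_i = 0 in the resolution of Hom(V, J), and then D^(d-i)(V) vanishes by
    [tb0_D]. *)
Lemma acyclic_of_null (V : lmodType A) : fgm V -> (forall i, (i < d)%N -> enull G i V) ->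
  forall n (z : V -> J n.+1), Zc dl z -> Bc dl z.
Proof.
move=> fV nV n z Zz; have [nd|dn] := leqP n.+1 d; last first.
  by exists \0 => x; rewrite linear0; exact: (du_bd du dn).
have lt : (d - n.+1 < d)%N by move: nd; lia.
have b0 : tb du nA lm G fV (d - n.+1) = 0%N.
  by have := tb_bass du nA lm fV ((elen0 lm 0%N (nV _ lt)).2 erefl).
exact: (tb0_D (subnKC nd) b0 Zz).
Qed.

Lemma elen_pow b i (V : lmodType A) h : elen G i V h -> elen G i ('I_b -> V : lmodType A) (b * h).
Proof. exact: (hlen_pow lm b (kr_EE G i)). Qed.

Lemma enull_pow b i (V : lmodType A) : enull G i V -> enull G i ('I_b -> V : lmodType A).
Proof.
move=> nV; have e0 := elen_pow b ((elen0 lm 0%N nV).2 erefl); rewrite muln0 in e0.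
exact: (elen_null lm e0).
Qed.

Lemma ring_nz : exists x : (A : comNzRingType)^o, x <> 0.
Proof. by exists (1 : A); apply/eqP; exact: oner_neq0. Qed.

(** If Ext^d(A/m, A) vanished as well, A would have a regular sequence of length d + 1, longer than
    its dimension. *)
Lemma type_gt0 tau : (forall i, (i < d)%N -> enull G i (A : comNzRingType)^o) ->
  elen G d (A : comNzRingType)^o tau -> (0 < tau)%N.
Proof.
move=> nullA; case: tau => // et; exfalso.
have n1 i : (i < d.+1)%N -> enull G i (A : comNzRingType)^o.
  rewrite ltnS leq_eqVlt => /orP[/eqP ->|]; last exact: nullA.
  exact: (elen_null lm et).
have [xs [xss xm xr]] := regular_of_ext nA lm (@fgm_ring A) ring_nz n1.
by have := regular_bound nA lm dmax (@fgm_ring A) xm xr; rewrite xss ltnn.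
Qed.

(* A minimal prime is the only associated prime of the kernel of the localization at it. *)
Lemma top_assoc (P : A -> Prop) : pchain d P -> exists b : A, prm (ann (b : A^o)) /\ ann (b : A^o) = P.
Proof.
move=> cP; have pP := pchain_prm cP; have mP := prm_mulc pP; have [[P0 PL] P1 PM] := pP.
pose I : A^o -> Prop := fun x => exists2 s, ~ P s & s * x = 0.
have sI : smod I.
  split; first by exists 1; rewrite ?mulr0.
  move=> a x y [s Ps sx] [t Pt ty]; exists (s * t); first exact: mP.2.
  rewrite mulrDr -[a *: x]/(a * x) (_ : s * t * (a * x) = t * a * (s * x)); last by ring.
  by rewrite sx mulr0 add0r -mulrA ty mulr0.
have n1 : qpi (Submod sI) (1 : A^o) <> 0.
  by move=> /(qpi0 (Submod sI))[s Ps]; rewrite mulr1 => s0; apply: Ps; rewrite s0.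
have [a pa] := assoc_ex1 nA n1; set Q := ann _ in pa.
have QE s : Q s <-> I (s * a).
  rewrite /Q /ann scalerA -linearZZ; have := qpi0 (Submod sI) ((s * a) *: (1 : A^o)).
  by rewrite -[_ *: (1 : A^o)]/(s * a * 1) mulr1.
have [_ Q1 _] := pa.
have nIa : ~ I a by move=> Ia; apply: Q1; apply/QE; rewrite mul1r.
have QP : Q = P.
  apply: (top_minimal dmax cP pa) => s /QE[t Pt tsa]; apply: contrapT => Ps; apply: nIa.
  by exists (t * s); [exact: mP.2 | rewrite -mulrA].
have [s sE] : fgs (V := A^o) P by apply: nA; case: pP.
have [t Pt tE] : exists2 t, ~ P t & forall x, spn (V := A^o) s x -> t * (x * a) = 0.
  have : forall v, v \in s -> P v by move=> v vs; apply/sE; exact: spn_mem.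
  elim: s {sE} => [|v s IH] vP; first by exists 1 => // x ->; rewrite mul0r mulr0.
  have [t Pt tE] := IH (fun w ws => vP w (mem_behead (s := v :: s) ws)).
  have [t' Pt' t'E] : I (v * a) by apply/QE; rewrite QP; apply: vP; exact: mem_head.
  exists (t * t'); first exact: mP.2.
  move=> x [c /tE xc]; rewrite (_ : t * t' * (x * a) = t' * (t * ((x - c * v) * a)) + t * c * (t' * (v * a))); last by ring.
  by rewrite t'E mulr0 addr0 -[x - c * v]/(x - c *: (v : A^o)) xc mulr0.
have aE : ann (t * a : A^o) = P.
  apply/funext => x; apply/propext; split=> [xta|/sE/tE xa].
    have : P (x * t).
      rewrite -QP; apply/QE; exists 1; first exact: mP.1.
      by rewrite mul1r -mulrA.
    by move=> /PM[].
  by rewrite /ann -[_ *: _]/(x * (t * a)) mulrCA.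
by exists (t * a); rewrite aE.
Qed.

(** Evaluation at 1 identifies D^0(A) with the kernel of J^0 -> J^1, and [dual_rank] gives D^0(A)
    the length of A at P. *)
Lemma omega_len (P : A -> Prop) a : pchain d P -> fgm om -> ml P (A : comNzRingType)^o a -> ml P om a.
Proof.
move=> cP fo ha; have mP := prm_mulc (pchain_prm cP).
have [a' ha' da'] := dual_rank du nA lm dmax cP (@fgm_ring A).
rewrite (has_len_uniq ha ha') => {a ha ha'}.
have [k hk _] := dual_rank du nA lm dmax cP fo; rewrite [a'](_ : _ = k) //.
pose K : J 0 -> Prop := fun x => dl 0 x = 0.
have sK : smod K by split=> [|a x y Kx Ky]; rewrite /K ?linear0 // linearP Kx Ky scaler0 addr0.
have s0 := @smod1 A (J 0).
have eL : linear (fun z : A^o -> J 0 => z 1) by [].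
apply: (@has_len_uniq A P _ _ _ (fun x : J 0 => x = 0) K).
  apply: (@len_img A P _ _ a' (mkL eL) _ _ _ _ mP (sBc dl _ 0) (sZc dl _ 0) s0 sK) da' => //.
  - by move=> z Bz; exact: (@Bc_Zc _ _ _ (du_dd du) _ 0 z Bz).
  - by move=> x ->; rewrite /K linear0.
  - by move=> z Zz; exact: Zz.2.
  - move=> y Ky; apply: (sub_qin mP); have [f fE] := @lin_ring A (J 0) y.
    exists (f : _ -> _); last by rewrite mkLE fE scale1r subrr.
    by split=> [|x]; [exact: linP | rewrite fE linearZZ Ky scaler0].
  - by move=> z Bz; exact: Bz.
  - move=> z Zz z0; apply: (sub_qin mP) => x; rewrite -[x]mulr1 -[x * 1]/(x *: (1 : A^o)).
    have e1 : mkL Zz.1 (1 : A^o) = 0 by exact: z0.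
    by rewrite -[z _]/(mkL Zz.1 _) linearZZ e1 scaler0.
apply: (@len_img A P _ _ k zo _ _ _ _ mP (@smod1 A om) (@smodT A om) s0 sK) hk => //.
- by move=> x ->; rewrite /K linear0.
- by move=> x _; exact: (sincP x).
- move=> y /(sinc_surj (S := Submod (smod_preim (dl 0) smod1)))[x xy]; apply: (sub_qin mP).
  by exists x => //; rewrite -xy subrr.
- by move=> x ->; rewrite linear0.
- by move=> x _ x0; apply: (sub_qin mP); apply: (@zi_inj _ _ dl 0); rewrite linear0.
Qed.

Section Module.
Variables (M : lmodType A) (r : nat).
Hypothesis fM : fgm M.
Local Notation tX := (tX d J M).
Local Notation tdX := (tdX d dl M).
Local Notation W j := (st_W (tw du nA lm G fM j)).
Local Notation e j := (st_e (tw du nA lm G fM j)).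
Local Notation b j := (tb du nA lm G fM j).
Local Notation g j := (tg du nA lm G fM j).
Local Notation i j := (ti du nA lm G fM j).

(** W_N is free, so it suffices to kill Ext^t(A/m, W_N), by induction on t. The map of W_N into
    F_(N-1) + X_N is zero on Ext by minimality, so this group comes from Ext^(t-1)(A/m, W_(N-1)),
    which vanishes by the lower cases. *)
Lemma null_below N : (d <= N)%N -> (forall w : W N.+1, w = 0) -> (0 < b N)%N ->
  forall t, (t < N)%N -> enull G t (A : comNzRingType)^o.
Proof.
move=> dN W0 b0.
suff H t : (t <= N)%N -> forall k, (k < t)%N -> enull G k (A : comNzRingType)^o by exact: H (leqnn N).
elim: t => [//|t IH] tN k; rewrite ltnS leq_eqVlt => /orP[/eqP ->|kt]; last exact: IH (ltnW tN) k kt.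
have {k}nullA := IH (ltnW tN); clear IH.
case: N dN W0 b0 tN => [//|N] dN W0 b0 tN.
have ez k : ezero G k (i N) by apply: (ezero_last dN W0 erefl); exact: (lk_min (tl du nA lm G fM N)).
have [iI _ _] := tses du nA lm G fM N.
have X : enull G t (W N.+1).
  case: t nullA tN => [|t] nullA tN; first exact: (enull_mono iI (ez 0%N)).
  have Y : enull G t (W N) by exact: (enull_W nullA (ltnSn t) tN).
  exact: (e_sub (tses du nA lm G fM N) Y (ez t.+1)).
exact: (enull_last dN W0 b0 X).
Qed.

Lemma height_eq N : (d <= N)%N -> (forall w : W N.+1, w = 0) -> (0 < b N)%N -> N = d.
Proof.
move=> dN W0 b0; have [xs [xss xm xr]] := regular_of_ext nA lm (@fgm_ring A) ring_nz (null_below dN W0 b0).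
by have := regular_bound nA lm dmax (@fgm_ring A) xm xr; rewrite xss => Nd; apply/eqP; rewrite eqn_leq Nd.
Qed.

Hypothesis nullA : forall i, (i < d)%N -> enull G i (A : comNzRingType)^o.
Hypothesis W0 : forall w : W d.+1, w = 0.

(** Into degrees below d the shift uses that F_j has no Ext there. The last step, into degree d, has
    no such vanishing; there W_d is free and its map into F_(d-1) is zero on Ext by minimality. *)
Lemma climb_top nu : tlen G 0 M nu -> elen G d (W d) nu.
Proof.
move=> tn; have h : elen G 0 (tX 0) nu by exact: (elen_dcx lm du tn).
suff H k : (d <= k)%N -> (k <= d)%N -> (forall w : W k.+1, w = 0) -> elen G k (W k) nu by exact: H.
case: k => [|k] dk kd Wk; first exact: h.
have ez : ezero G k.+1 (i k) by apply: (ezero_last dk Wk erefl); exact: (lk_min (tl du nA lm G fM k)).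
have X : elen G k (W k) nu by exact: (elen_climb du nA lm fM nullA kd h).
exact: (elen_ti nullA kd ez X).
Qed.

Lemma numgen nu tau : tlen G 0 M nu -> elen G d (A : comNzRingType)^o tau -> nu = (b d * tau)%N.
Proof. by move=> tn; exact: (elen_last (leqnn d) W0 (climb_top tn)). Qed.

(** b_d is the d-th Bass number of M, and that of the r-th power of [om] is r. *)
Lemma tb_iso (f : {linear M -> {ffun 'I_r -> om}}) : bijective f -> elen G d om 1 -> b d = r.
Proof.
move=> bf eo; pose phi (x : {ffun 'I_r -> om}) : ('I_r -> om : lmodType A) := fun l => x l.
have pL : linear phi by move=> a x y; apply/funext => l; rewrite /phi !ffunE.
have bp : bijective (mkL pL \o f : {linear M -> ('I_r -> om : lmodType A)}).
  apply: bij_comp => //; exists (fun y : 'I_r -> om => [ffun l => y l]) => [x|y].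
    by apply/ffunP => l; rewrite ffunE.
  by apply/funext => l; rewrite mkLE /phi ffunE.
have [t et] := elen_ex lm G d nA fM; have e1 := elen_pow r eo; rewrite muln1 in e1.
rewrite -(tb_bass du nA lm fM et).
exact: (has_len_uniq (hlen_iso lm (kr_EE G d) bp et) e1).
Qed.

Hypothesis ass_top : forall a : A, prm (ann (a : A^o)) -> pchain d (ann (a : A^o)).
Hypothesis rM : forall (b : A) a, prm (ann (b : A^o)) -> ml (ann (b : A^o)) (A : comNzRingType)^o a -> ml (ann (b : A^o)) M (r * a).
Local Notation ck j := (crk du nA lm G fM r j).

(** For j = d - 1 the recursion reads r = c_d = r + (b_j - c_j), so c_j = b_j and [ker_zero]
    applies. *)
Lemma ker_last : ck d = b d -> b d = r -> forall j, j.+1 = d -> forall w : W j.+1, (i j w).1 = 0.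
Proof.
move=> cd bd j jd; apply: (ker_zero dmax ass_top rM).
have [a0 pa] : exists a0 : A, prm (ann (a0 : A^o)).
  by have [x x0] := ring_nz; have [a pa] := assoc_ex1 nA x0; exists (a *: x).
have [a a_gt0 ha] := ml_ann du nA lm dmax ass_top pa.
have : (ck j <= b j)%N.
  rewrite -(leq_pmul2r a_gt0).
  exact: (crk_len du nA lm G fM dmax ass_top rM pa ha j).2.
have : ck j.+1 = r by rewrite jd cd.
rewrite [ck j.+1](_ : _ = (hrk d r j.+1 + (b j - ck j))%N) // /hrk jd eqxx; lia.
Qed.

Hypothesis w1 : forall j, j.+1 = d -> forall w : W j.+1, (i j w).1 = 0.

(** As the free component of W_d vanishes, its projection to X_d has exactly the cycles as image;
    for d = 0, W_0 is X_0 and everything is a cycle. *)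
Lemma top_cycles k : d = k -> exists u : {linear W k -> tX k}, (forall w, cycX tdX (u w)) /\
  forall x, cycX tdX x -> exists w, u w = x.
Proof.
case: k => [|k] dk; first by exists (idfun : {linear tX 0 -> tX 0}); split=> // x _; exists x.
have [iI ps ip] := tses du nA lm G fM k.
exists (psnd _ _ \o i k); split=> [w|x x0].
  apply/(tke du nA lm G fM); have : g k (i k w).1 + e k (i k w).2 = 0 by have := (ip (i k w)).2 (ex_intro _ w erefl).
  by rewrite (w1 (esym dk)) linear0 add0r.
have [|w wE] := (ip (0, x)).1; last by exists w; rewrite /= -wE.
by rewrite mkLE /addm /= linear0 add0r; exact/(tke du nA lm G fM).
Qed.

(** W_d is free on b_d generators by [tg_bij] and maps onto the cycles of X_d, which are the linear
    maps from M to [om]. *)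
Lemma cocycle_span : exists f : 'I_(b d) -> {linear M -> om}, forall z : M -> J 0, Zc dl z ->
  exists c : 'I_(b d) -> A, forall x, z x = \sum_l c l *: zo (f l x).
Proof.
have [u [uc us]] := top_cycles erefl.
have [t [tP tI tZ tB tE]] := dcx_spec du M (add0n d).
have /choice[f fE] : forall l : 'I_(b d), exists f : {linear M -> om}, forall x, zo (f x) = t (u (g d (fe A l))) x.
  move=> l; have Z := (tZ _).1 (uc (g d (fe A l))).
  apply: (@lin_lift A M (J 0) om zo (mkL Z.1)); first exact: zi_inj.
  by move=> x; apply: (sinc_surj (S := Submod (smod_preim (dl 0) smod1))); exact: Z.2.
exists f => z Zz; have [x xz] := tE z Zz.
have [|w wx] := us x; first by apply/tZ; rewrite xz.
have [h _ gK] := tg_bij (leqnn d) W0.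
exists (h w) => y.
have eL : linear (fun v : tX d => t v y) by move=> a v v'; rewrite tP.
transitivity (mkL eL (u (g d (h w)))); first by rewrite mkLE gK wx xz.
rewrite {1}[h w]free_sum !linear_sum; apply: eq_bigr => l _.
by rewrite !linearZZ fE.
Qed.

Hypothesis nM : forall i, (i < d)%N -> enull G i M.

(* M embeds P-locally into its double dual at every P of maximal dimension. *)
Lemma zero_of_cocycles (x : M) : (forall z : M -> J 0, Zc dl z -> z x = 0) -> x = 0.
Proof.
move=> H; apply: contrapT => x0; have [a pa] := assoc_ex1 nA x0; set y := a *: x in pa; set P := ann y in pa.
have [xs [xss xm xr]] := regular_of_ext nA lm fM (ex_intro _ x x0) nM.
have cP : pchain d P by rewrite -xss; exact: (regular_chain nA lm fM xm xr pa).
have mP := prm_mulc pa; have [h [nz _ _]] := du_prime du pa.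
have h0 : h = 0%N by have := NZ_dim du nA lm pa nz cP; lia.
rewrite h0 in nz; have [V [x' [xg xP nV]]] := nz.
have [f fE] := lin_ring y; pose S := Submod (smod_img f (@smodT _ A^o)).
have [y' y'E] : exists y' : subm S, sinc S y' = y.
  by apply: sinc_surj; exists 1 => //; rewrite fE scale1r.
have sI : injective (sinc S) by have [] := ses_sub S.
have yl k : sinc S (k *: y') = k *: y by transitivity (k *: sinc S y'); [exact: linearZZ | rewrite y'E].
have s0 : sinc S 0 = 0 by exact: linear0.
have yg : cyc y'.
  by move=> v; have [k _ vk] := sincP v; exists k; apply: sI; rewrite vk fE; exact/esym/yl.
have yP : ann y' = P.
  apply/funext => k; apply/propext; split=> ky; rewrite /P /ann.
    exact: (etrans (esym (yl k)) (etrans (congr1 (sinc S) ky) s0)).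
  by apply: sI; exact: (etrans (yl k) (etrans ky (esym s0))).
apply: nV; apply: (Dnull_cyc (du_dd du) mP yg xg (etrans yP (esym xP))) => z Zz.
have fW : fgm (quom S) by apply: (fgm_img (f := qpi S) fM) => v; exact: qpi_surj.
have [z' Zz' [w [wu wz]]] := conn_ex (@du_inj _ _ _ _ _ du) (du_dd du) (ses_sub S) Zz.
have [s Ps [v vE]] := @Dnull_top _ _ _ _ _ du nA lm _ cP 1 (quom S) fW isT z' Zz'.
pose q : {linear M -> J 0} := s \*: w \- (v \o qpi S).
have qx : q x = 0.
  apply: H; split=> [|u]; first exact: linP.
  by rewrite /q /= linearB linearZZ wz -[s *: z' _]/((s *: z') (qpi S u)) vE subrr.
exists s => // u; have -> : (s *: z) u = q (sinc S u).
  have pe : qpi S (sinc S u) = 0 by exact: (ses_pi (ses_sub S)).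
  have ve : v (qpi S (sinc S u)) = 0 by rewrite pe; exact: linear0.
  transitivity (s *: w (sinc S u) - v (qpi S (sinc S u))); last by [].
  by rewrite ve subr0; exact: (congr1 (fun t => s *: t) (esym (wu u))).
have [k _ ->] := sincP u; rewrite fE /y scalerA.
by transitivity ((k * a) *: q x); [exact: linearZZ | rewrite qx scaler0].
Qed.

Hypothesis bd : b d = r.
Hypothesis fo : fgm om.
Hypothesis no : forall i, (i < d)%N -> enull G i om.

Section Embedding.
Variables (psi : {linear M -> ('I_r -> om : lmodType A)}) (V : lmodType A).
Variable p : {linear ('I_r -> om : lmodType A) -> V}.
Hypothesis sip : ses psi p.
Hypothesis psiE : forall z : M -> J 0, Zc dl z -> exists c : 'I_r -> A, forall x, z x = \sum_l c l *: zo (psi x l).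
Let X : lmodType A := 'I_r -> om.

(** A nonzero value of z lies in [om], and an associated prime P below it has dimension d. There M
    and the r-th power of [om] have the same length, so V, and with it the value, vanishes at P. *)
Lemma coker_acyclic0 (z : V -> J 0) : Zc dl z -> Bc dl z.
Proof.
move=> Zz v; apply: contrapT => zv.
have [o oE] := sinc_surj (S := Submod (smod_preim (dl 0) smod1)) (Zz.2 v).
have o0 : o <> 0 by move=> o0; apply: zv; rewrite -oE o0 linear0.
have [a pa] := assoc_ex1 (V := om) nA o0; set P := ann _ in pa.
have [xs [xss xm xr]] := regular_of_ext nA lm fo (ex_intro _ o o0) no.
have cP : pchain d P by rewrite -xss; exact: (regular_chain nA lm fo xm xr pa).
have mP := prm_mulc pa; have [b' [pb bP]] := top_assoc cP.
have [k k_gt0 hk] := ml_ann du nA lm dmax ass_top pb; have hM := rM pb hk.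
rewrite bP in hk hM; have hX := ml_pow mP r (omega_len cP fo hk).
have [k1 [k2 [kE h1 h2]]] := ml_ses_inv mP sip hX.
have k20 : k2 = 0%N by have := has_len_uniq h1 hM; move: kE; lia.
rewrite k20 in h2; have [s Ps sv] := (ml0 V mP).2 h2 v; apply: Ps.
have so : s *: o = 0.
  apply: (@zi_inj _ _ dl 0); rewrite linear0 linearZZ [X in s *: X]oE -[z v]/(mkL Zz.1 v) -linearZZ.
  by rewrite sv linear0.
by rewrite /P /ann scaleC so scaler0.
Qed.

(** In positive degree the power of [om] is acyclic, so the class is a connecting image from M. In
    degree 1 it comes from a cocycle M -> J^0, which extends to the power of [om] by [psiE]; in
    higher degrees it comes from a class on M that vanishes because M has depth d. *)
Lemma coker_acyclic n (z : V -> J n) : Zc dl z -> Bc dl z.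
Proof.
case: n z => [|k] z Zz; first exact: coker_acyclic0.
have BX : Bc dl (z \o p).
  apply: (acyclic_of_null (V := X)) (Zc_comp p Zz); first exact: (fgm_pow r fo).
  by move=> l ld; apply: enull_pow; exact: no.
have [u Zu cu] := conn_ex' sip Zz BX.
case: k z Zz BX u Zu cu => [|k] z Zz BX u Zu cu; last first.
  exact: (conn_Bc (@du_inj _ _ _ _ _ du) (du_dd du) sip cu (acyclic_of_null fM nM Zu)).
have [c cE] := psiE Zu; have [w [wu wz]] := cu.
have wL : linear (fun y : X => \sum_l c l *: zo (y l)).
  move=> a y y'; rewrite scaler_sumr -big_split; apply: eq_bigr => l _ /=.
  transitivity (c l *: (a *: zo (y l) + zo (y' l))); first by congr (_ *: _); exact: linearP.
  by rewrite scalerDr scaleC.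
have w'0 x : (w \- mkL wL : {linear X -> J 0}) (psi x) = 0 by rewrite [LHS](_ : _ = w (psi x) - \sum_l c l *: zo (psi x l)) // wu cE subrr.
have [g' gE] := ses_fac sip w'0; exists g' => v.
have [_ ps _] := sip; have [y <-] := ps v.
transitivity (dl 0 (w y - \sum_l c l *: zo (y l))); last by rewrite gE.
rewrite linearB wz linear_sum big1 ?subr0 // => l _.
have d0 : dl 0 (zo (y l)) = 0 by exact: (sincP (y l)).
by rewrite linearZZ d0 scaler0.
Qed.
End Embedding.

(** The r spanning maps define psi. It is injective because cocycles separate the elements of M, and
    its cokernel is acyclic, hence zero by [acyclic_zero]. *)
Lemma iso_power : exists f : {linear M -> {ffun 'I_r -> om}}, bijective f.
Proof.
have [f fE] := cocycle_span; rewrite bd in f fE.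
have pL : linear (fun x => (fun l => f l x) : 'I_r -> om).
  by move=> a x y; apply/funext => l; rewrite linearP.
pose psi : {linear M -> ('I_r -> om : lmodType A)} := mkL pL.
have psi0 x : psi x = 0 -> x = 0.
  move=> px; apply: zero_of_cocycles => z /fE[c ->]; apply: big1 => l _.
  have e0 : zo (f l x) = 0 by rewrite -[f l x]/(psi x l) px; exact: linear0.
  by rewrite -[RHS](scaler0 (J 0) (c l)); congr (_ *: _); exact: e0.
pose S := Submod (smod_img psi (@smodT _ M)).
have sip : ses psi (qpi S).
  split; first by move=> x y xy; apply/eqP; rewrite -subr_eq0; apply/eqP/psi0; rewrite linearB xy subrr.
    by move=> v; exact: qpi_surj.
  move=> y; split=> [/(qpi0 S)[x _ ->]|[x ->]]; first by exists x.
  by apply/(qpi0 S); exists x.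
have fV : fgm (quom S) by apply: (fgm_img (f := qpi S) (fgm_pow r fo)) => v; exact: qpi_surj.
have V0 : forall v : quom S, v = 0.
  by apply: (acyclic_zero du nA lm G fV) => n z _; exact: (coker_acyclic sip fE).
pose phi (y : ('I_r -> om : lmodType A)) : {ffun 'I_r -> om} := [ffun l => y l].
have phL : linear phi by move=> a x y; apply/ffunP => l; rewrite !ffunE.
exists (mkL phL \o psi); apply: bij_of => [x /ffunP x0|y].
  apply: psi0; apply/funext => l.
  have e1 : phi (psi x) l = psi x l by rewrite /phi ffunE.
  have e2 : (0 : {ffun 'I_r -> om}) l = 0 by rewrite ffunE.
  exact: (etrans (esym e1) (etrans (x0 l) e2)).
have [x _ xy] := (qpi0 S (fun l => y l)).1 (V0 _).
exists x; apply/ffunP => l; have e1 : phi (psi x) l = psi x l by rewrite /phi ffunE.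
exact: (etrans e1 (esym (congr1 (fun h : 'I_r -> om => h l) xy))).
Qed.
End Module.
End Towers.

Theorem proposition1p5 (A : comNzRingType) (m : idealr A) (d r n mu : nat)
    (M : lmodType A)
    (A_noetherian : noetherian A) (A_local : local_ring m)
    (A_unmixed : unmixed m) (dim_A : krull_dim A d)
    (M_fg : finitely_generated M) (rank_M : has_rank M r) (r_ge1 : (1 <= r)%N)
    (n_ge_d : (d <= n)%N) (mu_n : bass_number m M n mu) (mu_le1 : (mu <= 1)%N)
    (A_quotient : gorenstein_quotient A) :
  exists (nu tau : nat) (omega : lmodType A),
    [/\ min_generators M nu, ring_type m tau, canonical_module m omega,
        (r * tau <= nu)%N
      & isomorphic M {ffun 'I_r -> omega} <-> nu = (r * tau)%N].
Proof.
have nA : noeth A by apply/noethP.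
have lm : mloc (fun a => a \in m) := local_mloc nA A_local.
have fM : fgm M by apply/fgmP.
have dmax p l : @pchain A l p -> (l <= d)%N.
  by move=> cp; apply: dim_A.2; apply/prime_chainP; exists p.
have [D [J [dl [du [x0 x0n]]]]] := dualizing_reduced lm A_quotient.
have Dd : D = d.
  apply: (dualizing_dim du nA lm (ex_intro _ x0 x0n) (fun l p => @dmax p l)).
  exact/prime_chainP/(proj1 dim_A).
have {}du : dualizing (fun a => a \in m) d dl by rewrite -Dd.
have sm : idl (fun a => a \in m) by case: lm => -[].
have [G] : inhabited (kres (fun a => a \in m)) := kres_ex nA sm.
have ass_top (a : A) : prm (ann (a : A^o)) -> pchain d (ann (a : A^o)).
  by move=> pa; apply: (unmixed_chain nA lm (a0 := a) A_unmixed dim_A pa) => x; exact: iff_refl.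
(* The rank hypothesis in terms of lengths: at an associated prime M has r times the length of A. *)
have rM (b : A) a : prm (ann (b : A^o)) -> ml (ann (b : A^o)) (A : comNzRingType)^o a -> ml (ann (b : A^o)) M (r * a).
  move=> pb ha; pose P := mk_prime pb.
  have PE : (fun x => is_true (x \in P)) = ann (b : A^o) by apply/funext => x; apply/propext; exact: mk_primeE.
  have aP : associated_prime P by exists b => x; apply/idP/eqP => [/(mk_primeE pb x)//|]; move=> xb; exact/(mk_primeE pb x).
  have : ml (fun x => x \in P) M (r * a) by apply: (rank_ml (rank_M P aP)); rewrite PE.
  by rewrite PE.
have [h eh] := elen_ex lm G n nA fM.
have bn : (tb du nA lm G fM n <= 1)%N.
  by rewrite -(tb_bass du nA lm fM eh); exact: (elen_le1 lm mu_n mu_le1 eh).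
have [N [dN W0 b0 cN]] := tower_stops dmax ass_top rM r_ge1 n_ge_d bn.
have nullA := null_below dN W0 b0; have Nd := height_eq dmax dN W0 b0; subst N.
have [tau et] := elen_ex lm G d nA (@fgm_ring A).
have [nu tn] := tlen0_ex lm G fM.
have nuE : nu = (tb du nA lm G fM d * tau)%N := numgen nullA W0 tn et.
have rb : (r <= tb du nA lm G fM d)%N by rewrite -cN; exact: crk_top.
have dA : depth m (A : comNzRingType)^o d := depth_of_ext nA lm (G := G) dmax (@fgm_ring A) (ring_nz A) nullA.
have tau0 := type_gt0 nA lm dmax nullA et.
have HD := acyclic_of_null du nA lm (@fgm_ring A) nullA.
have fo : fgm (zmodJ dl 0) := omega_fg du.
have eo : elen G d (zmodJ dl 0) 1.
  apply: (elen_zmodJ du lm HD); first exact: addn0.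
  exact: elen_top.
have no i : (i < d)%N -> enull G i (zmodJ dl 0).
  by move=> id; apply: (enull_zmodJ du HD); rewrite addn0.
exists nu, tau, (zmodJ dl 0); split.
- exact: (min_gen lm fM tn).
- by exists d; split=> //; exact: (bass_of_elen lm et).
- exact: (omega_canonical du nA lm G HD dim_A dA dmax (ex_intro _ x0 x0n)).
- by rewrite nuE leq_mul2r rb orbT.
split=> [[f bf]|nr]; first by rewrite nuE (tb_iso du nA lm fM bf eo).
(* As nu = b_d type(A) and the type is positive, nu = r type(A) cancels to b_d = r. *)
have bd : tb du nA lm G fM d = r by apply/eqP; rewrite -(eqn_pmul2r tau0) -nuE nr.
have w1 := ker_last dmax ass_top rM cN bd.
(* Below d the Bass numbers of M are the b_i, which vanish, so M has depth d in terms of Ext. *)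
have nM i : (i < d)%N -> enull G i M.
  move=> id; have b0' := tb_vanish nullA w1 id.
  have [k ek] := elen_ex lm G i nA fM; have kE := tb_bass du nA lm fM ek.
  by rewrite b0' in kE; rewrite kE in ek; exact: (elen_null lm ek).
exact: (iso_power dmax W0 ass_top rM w1 nM bd fo no).
Qed.
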